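(* Let Assumption 1 (stated in the context) hold. Let $\alpha^0,\alpha^b\in C_b^{\mathrm{UniLip}}([0,T]\times\mathbb{R}^n)$ be policies valued in $A$, and for an initial pair $(t,x)\in[0,T]\times\mathbb{R}^n$ let $\{\alpha^n\}$, $\{z^n\}$, $\{\epsilon_n\}$ be the sequences generated by the inexact BSDE-based policy iteration (defined in the context). Then $\alpha^n$ is admissible for every $n\ge 0$. Moreover, there exist constants $q\in(0,1)$ and $\gamma>0$, both independent of $(t,x)$, such that $$\limsup_{n\to\infty}\bigl|v^{\alpha^n}(t,x)-v^*(t,x)\bigr|^2\le\frac{q\,e^{\gamma(T-t)}}{1-q}\cdot\limsup_{n\to\infty}\epsilon_n .$$
   Context: Setting. Fix a horizon $T<\infty$, dimensions $n,m,d$, a set $A\subset\mathbb{R}^m$ with $0\in A$, and measurable functions $b:[0,T]\times\mathbb{R}^n\times\mathbb{R}^m\to\mathbb{R}^n$, $\sigma:[0,T]\times\mathbb{R}^n\to\mathbb{R}^{n\times d}$, $f:[0,T]\times\mathbb{R}^n\times\mathbb{R}^m\to\mathbb{R}$, $g:\mathbb{R}^n\to\mathbb{R}$. For $(t,x)\in[0,T]\times\mathbb{R}^n$, work on a complete probability space $(\Omega,\mathcal{F},\mathbb{P})$ carrying a $d$-dimensional Brownian motion $(W_s)_{t\le s\le T}$ with $W_t=0$, equipped with its natural filtration $(\mathcal{F}_s)_{t\le s\le T}$ augmented by $\mathbb{P}$-null sets. ''Adapted'' means progressively measurable. $\mathbb{S}^2$ is the set of adapted $Y$ with $\mathbb{E}[\sup_{t\le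 s\le T}|Y_s|^2]<\infty$; $\mathbb{H}^2$ is the set of adapted $Z$ with $\mathbb{E}\int_t^T\|Z_s\|^2ds<\infty$. A policy is a measurable map $\alpha:[0,T]\times\mathbb{R}^n\to\mathbb{R}^m$. For $F(t,x,a)$ write $F^a(t,x)=F(t,x,a)$ and $F^\alpha(t,x)=F(t,x,\alpha(t,x))$. $X^{\alpha,t,x}$ (or $X^\alpha$) is the solution of $X_s=x+\int_t^s b^\alpha(\tau,X_\tau)d\tau+\int_t^s\sigma(\tau,X_\tau)dW_\tau$, $s\in[t,T]$. A policy is admissible if it is valued in $A$ and this SDE has a unique solution; $\mathcal{A}$ is the set of admissible policies. Value function: $v^\alpha(t,x)=\mathbb{E}[\int_t^T f^\alpha(s,X_s^{\alpha,t,x})ds+g(X_T^{\alpha,t,x})]$; optimal value function: $v^*(t,x)=\inf_{\alpha\in\mathcal{A}}v^\alpha(t,x)$. Generator: $\mathscr{L}^\alpha v=\partial_t v+\langle b^\alpha,\partial_x v\rangle+\frac12\mathrm{tr}\{\sigma\sigma^\intercal\partial_{xx}v\}$ (and $\mathscr{L}^a$ with $b^a$ in place of $b^\alpha$). Structure of the drift: $b(t,x,a)=\bar b(t,x)+\sigma(t,x)\hat b(t,x,a)$ for all $(t,x,a)\in[0,T]\times\mathbb{R}^n\times A$. A measurable minimizing function $\mu:[0,T]\times\mathbb{R}^n\times\mathbb{R}^d\to A$ is given with $\mu(t,x,z)\in\operatorname{arginf}_{a\in A}\{\langle\hat b^a(t,x),z\rangle+f^a(t,x)\}$ for all $(t,x,z)$.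 Function classes: a continuous $\phi(t,x,y)$ on $E^1\times E^2\times E^3$ (nonempty subsets of Euclidean spaces) is in $C^{\mathrm{UniLip}}$ if for some constant $L$, $\|\phi(t,x,y)-\phi(t,x',y')\|\le L\|x-x'\|+L\|y-y'\|$ for all $t,x,x',y,y'$; it is in $C_b^{\mathrm{UniLip}}$ if moreover $\|\phi(t,0,0)\|\le L$ for all $t$. Functions of fewer variables are in these classes if their trivial extensions are. $C^{1,2}$: continuously differentiable once in $t$ and twice in $x$. Assumption 1. (1) $\bar b,\hat b,\sigma,f,g\in C^{\mathrm{UniLip}}([0,T]\times\mathbb{R}^n\times A)$ and $\mu\in C^{\mathrm{UniLip}}([0,T]\times\mathbb{R}^n\times\mathbb{R}^d)$. (2) There is a constant $L$ with $\|\bar b(t,0)\|+\|\mu(t,0,0)\|+|f(t,0,0)|\le L$ for all $t\in[0,T]$ and $\|\hat b(t,x,a)\|+\|\sigma(t,x)\|\le L$ for all $(t,x,a)\in[0,T]\times\mathbb{R}^n\times A$. (3) For every $A$-valued $\alpha\in C_b^{\mathrm{UniLip}}([0,T]\times\mathbb{R}^n)$, the linear Cauchy problem $0=\mathscr{L}^\alpha w+f^\alpha$ on $[0,T)\times\mathbb{R}^n$, $w(T,\cdot)=g$, has a solution $w^\alpha\in C^{1,2}([0,T]\times\mathbb{R}^n)$ with $\partial_x w^\alpha\in C_b^{\mathrm{UniLip}}$; and the HJB equation $0=\inf_{a\in A}\{\mathscr{L}^a v^*+f^a\}$ on $[0,T)\times\mathbb{R}^n$, $v^*(T,\cdot)=g$,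 has such a smooth solution $v^*$ too (identified with the optimal value function). Inexact BSDE-based policy iteration (input: policies $\alpha^0,\alpha^b$ and $(t,x)$): let $X^b=X^{\alpha^b,t,x}$, fixed throughout. For $n=0,1,2,\dots$: let $(Y,Z^{\alpha^n,b})\in\mathbb{S}^2\times\mathbb{H}^2$ be the adapted solution of $$Y_s=g(X^b_T)+\int_s^T f^{\alpha^n}(\tau,X^b_\tau)d\tau+\int_s^T\langle\hat b^{\alpha^n}(\tau,X^b_\tau)-\hat b^{\alpha^b}(\tau,X^b_\tau),Z_\tau\rangle d\tau-\int_s^T\langle Z_\tau,dW_\tau\rangle;$$ take any function $z^n:[0,T]\times\mathbb{R}^n\to\mathbb{R}^d$ in $C_b^{\mathrm{UniLip}}$ (the point returned by some numerical method for minimizing $z\mapsto\mathbb{E}\int_t^T\|z(s,X^b_s)-Z^{\alpha^n,b}_s\|^2ds$ over $C_b^{\mathrm{UniLip}}$, not necessarily optimal) and let $\epsilon_n=\mathbb{E}\int_t^T\|z^n(s,X^b_s)-Z^{\alpha^n,b}_s\|^2ds$ be its objective value; set $\alpha^{n+1}(s,y)=\mu(s,y,z^n(s,y))$. *)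

(* Defs.v *)
From mathcomp Require Export all_boot all_order all_algebra.
From mathcomp Require Export all_classical all_reals all_analysis.
Export Order.TTheory GRing.Theory Num.Theory.
Export numFieldNormedType.Exports.

Set Implicit Arguments.
Unset Strict Implicit.
Unset Printing Implicit Defensive.

Local Open Scope classical_set_scope.
Local Open Scope ring_scope.

(** * Euclidean spaces and function classes *)

(* The Euclidean inner product, and the Euclidean (Frobenius) norm: the norm
   that MathComp-Analysis puts on matrices is the sup norm. *)
Definition dotv (R : realType) (k : nat) (u v : 'cV[R]_k) : R :=
  \sum_i u i 0 * v i 0.

Definition enorm (R : realType) (p k : nat) (M : 'M[R]_(p, k)) : R :=
  Num.sqrt (\sum_i \sum_j M i j ^+ 2).

(* R^k with its Borel sigma-algebra. *)
Definition borelV (R : realType) (k : nat) :=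
  g_sigma_algebraType (@open 'cV[R]_k).

(* Measurability on [0, T] x R^k x R^l and on [0, T] x R^k. *)
Definition measurable3 (R : realType) (k l p q : nat) (T : R)
    (phi : R -> 'cV[R]_k -> 'cV[R]_l -> 'M[R]_(p, q)) : Prop :=
  forall i j, measurable_fun
    [set u : measurableTypeR R * borelV R k * borelV R l | 0 <= u.1.1 <= T]
    (fun u => phi u.1.1 u.1.2 u.2 i j).

Definition measurable2 (R : realType) (k p q : nat) (T : R)
    (phi : R -> 'cV[R]_k -> 'M[R]_(p, q)) : Prop :=
  forall i j, measurable_fun
    [set u : measurableTypeR R * borelV R k | 0 <= u.1 <= T]
    (fun u => phi u.1 u.2 i j).

Definition UniLip (R : realType) (k l p q : nat) (E1 : set R)
    (E2 : set 'cV[R]_k) (E3 : set 'cV[R]_l)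
    (phi : R -> 'cV[R]_k -> 'cV[R]_l -> 'M[R]_(p, q)) : Prop :=
  {within [set u : R * 'cV[R]_k * 'cV[R]_l | E1 u.1.1 /\ E2 u.1.2 /\ E3 u.2],
    continuous (fun u => phi u.1.1 u.1.2 u.2)} /\
  exists L : R, forall t x x' y y', E1 t -> E2 x -> E2 x' -> E3 y -> E3 y' ->
    enorm (phi t x y - phi t x' y') <= L * enorm (x - x') + L * enorm (y - y').

Definition UniLipb (R : realType) (k l p q : nat) (E1 : set R)
    (E2 : set 'cV[R]_k) (E3 : set 'cV[R]_l)
    (phi : R -> 'cV[R]_k -> 'cV[R]_l -> 'M[R]_(p, q)) : Prop :=
  UniLip E1 E2 E3 phi /\
  exists L : R, forall t, E1 t -> enorm (phi t 0 0) <= L.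

(* Functions of (t, x) are extended trivially by a dummy third variable. *)
Definition UniLipb2 (R : realType) (k p q : nat) (E1 : set R)
    (E2 : set 'cV[R]_k) (phi : R -> 'cV[R]_k -> 'M[R]_(p, q)) : Prop :=
  UniLipb E1 E2 [set: 'cV[R]_1] (fun t x _ => phi t x).

(* w is of class C^{1,2} on [0, T] x R^k, with time derivative wt, gradient wx
   and Hessian wxx.  At t = 0 and t = T the time derivative is one-sided. *)
Definition is_C12 (R : realType) (k : nat) (T : R) (w : R -> 'cV[R]_k -> R)
    (wt : R -> 'cV[R]_k -> R) (wx : R -> 'cV[R]_k -> 'cV[R]_k)
    (wxx : R -> 'cV[R]_k -> 'M[R]_k) : Prop :=
  (forall (t : R) (x : 'cV[R]_k), 0 <= t <= T ->
    [/\ (w s x - w t x) / (s - t) @[s --> within `[0, T] t^'] --> wt t x,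
        forall i : 'I_k, is_derive (0 : R) (1 : R)
          (fun h : R => w t (x + h *: delta_mx i 0)) (wx t x i 0)
      & forall i j : 'I_k, is_derive (0 : R) (1 : R)
          (fun h : R => wx t (x + h *: delta_mx j 0) i 0) (wxx t x i j)]) /\
  let D := [set u : R * 'cV[R]_k | 0 <= u.1 <= T] in
  [/\ {within D, continuous (fun u => w u.1 u.2)},
      {within D, continuous (fun u => wt u.1 u.2)},
      {within D, continuous (fun u => wx u.1 u.2)}
    & {within D, continuous (fun u => wxx u.1 u.2)}].

(** * Brownian motion and the Ito integral *)

(* Generators of F_s: the W_r for t <= r <= s, and the null sets. *)
Definition filtration_gen (dOmega : measure_display)
    (Omega : measurableType dOmega) (R : realType) (P : probability Omega R)
    (d : nat) (W : R -> Omega -> 'cV[R]_d) (t s : R) : set (set Omega) :=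
  [set E | P.-negligible E] `|`
  [set E | exists (r : R) (i : 'I_d) (Y : set R),
     [/\ t <= r <= s, measurable Y & E = (fun w => W r w i 0) @^-1` Y]].

(* The last field says that W_s - W_r is independent of F_r with law
   N(0, (s - r) I_d); the second parameter of normal_prob is the standard
   deviation. *)
Record brownian_basis (R : realType) (d : nat) (t T : R) := BrownianBasis {
  bb_disp : measure_display;
  bb_Omega : measurableType bb_disp;
  bb_P : probability bb_Omega R;
  bb_W : R -> bb_Omega -> 'cV[R]_d;
  bb_complete : measure_is_complete bb_P;
  bb_measurable : forall s i, t <= s <= T ->
    measurable_fun [set: bb_Omega] (fun w => bb_W s w i 0);
  bb_start : forall w, bb_W t w = 0;
  bb_continuous : forall w, {within `[t, T], continuous (bb_W ^~ w)};
  bb_increments : forall (r s : R) (E : set bb_Omega) (Y : 'I_d -> set R),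
    t <= r -> r < s -> s <= T ->
    <<s filtration_gen bb_P bb_W t r >> E -> (forall i, measurable (Y i)) ->
    (bb_P (E `&` [set w | forall i, Y i (bb_W s w i 0%R - bb_W r w i 0%R)%R]) =
     bb_P E * \prod_(i < d) normal_prob 0%R (Num.sqrt (s - r)%R) (Y i))%E
}.

Arguments bb_W {R d t T} b s w.

Section Basis.
Context (R : realType) (d : nat) (t T : R) (B : brownian_basis d t T).

Definition bb_gen (s : R) : set (set (bb_Omega B)) :=
  filtration_gen (bb_P B) (bb_W B) t s.
Arguments bb_gen : clear implicits.

Definition progressive (V : R -> bb_Omega B -> R) : Prop :=
  forall s : R, t <= s <= T ->
    measurable_fun [set p | t <= p.1 <= s]
      (fun p : measurableTypeR R * g_sigma_algebraType (bb_gen s) =>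
         V p.1 p.2).

Definition S2 (Y : R -> bb_Omega B -> R) : Prop :=
  progressive Y /\
  ((\int[bb_P B]_w ereal_sup [set ((`|Y s w| ^+ 2)%:E) | s in `[t, T]])
     < +oo)%E.

Definition sqdist2 (Z Z' : R -> bb_Omega B -> 'cV[R]_d) : \bar R :=
  (\int[bb_P B]_w \int[lebesgue_measure]_(s in `[t, T])
     (enorm (Z s w - Z' s w) ^+ 2)%:E)%E.

Definition H2 (Z : R -> bb_Omega B -> 'cV[R]_d) : Prop :=
  (forall i, progressive (fun s w => Z s w i 0)) /\
  (sqdist2 Z (fun _ _ => 0%R) < +oo)%E.

(* The process \sum_i coef_i 1_{]lo_i, hi_i]}, coef_i being bounded and
   F_{lo_i}-measurable. *)
Record simple_process := SimpleProcess {
  sp_size : nat;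
  sp_lo : 'I_sp_size -> R;
  sp_hi : 'I_sp_size -> R;
  sp_coef : 'I_sp_size -> bb_Omega B -> 'cV[R]_d;
  sp_order : forall i, [/\ t <= sp_lo i, sp_lo i <= sp_hi i & sp_hi i <= T];
  sp_adapted : forall i j, measurable_fun setT
    (fun w : g_sigma_algebraType (bb_gen (sp_lo i)) => sp_coef i w j 0);
  sp_bounded : forall i, exists M : R, forall w, enorm (sp_coef i w) <= M
}.
Arguments sp_coef : clear implicits.

Definition simple_val (S : simple_process)
    (s : R) (w : bb_Omega B) : 'cV[R]_d :=
  \sum_i (if (sp_lo i < s) && (s <= sp_hi i) then sp_coef S i w else 0).

Definition simple_int (S : simple_process)
    (s : R) (w : bb_Omega B) : R :=
  \sum_i dotv (sp_coef S i w)
           (bb_W B (Num.min s (sp_hi i)) w - bb_W B (Num.min s (sp_lo i)) w).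

(* I is (a continuous version of) the Ito integral \int_t^. <Z_r, dW_r> of an
   integrand Z in H^2: the L^2 limit of the integrals of simple processes
   converging to Z. *)
Definition is_ito (Z : R -> bb_Omega B -> 'cV[R]_d)
    (I : R -> bb_Omega B -> R) : Prop :=
  [/\ H2 Z,
      progressive I,
      forall w, {within `[t, T], continuous (I ^~ w)}
    & exists S : nat -> simple_process,
        sqdist2 (simple_val (S k)) Z @[k --> \oo] --> 0%E /\
        forall s : R, t <= s <= T ->
          (\int[bb_P B]_w ((simple_int (S k) s w - I s w) ^+ 2)%:E)%E
            @[k --> \oo] --> 0%E].

(** * Forward and backward equations *)

Definition path_integrable (V : R -> bb_Omega B -> R) : Prop :=
  {ae bb_P B, forall w,
     lebesgue_measure.-integrable `[t, T] (fun s => (V s w)%:E)}.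

(* X_s = x + \int_t^s beta(r, X_r) dr + \int_t^s sigma(r, X_r) dW_r.
   Integrands in H^2
   suffice here, as sigma is bounded under the standing assumptions. *)
Definition sde_solution (n : nat) (beta : R -> 'cV[R]_n -> 'cV[R]_n)
    (sigma : R -> 'cV[R]_n -> 'M[R]_(n, d)) (x : 'cV[R]_n)
    (X : R -> bb_Omega B -> 'cV[R]_n) : Prop :=
  [/\ forall i, progressive (fun s w => X s w i 0),
      forall i, path_integrable (fun s w => beta s (X s w) i 0)
    & exists I : 'I_n -> R -> bb_Omega B -> R,
        (forall i, is_ito (fun s w => (row i (sigma s (X s w)))^T) (I i)) /\
        {ae bb_P B, forall w, forall (s : R) (i : 'I_n), t <= s <= T ->
           X s w i 0 = x i 0
             + (\int[lebesgue_measure]_(r in `[t, s]) (beta r (X r w) i 0))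
             + I i s w}].

Definition indistinguishable (n : nat)
    (X X' : R -> bb_Omega B -> 'cV[R]_n) : Prop :=
  {ae bb_P B, forall w, forall s : R, t <= s <= T -> X s w = X' s w}.

(* Y_s = xi + \int_s^T phi_r dr + \int_s^T <c_r, Z_r> dr
         - \int_s^T <Z_r, dW_r>. *)
Definition bsde_solution (xi : bb_Omega B -> R)
    (phi : R -> bb_Omega B -> R) (c : R -> bb_Omega B -> 'cV[R]_d)
    (Y : R -> bb_Omega B -> R) (Z : R -> bb_Omega B -> 'cV[R]_d) : Prop :=
  [/\ S2 Y, H2 Z, path_integrable phi,
      path_integrable (fun s w => dotv (c s w) (Z s w))
    & exists I : R -> bb_Omega B -> R, is_ito Z I /\
        {ae bb_P B, forall w, forall s : R, t <= s <= T ->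
           Y s w = xi w
             + (\int[lebesgue_measure]_(r in `[s, T]) (phi r w))
             + (\int[lebesgue_measure]_(r in `[s, T]) (dotv (c r w) (Z r w)))
             - (I T w - I s w)}].

End Basis.

(** * The control problem *)

Record model (R : realType) (n m d : nat) := Model {
  horizon : R;
  actions : set 'cV[R]_m;
  drift : R -> 'cV[R]_n -> 'cV[R]_m -> 'cV[R]_n;
  drift_bar : R -> 'cV[R]_n -> 'cV[R]_n;
  drift_hat : R -> 'cV[R]_n -> 'cV[R]_m -> 'cV[R]_d;
  vol : R -> 'cV[R]_n -> 'M[R]_(n, d);
  cost : R -> 'cV[R]_n -> 'cV[R]_m -> R;
  final : 'cV[R]_n -> R;
  argmu : R -> 'cV[R]_n -> 'cV[R]_d -> 'cV[R]_m
}.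

Definition policy (R : realType) (n m : nat) := R -> 'cV[R]_n -> 'cV[R]_m.

(* F^alpha(t, x) = F(t, x, alpha(t, x)). *)
Definition along (R : realType) (n m : nat) (U : Type)
    (F : R -> 'cV[R]_n -> 'cV[R]_m -> U) (alpha : policy R n m) :=
  fun t x => F t x (alpha t x).

(* Scalar functions are regarded as 1 x 1 matrices. *)
Definition standing (R : realType) (n m d : nat) (M : model R n m d) : Prop :=
  let T := horizon M in
  [/\ 0 <= T,
      actions M 0,
      [/\ measurable3 T (drift M), measurable2 T (vol M),
          measurable3 T (fun t x a => (cost M t x a)%:M : 'M[R]_1)
        & measurable_fun [set: borelV R n] (final M)],
      forall t x a, 0 <= t <= T -> actions M a ->
        drift M t x a = drift_bar M t x + vol M t x *m drift_hat M t x a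
    & measurable3 T (argmu M) /\
      forall t x z, 0 <= t <= T ->
        actions M (argmu M t x z) /\
        forall a, actions M a ->
          dotv (drift_hat M t x (argmu M t x z)) z
            + cost M t x (argmu M t x z)
          <= dotv (drift_hat M t x a) z + cost M t x a].

Definition valued_in (R : realType) (n m d : nat) (M : model R n m d)
    (alpha : policy R n m) : Prop :=
  forall t x, 0 <= t <= horizon M -> actions M (alpha t x).

(* C_b^UniLip([0, T] x R^n) *)
Definition Cb (R : realType) (n m d p q : nat) (M : model R n m d)
    (phi : R -> 'cV[R]_n -> 'M[R]_(p, q)) : Prop :=
  UniLipb2 `[0, horizon M] [set: 'cV[R]_n] phi.

Section Stochastic.
Context (R : realType) (n m d : nat) (M : model R n m d).
Context (B : forall (t : R) (x : 'cV[R]_n), brownian_basis d t (horizon M)).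
Implicit Types (alpha : policy R n m) (t : R) (x : 'cV[R]_n).

Definition state_eq alpha t x : set (R -> bb_Omega (B t x) -> 'cV[R]_n) :=
  [set X | sde_solution (along (drift M) alpha) (vol M) x X].

Definition admissible alpha : Prop :=
  [/\ measurable2 (horizon M) alpha,
      valued_in M alpha
    & forall t x, 0 <= t <= horizon M ->
        exists X, state_eq alpha X /\
          forall X', @state_eq alpha t x X' -> indistinguishable X X'].

(* X^{alpha, t, x}; meaningful when the state equation has a solution. *)
Definition state alpha t x : R -> bb_Omega (B t x) -> 'cV[R]_n :=
  xget (fun _ _ => 0) (@state_eq alpha t x).

Definition value alpha t x : \bar R :=
  (\int[bb_P (B t x)]_w
     ((\int[lebesgue_measure]_(s in `[t, horizon M])
         (along (cost M) alpha s (state alpha s w))%:E)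
      + (final M (state alpha (horizon M) w))%:E))%E.

Definition opt_value t x : \bar R :=
  ereal_inf [set value alpha t x | alpha in admissible].

(* The generator with constant control a, applied to the function whose
   derivatives are wt, wx, wxx. *)
Definition generator (wt : R -> 'cV[R]_n -> R)
    (wx : R -> 'cV[R]_n -> 'cV[R]_n) (wxx : R -> 'cV[R]_n -> 'M[R]_n)
    (a : 'cV[R]_m) t x : R :=
  wt t x + dotv (drift M t x a) (wx t x)
  + 2^-1 * \tr (vol M t x *m (vol M t x)^T *m wxx t x).

Definition smooth (w wt : R -> 'cV[R]_n -> R)
    (wx : R -> 'cV[R]_n -> 'cV[R]_n) (wxx : R -> 'cV[R]_n -> 'M[R]_n) : Prop :=
  is_C12 (horizon M) w wt wx wxx /\ Cb M wx.

Definition assumption1 : Prop :=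
  let T := horizon M in
  let A := actions M in
  [/\ [/\ UniLip `[0, T] setT A (fun t x _ => drift_bar M t x),
          UniLip `[0, T] setT A (drift_hat M),
          UniLip `[0, T] setT A (fun t x _ => vol M t x),
          UniLip `[0, T] setT A (fun t x a => (cost M t x a)%:M : 'M[R]_1)
        & UniLip `[0, T] setT A (fun _ x _ => (final M x)%:M : 'M[R]_1)] /\
      UniLip `[0, T] setT setT (argmu M),
      exists L : R,
        (forall t, 0 <= t <= T ->
           enorm (drift_bar M t 0) + enorm (argmu M t 0 0) + `|cost M t 0 0|
             <= L) /\
        (forall t x a, 0 <= t <= T -> A a ->
           enorm (drift_hat M t x a) + enorm (vol M t x) <= L),
      forall alpha, Cb M alpha -> valued_in M alpha ->
        exists w wt wx wxx, [/\ smooth w wt wx wxx,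
          forall t x, 0 <= t < T ->
            generator wt wx wxx (alpha t x) t x + along (cost M) alpha t x = 0
          & forall x, w T x = final M x]
    & exists w wt wx wxx, [/\ smooth w wt wx wxx,
        forall t x, 0 <= t < T ->
          ereal_inf [set (generator wt wx wxx a t x + cost M t x a)%:E
                      | a in A] = 0%E,
        forall x, w T x = final M x
      & forall t x, 0 <= t <= T -> opt_value t x = (w t x)%:E]].

Definition pi_iteration (alpha0 alphab : policy R n m) t x
    (alpha : nat -> policy R n m) (z : nat -> R -> 'cV[R]_n -> 'cV[R]_d)
    (eps : nat -> \bar R) : Prop :=
  let X := @state alphab t x in
  alpha 0%N = alpha0 /\
  forall k : nat,
    [/\ exists (Y : R -> bb_Omega (B t x) -> R)
               (Z : R -> bb_Omega (B t x) -> 'cV[R]_d),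
          bsde_solution
            (fun w => final M (X (horizon M) w))
            (fun s w => along (cost M) (alpha k) s (X s w))
            (fun s w => along (drift_hat M) (alpha k) s (X s w)
                        - along (drift_hat M) alphab s (X s w))
            Y Z /\
          eps k = sqdist2 (fun s w => z k s (X s w)) Z,
        Cb M (z k)
      & forall (s : R) (y : 'cV[R]_n), 0 <= s <= horizon M ->
          alpha k.+1 s y = argmu M s y (z k s y)].

End Stochastic.

(* Main.v *)
(** Fix the path X = X^b.  Ito's formula along X turns the solution w of the linear
    problem of a policy alpha into the first component of its BSDE, the second
    component being p = sigma^T w_x(s, X_s); the energy estimate identifies it
    with Z^{alpha,b}.  Let p_n and p_opt belong to v^{alpha^n} and v_opt, and let
    zeta = p_{n+1} - p_opt.  The difference of the two BSDEs has a driver A with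
    A^2 <= 8 L^2 (|zeta|^2 + |z^n - p_opt|^2), since alpha^{n+1} minimises the
    Hamiltonian at z^n and alpha_opt minimises it at p_opt.  Weighting by
    e^{kap (s - t)} with kap large, the squared norms of a BSDE are bounded by 1/9 of
    those on the right-hand side, and z^n - p_opt = (z^n - Z^n) + (Z^n - p_opt) gives
      D_{n+1} + a_{n+1} <= (a_{n+1} + 4 e_n + 2 a_n) / 9
    for D_n = |v^{alpha^n} - v_opt|^2, a_n = |p_n - p_opt|^2 and
    e_n <= e^{kap (T - t)} eps_n, hence limsup D <= e^{kap (T - t)} limsup eps, the
    claim for q = 1/2.
    The weight is only needed on a grid, as (1 + kap h)^j, which makes the energy
    estimate a consequence of the Ito isometry.  In Ito's formula no localisation is
    needed: for U = Y - w(s, X) with Y the expected expansion, Dynkin's formula for the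
    bounded function exp (- (U^2 + eps |X|^2)), whose expectation becomes constant in
    time as eps tends to 0, shows U = 0. *)
Require Import Defs.
From mathcomp Require Import all_boot all_order all_algebra.
From mathcomp Require Import all_classical all_reals all_analysis.
From mathcomp Require Import measurable_realfun.
From mathcomp Require Import ring lra.
Set Implicit Arguments.
Unset Strict Implicit.
Unset Printing Implicit Defensive.
Local Open Scope classical_set_scope.
Local Open Scope ring_scope.

(** * Integrable and square-integrable real functions *)

(** The z^n are arbitrary approximations, so the values v^{alpha^n} need not decrease and no
    monotonicity argument is available; every policy is compared directly with the optimum through
    BSDEs on the one path X^b. The HJB infimum is attained at [argmu] evaluated at p_opt, so v_opt
    solves the linear equation of the feedback mu(s, y, p_opt(s, y)). As p_opt multiplies a bounded
    Lipschitz sigma with a Lipschitz, possibly unbounded gradient, this feedback is known to have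
    linear growth only. It never drives a state equation and is merely evaluated along X^b; hence
    the separate classes [lpc] (Lipschitz) and [lgc] (linear growth). The state of the statement is
    picked by choice and fixed only up to indistinguishability. Picard iteration yields a
    continuous, adapted, square-integrable version, and all integrals are transferred to it through
    null sets and completeness of P. The factor 1/9 is 1/18 + 1/18: the mesh of the grid and 1/kap
    each take one half. The final exponent is kap = 18 (8 L^2) + 1, which depends on L alone and
    hence not on (t, x). *)

Section L1L2.
Context d (T : measurableType d) (R : realType) (mu : {measure set T -> \bar R})
  (D : set T) (mD : measurable D).
Implicit Types f g : T -> R.

Definition L1 f := mu.-integrable D (EFin \o f).
Definition L2 f := measurable_fun D f /\ L1 (fun x => f x ^+ 2).
Notation E f := (Rintegral mu D f).

Lemma L1_meas f : L1 f -> measurable_fun D f.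
Proof. by move=> /measurable_int/measurable_EFinP. Qed.

Lemma L1_le f g : measurable_fun D f -> L1 g ->
  (forall x, D x -> `|f x| <= g x) -> L1 f.
Proof.
move=> mf ig fg; apply: (le_integrable mD _ _ ig); first exact/measurable_EFinP.
by move=> x Dx /=; rewrite lee_fin (le_trans (fg _ Dx))// ler_norm.
Qed.

Lemma eq_L1 f g : (forall x, D x -> f x = g x) -> L1 f -> L1 g.
Proof.
by move=> fg; apply: eq_integrable => // x; rewrite inE => Dx /=; rewrite fg.
Qed.

Lemma L1D f g : L1 f -> L1 g -> L1 (fun x => f x + g x).
Proof. by move=> fi gi; exact: (integrableD mD fi gi). Qed.

Lemma L1B f g : L1 f -> L1 g -> L1 (fun x => f x - g x).
Proof. by move=> fi gi; exact: (integrableB mD fi gi). Qed.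

Lemma L1Z k f : L1 f -> L1 (fun x => k * f x).
Proof. by move=> fi; exact: (integrableZl mD k fi). Qed.

Lemma L10 : L1 (fun=> 0).
Proof. exact: integrable0. Qed.

Lemma L1_sum (I : Type) (s : seq I) (P : pred I) (h : I -> T -> R) :
  (forall i, P i -> L1 (h i)) -> L1 (fun x => \sum_(i <- s | P i) h i x).
Proof.
move=> hi; elim: s => [|i s IH].
  by apply: eq_L1 L10 => x _; rewrite big_nil.
case Pi: (P i).
  by apply: eq_L1 (L1D (hi i Pi) IH) => x _; rewrite big_cons Pi.
by apply: eq_L1 IH => x _; rewrite big_cons Pi.
Qed.

Lemma L1_norm f : L1 f -> L1 (fun x => `|f x|).
Proof. exact: integrable_norm. Qed.

Lemma L1_normP f : measurable_fun D f -> L1 (fun x => `|f x|) -> L1 f.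
Proof. by move=> mf fi; apply: L1_le fi _. Qed.

Lemma L2_meas f : L2 f -> measurable_fun D f.
Proof. by case. Qed.

Lemma L2_sq f : L2 f -> L1 (fun x => f x ^+ 2).
Proof. by case. Qed.

Lemma measurable_sq f : measurable_fun D f -> measurable_fun D (fun x => f x ^+ 2).
Proof. by move=> mf; exact: measurable_funX. Qed.

Lemma L2_le f g : measurable_fun D f -> L2 g ->
  (forall x, D x -> `|f x| <= `|g x|) -> L2 f.
Proof.
move=> mf [mg ig] fg; split => //; apply: L1_le ig _; first exact: measurable_sq.
by move=> x Dx; rewrite normrX -(real_normK (num_real (g x))) lerXn2r ?nnegrE// fg.
Qed.

Lemma eq_L2 f g : (forall x, D x -> f x = g x) -> L2 f -> L2 g.
Proof.
move=> fg [mf fi]; split; first by apply: eq_measurable_fun mf => x /[!inE] Dx; rewrite fg.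
by apply: eq_L1 fi => x Dx; rewrite fg.
Qed.

Lemma L2M f g : L2 f -> L2 g -> L1 (fun x => f x * g x).
Proof.
move=> [mf fi] [mg gi]; apply: L1_le (L1D fi gi) _; first exact: measurable_funM.
move=> x _; rewrite normrM -(real_normK (num_real (f x))) -(real_normK (num_real (g x))).
by have := sqr_ge0 (`|f x| - `|g x|); nra.
Qed.

Lemma L2D f g : L2 f -> L2 g -> L2 (fun x => f x + g x).
Proof.
move=> Lf Lg; split; first by apply: measurable_funD; [case: Lf|case: Lg].
apply: eq_L1 (L1D (L1D Lf.2 (L1Z 2 (L2M Lf Lg))) Lg.2) => x _; ring.
Qed.

Lemma L2Z k f : L2 f -> L2 (fun x => k * f x).
Proof.
move=> [mf fi]; split; first exact: measurable_funM.
by apply: eq_L1 (L1Z (k ^+ 2) fi) => x _; rewrite exprMn.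
Qed.

Lemma L2N f : L2 f -> L2 (fun x => - f x).
Proof. by move=> /(L2Z (-1)); apply: eq_L2 => x _; rewrite mulN1r. Qed.

Lemma L2B f g : L2 f -> L2 g -> L2 (fun x => f x - g x).
Proof. by move=> Lf /L2N; exact: L2D. Qed.

Lemma L20 : L2 (fun=> 0).
Proof. by split => //; apply: eq_L1 L10 => x _; rewrite expr0n. Qed.

Lemma L2_sum (I : Type) (s : seq I) (P : pred I) (h : I -> T -> R) :
  (forall i, P i -> L2 (h i)) -> L2 (fun x => \sum_(i <- s | P i) h i x).
Proof.
move=> hi; elim: s => [|i s IH].
  by apply: eq_L2 L20 => x _; rewrite big_nil.
case Pi: (P i).
  by apply: eq_L2 (L2D (hi i Pi) IH) => x _; rewrite big_cons Pi.
by apply: eq_L2 IH => x _; rewrite big_cons Pi.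
Qed.

Lemma L2bM C f g : measurable_fun D f -> (forall x, D x -> `|f x| <= C) -> L2 g ->
  L2 (fun x => f x * g x).
Proof.
move=> mf fC Lg; apply: (@L2_le _ (fun x => C * g x)) => //.
- by apply: measurable_funM => //; exact: L2_meas.
- exact: L2Z.
- move=> x Dx; rewrite !normrM ler_wpM2r// (le_trans (fC _ Dx))//; exact: ler_norm.
Qed.

Lemma L1bM C f g : measurable_fun D f -> (forall x, D x -> `|f x| <= C) -> L1 g ->
  L1 (fun x => f x * g x).
Proof.
move=> mf fC Lg; apply: (@L1_le _ (fun x => C * `|g x|)).
- by apply: measurable_funM => //; exact: L1_meas.
- exact/L1Z/L1_norm.
- by move=> x Dx; rewrite normrM ler_wpM2r// fC.
Qed.

Lemma L1_EFin f : L1 f -> (\int[mu]_(x in D) (f x)%:E)%E = (E f)%:E.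
Proof. by move=> fi; rewrite fineK//; exact: integrable_fin_num. Qed.

Lemma L1P f : measurable_fun D f -> (forall x, D x -> 0 <= f x) ->
  (\int[mu]_(x in D) (f x)%:E < +oo)%E -> L1 f.
Proof.
move=> mf f0 fi; apply/integrableP; split; first exact/measurable_EFinP.
rewrite (le_lt_trans _ fi)// le_eqVlt; apply/orP; left; apply/eqP.
by apply: eq_integral => x /[!inE] Dx /=; rewrite ger0_norm// f0.
Qed.

Lemma L2P f : measurable_fun D f ->
  (\int[mu]_(x in D) (f x ^+ 2)%:E < +oo)%E -> L2 f.
Proof.
move=> mf fi; split => //; apply: L1P => //; first exact: measurable_sq.
by move=> *; exact: sqr_ge0.
Qed.

Lemma eq_E f g : (forall x, D x -> f x = g x) -> E f = E g.
Proof. by move=> fg; apply: eq_Rintegral => x /[!inE] /fg. Qed.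

Lemma ED f g : L1 f -> L1 g -> E (fun x => f x + g x) = E f + E g.
Proof. exact: RintegralD. Qed.

Lemma EB f g : L1 f -> L1 g -> E (fun x => f x - g x) = E f - E g.
Proof. exact: RintegralB. Qed.

Lemma EZ k f : L1 f -> E (fun x => k * f x) = k * E f.
Proof. exact: RintegralZl. Qed.

Lemma EN f : L1 f -> E (fun x => - f x) = - E f.
Proof.
by move=> fi; rewrite -mulN1r -EZ//; apply: eq_E => x _; rewrite mulN1r.
Qed.

Lemma E0 : E (fun=> 0) = 0.
Proof. by rewrite /Rintegral integral0. Qed.

Lemma E_sum (I : Type) (s : seq I) (P : pred I) (h : I -> T -> R) :
  (forall i, P i -> L1 (h i)) ->
  E (fun x => \sum_(i <- s | P i) h i x) = \sum_(i <- s | P i) E (h i).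
Proof.
move=> hi; elim: s => [|i s IH].
  by rewrite big_nil -[RHS]E0; apply: eq_E => x _; rewrite big_nil.
rewrite big_cons; case Pi: (P i).
  rewrite -IH -ED//; [|exact: hi|exact: L1_sum].
  by apply: eq_E => x _; rewrite big_cons Pi.
by rewrite -IH; apply: eq_E => x _; rewrite big_cons Pi.
Qed.

Lemma E_le f g : L1 f -> L1 g -> (forall x, D x -> f x <= g x) -> E f <= E g.
Proof. exact: le_Rintegral. Qed.

Lemma E_ge0 f : (forall x, D x -> 0 <= f x) -> 0 <= E f.
Proof. exact: Rintegral_ge0. Qed.

Lemma E_norm f : L1 f -> `|E f| <= E (fun x => `|f x|).
Proof. exact: le_normr_Rintegral. Qed.

(** The quadratic form E (u f + v g)^2 in (u, v) is nonnegative, and suitable values of (u, v) give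
    the inequality. *)
Lemma E_CS f g : L2 f -> L2 g ->
  E (fun x => f x * g x) ^+ 2 <= E (fun x => f x ^+ 2) * E (fun x => g x ^+ 2).
Proof.
move=> Lf Lg; set a := E _; set b := E _; set c := E _.
have b0 : 0 <= b by apply: E_ge0 => *; exact: sqr_ge0.
have c0 : 0 <= c by apply: E_ge0 => *; exact: sqr_ge0.
have H (u v : R) : 0 <= u ^+ 2 * b + (u * v *+ 2) * a + v ^+ 2 * c.
  rewrite -EZ; last exact: Lf.2.
  rewrite -EZ; last exact: L2M.
  rewrite -EZ; last exact: Lg.2.
  rewrite -ED; [|by apply: L1Z; exact: Lf.2|by apply: L1Z; exact: L2M].
  rewrite -ED; [|apply: L1D; [by apply: L1Z; exact: Lf.2|by apply: L1Z; exact: L2M]|by apply: L1Z; exact: Lg.2].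
  apply: E_ge0 => x _.
  by rewrite [leRHS](_ : _ = (u * f x + v * g x) ^+ 2) ?sqr_ge0//; ring.
have [c00|cn0] := eqVneq c 0.
  have [->|an0] := eqVneq a 0; first by rewrite expr0n mulr_ge0.
  (* With c = 0 the form is affine in v; this choice of (u, v) makes it equal to - a^2, which forces
     a = 0. *)
  have := H a (- (b + 1) / 2); rewrite c00 mulr0 addr0.
  rewrite [X in 0 <= X](_ : _ = - a ^+ 2); last by field.
  have := sqr_ge0 a; have : a ^+ 2 != 0 by rewrite sqrf_eq0.
  by move=> + a0; rewrite oppr_ge0 => /negbTE + a0'; rewrite (@le_anti _ _ (a ^+ 2) 0) ?a0 ?a0'// eqxx.
have cp : 0 < c by rewrite lt_neqAle eq_sym cn0.
have := H c (- a).
rewrite [X in 0 <= X](_ : _ = c * (b * c - a ^+ 2)); last by ring.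
by rewrite pmulr_rge0// subr_ge0.
Qed.

Lemma E_ae f g : measurable_fun D f -> measurable_fun D g ->
  {ae mu, forall x, D x -> f x = g x} -> E f = E g.
Proof.
move=> mf mg fg; congr fine; apply: ae_eq_integral => //; try exact/measurable_EFinP.
by apply: filterS fg => x /[apply] ->.
Qed.

Lemma E_dct (F : nat -> T -> R) f g : (forall n, measurable_fun D (F n)) ->
  measurable_fun D f ->
  {ae mu, forall x, D x -> F n x @[n --> \oo] --> f x} ->
  L1 g -> (forall n x, D x -> `|F n x| <= g x) ->
  L1 f /\ E (F n) @[n --> \oo] --> E f.
Proof.
move=> mF mf Ff gi Fg.
have [|||||fi _ c] := @dominated_convergence _ _ _ mu D mD (fun n => EFin \o F n)
  (EFin \o f) (EFin \o g).
- by move=> n; exact/measurable_EFinP.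
- exact/measurable_EFinP.
- by apply: filterS Ff => x /[apply] h; exact: cvg_EFin (nearW _ _) h.
- exact: gi.
- by apply: aeW => x n Dx /=; rewrite lee_fin Fg.
split => //; apply: fine_cvg; rewrite -L1_EFin//.
Qed.

Lemma L1_le_ae f g : measurable_fun D f -> L1 g ->
  {ae mu, forall x, D x -> `|f x| <= g x} -> L1 f.
Proof.
move=> mf /integrableP[mg ig] fg; apply/integrableP; split.
  exact/measurable_EFinP.
apply: le_lt_trans ig; apply: ae_ge0_le_integral => //=.
- exact/measurable_EFinP/measurableT_comp.
- by move/measurable_EFinP : mg => mg; exact/measurable_EFinP/measurableT_comp.
- by apply: filterS fg => x /[apply] h; rewrite lee_fin (le_trans h)// ler_norm.
Qed.

Lemma L1_bounded C f : (mu D < +oo)%E -> measurable_fun D f ->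
  (forall x, D x -> `|f x| <= C) -> L1 f.
Proof.
move=> fD mf fC; apply: measurable_bounded_integrable => //.
exists C; split; first exact: num_real.
by move=> M CM x Dx; apply: (le_trans (fC _ Dx)); exact: ltW.
Qed.

Lemma L2_bounded C f : (mu D < +oo)%E -> measurable_fun D f ->
  (forall x, D x -> `|f x| <= C) -> L2 f.
Proof.
move=> fD mf fC; split => //; apply: (@L1_bounded (C ^+ 2)) => //.
  exact: measurable_sq.
by move=> x Dx; rewrite normrX lerXn2r ?nnegrE ?fC// (le_trans _ (fC _ Dx)).
Qed.

Lemma L2_L1 f : (mu D < +oo)%E -> L2 f -> L1 f.
Proof.
move=> fD Lf; have L1' := @L2_bounded 1 (fun=> 1) fD (measurable_cst _).
have {}L1' : L2 (fun=> 1) by apply: L1' => x _; rewrite normr1.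
by apply: eq_L1 (L2M Lf L1') => x _; rewrite mulr1.
Qed.

(** F G - f g = (F - f) g + f (G - g) + (F - f) (G - g), and Cauchy-Schwarz bounds each term. This
    is how martingale and bracket identities pass from simple processes to their limits. *)
Lemma E_sq_cvgM (F G : nat -> T -> R) f g :
  (forall n, L2 (F n)) -> (forall n, L2 (G n)) -> L2 f -> L2 g ->
  E (fun x => (F n x - f x) ^+ 2) @[n --> \oo] --> (0 : R) ->
  E (fun x => (G n x - g x) ^+ 2) @[n --> \oo] --> (0 : R) ->
  E (fun x => F n x * G n x) @[n --> \oo] --> E (fun x => f x * g x).
Proof.
move=> LF LG Lf Lg cF cG.
pose a n := E (fun x => (F n x - f x) ^+ 2); pose b n := E (fun x => (G n x - g x) ^+ 2).
pose A := E (fun x => f x ^+ 2); pose B := E (fun x => g x ^+ 2).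
have sq0 h : 0 <= E (fun x => h x ^+ 2) by apply: E_ge0 => *; exact: sqr_ge0.
apply/cvgrPdist_le => e e0.
have bnd n : `|E (fun x => f x * g x) - E (fun x => F n x * G n x)| <=
   Num.sqrt (a n) * Num.sqrt B + Num.sqrt A * Num.sqrt (b n) + Num.sqrt (a n) * Num.sqrt (b n).
  have LFf := L2B (LF n) Lf; have LGg := L2B (LG n) Lg.
  have -> : E (fun x => f x * g x) - E (fun x => F n x * G n x) =
     - (E (fun x => (F n x - f x) * g x) + E (fun x => f x * (G n x - g x))
      + E (fun x => (F n x - f x) * (G n x - g x))).
    rewrite -ED; [|exact: L2M|exact: L2M]; rewrite -ED; [|apply: L1D; exact: L2M|exact: L2M].
    rewrite -EB; [|exact: L2M|exact: L2M]; rewrite -EN; last first.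
      by apply: L1D; [apply: L1D|]; exact: L2M.
    by apply: eq_E => x _; ring.
  rewrite normrN; have cs h k : L2 h -> L2 k -> `|E (fun x => h x * k x)| <=
      Num.sqrt (E (fun x => h x ^+ 2)) * Num.sqrt (E (fun x => k x ^+ 2)).
    by move=> Lh Lk; rewrite -sqrtrM// -sqrtr_sqr ler_wsqrtr// E_CS.
  by rewrite (le_trans (ler_normD _ _))// lerD ?cs// (le_trans (ler_normD _ _))// lerD ?cs.
have h : (fun n => Num.sqrt (a n) * Num.sqrt B + Num.sqrt A * Num.sqrt (b n)
    + Num.sqrt (a n) * Num.sqrt (b n)) @ \oo --> (0 : R).
  rewrite [X in _ --> X](_ : _ = Num.sqrt 0 * Num.sqrt B + Num.sqrt A * Num.sqrt 0 + Num.sqrt 0 * Num.sqrt 0);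
    last by rewrite sqrtr0; ring.
  have sa : Num.sqrt (a n) @[n --> \oo] --> Num.sqrt 0.
    exact: (continuous_cvg _ (@sqrt_continuous _ _) cF).
  have sb : Num.sqrt (b n) @[n --> \oo] --> Num.sqrt 0.
    exact: (continuous_cvg _ (@sqrt_continuous _ _) cG).
  apply: cvgD; [apply: cvgD|exact: cvgM].
    by apply: cvgM => //; exact: cvg_cst.
  by apply: cvgM => //; exact: cvg_cst.
move/cvgrPdist_le : h => /(_ e e0); apply: filterS => n.
by rewrite sub0r normrN => h; rewrite (le_trans (bnd n))// (le_trans (ler_norm _)).
Qed.

End L1L2.

(** * Moments of centred normal laws *)

Section NormalMoments.
Context (R : realType) (s : R) (s0 : 0 < s).
Notation mu := lebesgue_measure.
Notation N := (@normal_prob R 0 s).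
Notation E f := (Rintegral N setT f).

(** The Radon-Nikodym derivative of the normal law agrees almost everywhere with [normal_pdf],
    because both have the same integral over every measurable set. *)
Lemma normal_change_bounded (f : R -> R) (C : R) : measurable_fun setT f ->
  (forall x, 0 <= f x <= C) ->
  (\int[N]_x (f x)%:E = \int[mu]_x (f x * normal_pdf 0 s x)%:E)%E.
Proof.
move=> mf fC.
have fi : N.-integrable setT (EFin \o f).
  apply: (@L1_bounded _ _ _ N setT measurableT C) => //.
    by rewrite /= probability_setT ltry.
  by move=> x _; have /andP[f0 fc] := fC x; rewrite ger0_norm.
rewrite -(Radon_Nikodym_change_of_variables (@normal_prob_dominates R 0 s) _ fi)//.
apply: ae_eq_integral => //.
- apply: emeasurable_funM; first exact/measurable_EFinP.
  apply: (measurable_int mu).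
  by apply: Radon_Nikodym_integrable; exact: normal_prob_dominates.
- apply/measurable_EFinP/measurable_funM; [exact: mf|exact: measurable_normal_pdf].
- under [X in ae_eq _ _ _ X]eq_fun do rewrite EFinM.
  apply: ae_eqe_mul2l => /=.
  rewrite Radon_NikodymE//=; first exact: normal_prob_dominates.
  move=> abmu; case: cid => /= h [h1 h2 h3].
  apply: integral_ae_eq => //=.
  + by apply/measurable_EFinP; exact: measurable_normal_pdf.
  + by move=> A _ mA; rewrite -h3.
Qed.

(** At each point the truncation of f at level n is eventually f itself, so the bounded case passes
    to the limit by monotone convergence on both sides. *)
Lemma normal_change (f : R -> R) : measurable_fun setT f ->
  (forall x, 0 <= f x) ->
  (\int[N]_x (f x)%:E = \int[mu]_x (f x * normal_pdf 0 s x)%:E)%E.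
Proof.
move=> mf f0; pose g (n : nat) x := Num.min (f x) n%:R.
have mg n : measurable_fun setT (g n) by apply: measurable_minr.
have cg x : \forall n \near \oo, g n x = f x.
  near=> n; rewrite /g min_l// ltW//.
  by near: n; exact: nbhs_infty_gtr.
have gnd x : {homo (fun n => g n x) : n m / (n <= m)%N >-> n <= m}.
  by move=> n m nm; rewrite /g le_min !ge_min lexx/= ler_nat nm orbT.
have p0 x : 0 <= normal_pdf 0 s x by exact: normal_pdf_ge0.
have g0 n x : 0 <= g n x by rewrite le_min f0/=.
have -> : (\int[N]_x (f x)%:E = \int[N]_x (limn (fun n => (g n x)%:E)))%E.
  apply: eq_integral => x _; apply/esym/cvg_lim => //.
  by apply: cvg_near_cst; apply: filterS (cg x) => n ->.
have -> : (\int[mu]_x (f x * normal_pdf 0 s x)%:E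
          = \int[mu]_x (limn (fun n => (g n x * normal_pdf 0 s x)%:E)))%E.
  apply: eq_integral => x _; apply/esym/cvg_lim => //.
  by apply: cvg_near_cst; apply: filterS (cg x) => n ->.
rewrite monotone_convergence//=; last 3 first.
- by move=> n; apply/measurable_EFinP; exact: mg.
- by move=> n x _; rewrite lee_fin.
- by move=> x _ n m nm; rewrite lee_fin gnd.
rewrite monotone_convergence//=; last 3 first.
- by move=> n; apply/measurable_EFinP/measurable_funM; [exact: mg|exact: measurable_normal_pdf].
- by move=> n x _; rewrite lee_fin mulr_ge0.
- by move=> x _ n m nm; rewrite lee_fin ler_wpM2r// gnd.
congr (limn _); apply/funext => n.
apply: (@normal_change_bounded _ n%:R) => // x.
by rewrite g0/= /g ge_min lexx orbT.
Unshelve. all: by end_near. Qed.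

(** The exponential turns the density of deviation s into s' / s times the density of deviation s',
    whose mass is 1. The second and fourth moments below are both extracted from this one
    integral. *)
Lemma normal_gauss s' : 0 < s' ->
  L1 N setT (fun x => expR (x ^+ 2 / (s ^+ 2 *+ 2) - x ^+ 2 / (s' ^+ 2 *+ 2))) /\
  E (fun x => expR (x ^+ 2 / (s ^+ 2 *+ 2) - x ^+ 2 / (s' ^+ 2 *+ 2))) = s' / s.
Proof.
move=> s'0; set f := (fun x => expR _).
have mf : measurable_fun setT f.
  apply: measurableT_comp => //; apply: measurable_funB.
    by apply: measurable_funM => //; exact: measurable_funX.
  by apply: measurable_funM => //; exact: measurable_funX.
have f0 x : 0 <= f x by exact: expR_ge0.
have h : (\int[N]_x (f x)%:E = (s' / s)%:E)%E.
  rewrite normal_change//.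
  have -> : (\int[mu]_x (f x * normal_pdf 0 s x)%:E
     = \int[mu]_x ((s' / s)%:E * (normal_pdf 0 s' x)%:E))%E.
    apply: eq_integral => x _; rewrite -EFinM; congr EFin.
    rewrite !normal_pdfE ?gt_eqF//= /f /normal_fun !subr0.
    rewrite mulrCA -expRD [X in expR X](_ : _ = - x ^+ 2 / (s' ^+ 2 *+ 2)); last first.
      by rewrite mulNr; ring.
    have pk (a : R) : 0 < a -> normal_peak a = (a * Num.sqrt (pi *+ 2))^-1.
      by move=> a0; rewrite /normal_peak -mulrnAr sqrtrM ?sqr_ge0// sqrtr_sqr gtr0_norm.
    rewrite mulrA; congr (_ * _); rewrite !pk//.
    have : Num.sqrt (pi *+ 2 : R) != 0 by rewrite gt_eqF// sqrtr_gt0 mulrn_wgt0// pi_gt0.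
    by move=> pp; field; rewrite pp !gt_eqF.
  rewrite ge0_integralZl_EFin//=.
  - by rewrite integral_normal_pdf mule1.
  - by move=> x _; rewrite lee_fin normal_pdf_ge0.
  - by apply/measurable_EFinP; exact: measurable_normal_pdf.
  - by rewrite divr_ge0// ltW.
have fi : L1 N setT f by apply: L1P => //; rewrite h ltry.
split => //; by rewrite /Rintegral h.
Qed.

Let D := normal_gauss (s' := s * Num.sqrt 2).

Let gauss4 : L1 N setT (fun x => expR (x ^+ 2 / (s ^+ 2 *+ 4))) /\
  E (fun x => expR (x ^+ 2 / (s ^+ 2 *+ 4))) = Num.sqrt 2.
Proof.
have s2 : 0 < s * Num.sqrt 2 by rewrite mulr_gt0// sqrtr_gt0.
have [i e] := D s2.
have eqf x : expR (x ^+ 2 / (s ^+ 2 *+ 2) - x ^+ 2 / ((s * Num.sqrt 2) ^+ 2 *+ 2))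
   = expR (x ^+ 2 / (s ^+ 2 *+ 4)).
  by congr expR; rewrite exprMn sqr_sqrtr//; field; rewrite gt_eqF.
split; first by apply: eq_L1 i => // x _; rewrite eqf.
under eq_E do rewrite -eqf.
by rewrite e mulrC mulKf// gt_eqF.
Qed.

(** With y = x^2 / (4 s^2), the inequality y^2 / 2 <= exp y gives x^4 <= 32 s^4 exp y, and E (exp y)
    = sqrt 2 <= 2. Only the order s^4 matters later, so 64 may replace the exact 3. *)
Lemma normal_moment4 : L1 N setT (fun x => x ^+ 4) /\
  E (fun x => x ^+ 4) <= 64 * s ^+ 4.
Proof.
have [i e] := gauss4.
have le4 x : x ^+ 4 <= (32 * s ^+ 4) * expR (x ^+ 2 / (s ^+ 2 *+ 4)).
  set y := x ^+ 2 / _.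
  have y0 : 0 <= y by rewrite divr_ge0// ?sqr_ge0// mulrn_wge0// sqr_ge0.
  have : y ^+ 2 / 2 <= expR y.
    have := @expR_ge1Dxn _ y 1 y0; rewrite (_ : 2`! = 2)%N//; lra.
  have -> : x ^+ 4 = 16 * s ^+ 4 * y ^+ 2 by rewrite /y; field; rewrite gt_eqF.
  have : 0 < s ^+ 4 by rewrite exprn_gt0.
  nra.
have i4 : L1 N setT (fun x => x ^+ 4).
  apply: (@L1_le _ _ _ N setT measurableT _ _ _ (L1Z measurableT (32 * s ^+ 4) i)).
    exact: measurable_funX.
  by move=> x _; rewrite ger0_norm ?le4// exprn_even_ge0.
split => //; apply: (@le_trans _ _ (E (fun x => (32 * s ^+ 4) * expR (x ^+ 2 / (s ^+ 2 *+ 4))))).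
  by apply: E_le => //; exact: L1Z.
rewrite EZ// e; have : Num.sqrt 2 <= 2 :> R.
  by rewrite -[leRHS]ger0_norm// -sqrtr_sqr ler_wsqrtr//; lra.
have : 0 < s ^+ 4 by rewrite exprn_gt0.
nra.
Qed.

(** The exact value is what makes the Ito isometry an equality. It is obtained as the limit for h
    tending to 0 of E (1 - exp (- h x^2)) / h, whose integrand is dominated by x^2; [normal_gauss]
    with s' = s / r and r^2 = 1 + 2 h s^2 evaluates it as 2 s^2 / (r (r + 1)). *)
Lemma normal_moment2 : L1 N setT (fun x => x ^+ 2) /\ E (fun x => x ^+ 2) = s ^+ 2.
Proof.
have [i4 _] := normal_moment4.
have i1 : L1 N setT (fun=> 1).
  by apply: (@L1_bounded _ _ _ N setT measurableT 1) => //=; [rewrite probability_setT ltry|move=> x _; rewrite normr1].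
have i2 : L1 N setT (fun x => x ^+ 2).
  apply: (L1_le measurableT _ (L1D measurableT i1 i4)); first exact: measurable_funX.
  move=> x _; rewrite ger0_norm ?sqr_ge0//.
  by have := sqr_ge0 (x ^+ 2 - 1); have := sqr_ge0 (x ^+ 2); nra.
split => //.
pose h (n : nat) : R := n.+1%:R^-1.
have h0 n : 0 < h n by rewrite invr_gt0.
have ch : h @ \oo --> (0 : R) by exact: cvg_harmonic.
pose F n x := (1 - expR (- h n * x ^+ 2)) / h n.
pose r n : R := Num.sqrt (1 + 2 * h n * s ^+ 2).
have r1 n : 1 <= r n.
  rewrite -sqrtr1 ler_wsqrtr// lerDl !mulr_ge0// ?sqr_ge0//; exact: ltW.
have r0 n : 0 < r n by exact: lt_le_trans (r1 n).
have gi n := normal_gauss (divr_gt0 s0 (r0 n)).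
have eqf n x : expR (x ^+ 2 / (s ^+ 2 *+ 2) - x ^+ 2 / ((s / r n) ^+ 2 *+ 2))
  = expR (- h n * x ^+ 2).
  congr expR; rewrite expr_div_n sqr_sqrtr; last first.
    by rewrite addr_ge0// !mulr_ge0// ?sqr_ge0// ltW.
  field; rewrite (gt_eqF s0) andbT gt_eqF// ltr_pwDl// !mulr_ge0 ?exprn_ge0 ?(ltW s0) ?(ltW (h0 n))//.

have EF n : E (F n) = 2 * s ^+ 2 / (r n * (r n + 1)).
  have [gi1 gi2] := gi n.
  have ig : L1 N setT (fun x => expR (- h n * x ^+ 2)).
    by apply: eq_L1 gi1 => // x _; rewrite eqf.
  rewrite [LHS](_ : _ = (h n)^-1 * (1 - s / r n / s)); last first.
    rewrite -gi2; under [in RHS]eq_E do rewrite eqf.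
    have e1 : E (fun=> 1) = 1 by rewrite Rintegral_cst//= probability_setT/= mulr1.
    rewrite -[X in _ * (X - _)]e1.
    rewrite -EB// -EZ//; last exact: L1B.
    by apply: eq_E => x _; rewrite mulrC.
  have e : 2 * s ^+ 2 = (r n ^+ 2 - 1) / h n.
    rewrite sqr_sqrtr; first by field; rewrite gt_eqF.
    by rewrite addr_ge0// !mulr_ge0// ?sqr_ge0// ltW.
  by rewrite e; field; rewrite !gt_eqF// addr_gt0.
have mF n : measurable_fun setT (F n).
  apply: measurable_funM => //; apply: measurable_funB => //.
  by apply: measurableT_comp => //; apply: measurable_funM => //; exact: measurable_funX.
have cF x : F n x @[n --> \oo] --> x ^+ 2.
  apply: (@squeeze_cvgr _ _ _ _ (fun n => x ^+ 2 / (1 + h n * x ^+ 2)) (fun=> x ^+ 2)).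
  - near=> n; set y := h n * x ^+ 2; have y0 : 0 <= y by rewrite mulr_ge0 ?sqr_ge0 ?ltW.
    have ey : expR (- y) * (1 + y) <= 1.
      have := @expR_ge1Dx _ y; rewrite expRN => h1.
      by rewrite mulrC ler_pdivrMr ?expR_gt0// mul1r.
    apply/andP; split.
      rewrite ler_pdivrMr; last by rewrite ltr_pwDl.
      rewrite /F mulrAC ler_pdivlMr// mulNr -/y.
      by rewrite mulrBl mul1r (mulrC (x ^+ 2)) -/y; lra.
    rewrite /F ler_pdivrMr//.
    by have := @expR_ge1Dx _ (- h n * x ^+ 2); lra.
  - rewrite [X in _ --> X](_ : _ = x ^+ 2 / (1 + 0 * x ^+ 2)); last by rewrite mul0r addr0 divr1.
    apply: cvgM; first exact: cvg_cst.
    apply: cvgV; first by rewrite mul0r addr0 oner_neq0.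
    apply: cvgD; first exact: cvg_cst.
    by apply: cvgM => //; exact: cvg_cst.
  - exact: cvg_cst.
have bF n x : `|F n x| <= x ^+ 2.
  rewrite /F normrM normfV (gtr0_norm (h0 n)) ler_pdivrMr// ger0_norm.
    by have := @expR_ge1Dx _ (- h n * x ^+ 2); lra.
  by rewrite subr_ge0 -[leRHS]expR0 ler_expR mulNr oppr_le0 mulr_ge0 ?sqr_ge0 ?ltW.
have [_ c1] : L1 N setT (fun x => x ^+ 2) /\ E (F n) @[n --> \oo] --> E (fun x => x ^+ 2).
  apply: (@E_dct _ _ _ N setT measurableT _ _ (fun x => x ^+ 2)); first exact: mF.
  - exact: measurable_funX.
  - by apply: aeW => x _.
  - exact: i2.
  - by move=> n x _.
have c2 : E (F n) @[n --> \oo] --> s ^+ 2.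
  rewrite [X in X @ _ --> _](_ : _ = fun n => 2 * s ^+ 2 / (r n * (r n + 1))); last first.
    by apply/funext.
  have cr : r @ \oo --> (1 : R).
    rewrite -[X in _ --> X]sqrtr1 /r.
    apply: (continuous_cvg _ (@sqrt_continuous _ _)).
    rewrite [X in _ --> X](_ : _ = 1 + 2 * 0 * s ^+ 2 :> R); last by ring.
    apply: cvgD; first exact: cvg_cst.
    apply: cvgM; last exact: cvg_cst.
    by apply: cvgM => //; exact: cvg_cst.
  rewrite [X in _ --> X](_ : _ = 2 * s ^+ 2 / (1 * (1 + 1))); last by field.
  apply: cvgM; first exact: cvg_cst.
  apply: cvgV; first by rewrite mul1r.
  by apply: cvgM => //; apply: cvgD => //; exact: cvg_cst.
exact: (cvg_unique _ c1 c2).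
Unshelve. all: by end_near. Qed.

(** The density is even and Lebesgue measure is its own image under x -> - x, so the positive and
    negative parts of x have the same integral. *)
Lemma normal_mean : L1 N setT (fun x => x) /\ E (fun x => x) = 0.
Proof.
have [i2 _] := normal_moment2.
have L2x : L2 N setT (fun x => x) by split => //; exact: measurable_id.
have i1 : L1 N setT (fun x => x).
  by apply: L2_L1 => //=; rewrite probability_setT ltry.
split => //.
pose p x : R := Num.max x 0; pose m x : R := Num.max (- x) 0.
have mp : measurable_fun setT p by apply: measurable_maxr => //; exact: measurable_id.
have mm : measurable_fun setT m.
  by apply: measurable_maxr => //; apply: measurableT_comp => //; exact: measurable_id.
have ip : L1 N setT p.
  apply: L1_le (L1_norm i1) _; [exact: measurableT|exact: mp|move=> x _].
  by rewrite /p; case: (lerP x 0) => [x0|x0]; rewrite ?normr0.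
have im : L1 N setT m.
  apply: L1_le (L1_norm i1) _; [exact: measurableT|exact: mm|move=> x _].
  by rewrite /m; case: (lerP (- x) 0) => x0; rewrite ?normr0 ?normrN.
have -> : E (fun x => x) = E p - E m.
  rewrite -EB//; apply: eq_E => x _; rewrite /p /m.
  by case: (lerP x 0) => x0; case: (lerP (- x) 0) => x1; lra.
apply/eqP; rewrite subr_eq0; apply/eqP; congr fine.
rewrite !normal_change//; last 2 first.
- by move=> x; rewrite le_max lexx orbT.
- by move=> x; rewrite le_max lexx orbT.
transitivity (\int[pushforward mu (-%R : measurableTypeR R -> measurableTypeR R)]_x
    (p x * normal_pdf 0 s x)%:E)%E.
  by apply: eq_measure_integral => A mA _; apply/esym/lebesgue_measureN.
rewrite ge0_integral_pushforward; last 4 first.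
- exact: oppr_measurable.
- exact: measurableT.
- apply/measurable_EFinP/measurable_funM; [exact: mp|exact: measurable_normal_pdf].
- by move=> x _ /=; rewrite lee_fin mulr_ge0 ?normal_pdf_ge0// le_max lexx orbT.
apply: eq_integral => x _; congr (_ * _)%:E.
by rewrite !normal_pdfE ?gt_eqF//= /normal_fun !subr0 sqrrN.
Qed.

End NormalMoments.

(** * Independent increments *)

Definition mfun_of d d' (T : measurableType d) (T' : measurableType d') (f : T -> T')
    (mf : measurable_fun setT f) : {mfun T >-> T'} :=
  MeasurableFun.Pack (MeasurableFun.Class (isMeasurableFun.Build _ _ _ _ _ mf)).

Section Indep.
Context d (Om : measurableType d) (R : realType) (P : probability Om R).
Context d1 (T1 : measurableType d1) d2 (T2 : measurableType d2).

(** On rectangles the measure A -> P ((f, g) in A, h in C) agrees with N3 C times the product of the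
    law of f and N2, and uniqueness of product measures extends this to every A. It allows two
    coordinates of a Brownian increment to be integrated out one after the other. *)
Lemma mrestr_pair_law d3 (T3 : measurableType d3) (N2 : probability T2 R)
    (N3 : probability T3 R)
    (f : Om -> T1) (g : Om -> T2) (h : Om -> T3)
    (mf : measurable_fun setT f) (mg : measurable_fun setT g)
    (mh : measurable_fun setT h) :
  (forall A B C, measurable A -> measurable B -> measurable C ->
    P (f @^-1` A `&` g @^-1` B `&` h @^-1` C) = (P (f @^-1` A) * N2 B * N3 C)%E) ->
  forall A C, measurable A -> measurable C ->
    P ((fun w => (f w, g w)) @^-1` A `&` h @^-1` C)
      = (P ((fun w => (f w, g w)) @^-1` A) * N3 C)%E.
Proof.
move=> H A C mA mC.
pose F : {mfun Om >-> T1} := mfun_of mf.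
have mfg : measurable_fun setT (fun w => (f w, g w)) by exact: measurable_fun_pair.
pose FG : {mfun Om >-> (T1 * T2)%type} := mfun_of mfg.
have mhC : measurable (h @^-1` C) by rewrite -[X in measurable X]setTI; exact: mh.
have lawE (X : set (T1 * T2)) : measurable X -> (distribution P F \x N2)%E X = P (FG @^-1` X).
  move=> mX.
  apply: (@product_measure_unique _ _ _ _ _ (distribution P F) N2 (distribution P FG)) => //.
  move=> A' B mA' mB; rewrite /distribution /pushforward /=.
  have := H A' B setT mA' mB measurableT.
  by rewrite preimage_setT setIT probability_setT mule1.
have N3C : (0 <= fine (N3 C))%R by rewrite fine_ge0.
pose c : {nonneg R} := NngNum N3C.
have cE : c%:num%:E = N3 C by rewrite /= fineK// fin_num_measure.
rewrite -[in RHS]lawE// muleC -cE.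
transitivity ((mscale c (distribution P F) \x N2)%E A).
  apply/esym.
  apply: (@product_measure_unique _ _ _ _ _ (mscale c (distribution P F)) N2
    (pushforward (mrestr P mhC) FG)) => //.
  move=> A' B mA' mB; rewrite /pushforward /mrestr /= [LHS](H A' B C)// /mscale.
  by rewrite [in RHS]cE muleC -muleA; congr (_ * _)%E; rewrite muleC.
have -> : (c%:num%:E * (distribution P F \x N2)%E A)%E = mscale c (distribution P F \x N2)%E A by [].
apply: (@product_measure_unique _ _ _ _ _ (mscale c (distribution P F)) N2
    (mscale c (distribution P F \x N2)%E)) => //.
by move=> A' B mA' mB; rewrite /mscale/= -muleA; congr (_ * _)%E; exact: product_measure1E.
Qed.

Context (N : probability T2 R) (f : Om -> T1) (g : Om -> T2)
  (mf : measurable_fun setT f) (mg : measurable_fun setT g).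
Hypothesis H : forall A B, measurable A -> measurable B ->
  P (f @^-1` A `&` g @^-1` B) = (P (f @^-1` A) * N B)%E.

(** The hypothesis on rectangles makes the law of (f, g) a product measure, on which Fubini
    separates the two factors. *)
Lemma indep_integral (eta : T1 -> R) (phi : T2 -> R) :
  measurable_fun setT eta -> measurable_fun setT phi ->
  L1 P setT (eta \o f) -> L1 N setT phi ->
  L1 P setT (fun w => eta (f w) * phi (g w)) /\
  \int[P]_w (eta (f w) * phi (g w)) = \int[P]_w (eta (f w)) * \int[N]_x phi x.
Proof.
move=> me mp ie ip.
pose F : {mfun Om >-> T1} := mfun_of mf.
have mfg : measurable_fun setT (fun w => (f w, g w)) by exact: measurable_fun_pair.
pose FG : {mfun Om >-> (T1 * T2)%type} := mfun_of mfg.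
pose K (z : T1 * T2) := (eta z.1 * phi z.2)%:E.
have mK : measurable_fun setT K.
  apply/measurable_EFinP/measurable_funM.
    by apply: (measurableT_comp me); exact: measurable_fst.
  by apply: (measurableT_comp mp); exact: measurable_snd.
have lawE (X : set (T1 * T2)) : measurable X -> distribution P FG X = (distribution P F \x N)%E X.
  move=> mX; apply/esym.
  apply: (@product_measure_unique _ _ _ _ _ (distribution P F) N (distribution P FG)) => //.
have ieF : (distribution P F).-integrable setT (EFin \o eta).
  by apply: (@integrable_pushforward _ _ _ _ _ f) => //; exact/measurable_EFinP.
have iK : (distribution P F \x N)%E.-integrable setT K.
  apply/(integrable12ltyP _ _ mK).
  have -> : (\int[distribution P F]_x \int[N]_y `|K (x, y)|
     = \int[distribution P F]_x ((\int[N]_y `|phi y|)%:E * `|eta x|%:E))%E.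
    apply: eq_integral => x _.
    under eq_integral => y _ do rewrite /K/= normrM EFinM.
    rewrite ge0_integralZl_EFin//=; first by rewrite (L1_EFin measurableT (L1_norm ip)) muleC.
    by apply/measurable_EFinP; exact: measurableT_comp.
  rewrite ge0_integralZl_EFin//=.
  - rewrite lte_mul_pinfty// ?lee_fin; first exact: E_ge0.
    by case/integrableP: ieF.
  - by apply/measurable_EFinP; exact: measurableT_comp.
  - exact: E_ge0.
have iP : P.-integrable setT (K \o FG).
  apply/integrableP; split; first exact: measurableT_comp.
  rewrite -(@ge0_integral_distribution _ _ _ _ _ P FG (fun z => `|K z|)%E)//; last first.
    exact: measurableT_comp.
  rewrite (@eq_measure_integral _ _ _ _ (distribution P F \x N)%E); last first.
    by move=> A mA _; exact: lawE.
  by case/integrableP : iK.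
split; first exact: iP.
have e : (\int[P]_w (eta (f w) * phi (g w))%:E = (\int[P]_w (eta (f w)) * \int[N]_x phi x)%:E)%E.
  rewrite -[LHS](@integral_distribution _ _ _ _ _ P FG K)//.
  rewrite (@eq_measure_integral _ _ _ _ (distribution P F \x N)%E); last first.
    by move=> A mA _; exact: lawE.
  rewrite -integral12_prod_meas1// /fubini_F.
  have -> : (\int[distribution P F]_x \int[N]_y K (x, y)
     = \int[distribution P F]_x ((\int[N]_y phi y)%:E * (eta x)%:E))%E.
    apply: eq_integral => x _.
    under eq_integral => y _ do rewrite /K/= EFinM.
    by rewrite integralZl//= L1_EFin// muleC.
  rewrite integralZl//= (@integral_distribution _ _ _ _ _ P F (EFin \o eta))//; last first.
    exact/measurable_EFinP.
  have -> : (\int[P]_x ((EFin \o eta) \o F) x = (\int[P]_w eta (f w))%:E)%E.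
    exact: (@L1_EFin _ _ _ P setT measurableT (eta \o f)).
  by rewrite -EFinM mulrC.
by rewrite /Rintegral e.
Qed.

End Indep.

(** * Brownian increments tested against variables of the past *)

Section Filtration.
Context (R : realType) (d : nat) (t T : R) (B : brownian_basis d t T).
Notation Om := (bb_Omega B).
Notation P := (bb_P B).
Notation W := (bb_W B).
Implicit Types (f g : Om -> R).

(** The same outcomes with the sigma-algebra F_s, so that adaptedness is ordinary measurability out
    of [FT s]. *)
Definition FT (s : R) := g_sigma_algebraType (bb_gen (B := B) s).

Definition Fm (s : R) (f : Om -> R) := measurable_fun [set: FT s] f.

Lemma filtration_measurable s E : t <= s <= T -> <<s bb_gen (B := B) s>> E ->
  measurable (E : set Om).
Proof.
move=> /andP[ts sT]; apply: smallest_sub; first exact: sigma_algebra_measurable.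
move=> A [nA|[r [i [Y [/andP[tr rs] mY ->]]]]].
  exact: bb_complete nA.
have mW : measurable_fun setT (fun w => W r w i 0).
  by apply: bb_measurable; rewrite tr (le_trans rs).
by rewrite -[X in measurable X]setTI; exact: mW.
Qed.

Lemma filtration_mono r s : r <= s ->
  <<s bb_gen (B := B) r>> `<=` <<s bb_gen (B := B) s>>.
Proof.
move=> rs; apply: sub_smallest2r; first exact: smallest_sigma_algebra.
move=> A [nA|[u [i [Y [/andP[tu ur] mY ->]]]]].
  by left.
right; exists u, i, Y; split => //.
by rewrite tu (le_trans ur).
Qed.

Lemma Fm_meas s f : t <= s <= T -> Fm s f -> measurable_fun setT f.
Proof.
move=> ts mf _ Y mY; rewrite setTI.
have := mf measurableT Y mY; rewrite setTI; exact: filtration_measurable.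
Qed.

Lemma Fm_mono r s f : r <= s -> Fm r f -> Fm s f.
Proof.
move=> rs mf _ Y mY; rewrite setTI.
have := mf measurableT Y mY; rewrite setTI; exact: filtration_mono.
Qed.

Lemma Fm_W r s i : t <= r <= s -> Fm s (fun w => W r w i 0).
Proof.
move=> trs _ Y mY; rewrite setTI; apply: sub_sigma_algebra; right.
by exists r, i, Y.
Qed.

Lemma filtration_null s E : P.-negligible E -> measurable (E : set (FT s)).
Proof. by move=> nE; apply: sub_sigma_algebra; left. Qed.

Lemma dW_meas r s i : t <= r <= T -> t <= s <= T ->
  measurable_fun setT (fun w => W s w i 0 - W r w i 0).
Proof. by move=> hr hs; apply: measurable_funB; exact: bb_measurable. Qed.

Notation E f := (Rintegral P setT f).
Notation N r s := (@normal_prob R 0 (Num.sqrt (s - r))).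

(** The identity is viewed as a random variable with values in (Omega, F_r). Independence of an
    increment from F_r is then independence from this variable, the form that [indep_integral]
    takes. *)
Let idF r (hr : t <= r <= T) : measurable_fun [set: Om] (id : Om -> FT r).
Proof. by move=> _ A mA; rewrite setTI; exact: filtration_measurable mA. Qed.

Lemma dW_indep1 r s (a : 'I_d) (A : set (FT r)) (Y : set R) :
  t <= r -> r < s -> s <= T -> measurable A -> measurable Y ->
  P (A `&` (fun w => W s w a 0 - W r w a 0) @^-1` Y) = (P A * N r s Y)%E.
Proof.
move=> tr rs sT mA mY.
have := @bb_increments _ _ _ _ B r s A (fun i => if i == a then Y else setT) tr rs sT mA.
move=> /(_ _)/wrap[|]; first by move=> i; case: eqP.
rewrite (bigD1 a)//= eqxx big1 ?mule1; last first.
  by move=> i /negbTE ->; rewrite probability_setT.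
move=> <-; congr (P (_ `&` _)); apply/seteqP; split => w /=.
  by move=> h i; case: eqP => // ->.
by move/(_ a); rewrite eqxx.
Qed.

Lemma dW_indep2 r s (a b : 'I_d) (A : set (FT r)) (Y Z : set R) : a != b ->
  t <= r -> r < s -> s <= T -> measurable A -> measurable Y -> measurable Z ->
  P (A `&` (fun w => W s w a 0 - W r w a 0) @^-1` Y
       `&` (fun w => W s w b 0 - W r w b 0) @^-1` Z) = (P A * N r s Y * N r s Z)%E.
Proof.
move=> ab tr rs sT mA mY mZ.
have := @bb_increments _ _ _ _ B r s A
  (fun i => if i == a then Y else if i == b then Z else setT) tr rs sT mA.
move=> /(_ _)/wrap[|]; first by move=> i; case: eqP => // _; case: eqP.
have ba : b != a by rewrite eq_sym.
rewrite (bigD1 a)//= eqxx (bigD1 b ba)/= (negbTE ba) eqxx.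
rewrite big1 ?mule1; last first.
  by move=> i /andP[/negbTE -> /negbTE ->]; rewrite probability_setT.
rewrite muleA => <-; rewrite -setIA; congr (P (_ `&` _)); apply/seteqP; split => w /=.
  by move=> [h1 h2] i; case: eqP => [->//|_]; case: eqP => // ->.
by move=> h; split; [have := h a; rewrite eqxx|have := h b; rewrite eq_sym (negbTE ab) eqxx].
Qed.

Let sq_sqrt (r s : R) : r < s -> Num.sqrt (s - r) ^+ 2 = s - r.
Proof. by move=> rs; rewrite sqr_sqrtr// subr_ge0 ltW. Qed.

Let sqrt0 (r s : R) : r < s -> 0 < Num.sqrt (s - r).
Proof. by move=> rs; rewrite sqrtr_gt0 subr_gt0. Qed.

Section Moments.
Context (r s : R) (tr : t <= r) (rs : r <= s) (sT : s <= T).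
Notation dW a := (fun w => W s w a 0 - W r w a 0).

Let hr : t <= r <= T. Proof. by rewrite tr (le_trans rs). Qed.
Let hs : t <= s <= T. Proof. by rewrite (le_trans tr). Qed.

Let indep_phi (eta : Om -> R) (a : 'I_d) (phi : R -> R) : r < s ->
  Fm r eta -> L1 P setT eta -> measurable_fun setT phi -> L1 (N r s) setT phi ->
  L1 P setT (fun w => eta w * phi (dW a w)) /\
  E (fun w => eta w * phi (dW a w)) = E eta * \int[N r s]_x phi x.
Proof.
move=> lrs meta ieta mphi iphi.
apply: (@indep_integral _ Om R P _ (FT r) _ _ (N r s) id (dW a)) => //.
- exact: idF.
- exact: dW_meas.
- by move=> A Y mA mY; rewrite preimage_id; exact: dW_indep1.
Qed.

Lemma E_dW eta a : Fm r eta -> L1 P setT eta ->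
  L1 P setT (fun w => eta w * dW a w) /\ E (fun w => eta w * dW a w) = 0.
Proof.
move=> meta ieta; have [ers|] := eqVneq r s.
  have eqf w : 0 = eta w * dW a w by rewrite ers subrr mulr0.
  split; first by apply: eq_L1 (L10 P setT) => // w _.
  by rewrite -[RHS](E0 P setT); apply: eq_E => w _; rewrite -eqf.
move=> nrs; have lrs : r < s by rewrite lt_neqAle nrs.
have [i1 e1] := normal_mean (sqrt0 lrs).
have [//|i e] := @indep_phi eta a id lrs meta ieta _ i1.
by split; [exact: i|rewrite e e1 mulr0].
Qed.

Lemma E_dW2 eta a b : Fm r eta -> L1 P setT eta ->
  L1 P setT (fun w => eta w * (dW a w * dW b w)) /\
  E (fun w => eta w * (dW a w * dW b w)) = (a == b)%:R * (s - r) * E eta.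
Proof.
move=> meta ieta; have [ers|] := eqVneq r s.
  have eqf w : 0 = eta w * (dW a w * dW b w) by rewrite ers !subrr !mulr0.
  split; first by apply: eq_L1 (L10 P setT) => // w _.
  rewrite ers subrr mulr0 mul0r -[RHS](E0 P setT); apply: eq_E => w _.
  by rewrite !subrr !(mul0r, mulr0).
move=> nrs; have lrs : r < s by rewrite lt_neqAle nrs.
have [<-|ab] := eqVneq a b.
  have [i1 e1] := normal_moment2 (sqrt0 lrs).
  have [|i e] := @indep_phi eta a (fun x => x ^+ 2) lrs meta ieta _ i1.
    exact: measurable_funX.
  split; first exact: i.
  by rewrite [LHS]e e1 sq_sqrt// mul1r mulrC.
rewrite mul0r mul0r.
have [i1 e1] := normal_mean (sqrt0 lrs).
have [//|i e] := @indep_phi eta a id lrs meta ieta _ i1.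
(* For a <> b the pair formed by the identity into [FT r] and [dW a] is the past, [dW b] is
   independent of it, and its mean 0 kills the product. *)
have mpair : measurable_fun [set: Om] (fun w => (w : FT r, dW a w)).
  by apply: measurable_fun_pair; [exact: idF|exact: dW_meas].
have [|||i2 e2] := @indep_integral _ Om R P _ (FT r * measurableTypeR R)%type _ _ (N r s)
  (fun w => (w : FT r, dW a w)) (dW b) mpair (dW_meas b hr hs) _
  (fun z => eta z.1 * z.2) id _ _ i i1.
- apply: (@mrestr_pair_law _ Om R P _ (FT r) _ (measurableTypeR R) _ (measurableTypeR R) (N r s) (N r s) id (dW a) (dW b)).
  + exact: idF.
  + exact: dW_meas.
  + exact: dW_meas.
  + by move=> A Y Z mA mY mZ; rewrite preimage_id; exact: dW_indep2.
- apply: measurable_funM; last exact: measurable_snd.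
  by apply: (measurableT_comp meta); exact: measurable_fst.
- exact: measurable_id.
split; first by apply: eq_L1 i2 => // w _; rewrite mulrA.
transitivity (E (fun w => eta w * dW a w * dW b w)); first by apply: eq_E => w _; rewrite mulrA.
by rewrite [LHS]e2 e1 mulr0.
Qed.

Lemma E_dW4 a : L1 P setT (fun w => dW a w ^+ 4) /\
  E (fun w => dW a w ^+ 4) <= 64 * (s - r) ^+ 2.
Proof.
have [ers|] := eqVneq r s.
  have eqf w : 0 = dW a w ^+ 4 by rewrite ers subrr expr0n.
  split; first by apply: eq_L1 (L10 P setT) => // w _.
  rewrite [leLHS](_ : _ = 0); first by rewrite mulr_ge0// sqr_ge0.
  by rewrite -[RHS](E0 P setT); apply: eq_E => w _.
move=> nrs; have lrs : r < s by rewrite lt_neqAle nrs.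
have [i1 e1] := normal_moment4 (sqrt0 lrs).
have iI : L1 P setT (fun=> 1).
  by apply: (@L1_bounded _ _ _ P setT measurableT 1) => //=; [rewrite probability_setT ltry|move=> x _; rewrite normr1].
have [||i e] := @indep_phi (fun=> 1) a (fun x => x ^+ 4) lrs _ iI _ i1.
- exact: measurable_cst.
- exact: measurable_funX.
split; first by apply: eq_L1 i => // w _; rewrite mul1r.
have -> : E (fun w => dW a w ^+ 4) = \int[P]_w (1 * dW a w ^+ 4).
  by apply: eq_E => w _; rewrite mul1r.
rewrite [leLHS]e Rintegral_cst//= probability_setT/= !mul1r.
by rewrite (le_trans e1)// -[4%N]/(2 * 2)%N exprM sq_sqrt.
Qed.

End Moments.
End Filtration.

Section Euclid.
Context (R : realType).

Lemma enorm_sq p k (M : 'M[R]_(p, k)) : enorm M ^+ 2 = \sum_i \sum_j M i j ^+ 2.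
Proof.
by rewrite sqr_sqrtr// sumr_ge0// => i _; rewrite sumr_ge0// => j _; exact: sqr_ge0.
Qed.

Lemma enormc_sq k (v : 'cV[R]_k) : enorm v ^+ 2 = \sum_i v i 0 ^+ 2.
Proof. by rewrite enorm_sq; apply: eq_bigr => i _; rewrite big_ord1. Qed.

Lemma enorm_ge0 p k (M : 'M[R]_(p, k)) : 0 <= enorm M.
Proof. exact: sqrtr_ge0. Qed.

End Euclid.

(** * Integration over time and chance jointly *)

Section ProductSpace.
Context (R : realType) (d0 : measure_display) (Om : measurableType d0) (P : probability Om R).
Notation lam := (@lebesgue_measure R).
Notation mu := (lam \x P)%E.

(** Double integrals of processes are taken as one integral over this strip, so that all lemmas on
    [L1] and [L2] apply to them. *)
Definition Dom (r s : R) : set (measurableTypeR R * Om) := [set p | r <= p.1 <= s].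

Lemma Dom_setX r s : Dom r s = `[r, s]%classic `*` setT.
Proof. by apply/seteqP; split => [p /= h|p /= []]; rewrite /Dom/= in_itv/=. Qed.

Lemma mem_DomE r s (tau : R) (w : Om) :
  (tau \in (`[r, s]%classic : set R)) = ((tau, w) \in Dom r s).
Proof. by apply/idP/idP => /set_mem h; apply/mem_set; move: h; rewrite /Dom/= in_itv. Qed.

Lemma measurable_Dom r s : measurable (Dom r s).
Proof. by rewrite Dom_setX; exact: measurableX. Qed.

Lemma mu_Dom r s : (mu (Dom r s) < +oo)%E.
Proof.
have -> : (mu (Dom r s) = lam `[r, s] * 1)%E.
  by rewrite Dom_setX product_measure1E//; congr (_ * _)%E; exact: probability_setT.
rewrite mule1 lebesgue_measure_itv/=.
by case: ifP => // _; rewrite -EFinB ltry.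
Qed.

Lemma Dom_sub r s r' s' : r' <= r -> s <= s' -> Dom r s `<=` Dom r' s'.
Proof. by move=> rr ss p /andP[h1 h2]; apply/andP; rewrite (le_trans rr)// (le_trans h2). Qed.

Lemma Dom_tonelli (f : R -> Om -> R) r s :
  measurable_fun (Dom r s) (fun p => f p.1 p.2) ->
  (forall p, Dom r s p -> 0 <= f p.1 p.2) ->
  (\int[P]_w \int[lam]_(tau in `[r, s]) (f tau w)%:E
    = \int[mu]_(p in Dom r s) (f p.1 p.2)%:E)%E /\
  (\int[lam]_(tau in `[r, s]) \int[P]_w (f tau w)%:E
    = \int[mu]_(p in Dom r s) (f p.1 p.2)%:E)%E /\
  measurable_fun setT (fun w => \int[lam]_(tau in `[r, s]) (f tau w)%:E)%E /\
  measurable_fun `[r, s] (fun tau : measurableTypeR R => \int[P]_w (f tau w)%:E)%E.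
Proof.
move=> mf f0; pose g : measurableTypeR R * Om -> \bar R := (fun p => (f p.1 p.2)%:E) \_ (Dom r s).
have mg : measurable_fun setT g.
  by apply/(measurable_restrictT _ (measurable_Dom r s)); exact/measurable_EFinP.
have g0 p : (0 <= g p)%E.
  by rewrite /g patchE; case: ifPn => //; rewrite inE => Dp; rewrite lee_fin f0.
have e0 : (\int[mu]_(p in Dom r s) (f p.1 p.2)%:E = \int[mu]_p g p)%E.
  by rewrite integral_mkcond.
have e1 w : (\int[lam]_(tau in `[r, s]) (f tau w)%:E = \int[lam]_tau g (tau, w))%E.
  rewrite integral_mkcond; apply: eq_integral => tau _; rewrite /g !patchE/=.
  by rewrite (mem_DomE _ _ _ w).
have e2 tau : `[r, s]%classic tau -> (\int[P]_w (f tau w)%:E = \int[P]_w g (tau, w))%E.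
  rewrite /= in_itv/= => h; apply: eq_integral => w _; rewrite /g patchE.
  by rewrite mem_set.
have e3 tau : ~ `[r, s]%classic tau -> (\int[P]_w g (tau, w) = 0)%E.
  rewrite /= in_itv/= => h; apply: integral0_eq => w _; rewrite /g patchE.
  by rewrite memNset.
split; first by rewrite e0 (@fubini_tonelli2 _ _ _ _ _ lam P g mg g0); apply: eq_integral => w _; rewrite e1.
split.
  rewrite e0 (@fubini_tonelli1 _ _ _ _ _ lam P g mg g0) integral_mkcond; apply: eq_integral => tau _.
  by rewrite patchE; case: ifPn; rewrite ?inE ?notin_setE => h; rewrite ?e2// /fubini_F e3.
split.
  apply: (eq_measurable_fun (fun w => \int[lam]_tau g (tau, w))%E) => [w _|]; first by rewrite e1.
  exact: measurable_fun_fubini_tonelli_G.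
apply: (eq_measurable_fun (fun tau => \int[P]_w g (tau, w))%E) => [tau|]; first by rewrite inE => h; rewrite e2.
by apply: measurable_funTS; exact: measurable_fun_fubini_tonelli_F.
Qed.

(** The inner integral is a real number, namely [fine] of the extended one. The two agree for almost
    every outcome, those whose path is integrable, and this is enough for the outer integral. *)
Lemma Dom_fubini (f : R -> Om -> R) r s :
  L1 mu (Dom r s) (fun p => f p.1 p.2) ->
  L1 P setT (fun w => \int[lam]_(tau in `[r, s]) f tau w) /\
  \int[P]_w (\int[lam]_(tau in `[r, s]) f tau w) = \int[mu]_(p in Dom r s) f p.1 p.2 /\
  {ae P, forall w, L1 lam `[r, s] (fun tau => f tau w)}.
Proof.
move=> fi; pose g : measurableTypeR R * Om -> \bar R := (fun p => (f p.1 p.2)%:E) \_ (Dom r s).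
have ig : mu.-integrable setT g by apply/(integrable_mkcond _ (measurable_Dom r s)).
have e1 w : (\int[lam]_(tau in `[r, s]) (f tau w)%:E = \int[lam]_tau g (tau, w))%E.
  rewrite integral_mkcond; apply: eq_integral => tau _; rewrite /g !patchE/=.
  by rewrite (mem_DomE _ _ _ w).
have ae : {ae P, forall w, L1 lam `[r, s] (fun tau => f tau w)}.
  apply: filterS (ae_integrable2 ig) => w iw.
  apply/(integrable_mkcond _) => //.
have iG : P.-integrable setT (fubini_G lam g).
  apply/integrableP; split; first exact: measurable_fubini_G ig.
  have mg := measurable_int _ ig.
  have mag : measurable_fun setT (abse \o g) by exact: measurableT_comp.
  apply: le_lt_trans ((integrable21ltyP lam P mg).1 ig).
  apply: ge0_le_integral => //.
  - by apply: measurableT_comp => //; exact: measurable_fubini_G ig.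
  - by apply: (measurable_fun_fubini_tonelli_G _ mag) => p; exact: abse_ge0.
  - move=> w _; apply: le_abse_integral => //.
    exact: measurableT_comp.
have fe : {ae P, forall w, (fine (fubini_G lam g w))%:E = fubini_G lam g w}.
  apply: filterS ae => w iw; rewrite fineK// /fubini_G -e1.
  exact: integrable_fin_num.
have mfine : measurable_fun setT (fun w => (fine (fubini_G lam g w))%:E).
  by apply/measurable_EFinP/measurableT_comp => //; exact: measurable_int iG.
have ifi : P.-integrable setT (fun w => (fine (fubini_G lam g w))%:E).
  apply/integrableP; split => //.
  move/integrableP : (iG) => [mG]; apply: le_lt_trans.
  apply: ae_ge0_le_integral => //=.
  - exact: (measurableT_comp (@abse_measurable _ setT) mfine).
  - exact: (measurableT_comp (@abse_measurable _ setT) mG).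
  - by apply: filterS fe => w e _; rewrite -[in leRHS]e.
have eR w : (\int[lam]_(tau in `[r, s]) f tau w)%:E = (fine (fubini_G lam g w))%:E.
  by rewrite /Rintegral e1.
split; last split => //.
  by apply: eq_integrable ifi => // w _ /=; rewrite eR.
rewrite /Rintegral; congr fine; rewrite [RHS]integral_mkcond -[RHS](integral21_prod_meas1 ig).
apply: ae_eq_integral => //.
- by apply: eq_measurable_fun mfine => w _; rewrite eR.
- exact: measurable_int iG.
- by apply: filterS fe => w e _; rewrite eR e.
Qed.

Lemma L1_param (f : Om -> R) r s : L1 P setT f -> L1 mu (Dom r s) (fun p => f p.2).
Proof.
move=> fi; have mf : measurable_fun (Dom r s) (fun p => f p.2).
  apply: measurable_funTS; apply: (@measurableT_comp _ _ _ _ _ _ f) => //.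
  exact: L1_meas fi.
apply: L1_normP => //; first exact: measurable_Dom.
apply: L1P => //; first exact: measurableT_comp.
have [<- _] := @Dom_tonelli (fun _ w => `|f w|) r s (measurableT_comp (@normr_measurable _ _) mf) (fun _ _ => normr_ge0 _).
under eq_integral => w _ do rewrite integral_cst//=.
rewrite ge0_integralZr//=; last first.
  by apply/measurable_EFinP/measurableT_comp => //; exact: L1_meas fi.
rewrite lte_mul_pinfty//.
- by apply: integral_ge0.
- by rewrite ge0_fin_numE ?integral_ge0//; case/integrableP : fi.
- by rewrite lebesgue_measure_itv/=; case: ifP => // _; rewrite -EFinB ltry.
Qed.

Lemma E_param (f : Om -> R) r s : r <= s -> L1 P setT f ->
  \int[mu]_(p in Dom r s) f p.2 = (s - r) * \int[P]_w f w.
Proof.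
move=> rs fi; have [_ [<- _]] := Dom_fubini (f := fun _ w => f w) (L1_param r s fi).
rewrite -EZ//; apply: eq_E => w _; rewrite Rintegral_cst//= lebesgue_measure_itv/=.
by rewrite lte_fin; case: ltgtP rs => //= [_|->] _; rewrite ?subrr mulrC ?mul0r.
Qed.

(** The time r is negligible. Simple processes are built on left-open intervals, so on a cell their
    value is known only after its left end. *)
Lemma Dom_ae r s (f g : R -> Om -> R) : 
  measurable_fun (Dom r s) (fun p => f p.1 p.2) ->
  measurable_fun (Dom r s) (fun p => g p.1 p.2) ->
  (forall tau w, r < tau <= s -> f tau w = g tau w) ->
  \int[mu]_(p in Dom r s) f p.1 p.2 = \int[mu]_(p in Dom r s) g p.1 p.2.
Proof.
move=> mf mg fg; apply: E_ae => //; first exact: measurable_Dom.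
exists ([set r] `*` setT); split.
- by apply: measurableX.
- have m1 : measurable ([set r] : set (measurableTypeR R)) by [].
  transitivity (lam [set r] * P setT)%E.
    exact: (@product_measure1E _ _ _ _ _ lam P [set r] setT m1 measurableT).
  by rewrite lebesgue_measure_set1 mul0e.
move=> [tau w] /= /not_implyP[/andP[h1 h2]] ne; split => //; apply/eqP.
apply: contra_notT ne => ne; apply: fg.
by rewrite h2 andbT lt_neqAle eq_sym ne.
Qed.

End ProductSpace.

(** * Simple processes *)

Section Dotv.
Context (R : realType) (k : nat).
Implicit Types u v w : 'cV[R]_k.

Lemma dotvBr u v w : dotv u (v - w) = dotv u v - dotv u w.
Proof. by rewrite /dotv -sumrB; apply: eq_bigr => i _; rewrite !mxE mulrBr. Qed.

Lemma dotvBl u v w : dotv (u - v) w = dotv u w - dotv v w.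
Proof. by rewrite /dotv -sumrB; apply: eq_bigr => i _; rewrite !mxE mulrBl. Qed.

Lemma dotvDl u v w : dotv (u + v) w = dotv u w + dotv v w.
Proof. by rewrite /dotv -big_split/=; apply: eq_bigr => i _; rewrite !mxE mulrDl. Qed.

Lemma dotv0l v : dotv 0 v = 0.
Proof. by rewrite /dotv big1// => i _; rewrite !mxE mul0r. Qed.

Lemma dotv0r v : dotv v 0 = 0.
Proof. by rewrite /dotv big1// => i _; rewrite !mxE mulr0. Qed.

Lemma dotv_suml (I : finType) (F : I -> 'cV[R]_k) v :
  dotv (\sum_i F i) v = \sum_i dotv (F i) v.
Proof.
by elim/big_rec2 : _ => [|i x y _ <-]; rewrite ?dotv0l ?dotvDl.
Qed.

Lemma abs_coord_le p (M : 'M[R]_(p, k)) i j : `|M i j| <= enorm M.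
Proof.
rewrite -sqrtr_sqr ler_wsqrtr// (bigD1 i)//= (bigD1 j)//= -addrA lerDl addr_ge0//.
  by apply: sumr_ge0 => *; exact: sqr_ge0.
by apply: sumr_ge0 => *; apply: sumr_ge0 => *; exact: sqr_ge0.
Qed.

End Dotv.

Section SimpleIntegral.
Context (R : realType) (d : nat) (t T : R) (B : brownian_basis d t T) (tT : t <= T).
Notation Om := (bb_Omega B).
Notation P := (bb_P B).
Notation W := (bb_W B).
Notation lam := (@lebesgue_measure R).
Notation mu := (lam \x P)%E.
Notation Dom := (@Dom R (bb_disp B) Om).
Notation E f := (Rintegral P setT f).
Notation Fm := (Fm (B := B)).

Definition bnd (f : Om -> R) := exists C, forall w, `|f w| <= C.

Lemma FmM s f g : Fm s f -> Fm s g -> Fm s (fun w => f w * g w).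
Proof. by move=> mf mg; exact: measurable_funM. Qed.

Lemma FmB s f g : Fm s f -> Fm s g -> Fm s (fun w => f w - g w).
Proof. by move=> mf mg; exact: measurable_funB. Qed.

Lemma Fm_cst s (c : R) : Fm s (fun=> c).
Proof. exact: measurable_cst. Qed.

Lemma PT_lty : (P setT < +oo)%E. Proof. by rewrite probability_setT ltry. Qed.

Lemma L1_bnd f : measurable_fun setT f -> bnd f -> L1 P setT f.
Proof.
by move=> mf [C fC]; apply: (@L1_bounded _ _ _ P setT measurableT C) => //; exact: PT_lty.
Qed.

Lemma L2_bnd f : measurable_fun setT f -> bnd f -> L2 P setT f.
Proof.
by move=> mf [C fC]; apply: (@L2_bounded _ _ _ P setT measurableT C) => //; exact: PT_lty.
Qed.

Lemma bndM f g : bnd f -> bnd g -> bnd (fun w => f w * g w).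
Proof.
move=> [C fC] [K gK]; exists (C * K) => w; rewrite normrM ler_pM//.
Qed.

Lemma progressive_meas V : progressive V -> measurable_fun (Dom t T) (fun p => V p.1 p.2).
Proof.
move=> pV; have hT : t <= T <= T by rewrite tT lexx.
have := pV T hT; set F := [set p | _] => mV.
pose h (p : measurableTypeR R * Om) : measurableTypeR R * FT B T := (p.1, p.2).
apply: (measurable_comp (F := F) (f := fun p => V p.1 p.2) (g := h)) => //.
- have -> : F = `[t, T]%classic `*` setT.
    by apply/seteqP; split => [p /= hh|p /= []]; rewrite /F/= in_itv/=.
  exact: measurableX.
- by move=> _ [p /= hp <-].
- apply: measurable_funTS; apply: measurable_fun_pair; first exact: measurable_fst.
  apply: (measurable_comp (F := setT) (f := id : Om -> FT B T) (g := snd)) => //.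
    by move=> _ A mA; rewrite setTI; exact: filtration_measurable mA.
Qed.

Lemma progressive_Fm V s : t <= s <= T -> progressive V -> Fm s (V s).
Proof.
move=> hs pV; have := pV s hs; set F := [set p | _] => mV.
pose h (w : FT B s) : measurableTypeR R * FT B s := (s, w).
apply: (measurable_comp (F := F) (f := fun p => V p.1 p.2) (g := h)) => //.
- have -> : F = `[t, s]%classic `*` setT.
    by apply/seteqP; split => [p /= hh|p /= []]; rewrite /F/= in_itv/=.
  exact: measurableX.
- by move=> _ [p /= hp <-]; rewrite /F/= lexx andbT; case/andP : hs.
- exact: measurable_fun_pair.
Qed.

Lemma measurable_DomS r s (f : R -> Om -> R) : t <= r -> s <= T ->
  measurable_fun (Dom t T) (fun p => f p.1 p.2) ->
  measurable_fun (Dom r s) (fun p => f p.1 p.2).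
Proof.
by move=> tr sT; apply: measurable_funS; [exact: measurable_Dom|exact: Dom_sub].
Qed.

Lemma measurable_snd_Dom r s (f : Om -> R) : measurable_fun setT f ->
  measurable_fun (Dom r s) (fun p => f p.2).
Proof. by move=> mf; apply: measurable_funTS; exact: (measurableT_comp mf). Qed.

Lemma measurable_fst_Dom r s (f : R -> R) : measurable_fun setT f ->
  measurable_fun (Dom r s) (fun p => f p.1).
Proof. by move=> mf; apply: measurable_funTS; exact: (measurableT_comp mf). Qed.

Lemma dW_L2 r s a : t <= r -> r <= s -> s <= T ->
  L2 P setT (fun w => W s w a 0 - W r w a 0).
Proof.
move=> tr rs sT; split; first by apply: dW_meas; rewrite ?tr ?(le_trans rs)// (le_trans tr).
have i1 : L1 P setT (fun=> 1) by apply: L1_bnd => //; exists 1 => w; rewrite normr1.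
have [i _] := E_dW2 tr rs sT a a (@measurable_cst _ _ _ _ setT (1 : R) : Fm r (fun=> 1)) i1.
by apply: eq_L1 i => // w _; rewrite mul1r expr2.
Qed.

Variable S : simple_process B.
Notation D := (simple_int S).

Lemma sp_lo_ge i : t <= @sp_lo _ _ _ _ _ S i. Proof. by have [] := sp_order i. Qed.
Lemma sp_lo_hi i : @sp_lo _ _ _ _ _ S i <= sp_hi i. Proof. by have [] := sp_order i. Qed.
Lemma sp_hi_le i : @sp_hi _ _ _ _ _ S i <= T. Proof. by have [] := sp_order i. Qed.

Lemma simple_valE s w a : simple_val S s w a 0 =
  \sum_i ((sp_lo i < s) && (s <= sp_hi i))%:R * sp_coef (s := S) i w a 0.
Proof.
rewrite /simple_val summxE; apply: eq_bigr => i _.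
by case: ifP => _; rewrite ?mul1r// mxE mul0r.
Qed.

Lemma coef_Fm i a s : sp_lo i <= s -> Fm s (fun w => sp_coef (s := S) i w a 0).
Proof. by move=> h; apply: (Fm_mono h); exact: sp_adapted. Qed.

Lemma coef_bnd i a : bnd (fun w => sp_coef (s := S) i w a 0).
Proof.
by have [M hM] := sp_bounded (s := S) i; exists M => w; rewrite (le_trans _ (hM w))// abs_coord_le.
Qed.

Lemma coef_meas i a : measurable_fun setT (fun w => sp_coef (s := S) i w a 0).
Proof.
apply: (@Fm_meas _ _ _ _ B (sp_lo i)); last exact: coef_Fm.
by rewrite sp_lo_ge (le_trans (sp_lo_hi i))// sp_hi_le.
Qed.

Lemma simple_val_meas a : measurable_fun (Dom t T) (fun p => simple_val S p.1 p.2 a 0).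
Proof.
under eq_fun do rewrite simple_valE.
apply: measurable_sum => i; apply: measurable_funM.
  apply: (measurable_fst_Dom (f := fun s => ((sp_lo i < s) && (s <= sp_hi i))%:R)).
  have -> : (fun s => ((sp_lo i < s) && (s <= sp_hi i))%:R) = \1_(`]sp_lo i, sp_hi i]) :> (R -> R).
    by apply/funext => s; rewrite indicE mem_setE in_itv.
  exact: measurable_indic.
by apply: (measurable_snd_Dom (f := fun w => sp_coef (s := S) i w a 0)); exact: coef_meas.
Qed.

Lemma simple_val_bnd a : exists M, forall s w, `|simple_val S s w a 0| <= M.
Proof.
pose M i := sval (cid (coef_bnd i a)).
exists (\sum_i M i) => s w; rewrite simple_valE (le_trans (ler_norm_sum _ _ _))//.
apply: ler_sum => i _; rewrite normrM /M; case: cid => /= C hC.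
have C0 : 0 <= C by exact: le_trans (hC w).
by case: (_ && _); rewrite ?normr1 ?mul1r// normr0 mul0r.
Qed.

(** Before [sp_lo i] both minima equal s and the increment vanishes, so the indicator may be
    inserted; it makes the coefficient F_s-measurable. *)
Lemma sp_termE s w i : dotv (sp_coef (s := S) i w)
     (W (Num.min s (sp_hi i)) w - W (Num.min s (sp_lo i)) w)
  = \sum_a ((sp_lo i <= s)%R%:R * sp_coef (s := S) i w a 0) *
       (W (Num.min s (sp_hi i)) w a 0 - W (Num.min s (sp_lo i)) w a 0).
Proof.
have [h|h] := lerP (sp_lo i) s.
  by apply: eq_bigr => a _; rewrite !mxE mul1r.
rewrite (min_l (y := sp_hi i)) ?subrr ?dotv0r; last by rewrite (le_trans (ltW h))// sp_lo_hi.
by rewrite big1// => a _; rewrite !mul0r.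
Qed.

Let minlo s i : t <= s <= T -> t <= Num.min s (@sp_lo _ _ _ _ _ S i) <= T.
Proof. by move=> /andP[ts sT]; rewrite le_min ts sp_lo_ge ge_min sT. Qed.

Let minhi s i : t <= s <= T -> t <= Num.min s (@sp_hi _ _ _ _ _ S i) <= T.
Proof.
by move=> /andP[ts sT]; rewrite le_min ts (le_trans (sp_lo_ge i) (sp_lo_hi i)) ge_min sT.
Qed.

Lemma simple_int_Fm s : t <= s <= T -> Fm s (D s).
Proof.
move=> hs; rewrite /simple_int; under eq_fun do under eq_bigr do rewrite sp_termE.
apply: measurable_sum => i; apply: measurable_sum => a; apply: measurable_funM.
  have [h|h] := lerP (sp_lo i) s.
    by apply: measurable_funM => //; exact: coef_Fm.
  by under eq_fun do rewrite mul0r; exact: measurable_cst.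
have /andP[? _] := minlo i hs; have /andP[? _] := minhi i hs.
by apply: measurable_funB; apply: Fm_W; rewrite ge_min lexx ?andbT.
Qed.

Lemma simple_int_L2 s : t <= s <= T -> L2 P setT (D s).
Proof.
move=> hs; rewrite /simple_int.
have H : L2 P setT (fun w => \sum_i \sum_a ((sp_lo i <= s)%R%:R * sp_coef (s := S) i w a 0) *
       (W (Num.min s (sp_hi i)) w a 0 - W (Num.min s (sp_lo i)) w a 0)).
  apply: L2_sum => // i _; apply: L2_sum => // a _.
  have [C hC] := coef_bnd i a.
  apply: (@L2bM _ _ _ P setT measurableT C).
  - by apply: measurable_funM => //; exact: coef_meas.
  - move=> w _; rewrite normrM; case: (sp_lo i <= s); rewrite ?normr1 ?mul1r//.
    by rewrite normr0 mul0r (le_trans _ (hC w)).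
  - have /andP[? _] := minlo i hs; have /andP[_ ?] := minhi i hs.
    apply: dW_L2 => //; by rewrite le_min !ge_min lexx/= sp_lo_hi orbT.
by apply: eq_L2 H => // w _; apply: eq_bigr => i _; rewrite sp_termE.
Qed.

Definition noknot r s := forall i : 'I_(sp_size S),
  (sp_lo i <= r \/ s <= sp_lo i) /\ (sp_hi i <= r \/ s <= sp_hi i).

(** Martingale property and conditional Ito isometry over [r, s], with a test variable xi in place
    of conditional expectations. The first half is required for square-integrable xi because the
    chaining of intervals applies it to xi (D_m - D_r), which need not be bounded. *)
Definition incr_ok r s :=
  (forall xi, Fm r xi -> L2 P setT xi -> E (fun w => xi w * (D s w - D r w)) = 0) /\
  (forall xi, Fm r xi -> bnd xi -> E (fun w => xi w * (D s w - D r w) ^+ 2) =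
     \int[mu]_(p in Dom r s) (xi p.2 * enorm (simple_val S p.1 p.2) ^+ 2)).

Section Base.
Context (r s : R) (tr : t <= r) (rs : r < s) (sT : s <= T) (nk : noknot r s).
(** The constant value of the process on ]r, s] when no knot lies strictly between r and s. *)
Let C (w : Om) : 'cV[R]_d := \sum_i (if (sp_lo i <= r) && (s <= sp_hi i) then sp_coef (s := S) i w else 0).
Notation dW a := (fun w => W s w a 0 - W r w a 0).

Let CE w a : C w a 0 = \sum_i ((sp_lo i <= r) && (s <= sp_hi i))%:R * sp_coef (s := S) i w a 0.
Proof.
rewrite /C summxE; apply: eq_bigr => i _.
by case: ifP => _; rewrite ?mul1r// mxE mul0r.
Qed.

Let CFm a : Fm r (fun w => C w a 0).
Proof.
under eq_fun do rewrite CE.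
apply: measurable_sum => i; case lr: (sp_lo i <= r) => /=.
  by apply: measurable_funM => //; exact: coef_Fm.
by under eq_fun do rewrite mul0r; exact: measurable_cst.
Qed.

Let Cbnd a : bnd (fun w => C w a 0).
Proof.
pose M i := sval (cid (coef_bnd i a)).
exists (\sum_i M i) => w; rewrite CE (le_trans (ler_norm_sum _ _ _))//.
apply: ler_sum => i _; rewrite normrM /M; case: cid => /= K hK.
have K0 : 0 <= K by exact: le_trans (hK w).
by case: (_ && _); rewrite ?normr1 ?mul1r// normr0 mul0r.
Qed.

Let DE w : D s w - D r w = \sum_a C w a 0 * (W s w a 0 - W r w a 0).
Proof.
have -> : \sum_a C w a 0 * (W s w a 0 - W r w a 0) = dotv (C w) (W s w - W r w).
  by apply: eq_bigr => a _; rewrite !mxE.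
rewrite /simple_int -sumrB dotv_suml; apply: eq_bigr => i _; rewrite -dotvBr.
have [[lr|sl] hh] := nk i; last first.
  have := sp_lo_hi i => lh.
  have sh : s <= sp_hi i by rewrite (le_trans sl).
  have rl := le_trans (ltW rs) sl; have rh := le_trans (ltW rs) sh.
  rewrite (min_l sl) (min_l sh) (min_l rl) (min_l rh) !subrr dotv0r.
  by rewrite leNgt (lt_le_trans rs sl)/= dotv0l.
rewrite lr/= !(min_r (y := sp_lo i)) ?(le_trans lr (ltW rs))//.
case: hh => [hr|sh].
  rewrite !(min_r (y := sp_hi i)) ?(le_trans hr (ltW rs))// subrr dotv0r.
  by rewrite leNgt (le_lt_trans hr rs)/= dotv0l.
rewrite sh !(min_l (y := sp_hi i)) ?(le_trans (ltW rs))//.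
by rewrite opprB addrA subrK.
Qed.

Let valE tau w : r < tau <= s -> simple_val S tau w = C w.
Proof.
move=> /andP[rt ts]; apply: eq_bigr => i _.
have [[lr|sl] [hr|sh]] := nk i.
- have -> : (tau <= sp_hi i) = false by apply/negbTE; rewrite -ltNge (le_lt_trans hr rt).
  have -> : (s <= sp_hi i) = false by apply/negbTE; rewrite -ltNge (le_lt_trans hr rs).
  by rewrite !andbF.
- by rewrite lr sh (le_lt_trans lr rt) (le_trans ts sh).
- have -> : (tau <= sp_hi i) = false by apply/negbTE; rewrite -ltNge (le_lt_trans hr rt).
  have -> : (s <= sp_hi i) = false by apply/negbTE; rewrite -ltNge (le_lt_trans hr rs).
  by rewrite !andbF.
- have -> : (sp_lo i < tau) = false by apply/negbTE; rewrite -leNgt (le_trans ts sl).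
  by have -> : (sp_lo i <= r) = false by apply/negbTE; rewrite -ltNge (lt_le_trans rs sl).
Qed.

Let rsle := ltW rs.
Let hr : t <= r <= T. Proof. by rewrite tr (le_trans rsle). Qed.

Lemma incr_ok_base : incr_ok r s.
Proof.
split => xi mxi.
  move=> ixi; under eq_E do rewrite DE mulr_sumr.
  have H a : L1 P setT (fun w => xi w * (C w a 0 * (W s w a 0 - W r w a 0))) /\
      E (fun w => xi w * (C w a 0 * (W s w a 0 - W r w a 0))) = 0.
    have [K hK] := Cbnd a.
    have i1 : L1 P setT (fun w => C w a 0 * xi w).
      apply: (@L1bM _ _ _ P setT measurableT K) => //.
      - exact: Fm_meas (CFm a).
      - by apply: L2_L1 => //; exact: PT_lty.
    have [i e] := E_dW tr rsle sT a (measurable_funM (CFm a) mxi : Fm r _) i1.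
    split; first by apply: eq_L1 i => // w _ /=; ring.
    by rewrite -[RHS]e; apply: eq_E => w _ /=; ring.
  rewrite E_sum//; last by move=> a _; have [] := H a.
  by rewrite big1// => a _; have [] := H a.
move=> bxi.
have i2 a b : L1 P setT (fun w => xi w * C w a 0 * C w b 0).
  apply: L1_bnd; last by apply: bndM => //; exact: bndM.
  exact: (Fm_meas hr (FmM (FmM mxi (CFm a)) (CFm b))).
have H a b : L1 P setT (fun w => xi w * C w a 0 * C w b 0 * (dW a w * dW b w)) /\
   E (fun w => xi w * C w a 0 * C w b 0 * (dW a w * dW b w)) =
   (a == b)%:R * (s - r) * E (fun w => xi w * C w a 0 * C w b 0).
  by apply: E_dW2 => //; exact: (FmM (FmM mxi (CFm a)) (CFm b)).
transitivity ((s - r) * E (fun w => xi w * enorm (C w) ^+ 2)).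
  transitivity (E (fun w => \sum_a \sum_b (xi w * C w a 0 * C w b 0 * (dW a w * dW b w)))).
    apply: eq_E => w _; rewrite DE expr2 mulr_suml mulr_sumr; apply: eq_bigr => a _.
    rewrite mulr_sumr mulr_sumr; apply: eq_bigr => b _; ring.
  rewrite E_sum//; last by move=> a _; apply: L1_sum => // b _; have [] := H a b.
  under eq_bigr => a _ do (rewrite E_sum//; [|by move=> b _; have [] := H a b]).
  transitivity (\sum_a (s - r) * E (fun w => xi w * C w a 0 * C w a 0)).
    apply: eq_bigr => a _; rewrite (bigD1 a)//= (H a a).2 eqxx mul1r big1 ?addr0//.
    by move=> b ba; rewrite (H a b).2 eq_sym (negbTE ba) !mul0r.
  rewrite -mulr_sumr; congr (_ * _); rewrite -E_sum//.
  apply: eq_E => w _; rewrite enormc_sq mulr_sumr; apply: eq_bigr => a _; ring.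
have iC : L1 P setT (fun w => xi w * enorm (C w) ^+ 2).
  have : L1 P setT (fun w => \sum_a xi w * C w a 0 * C w a 0) by apply: L1_sum.
  apply: eq_L1 => // w _; rewrite enormc_sq mulr_sumr; apply: eq_bigr => a _; ring.
rewrite -(E_param rsle iC); apply/esym.
have mxi0 := Fm_meas hr mxi.
have -> : \int[mu]_(p in Dom r s) (xi p.2 * enorm (simple_val S p.1 p.2) ^+ 2)
   = \int[mu]_(p in Dom r s) (xi p.2 * \sum_a (simple_val S p.1 p.2 a 0) ^+ 2).
  by apply: eq_E => p _; rewrite enormc_sq.
apply: (@Dom_ae _ _ _ _ _ _ (fun tau w => xi w * \sum_a (simple_val S tau w a 0) ^+ 2)
   (fun tau w => xi w * enorm (C w) ^+ 2)).
- apply: measurable_funM; first exact: (measurable_snd_Dom (f := xi)).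
  apply: measurable_sum => a; apply: measurable_funX.
  apply: (measurable_DomS (f := fun tau w => simple_val S tau w a 0)) => //.
  exact: simple_val_meas.
- by apply: (measurable_snd_Dom (f := fun w => xi w * enorm (C w) ^+ 2)); exact: L1_meas iC.
- by move=> tau w h; rewrite -enormc_sq (valE w h).
Qed.

End Base.

Lemma Dom_split r m s (f : R -> Om -> R) : r <= m -> m <= s ->
  L1 mu (Dom r s) (fun p => f p.1 p.2) ->
  \int[mu]_(p in Dom r s) f p.1 p.2 =
  \int[mu]_(p in Dom r m) f p.1 p.2 + \int[mu]_(p in Dom m s) f p.1 p.2.
Proof.
move=> rm ms fi.
have sub u v : r <= u -> v <= s -> L1 mu (Dom u v) (fun p => f p.1 p.2).
  move=> ru vs; apply: integrableS fi; try exact: measurable_Dom.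
  exact: Dom_sub.
have [i0 [e0 a0]] := Dom_fubini fi.
have [i1 [e1 a1]] := Dom_fubini (sub r m (lexx r) ms).
have [i2 [e2 a2]] := Dom_fubini (sub m s rm (lexx s)).
rewrite -e0 -e1 -e2 -ED//; apply: E_ae => //.
- exact: L1_meas i0.
- exact: measurable_funD (L1_meas i1) (L1_meas i2).
- apply: filterS a0 => w iw _.
  rewrite -(@Rintegral_itv_obnd_cbnd _ m (BRight s)); last first.
    by apply: integrableS iw => //; apply: subset_itvr; rewrite bnd_simp.
  by rewrite -(@Rintegral_itvB _ _ (BLeft r) (BRight s) m)// ?bnd_simp// addrC subrK.
Qed.

Lemma L2_bnd_val a r s : t <= r -> s <= T ->
  L2 mu (Dom r s) (fun p => simple_val S p.1 p.2 a 0).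
Proof.
move=> tr sT; have [M hM] := simple_val_bnd a.
apply: (@L2_bounded _ _ _ mu (Dom r s) (@measurable_Dom _ _ _ _ _) M).
- exact: mu_Dom.
- apply: (measurable_DomS (f := fun tau w => simple_val S tau w a 0)) => //.
  exact: simple_val_meas.
- by move=> p _; exact: hM.
Qed.

Lemma xi_val_L1 r s xi : t <= r -> s <= T -> measurable_fun setT xi -> bnd xi ->
  L1 mu (Dom r s) (fun p => xi p.2 * enorm (simple_val S p.1 p.2) ^+ 2).
Proof.
move=> tr sT mxi [C hC]; apply: (@L1bM _ _ _ _ _ (@measurable_Dom _ _ _ _ _) C).
- exact: measurable_snd_Dom.
- by move=> p _; exact: hC.
- have : L1 mu (Dom r s) (fun p => \sum_a simple_val S p.1 p.2 a 0 ^+ 2).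
    apply: L1_sum => [|a _]; first exact: measurable_Dom.
    by have [] := L2_bnd_val a tr sT.
  by apply: eq_L1 => [|p _]; [exact: measurable_Dom|rewrite enormc_sq].
Qed.

Lemma L2_bndM xi f : measurable_fun setT xi -> bnd xi -> L2 P setT f ->
  L2 P setT (fun w => xi w * f w).
Proof. by move=> mxi [C hC]; apply: (@L2bM _ _ _ P setT measurableT C). Qed.

(** Increments add up, and in the square the cross term is the martingale identity on [m, s] tested
    against xi (D_m - D_r). *)
Lemma incr_ok_chain r m s : t <= r -> r <= m -> m <= s -> s <= T ->
  incr_ok r m -> incr_ok m s -> incr_ok r s.
Proof.
move=> tr rm ms sT [M1 Q1] [M2 Q2].
have hr : t <= r <= T by rewrite tr (le_trans rm)// (le_trans ms).
have hm : t <= m <= T by rewrite (le_trans tr)//= (le_trans ms).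
have hs : t <= s <= T by rewrite (le_trans tr)//= (le_trans rm).
have Lr := simple_int_L2 hr; have Lm := simple_int_L2 hm; have Ls := simple_int_L2 hs.
have Lmr := L2B measurableT Lm Lr; have Lsm := L2B measurableT Ls Lm.
split => xi mxi.
  move=> ixi; transitivity (E (fun w => xi w * (D m w - D r w) + xi w * (D s w - D m w))).
    by apply: eq_E => w _; ring.
  rewrite ED//; [|exact: L2M|exact: L2M].
  by rewrite M1// M2// ?addr0//; exact: Fm_mono rm mxi.
move=> bxi; have mxi0 := Fm_meas hr mxi.
have Lx := L2_bndM mxi0 bxi Lmr; have Ly := L2_bndM mxi0 bxi Lsm.
transitivity (E (fun w => xi w * (D m w - D r w) ^+ 2 + xi w * (D s w - D m w) ^+ 2
    + 2 * ((xi w * (D m w - D r w)) * (D s w - D m w)))).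
  by apply: eq_E => w _; ring.
have i1 : L1 P setT (fun w => xi w * (D m w - D r w) ^+ 2).
  by apply: eq_L1 (L2M measurableT Lx Lmr) => // w _; ring.
have i2 : L1 P setT (fun w => xi w * (D s w - D m w) ^+ 2).
  by apply: eq_L1 (L2M measurableT Ly Lsm) => // w _; ring.
have i3 := L2M measurableT Lx Lsm.
rewrite ED//; [|exact: L1D|exact: L1Z].
rewrite ED// EZ// Q1// Q2//; last exact: Fm_mono rm mxi.
rewrite M2 ?mulr0 ?addr0//; last first.
  apply: FmM; first exact: Fm_mono rm mxi.
  by apply: FmB; [exact: simple_int_Fm|apply: Fm_mono rm _; exact: simple_int_Fm].
rewrite (Dom_split (f := fun tau w => xi w * enorm (simple_val S tau w) ^+ 2) rm ms)//.
exact: xi_val_L1.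
Qed.

Lemma incr_ok_refl r : t <= r <= T -> incr_ok r r.
Proof.
move=> hr; have /andP[tr rT] := hr; split => xi mxi bxi.
  by rewrite -[RHS](E0 P setT); apply: eq_E => w _; rewrite subrr mulr0.
have i0 := xi_val_L1 tr rT (Fm_meas hr mxi) bxi.
rewrite (@Dom_ae _ _ _ _ _ _ (fun tau w => xi w * enorm (simple_val S tau w) ^+ 2) (fun _ _ => 0)).
- rewrite E0 -[RHS](E0 P setT); apply: eq_E => w _.
  by rewrite subrr expr0n mulr0.
- exact: L1_meas i0.
- exact: measurable_cst.
- by move=> tau w /andP[rt tr']; have := lt_le_trans rt tr'; rewrite ltxx.
Qed.

(** L collects the knots that may still lie inside ]r, s[. If its head does, the interval is cut
    there and both halves are treated with the tail; otherwise the head is discarded. The empty list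
    is the case of a constant integrand. *)
Lemma incr_ok_list (L : seq R) : forall r s, t <= r -> r <= s -> s <= T ->
  (forall i : 'I_(sp_size S), (sp_lo i \in L \/ (sp_lo i <= r \/ s <= sp_lo i)) /\
    (sp_hi i \in L \/ (sp_hi i <= r \/ s <= sp_hi i))) -> incr_ok r s.
Proof.
elim: L => [|b L IH] r s tr rs sT H.
  move: (rs); rewrite le_eqVlt => /predU1P[rse|lrs].
    by rewrite -rse; apply: incr_ok_refl; rewrite tr rse.
  by apply: incr_ok_base => // i; have [[//|h1] [//|h2]] := H i.
have [/andP[rb bs]|nb] := boolP ((r < b) && (b < s)).
  have key x : (x \in b :: L) \/ (x <= r \/ s <= x) ->
      ((x \in L) \/ (x <= r \/ b <= x)) /\ ((x \in L) \/ (x <= b \/ s <= x)).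
    case=> [|[xr|sx]].
    - rewrite inE => /orP[/eqP ->|xL]; last by split; left.
      by split; right; [right|left].
    - by split; right; left => //; rewrite (le_trans xr)// ltW.
    - by split; right; right => //; rewrite (le_trans _ sx)// ltW.
  apply: (@incr_ok_chain r b s) => //; try exact: ltW.
    apply: IH => //; [exact: ltW|by rewrite (le_trans (ltW bs))|].
    by move=> i; have [/key[h _] /key[h' _]] := H i.
  apply: IH => //; [by rewrite (le_trans tr)// ltW|exact: ltW|].
  by move=> i; have [/key[_ h] /key[_ h']] := H i.
have key x : (x \in b :: L) \/ (x <= r \/ s <= x) -> (x \in L) \/ (x <= r \/ s <= x).
  case=> [|h]; last by right.
  rewrite inE => /orP[/eqP ->|xL]; last by left.
  by right; move: nb; rewrite negb_and -!leNgt => /orP[]; [left|right].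
apply: IH => // i; by have [/key h /key h'] := H i.
Qed.

Lemma simple_incr_ok r s : t <= r -> r <= s -> s <= T -> incr_ok r s.
Proof.
move=> tr rs sT.
apply: (@incr_ok_list ([seq sp_lo i | i <- enum 'I_(sp_size S)] ++
   [seq sp_hi i | i <- enum 'I_(sp_size S)])) => // i.
split; left; rewrite mem_cat; apply/orP; [left|right];
  by apply/mapP; exists i => //; rewrite mem_enum.
Qed.

(** A Kolmogorov-type bound of order (s - r)^2. It controls the Taylor remainder in Dynkin's
    formula, for which the second moment of a general Ito integral is too weak. *)
Definition fourth_ok (F : R -> R -> Om -> R) := exists K, 0 <= K /\ forall r s,
  t <= r -> r <= s -> s <= T -> measurable_fun setT (F r s) /\
  L1 P setT (fun w => F r s w ^+ 4) /\ E (fun w => F r s w ^+ 4) <= K * (s - r) ^+ 2.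

Lemma fourth_okD F G : fourth_ok F -> fourth_ok G ->
  fourth_ok (fun r s w => F r s w + G r s w).
Proof.
move=> [K [K0 hF]] [K' [K0' hG]]; exists (8 * K + 8 * K'); split.
  by rewrite addr_ge0// mulr_ge0.
move=> r s tr rs sT; have [mF [iF eF]] := hF r s tr rs sT; have [mG [iG eG]] := hG r s tr rs sT.
have mFG := measurable_funD mF mG.
have i8 := L1D measurableT (L1Z measurableT 8 iF) (L1Z measurableT 8 iG).
have le8 w : (F r s w + G r s w) ^+ 4 <= 8 * F r s w ^+ 4 + 8 * G r s w ^+ 4.
  set x := F r s w; set y := G r s w.
  have h (u v : R) : (u + v) ^+ 2 <= 2 * u ^+ 2 + 2 * v ^+ 2.
    by have := sqr_ge0 (u - v); nra.
  have := h (x ^+ 2) (y ^+ 2); have := h x y; have := sqr_ge0 (x + y).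
  have -> (z : R) : z ^+ 4 = (z ^+ 2) ^+ 2 by rewrite -exprM.
  have := sqr_ge0 x; have := sqr_ge0 y; set a := x ^+ 2; set b := y ^+ 2; set c := (x + y) ^+ 2.
  rewrite -[4%N]/(2 * 2)%N !exprM -/a -/b -/c; nra.
have i4 : L1 P setT (fun w => (F r s w + G r s w) ^+ 4).
  apply: L1_le i8 _ => //; first exact: measurable_funX.
  by move=> w _; rewrite ger0_norm ?le8// -[4%N]/(2 * 2)%N exprM sqr_ge0.
split => //; split => //.
apply: (le_trans (E_le measurableT i4 i8 (fun w _ => le8 w))).
rewrite ED//; [|exact: L1Z|exact: L1Z]; rewrite !EZ//; lra.
Qed.

Lemma fourth_okZ F c : measurable_fun setT c -> bnd c -> fourth_ok F ->
  fourth_ok (fun r s w => c w * F r s w).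
Proof.
move=> mc [C hC] [K [K0 hF]]; exists (C ^+ 4 * K); split.
  by rewrite mulr_ge0// -[4%N]/(2 * 2)%N exprM sqr_ge0.
move=> r s tr rs sT; have [mF [iF eF]] := hF r s tr rs sT.
have iC := L1Z measurableT (C ^+ 4) iF.
have le w : (c w * F r s w) ^+ 4 <= C ^+ 4 * F r s w ^+ 4.
  rewrite exprMn ler_wpM2r//; first by rewrite -[4%N]/(2 * 2)%N exprM sqr_ge0.
  rewrite -[leLHS]ger0_norm; last by rewrite -[4%N]/(2 * 2)%N exprM sqr_ge0.
  by rewrite normrX lerXn2r// nnegrE ?(le_trans _ (hC w)).
have i4 : L1 P setT (fun w => (c w * F r s w) ^+ 4).
  apply: L1_le iC _ => //; first by apply: measurable_funX; exact: measurable_funM.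
  by move=> w _; rewrite ger0_norm ?le// -[4%N]/(2 * 2)%N exprM sqr_ge0.
split; first exact: measurable_funM.
split => //; apply: (le_trans (E_le measurableT i4 iC (fun w _ => le w))).
rewrite EZ// -mulrA ler_wpM2l//.
by rewrite -[4%N]/(2 * 2)%N exprM sqr_ge0.
Qed.

Lemma fourth_ok0 : fourth_ok (fun _ _ _ => 0).
Proof.
exists 0; split => // r s _ _ _; split => //; split.
  by apply: eq_L1 (L10 P setT) => // w _; rewrite expr0n.
by rewrite mul0r -[leRHS](E0 P setT) le_eqVlt; apply/orP; left; apply/eqP; apply: eq_E => w _; rewrite expr0n.
Qed.

(** The increment over [r, s] of W stopped at a knot x equals W at the clamped x minus W at r. All
    times involved then lie in [r, s], which bounds their distance by s - r. *)
Let clamp r s x : R := Num.max r (Num.min s x).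

Lemma simple_int_fourth : fourth_ok (fun r s w => D s w - D r w).
Proof.
have H : fourth_ok (fun r s w => \sum_i \sum_a sp_coef (s := S) i w a 0 *
    (W (clamp r s (sp_hi i)) w a 0 - W (clamp r s (sp_lo i)) w a 0)).
  have sumok (I : finType) (F : I -> R -> R -> Om -> R) : (forall i, fourth_ok (F i)) ->
      fourth_ok (fun r s w => \sum_i F i r s w).
    move=> h; elim: (index_enum I) => [|i e IH].
      by under eq_fun do under eq_fun do under eq_fun do rewrite big_nil; exact: fourth_ok0.
    under eq_fun do under eq_fun do under eq_fun do rewrite big_cons.
    exact: fourth_okD.
  apply: (@sumok _ _) => i; apply: (@sumok _ _) => a; apply: fourth_okZ; [exact: coef_meas|exact: coef_bnd|].
  exists 64; split => // r s tr rs sT.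
  have cl x : t <= clamp r s x <= T.
    by rewrite /clamp le_max tr/= ge_max (le_trans rs)//= ge_min sT.
  have c1 : clamp r s (sp_lo i) <= clamp r s (sp_hi i).
    rewrite /clamp ge_max !le_max lexx/=; apply/orP; right.
    by rewrite le_min !ge_min lexx/= sp_lo_hi orbT.
  have /andP[h1 _] := cl (sp_lo i); have /andP[_ h2] := cl (sp_hi i).
  split; first exact: dW_meas.
  have [j e] := @E_dW4 _ _ _ _ B _ _ h1 c1 h2 a.
  split => //; apply: (le_trans e); rewrite ler_wpM2l// lerXn2r ?nnegrE ?subr_ge0//.
  have : clamp r s (sp_hi i) <= s by rewrite /clamp ge_max rs ge_min lexx.
  have : r <= clamp r s (sp_lo i) by rewrite /clamp le_max lexx.
  lra.
have [K [K0 hK]] := H; exists K; split => // r s tr rs sT.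
have eD w : \sum_i \sum_a sp_coef (s := S) i w a 0 *
    (W (clamp r s (sp_hi i)) w a 0 - W (clamp r s (sp_lo i)) w a 0) = D s w - D r w.
  rewrite /simple_int -sumrB; apply: eq_bigr => i _; rewrite -dotvBr.
  apply: eq_bigr => a _; rewrite !mxE; congr (_ * _).
  have e x : W (Num.min s x) w a 0 - W (Num.min r x) w a 0 = W (clamp r s x) w a 0 - W r w a 0.
    rewrite /clamp; case: (lerP s x) => [sx|xs].
      by rewrite (min_l (le_trans rs sx)) (max_r rs).
    by case: (lerP r x) => [rx|xr]; rewrite ?subrr.
  have := e (sp_lo i); have := e (sp_hi i); lra.
have [m [i e]] := hK r s tr rs sT; split; last split.
- by apply: eq_measurable_fun m => w _; rewrite eD.
- by apply: eq_L1 i => // w _; rewrite eD.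
- by apply: le_trans e; rewrite le_eqVlt; apply/orP; left; apply/eqP; apply: eq_E => w _; rewrite eD.
Qed.

End SimpleIntegral.

(** * The Ito integral *)

Lemma cvg_sumr (R : realType) (T : Type) (F : set_system T) {FF : Filter F}
    (I : Type) (e : seq I) (f : I -> T -> R) (l : I -> R) :
  (forall i, f i x @[x --> F] --> l i) ->
  \sum_(i <- e) f i x @[x --> F] --> \sum_(i <- e) l i.
Proof.
move=> h; elim: e => [|i e IH].
  by rewrite big_nil; under eq_fun do rewrite big_nil; exact: cvg_cst.
by rewrite big_cons; under eq_fun do rewrite big_cons; exact: cvgD.
Qed.

Section Ito.
Context (R : realType) (d : nat) (t T : R) (B : brownian_basis d t T) (tT : t <= T).
Notation Om := (bb_Omega B).
Notation P := (bb_P B).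
Notation W := (bb_W B).
Notation lam := (@lebesgue_measure R).
Notation mu := (lam \x P)%E.
Notation Dom := (@Dom R (bb_disp B) Om).
Notation E f := (Rintegral P setT f).
Notation Fm := (Fm (B := B)).
Notation mDom := (@measurable_Dom R (bb_disp B) Om _ _).
Implicit Types (Z : R -> Om -> 'cV[R]_d) (I : R -> Om -> R) (V : R -> Om -> R).

Definition L2p Z := forall a, L2 mu (Dom t T) (fun p => Z p.1 p.2 a 0).

(** Squared L^2 norm over time and chance as a real number; on the whole of [t, T] it agrees with
    [sqdist2] for [L2p] processes ([sqdist2E]). *)
Definition n2 r s Z : R := \int[mu]_(p in Dom r s) (enorm (Z p.1 p.2) ^+ 2).

Lemma L2_Dom r s (f : R -> Om -> R) : t <= r -> s <= T ->
  L2 mu (Dom t T) (fun p => f p.1 p.2) -> L2 mu (Dom r s) (fun p => f p.1 p.2).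
Proof.
move=> tr sT [mf fi]; split; first exact: measurable_DomS.
by apply: integrableS fi; try exact: mDom; exact: Dom_sub.
Qed.

Lemma L1_Dom r s (f : R -> Om -> R) : t <= r -> s <= T ->
  L1 mu (Dom t T) (fun p => f p.1 p.2) -> L1 mu (Dom r s) (fun p => f p.1 p.2).
Proof.
by move=> tr sT fi; apply: integrableS fi; try exact: mDom; exact: Dom_sub.
Qed.

Lemma L2p_L1 Z r s : t <= r -> s <= T -> L2p Z ->
  L1 mu (Dom r s) (fun p => enorm (Z p.1 p.2) ^+ 2).
Proof.
move=> tr sT LZ; have : L1 mu (Dom r s) (fun p => \sum_a Z p.1 p.2 a 0 ^+ 2).
  apply: L1_sum => [|a _]; first exact: mDom.
  by have [] := L2_Dom (f := fun s w => Z s w a 0) tr sT (LZ a).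
by apply: eq_L1 => [|p _]; [exact: mDom|rewrite enormc_sq].
Qed.

Lemma L2pD Z Z' : L2p Z -> L2p Z' -> L2p (fun s w => Z s w + Z' s w).
Proof.
move=> LZ LZ' a; apply: eq_L2 (L2D mDom (LZ a) (LZ' a)); first exact: mDom.
by move=> p _; rewrite mxE.
Qed.

Lemma L2pZ c Z : L2p Z -> L2p (fun s w => c *: Z s w).
Proof.
move=> LZ a; apply: eq_L2 (L2Z mDom c (LZ a)); first exact: mDom.
by move=> p _; rewrite mxE.
Qed.

Lemma L2pB Z Z' : L2p Z -> L2p Z' -> L2p (fun s w => Z s w - Z' s w).
Proof.
move=> LZ LZ' a; apply: eq_L2 (L2B mDom (LZ a) (LZ' a)); first exact: mDom.
by move=> p _; rewrite !mxE.
Qed.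

Lemma n2_ge0 r s Z : 0 <= n2 r s Z.
Proof. by apply: E_ge0 => p _; exact: sqr_ge0. Qed.

Lemma n2_mono r s Z : t <= r -> s <= T -> L2p Z -> n2 r s Z <= n2 t T Z.
Proof.
move=> tr sT LZ; rewrite -lee_fin /n2 -!L1_EFin; try exact: mDom.
- apply: ge0_subset_integral; try exact: mDom.
  + by apply/measurable_EFinP; apply: L1_meas; exact: L2p_L1.
  + by move=> p _; rewrite lee_fin sqr_ge0.
  + exact: Dom_sub.
- exact: L2p_L1.
- exact: L2p_L1.
Qed.

Lemma n2_coord r s Z a : t <= r -> s <= T -> L2p Z ->
  \int[mu]_(p in Dom r s) (Z p.1 p.2 a 0 ^+ 2) <= n2 r s Z.
Proof.
move=> tr sT LZ; apply: E_le; try exact: mDom.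
- by have [] := L2_Dom (f := fun s w => Z s w a 0) tr sT (LZ a).
- exact: L2p_L1.
- move=> p _; rewrite enormc_sq (bigD1 a)//= lerDl.
  by apply: sumr_ge0 => *; exact: sqr_ge0.
Qed.

Lemma enormD_sq (u v : 'cV[R]_d) :
  enorm (u + v) ^+ 2 <= 2 * enorm u ^+ 2 + 2 * enorm v ^+ 2.
Proof.
rewrite !enormc_sq !mulr_sumr -big_split/=; apply: ler_sum => a _; rewrite mxE.
by have := sqr_ge0 (u a 0 - v a 0); nra.
Qed.

Lemma enormZ_sq c (u : 'cV[R]_d) : enorm (c *: u) ^+ 2 = c ^+ 2 * enorm u ^+ 2.
Proof. by rewrite !enormc_sq mulr_sumr; apply: eq_bigr => a _; rewrite mxE exprMn. Qed.

Lemma n2D r s Z Z' : t <= r -> s <= T -> L2p Z -> L2p Z' ->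
  n2 r s (fun s w => Z s w + Z' s w) <= 2 * n2 r s Z + 2 * n2 r s Z'.
Proof.
move=> tr sT LZ LZ'; have i1 := L2p_L1 tr sT LZ; have i2 := L2p_L1 tr sT LZ'.
rewrite /n2 -!EZ//; try exact: mDom.
rewrite -ED; try exact: mDom; [|by apply: L1Z => //; exact: mDom|by apply: L1Z => //; exact: mDom].
apply: E_le; try exact: mDom.
- exact: L2p_L1 (L2pD LZ LZ').
- by apply: L1D; try exact: mDom; apply: L1Z => //; exact: mDom.
- by move=> p _; exact: enormD_sq.
Qed.

Lemma n2Z r s c Z : t <= r -> s <= T -> L2p Z ->
  n2 r s (fun s w => c *: Z s w) = c ^+ 2 * n2 r s Z.
Proof.
move=> tr sT LZ; rewrite /n2 -EZ; try exact: mDom; last exact: L2p_L1.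
by apply: eq_E => p _; rewrite enormZ_sq.
Qed.

Lemma sqdist2_meas Z Z' : (forall a, measurable_fun (Dom t T) (fun p => Z p.1 p.2 a 0)) ->
  (forall a, measurable_fun (Dom t T) (fun p => Z' p.1 p.2 a 0)) ->
  sqdist2 Z Z' = (\int[mu]_(p in Dom t T) (enorm (Z p.1 p.2 - Z' p.1 p.2) ^+ 2)%:E)%E.
Proof.
move=> mZ mZ'.
have [||<- _//] := @Dom_tonelli _ _ _ P (fun s w => enorm (Z s w - Z' s w) ^+ 2) t T _ _.
- under eq_fun do rewrite enormc_sq.
  apply: measurable_sum => a; apply: measurable_funX; under eq_fun do rewrite !mxE.
  exact: measurable_funB.
- by move=> p _; exact: sqr_ge0.
Qed.

Lemma L2p_meas Z : L2p Z -> forall a, measurable_fun (Dom t T) (fun p => Z p.1 p.2 a 0).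
Proof. by move=> LZ a; have [] := LZ a. Qed.

Lemma sqdist2E Z Z' : L2p Z -> L2p Z' ->
  sqdist2 Z Z' = (n2 t T (fun s w => Z s w - Z' s w))%:E.
Proof.
move=> LZ LZ'; rewrite sqdist2_meas ?L1_EFin//; try exact: L2p_meas; try exact: mDom.
exact: L2p_L1 (L2pB LZ LZ').
Qed.

Lemma sqdist2_L2p Z : (forall a, measurable_fun (Dom t T) (fun p => Z p.1 p.2 a 0)) ->
  (sqdist2 Z (fun _ _ => 0%R) < +oo)%E -> L2p Z.
Proof.
move=> mZ; rewrite sqdist2_meas//.
move=> h a; apply: L2P => //.
apply: le_lt_trans h; apply: ge0_le_integral; try exact: mDom.
- by move=> p _; rewrite lee_fin sqr_ge0.
- by apply/measurable_EFinP; exact: measurable_funX.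
- apply/measurable_EFinP; under eq_fun do rewrite subr0 enormc_sq.
  by apply: measurable_sum => b; exact: measurable_funX.
- move=> p _; rewrite lee_fin subr0 enormc_sq (bigD1 a)//= lerDl.
  by apply: sumr_ge0 => *; exact: sqr_ge0.
Qed.

Lemma H2_progressive Z a : H2 Z -> progressive (fun s w => Z s w a 0).
Proof. by case. Qed.

Lemma H2_L2p Z : H2 Z -> L2p Z.
Proof. by move=> [pZ fZ]; apply: sqdist2_L2p => // a; exact: (progressive_meas tT (pZ a)). Qed.

Lemma L2p_H2 Z : (forall a, progressive (fun s w => Z s w a 0)) -> L2p Z -> H2 Z.
Proof.
move=> pZ LZ; split => //; rewrite sqdist2E ?ltry// => a.
by apply: eq_L2 (L20 mu mDom) => [|p _]; [exact: mDom|rewrite mxE].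
Qed.

Lemma L2p_simple (S : simple_process B) : L2p (simple_val S).
Proof. by move=> a; exact: L2_bnd_val. Qed.

Definition E2 (f : Om -> R) := E (fun w => f w ^+ 2).

(** The definition of the integral is in extended reals. One simple integral at finite distance
    already shows that I_s is square-integrable, after which all limits can be stated in the
    reals. *)
Lemma ito_approx Z I : is_ito Z I ->
  [/\ L2p Z, forall s, t <= s <= T -> Fm s (I s) /\ L2 P setT (I s) &
   exists S : nat -> simple_process B,
     n2 t T (fun s w => simple_val (S k) s w - Z s w) @[k --> \oo] --> (0 : R) /\
     forall s, t <= s <= T -> E2 (fun w => simple_int (S k) s w - I s w) @[k --> \oo] --> (0 : R)].
Proof.
move=> [HZ pI cI [S [S1 S2]]]; have LZ := H2_L2p HZ.
have FI s : t <= s <= T -> Fm s (I s) by move=> hs; exact: progressive_Fm.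
have LI s : t <= s <= T -> L2 P setT (I s).
  move=> hs; have /fine_cvgP[h1 _] := S2 s hs.
  have [N _ hN] : \forall k \near \oo,
     ((\int[P]_w ((simple_int (S k) s w - I s w) ^+ 2)%:E)%E \is a fin_num) by [].
  have LS := simple_int_L2 (S N) hs.
  have LD : L2 P setT (fun w => simple_int (S N) s w - I s w).
    apply: L2P => //; last first.
      have := hN N (leqnn N); rewrite /= ge0_fin_numE//.
      by apply: integral_ge0 => w _; rewrite lee_fin sqr_ge0.
    by apply: measurable_funB; [exact: L2_meas LS|exact: Fm_meas (FI s hs)].
  by apply: eq_L2 (L2B measurableT LS LD) => // w _; ring.
split => //; first by move=> s hs; split; [exact: FI|exact: LI].
exists S; split.
  have := S1; rewrite [X in X @ _ --> _ -> _](_ : _ = fun k => (n2 t T (fun s w => simple_val (S k) s w - Z s w))%:E).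
    by move/fine_cvg.
  by apply/funext => k; rewrite sqdist2E//; exact: L2p_simple.
move=> s hs; have := S2 s hs.
under eq_cvg => k. rewrite (L1_EFin measurableT). over.
  have := L2B measurableT (simple_int_L2 (S k) hs) (LI s hs).
  by move/L2_sq.
by move/fine_cvg.
Qed.

Lemma mk_ito Z I : H2 Z -> progressive I -> (forall w, {within `[t, T], continuous (I ^~ w)}) ->
  (exists S : nat -> simple_process B,
     n2 t T (fun s w => simple_val (S k) s w - Z s w) @[k --> \oo] --> (0 : R) /\
     forall s, t <= s <= T -> L2 P setT (I s) /\
       E2 (fun w => simple_int (S k) s w - I s w) @[k --> \oo] --> (0 : R)) -> is_ito Z I.
Proof.
move=> HZ pI cI [S [S1 S2]]; split => //; exists S; split.
  rewrite [X in X @ _ --> _](_ : _ = fun k => (n2 t T (fun s w => simple_val (S k) s w - Z s w))%:E).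
    by apply/fine_cvgP; split; [exact: nearW|exact: S1].
  by apply/funext => k; rewrite sqdist2E//; [exact: L2p_simple|exact: H2_L2p].
move=> s hs; have [LI c] := S2 s hs.
rewrite [X in X @ _ --> _](_ : _ = fun k => (E2 (fun w => simple_int (S k) s w - I s w))%:E).
  by apply/fine_cvgP; split; [exact: nearW|exact: c].
apply/funext => k; rewrite (L1_EFin measurableT)//.
exact: L2_sq (L2B measurableT (simple_int_L2 (S k) hs) LI).
Qed.

Lemma cvg_cst_eq (u : nat -> R) a b : (forall k, u k = a) -> u @ \oo --> b -> b = a.
Proof.
move=> ua; have -> : u = cst a by exact/funext.
by move=> ub; apply: (cvg_unique _ ub) => //; exact: cvg_cst.
Qed.

(** Conditional expectations are replaced by orthogonality of later increments to all
    square-integrable F_r-measurable variables. *)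
Definition martingale I := (forall s, t <= s <= T -> Fm s (I s) /\ L2 P setT (I s)) /\
  forall r s xi, t <= r -> r <= s -> s <= T -> Fm r xi -> L2 P setT xi ->
    E (fun w => xi w * (I s w - I r w)) = 0.

Lemma E2_cst (f : Om -> R) : E (fun w => (f w - f w) ^+ 2) @[k --> \oo] --> (0 : R).
Proof.
rewrite [X in _ --> X](_ : _ = E (fun w => (f w - f w) ^+ 2)); first exact: cvg_cst.
by rewrite -[LHS](E0 P setT); apply: eq_E => w _; rewrite subrr expr0n.
Qed.

Lemma E2_cvgB (F G : nat -> Om -> R) f g : (forall k, L2 P setT (F k)) ->
  (forall k, L2 P setT (G k)) -> L2 P setT f -> L2 P setT g ->
  E2 (fun w => F k w - f w) @[k --> \oo] --> (0 : R) ->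
  E2 (fun w => G k w - g w) @[k --> \oo] --> (0 : R) ->
  E2 (fun w => (F k w - G k w) - (f w - g w)) @[k --> \oo] --> (0 : R).
Proof.
move=> LF LG Lf Lg c1 c2.
apply: (@squeeze_cvgr _ _ _ _ (fun=> 0) (fun k => 2 * E2 (fun w => F k w - f w) + 2 * E2 (fun w => G k w - g w))).
- near=> k; apply/andP; split; first by apply: E_ge0 => *; exact: sqr_ge0.
  have L1' := L2B measurableT (LF k) Lf; have L2' := L2B measurableT (LG k) Lg.
  rewrite /E2 -!EZ//; [|exact: L2_sq L2'|exact: L2_sq L1'].
  rewrite -ED//; [|by apply: L1Z => //; exact: L2_sq|by apply: L1Z => //; exact: L2_sq].
  apply: E_le => //.
  + apply: L2_sq; apply: eq_L2 (L2B measurableT L1' L2') => // w _; ring.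
  + by apply: L1D => //; apply: L1Z => //; exact: L2_sq.
  + move=> w _; have := sqr_ge0 ((F k w - f w) + (G k w - g w)); nra.
- exact: cvg_cst.
- rewrite [X in _ --> X](_ : _ = 2 * 0 + 2 * 0 :> R); last by rewrite mulr0 addr0.
  by apply: cvgD; apply: cvgM => //; exact: cvg_cst.
Unshelve. all: by end_near. Qed.

Lemma L2bndM xi f : measurable_fun setT xi -> bnd xi -> L2 P setT f ->
  L2 P setT (fun w => xi w * f w).
Proof. by move=> mxi [C hC]; apply: (@L2bM _ _ _ P setT measurableT C). Qed.

Lemma ito_martingale Z I : is_ito Z I -> martingale I.
Proof.
move=> /ito_approx[LZ FI [S [_ S2]]]; split => // r s xi tr rs sT mxi ixi.
have hr : t <= r <= T by rewrite tr (le_trans rs).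
have hs : t <= s <= T by rewrite (le_trans tr).
have [_ Lr] := FI r hr; have [_ Ls] := FI s hs.
have LSr k := simple_int_L2 (S k) hr.
have LSs k := simple_int_L2 (S k) hs.
have c := E_sq_cvgM measurableT (fun=> ixi) (fun k => L2B measurableT (LSs k) (LSr k)) ixi
  (L2B measurableT Ls Lr) (E2_cst xi) (E2_cvgB LSs LSr Ls Lr (S2 s hs) (S2 r hr)).
apply: (cvg_cst_eq _ c) => k; have [h _] := simple_incr_ok (S k) tr rs sT; exact: h.
Qed.

(** For simple processes this is [simple_incr_ok]. Both sides pass to the limit by [E_sq_cvgM], once
    the bounded xi has been attached to one of the two equal factors. *)
Lemma ito_bracket Z I : is_ito Z I -> forall r s xi, t <= r -> r <= s -> s <= T ->
  Fm r xi -> bnd xi ->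
  E (fun w => xi w * (I s w - I r w) ^+ 2) =
    \int[mu]_(p in Dom r s) (xi p.2 * enorm (Z p.1 p.2) ^+ 2).
Proof.
move=> /ito_approx[LZ FI [S [S1 S2]]] r s xi tr rs sT mxi bxi.
have hr : t <= r <= T by rewrite tr (le_trans rs).
have hs : t <= s <= T by rewrite (le_trans tr).
have mxi0 := Fm_meas hr mxi; have [C hC] := bxi.
have [_ Lr] := FI r hr; have [_ Ls] := FI s hs.
have LSr k := simple_int_L2 (S k) hr.
have LSs k := simple_int_L2 (S k) hs.
have LD k := L2B measurableT (LSs k) (LSr k); have LI := L2B measurableT Ls Lr.
have cD := E2_cvgB LSs LSr Ls Lr (S2 s hs) (S2 r hr).
have c1 : E (fun w => (xi w * (simple_int (S k) s w - simple_int (S k) r w)) *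
    (simple_int (S k) s w - simple_int (S k) r w)) @[k --> \oo] -->
   E (fun w => (xi w * (I s w - I r w)) * (I s w - I r w)).
  apply: E_sq_cvgM => //; try by move=> *; exact: L2bndM.
  - apply: (@squeeze_cvgr _ _ _ _ (fun=> 0) (fun k => C ^+ 2 *
      E2 (fun w => (simple_int (S k) s w - simple_int (S k) r w) - (I s w - I r w)))).
    + near=> k; apply/andP; split; first by apply: E_ge0 => *; exact: sqr_ge0.
      have LDI := L2B measurableT (LD k) LI.
      rewrite /E2 -EZ//; last exact: L2_sq LDI.
      apply: E_le => //.
      * apply: L2_sq; apply: eq_L2 (L2bndM mxi0 bxi LDI) => // w _; ring.
      * by apply: L1Z => //; exact: L2_sq LDI.
      * move=> w _; rewrite -mulrBr exprMn ler_wpM2r ?sqr_ge0// -(real_normK (num_real (xi w))).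
        by rewrite lerXn2r// nnegrE (le_trans _ (hC w)).
    + exact: cvg_cst.
    + by rewrite -[X in _ --> X](mulr0 (C ^+ 2)); apply: cvgM => //; exact: cvg_cst.
have mxiD : measurable_fun (Dom r s) (fun p => xi p.2) by exact: measurable_snd_Dom.
have c2 : \int[mu]_(p in Dom r s) (xi p.2 * enorm (simple_val (S k) p.1 p.2) ^+ 2) @[k --> \oo] -->
    \int[mu]_(p in Dom r s) (xi p.2 * enorm (Z p.1 p.2) ^+ 2).
  have eS (V : R -> Om -> 'cV[R]_d) : L2p V ->
     \int[mu]_(p in Dom r s) (xi p.2 * enorm (V p.1 p.2) ^+ 2) =
     \sum_a \int[mu]_(p in Dom r s) ((xi p.2 * V p.1 p.2 a 0) * V p.1 p.2 a 0).
    move=> LV; rewrite -E_sum; try exact: mDom.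
      apply: eq_E => p _; rewrite enormc_sq mulr_sumr; apply: eq_bigr => a _; ring.
    move=> a _; have La := L2_Dom (f := fun s w => V s w a 0) tr sT (LV a).
    apply: L2M => //; first exact: mDom.
    by apply: (@L2bM _ _ _ _ _ mDom C) => // p _; exact: hC.
  rewrite eS// [X in X @ _ --> _](_ : _ = fun k => \sum_a \int[mu]_(p in Dom r s)
    ((xi p.2 * simple_val (S k) p.1 p.2 a 0) * simple_val (S k) p.1 p.2 a 0)); last first.
    by apply/funext => k; rewrite eS//; exact: L2p_simple.
  apply: cvg_sumr => a.
  have La := L2_Dom (f := fun s w => Z s w a 0) tr sT (LZ a).
  have LSa k := L2_Dom (f := fun s w => simple_val (S k) s w a 0) tr sT (L2p_simple (S k) a).
  have bM (f : measurableTypeR R * Om -> R) : L2 mu (Dom r s) f -> L2 mu (Dom r s) (fun p => xi p.2 * f p).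
    by move=> Lf; apply: (@L2bM _ _ _ _ _ mDom C) => // p _; exact: hC.
  have cc : \int[mu]_(p in Dom r s) ((simple_val (S k) p.1 p.2 a 0 - Z p.1 p.2 a 0) ^+ 2) @[k --> \oo] --> (0 : R).
    apply: (@squeeze_cvgr _ _ _ _ (fun=> 0) (fun k => n2 t T (fun s w => simple_val (S k) s w - Z s w))) => //.
      near=> k; apply/andP; split; first by apply: E_ge0 => *; exact: sqr_ge0.
      have LSZ := L2pB (L2p_simple (S k)) LZ.
      apply: le_trans (n2_mono tr sT LSZ).
      apply: le_trans (n2_coord a tr sT LSZ).
      by rewrite le_eqVlt; apply/orP; left; apply/eqP; apply: eq_E => p _; rewrite !mxE.
    exact: cvg_cst.
  apply: (E_sq_cvgM mDom) => //.
  - by move=> k; exact: bM.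
  - exact: bM.
  - apply: (@squeeze_cvgr _ _ _ _ (fun=> 0) (fun k => C ^+ 2 *
      \int[mu]_(p in Dom r s) ((simple_val (S k) p.1 p.2 a 0 - Z p.1 p.2 a 0) ^+ 2))).
    + near=> k; apply/andP; split; first by apply: E_ge0 => *; exact: sqr_ge0.
      have LDI := L2B mDom (LSa k) La.
      rewrite -EZ; try exact: mDom; last exact: L2_sq LDI.
      apply: E_le; try exact: mDom.
      * apply: L2_sq; apply: eq_L2 (bM _ LDI); first exact: mDom.
        by move=> p _; rewrite mulrBr.
      * by apply: L1Z; [exact: mDom|exact: L2_sq LDI].
      * move=> p _; rewrite -mulrBr exprMn ler_wpM2r ?sqr_ge0// -(real_normK (num_real (xi p.2))).
        by rewrite lerXn2r// nnegrE (le_trans _ (hC p.2)).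
    + exact: cvg_cst.
    + by rewrite -[X in _ --> X](mulr0 (C ^+ 2)); apply: cvgM => //; exact: cvg_cst.
have -> : E (fun w => xi w * (I s w - I r w) ^+ 2) = E (fun w => (xi w * (I s w - I r w)) * (I s w - I r w)).
  by apply: eq_E => w _; ring.
apply: (cvg_unique _ c1) => //; apply: cvg_trans c2.
apply: near_eq_cvg; apply: nearW => k; have [_ <-//] := simple_incr_ok (S k) tr rs sT.
by apply: eq_E => w _; ring.
Unshelve. all: by end_near. Qed.

(** Simple integrals vanish at time t, and I_t is their L^2 limit. The definition itself leaves the
    value at t free on a null set. *)
Lemma ito_start Z I : is_ito Z I -> {ae P, forall w, I t w = 0}.
Proof.
move=> /ito_approx[LZ FI [S [S1 S2]]].
have ht : t <= t <= T by rewrite lexx.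
have [FIt LIt] := FI t ht.
have c := S2 t ht.
have D0 k w : simple_int (S k) t w = 0.
  rewrite /simple_int big1// => i _; rewrite !min_l ?subrr ?dotv0r//.
    exact: sp_lo_ge.
  by rewrite (le_trans (sp_lo_ge i))// sp_lo_hi.
have e0 : E2 (I t) = 0.
  by apply/esym; apply: (cvg_cst_eq _ c) => k; apply: eq_E => w _; rewrite D0 sub0r sqrrN.
have e1 : (\int[P]_w `|(I t w ^+ 2)%:E| = 0)%E.
  under eq_integral do rewrite gee0_abs ?lee_fin ?sqr_ge0//.
  by rewrite (L1_EFin measurableT (L2_sq LIt)) -/(E2 _) e0.
have mI : measurable_fun setT (fun w => (I t w ^+ 2)%:E).
  by apply/measurable_EFinP; exact: L1_meas (L2_sq LIt).
have [h _] := ae_eq_integral_abs P measurableT mI; move: (h e1).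
apply: filterS => w /(_ Logic.I)[] /eqP; rewrite sqrf_eq0 => /eqP //.
Qed.

End Ito.

Section L2Fatou.
Context d (T : measurableType d) (R : realType) (mu : {measure set T -> \bar R})
  (D : set T) (mD : measurable D).

Lemma E_lin3 (a b c : R) (f g h k : T -> R) : L1 mu D g -> L1 mu D h -> L1 mu D k ->
  (forall x, D x -> f x = a * g x + b * h x + c * k x) ->
  L1 mu D f /\ Rintegral mu D f =
    a * Rintegral mu D g + b * Rintegral mu D h + c * Rintegral mu D k.
Proof.
move=> ig ih ik fe.
have ab := L1D mD (L1Z mD a ig) (L1Z mD b ih).
split; first by apply: eq_L1 (L1D mD ab (L1Z mD c ik)) => // x Dx; rewrite fe.
have -> : Rintegral mu D f = Rintegral mu D (fun x => a * g x + b * h x + c * k x) by exact: eq_E.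
rewrite (ED mD ab (L1Z mD c ik)) (ED mD (L1Z mD a ig) (L1Z mD b ih)).
by rewrite !EZ.
Qed.

Lemma E_le_lin2 (a b : R) (f g h : T -> R) : L1 mu D f -> L1 mu D g -> L1 mu D h ->
  (forall x, D x -> f x <= a * g x + b * h x) ->
  Rintegral mu D f <= a * Rintegral mu D g + b * Rintegral mu D h.
Proof.
move=> jf ig ih fe.
have [l e] := @E_lin3 a b 0 _ g h g ig ih ig (fun x _ => erefl).
have {}e := etrans e (_ : _ = a * Rintegral mu D g + b * Rintegral mu D h).
rewrite -e; last by rewrite mul0r addr0.
by apply: E_le => // x Dx; rewrite mul0r addr0 fe.
Qed.

Lemma cvg_lin0 (a b : R) (u v : nat -> R) : u @ \oo --> (0 : R) -> v @ \oo --> (0 : R) ->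
  (fun k => a * u k + b * v k) @ \oo --> (0 : R).
Proof.
move=> u0 v0; rewrite -[X in _ --> X](_ : a * 0 + b * 0 = 0); last by rewrite !mulr0 addr0.
by apply: cvgD; apply: cvgM => //; exact: cvg_cst.
Qed.

(** Fatou's lemma applied to the squares; square-integrability of the limit is part of what the
    bound yields. *)
Lemma L2_fatou (F : nat -> T -> R) (f : T -> R) (C : R) : (forall n, L2 mu D (F n)) ->
  (forall n, Rintegral mu D (fun x => F n x ^+ 2) <= C) -> measurable_fun D f ->
  {ae mu, forall x, D x -> F n x @[n --> \oo] --> f x} ->
  L2 mu D f /\ Rintegral mu D (fun x => f x ^+ 2) <= C.
Proof.
move=> LF FC mf Ff.
have mF n : measurable_fun D (fun x => (F n x ^+ 2)%:E).
  by apply/measurable_EFinP; exact: L1_meas (L2_sq (LF n)).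
have h : (\int[mu]_(x in D) (f x ^+ 2)%:E <= C%:E)%E.
  apply: (@le_trans _ _ (\int[mu]_(x in D) limn_einf (fun n => (F n x ^+ 2)%:E))%E).
    apply: ae_ge0_le_integral => //.
    - by move=> x _; rewrite lee_fin sqr_ge0.
    - by apply/measurable_EFinP; exact: measurable_sq.
    - move=> x _; rewrite limn_einf_lim; apply: lime_ge; first exact: is_cvg_einfs.
      apply: nearW => n; apply: le_ereal_inf_tmp => _ [k _ <-].
      by rewrite lee_fin sqr_ge0.
    - rewrite (_ : (fun _ => _) = fun x => (- limn_esup (fun n => - (F n x ^+ 2)%:E))%E).
        apply: measurableT_comp => //; apply: measurable_fun_limn_esup => n.
        exact: measurableT_comp.
      by apply/funext => x; rewrite -limn_einfN; congr limn_einf; apply/funext => n /=; rewrite ?oppeK ?opprK.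
    - apply: filterS Ff => x /[apply] c.
      have c2 : (F n x ^+ 2)%:E @[n --> \oo] --> (f x ^+ 2)%:E.
        by apply/fine_cvgP; split; [exact: nearW|rewrite expr2; exact: (cvgM c c)].
      by rewrite (cvg_limn_einf_sup c2).1.
  apply: le_trans (fatou mu mD mF _) _; first by move=> n x _; rewrite lee_fin sqr_ge0.
  rewrite limn_einf_lim; apply: lime_le; first exact: is_cvg_einfs.
  apply: nearW => n; apply: (@le_trans _ _ (\int[mu]_(x in D) (F n x ^+ 2)%:E)%E).
    by apply: ereal_inf_lbound; exists n => /=.
  by rewrite L1_EFin ?lee_fin//; exact: L2_sq.
have Lf : L2 mu D f by apply: L2P => //; exact: le_lt_trans h (ltry _).
by split => //; rewrite -lee_fin -L1_EFin//; exact: L2_sq.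
Qed.

End L2Fatou.

(** * Linearity, polarisation and Doob's inequality *)

Section LinearIto.
Context (R : realType) (d : nat) (t T : R) (B : brownian_basis d t T) (tT : t <= T).
Notation Om := (bb_Omega B).
Notation P := (bb_P B).
Notation W := (bb_W B).
Notation lam := (@lebesgue_measure R).
Notation mu := (lam \x P)%E.
Notation Dom := (@Dom R (bb_disp B) Om).
Notation E f := (Rintegral P setT f).
Notation Fm := (Fm (B := B)).
Notation mDom := (@measurable_Dom R (bb_disp B) Om _ _).
Implicit Types (Z : R -> Om -> 'cV[R]_d) (I : R -> Om -> R) (V : R -> Om -> R).

Section SpLin.
Variables (S S' : simple_process B) (c : R).
Let sz := (sp_size S + sp_size S')%N.
Let lo (i : 'I_sz) := match fintype.split i with inl j => sp_lo j | inr j => sp_lo j end.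
Let hi (i : 'I_sz) := match fintype.split i with inl j => sp_hi j | inr j => sp_hi j end.
Let cf (i : 'I_sz) (w : Om) := match fintype.split i with
  inl j => sp_coef (s := S) j w | inr j => c *: sp_coef (s := S') j w end.

Lemma sp_lin_order i : [/\ t <= lo i, lo i <= hi i & hi i <= T].
Proof. by rewrite /lo /hi; case: (fintype.split i) => j; exact: sp_order. Qed.

Lemma sp_lin_adapted i j : measurable_fun setT
    (fun w : g_sigma_algebraType (bb_gen (lo i)) => cf i w j 0).
Proof.
rewrite /lo /cf; case: (fintype.split i) => k; first exact: sp_adapted.
under eq_fun do rewrite mxE; apply: measurable_funM => //; exact: sp_adapted.
Qed.

Lemma enormZ p k a (M : 'M[R]_(p, k)) : enorm (a *: M) = `|a| * enorm M.
Proof.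
rewrite /enorm -sqrtr_sqr -sqrtrM ?sqr_ge0//; congr Num.sqrt.
rewrite mulr_sumr; apply: eq_bigr => i _; rewrite mulr_sumr; apply: eq_bigr => j _.
by rewrite mxE exprMn.
Qed.

Lemma sp_lin_bounded i : exists M : R, forall w, enorm (cf i w) <= M.
Proof.
rewrite /cf; case: (fintype.split i) => k; first exact: sp_bounded.
have [M hM] := sp_bounded (s := S') k; exists (`|c| * M) => w.
by rewrite enormZ ler_wpM2l.
Qed.

(** The intervals of the two processes are simply listed one after the other; overlaps are harmless
    because [simple_val] sums over all intervals. *)
Definition sp_lin : simple_process B :=
  @SimpleProcess _ _ _ _ B sz lo hi cf sp_lin_order sp_lin_adapted sp_lin_bounded.

Let split_l j : fintype.split (lshift (sp_size S') j : 'I_sz) = inl j.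
Proof. exact: (unsplitK (inl j)). Qed.
Let split_r j : fintype.split (rshift (sp_size S) j : 'I_sz) = inr j.
Proof. exact: (unsplitK (inr j)). Qed.

Lemma sp_lin_val s w : simple_val sp_lin s w = simple_val S s w + c *: simple_val S' s w.
Proof.
rewrite /simple_val big_split_ord/= scaler_sumr; congr (_ + _); apply: eq_bigr => i _.
  by rewrite /lo /hi /cf split_l.
by rewrite /lo /hi /cf split_r; case: ifP => // _; rewrite scaler0.
Qed.

Lemma dotvZl (u v : 'cV[R]_d) : dotv (c *: u) v = c * dotv u v.
Proof. by rewrite /dotv mulr_sumr; apply: eq_bigr => i _; rewrite mxE mulrA. Qed.

Lemma sp_lin_int s w : simple_int sp_lin s w = simple_int S s w + c * simple_int S' s w.
Proof.
rewrite /simple_int big_split_ord/= mulr_sumr; congr (_ + _); apply: eq_bigr => i _.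
  by rewrite /lo /hi /cf split_l.
by rewrite /lo /hi /cf split_r dotvZl.
Qed.

End SpLin.

Lemma progressive_lin c V V' : progressive V -> progressive V' ->
  progressive (fun s w => V s w + c * V' s w).
Proof.
move=> pV pV' s hs; apply: measurable_funD; first exact: pV.
by apply: measurable_funM => //; exact: pV'.
Qed.

Lemma eps_within (f : R -> R) : {within `[t, T], continuous f} <->
  (forall s, t <= s <= T -> forall e, 0 < e -> exists2 eta, 0 < eta &
     forall u, t <= u <= T -> `|u - s| < eta -> `|f u - f s| < e).
Proof.
split.
  move=> cf s hs e e0; have /subspace_continuousP/(_ s) := cf.
  rewrite /= in_itv/= => /(_ hs)/cvgrPdist_lt/(_ e e0); rewrite near_withinE.
  move=> /nbhs_ballP[eta /= eta0 h]; exists eta => // u hu us.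
  by rewrite distrC; apply: h => //=; rewrite ?in_itv// /ball/= distrC.
move=> h; apply/subspace_continuousP => s; rewrite /= in_itv/= => hs.
apply/cvgrPdist_lt => e e0; have [eta eta0 H] := h s hs e e0.
rewrite near_withinE; apply/nbhs_ballP; exists eta => //= u; rewrite /ball/= => us.
by rewrite in_itv/= => hu; rewrite distrC; apply: H => //; rewrite distrC.
Qed.

Lemma cont_lin c (f g : R -> R) : {within `[t, T], continuous f} ->
  {within `[t, T], continuous g} -> {within `[t, T], continuous (fun s => f s + c * g s)}.
Proof.
move=> /subspace_continuousP cf /subspace_continuousP cg; apply/subspace_continuousP => x hx.
by apply: cvgD; [exact: cf|apply: cvgM; [exact: cvg_cst|exact: cg]].
Qed.

Lemma n2_squeeze (u v : nat -> R) : (forall k, 0 <= u k <= v k) ->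
  v @ \oo --> (0 : R) -> u @ \oo --> (0 : R).
Proof.
move=> uv v0; apply: (@squeeze_cvgr _ _ _ _ (fun=> 0) v) => //; last exact: cvg_cst.
exact: nearW.
Qed.

Lemma is_ito_lin c Z I Z' I' : is_ito Z I -> is_ito Z' I' ->
  is_ito (fun s w => Z s w + c *: Z' s w) (fun s w => I s w + c * I' s w).
Proof.
move=> iZ iZ'; have [HZ pI cI _] := iZ; have [HZ' pI' cI' _] := iZ'.
have [LZ FI [S [S1 S2]]] := ito_approx tT iZ.
have [LZ' FI' [S' [S1' S2']]] := ito_approx tT iZ'.
apply: (mk_ito tT).
- apply: L2p_H2; last exact: L2pD LZ (L2pZ c LZ').
  move=> a; have := progressive_lin c (H2_progressive a HZ) (H2_progressive a HZ').
  congr progressive; apply/funext => s; apply/funext => w; by rewrite !mxE.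
- exact: progressive_lin.
- by move=> w; exact: cont_lin.
exists (fun k => sp_lin (S k) (S' k) c); split.
  apply: (@n2_squeeze _ (fun k => 2 * n2 t T (fun s w => simple_val (S k) s w - Z s w)
     + (2 * c ^+ 2) * n2 t T (fun s w => simple_val (S' k) s w - Z' s w))); last exact: cvg_lin0.
  move=> k; rewrite n2_ge0/=.
  have LSZ := L2pB (L2p_simple (S k)) LZ; have LSZ' := L2pB (L2p_simple (S' k)) LZ'.
  rewrite -mulrA -(n2Z c (lexx t) (lexx T) LSZ').
  apply: le_trans (n2D (lexx t) (lexx T) LSZ (L2pZ c LSZ')).
  rewrite le_eqVlt; apply/orP; left; apply/eqP; apply: eq_E => p _.
  by rewrite sp_lin_val scalerBr opprD addrACA.
move=> s hs; have [_ Ls] := FI s hs; have [_ Ls'] := FI' s hs; split.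
  exact: L2D Ls (L2Z _ c Ls').
apply: (@n2_squeeze _ (fun k => 2 * E2 (fun w => simple_int (S k) s w - I s w)
     + (2 * c ^+ 2) * E2 (fun w => simple_int (S' k) s w - I' s w))); last first.
  by apply: cvg_lin0; [exact: (S2 s hs)|exact: (S2' s hs)].
move=> k; apply/andP; split; first by apply: E_ge0 => *; exact: sqr_ge0.
have LD := L2B measurableT (simple_int_L2 (S k) hs) Ls.
have LD' := L2B measurableT (simple_int_L2 (S' k) hs) Ls'.
apply: (@E_le_lin2 _ _ _ P setT measurableT); [|exact: L2_sq LD|exact: L2_sq LD'|].
  apply: L2_sq; apply: eq_L2 (L2D measurableT LD (L2Z measurableT c LD')) => // w _.
  by rewrite sp_lin_int; ring.
move=> w _; rewrite sp_lin_int.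
have := sqr_ge0 ((simple_int (S k) s w - I s w) - c * (simple_int (S' k) s w - I' s w)).
by nra.
Qed.

(** Polarisation: the isometry for I + I' minus those for I and I'. *)
Lemma ito_bracket2 Z I Z' I' : is_ito Z I -> is_ito Z' I' -> forall r s xi,
  t <= r -> r <= s -> s <= T -> Fm r xi -> bnd xi ->
  E (fun w => xi w * ((I s w - I r w) * (I' s w - I' r w))) =
    \int[mu]_(p in Dom r s) (xi p.2 * dotv (Z p.1 p.2) (Z' p.1 p.2)).
Proof.
move=> iZ iZ' r s xi tr rs sT mxi bxi.
have hr : t <= r <= T by rewrite tr (le_trans rs).
have hs : t <= s <= T by rewrite (le_trans tr).
have [LZ FI _] := ito_approx tT iZ; have [LZ' FI' _] := ito_approx tT iZ'.
have [_ Lr] := FI r hr; have [_ Ls] := FI s hs.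
have [_ Lr'] := FI' r hr; have [_ Ls'] := FI' s hs.
have LD := L2B measurableT Ls Lr; have LD' := L2B measurableT Ls' Lr'.
have mxi0 := Fm_meas hr mxi; have [C hC] := bxi.
have e1 := ito_bracket tT iZ tr rs sT mxi bxi.
have e2 := ito_bracket tT iZ' tr rs sT mxi bxi.
have e3 := ito_bracket tT (is_ito_lin 1 iZ iZ') tr rs sT mxi bxi.
have i1 : L1 P setT (fun w => xi w * (I s w - I r w) ^+ 2).
  by apply: (@L1bM _ _ _ P setT measurableT C) => //; exact: L2_sq.
have i2 : L1 P setT (fun w => xi w * (I' s w - I' r w) ^+ 2).
  by apply: (@L1bM _ _ _ P setT measurableT C) => //; exact: L2_sq.
have i3 : L1 P setT (fun w => xi w * ((I s w - I r w) * (I' s w - I' r w))).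
  by apply: (@L1bM _ _ _ P setT measurableT C) => //; exact: L2M.
have mxiD : measurable_fun (Dom r s) (fun p => xi p.2) by exact: measurable_snd_Dom.
have bD (f : measurableTypeR R * Om -> R) : L1 mu (Dom r s) f -> L1 mu (Dom r s) (fun p => xi p.2 * f p).
  by move=> fi; apply: (@L1bM _ _ _ _ _ mDom C) => // p _; exact: hC.
have j1 := bD _ (L2p_L1 tr sT LZ); have j2 := bD _ (L2p_L1 tr sT LZ').
have j3 : L1 mu (Dom r s) (fun p => xi p.2 * dotv (Z p.1 p.2) (Z' p.1 p.2)).
  apply: bD; apply: L1_sum => [|a _]; first exact: mDom.
  apply: L2M; [exact: mDom|exact: (L2_Dom (f := fun s w => Z s w a 0))|
    exact: (L2_Dom (f := fun s w => Z' s w a 0))].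
have : E (fun w => xi w * (I s w - I r w) ^+ 2) + E (fun w => xi w * (I' s w - I' r w) ^+ 2)
   + 2 * E (fun w => xi w * ((I s w - I r w) * (I' s w - I' r w))) =
   \int[mu]_(p in Dom r s) (xi p.2 * enorm (Z p.1 p.2) ^+ 2) +
   \int[mu]_(p in Dom r s) (xi p.2 * enorm (Z' p.1 p.2) ^+ 2) +
   2 * \int[mu]_(p in Dom r s) (xi p.2 * dotv (Z p.1 p.2) (Z' p.1 p.2)).
  rewrite -!EZ//; try exact: mDom.
  rewrite -ED// -ED//; [|exact: L1D|exact: L1Z].
  rewrite -(ED mDom j1 j2) -(ED mDom (L1D mDom j1 j2) (L1Z mDom 2 j3)).
  transitivity (E (fun w => xi w * ((I s w + 1 * I' s w) - (I r w + 1 * I' r w)) ^+ 2)).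
    by apply: eq_E => w _; ring.
  rewrite e3; apply: eq_E => p _; rewrite !enormc_sq /dotv !mulr_sumr -!big_split/=.
  by apply: eq_bigr => a _; rewrite !mxE; ring.
rewrite e1 e2 => /addrI /(mulfI _)-> //; by rewrite pnatr_eq0.
Qed.

Lemma ito_E2 Z I r s : is_ito Z I -> t <= r -> r <= s -> s <= T ->
  E2 (fun w => I s w - I r w) = n2 r s Z.
Proof.
move=> iZ tr rs sT.
have := ito_bracket tT iZ tr rs sT (@Fm_cst _ _ _ _ B r 1) (ex_intro _ 1 (fun _ => _)).
move=> /(_ _)/wrap[|]; first by rewrite normr1.
move=> e; rewrite -[RHS](_ : \int[mu]_(p in Dom r s) (1 * enorm (Z p.1 p.2) ^+ 2) = _).
  by rewrite -e; apply: eq_E => w _; rewrite mul1r.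
by apply: eq_E => w _; rewrite mul1r.
Qed.

Lemma ae_E2_0 (f : Om -> R) : L2 P setT f -> E2 f = 0 -> {ae P, forall w, f w = 0}.
Proof.
move=> Lf e0.
have e1 : (\int[P]_w `|(f w ^+ 2)%:E| = 0)%E.
  under eq_integral do rewrite gee0_abs ?lee_fin ?sqr_ge0//.
  by rewrite (L1_EFin measurableT (L2_sq Lf)) -/(E2 _) e0.
have mI : measurable_fun setT (fun w => (f w ^+ 2)%:E).
  by apply/measurable_EFinP; exact: L1_meas (L2_sq Lf).
have [h _] := ae_eq_integral_abs P measurableT mI; move: (h e1).
apply: filterS => w /(_ Logic.I)[] /eqP; rewrite sqrf_eq0 => /eqP //.
Qed.

Lemma simple_martingale (S : simple_process B) : martingale (simple_int S).
Proof.
split=> [s hs|r s xi tr rs sT mxi ixi].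
  by split; [exact: simple_int_Fm|exact: simple_int_L2].
by have [h _] := simple_incr_ok S tr rs sT; exact: h.
Qed.

Section DoobDiscrete.
Variables (I : R -> Om -> R) (mI : martingale I) (tau : nat -> R) (l : R).
Hypotheses (htau : forall j, t <= tau j <= T) (ntau : forall j, tau j <= tau j.+1).

Let c j w : R := (l <= `|I (tau j) w|)%R%:R.
(** Indicator that |I| has reached the level l at one of the times tau 0, ..., tau m. The recursive
    form adds the paths that reach it for the first time at tau m, and shows measurability for the
    last time. *)
Fixpoint doobb m w : R := if m is m'.+1 then doobb m' w + (1 - doobb m' w) * c m w else c 0%N w.

Let cFm j : Fm (tau j) (c j).
Proof.
have -> : c j = \1_((fun w => `|I (tau j) w|) @^-1` `[l, +oo[).
  apply/funext => w; rewrite indicE /c; congr (_%:R); congr nat_of_bool.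
  by apply/idP/idP; rewrite inE/= in_itv/= andbT.
apply: measurable_indic; rewrite -[X in measurable X]setTI.
by apply: (measurableT_comp (@normr_measurable _ _) (mI.1 (tau j) (htau j)).1).
Qed.

Lemma doobb_Fm m : Fm (tau m) (doobb m).
Proof.
elim: m => [|m IH]; first exact: cFm.
have mb := Fm_mono (ntau m) IH.
apply: measurable_funD => //; apply: measurable_funM; [exact: measurable_funB|exact: cFm].
Qed.

Lemma doobb01 m w : doobb m w = 0 \/ doobb m w = 1.
Proof.
elim: m => [|m] /=; [|case=> ->]; rewrite /c; case: (_ <= _);
  rewrite ?subr0 ?subrr ?mulr0 ?mul0r ?mulr1 ?addr0 ?add0r; by [left|right].
Qed.

Lemma doobb_ge m j w : (j <= m)%N -> l <= `|I (tau j) w| -> doobb m w = 1.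
Proof.
elim: m => [|m IH]; first by rewrite leqn0 => /eqP -> h; rewrite /= /c h.
rewrite leq_eqVlt => /predU1P[->|jm] h /=; last by rewrite IH// subrr mul0r addr0.
by rewrite /c h mulr1 addrCA subrr addr0.
Qed.

Let bbnd m : bnd (doobb m).
Proof. by exists 1 => w; have [->|->] := doobb01 m w; rewrite ?normr0 ?normr1. Qed.

Hypothesis l0 : 0 < l.

(** Induction on m. On paths that have reached the level before, the expectation of I^2 can only
    grow, since the new increment is orthogonal to [doobb m] times I; on those that reach it for the
    first time, I^2 >= l^2. *)
Lemma doob_discrete m : l ^+ 2 * E (doobb m) <= E (fun w => I (tau m) w ^+ 2 * doobb m w).
Proof.
have LI j := (mI.1 _ (htau j)).2.
have mb j := Fm_meas (htau j) (@doobb_Fm j).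
have mc j := Fm_meas (htau j) (@cFm j).
have ib j : L1 P setT (doobb j) by exact: L1_bnd.
have iIb j (f : Om -> R) : measurable_fun setT f -> bnd f -> L1 P setT (fun w => I (tau j) w ^+ 2 * f w).
  move=> mf [K hK]; have := @L1bM _ _ _ P setT measurableT K f _ mf (fun w _ => hK w) (L2_sq (LI j)).
  by apply: eq_L1 => // w _; rewrite mulrC.
have cb j : bnd (c j).
  by exists 1 => w; rewrite /c; case: (l <= _); rewrite ?normr0 ?normr1.
have lc j w : l ^+ 2 * c j w <= I (tau j) w ^+ 2 * c j w.
  rewrite /c; have [h|h] := boolP (l <= _); rewrite ?mulr0// !mulr1.
  by rewrite -[leRHS](real_normK (num_real _)) lerXn2r// nnegrE ltW.
elim: m => [|m IH] /=.
  rewrite -(EZ measurableT _ (ib 0%N)); apply: E_le => //; first exact: L1Z (ib 0%N).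
    exact: (iIb 0%N).
  by move=> w _; exact: lc.
pose g w := (1 - doobb m w) * c m.+1 w.
have mg : measurable_fun setT g by apply: measurable_funM => //; exact: measurable_funB.
have bg : bnd g.
  exists 1 => w; rewrite /g /c; have [->|->] := doobb01 m w; case: (l <= _);
  by rewrite ?subr0 ?subrr ?mulr0 ?mul0r ?mulr1 ?normr0 ?normr1.
have ig : L1 P setT g by exact: L1_bnd.
rewrite ED// mulrDr.
have -> : E (fun w => I (tau m.+1) w ^+ 2 * (doobb m w + (1 - doobb m w) * c m.+1 w)) =
  E (fun w => I (tau m.+1) w ^+ 2 * doobb m w + I (tau m.+1) w ^+ 2 * g w).
  by apply: eq_E => w _; rewrite mulrDr.
rewrite ED//; [|exact: iIb|exact: iIb].
apply: lerD; last first.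
  rewrite -EZ//; apply: E_le => //; [exact: L1Z|exact: iIb|].
  move=> w _; rewrite /g mulrCA [leRHS]mulrCA; apply: ler_wpM2l; last exact: lc.
  by have [->|->] := doobb01 m w; rewrite ?subr0 ?subrr.
apply: (le_trans IH).
have LD := L2B measurableT (LI m.+1) (LI m).
have LbI : L2 P setT (fun w => doobb m w * I (tau m) w) by exact: L2bndM.
have LbD : L2 P setT (fun w => doobb m w * (I (tau m.+1) w - I (tau m) w)) by exact: L2bndM.
have z : E (fun w => (doobb m w * I (tau m) w) * (I (tau m.+1) w - I (tau m) w)) = 0.
  apply: mI.2 => //; first by have /andP[] := htau m.
    by have /andP[] := htau m.+1.
  by apply: FmM; [exact: doobb_Fm|exact: (mI.1 _ (htau m)).1].
have -> : E (fun w => I (tau m.+1) w ^+ 2 * doobb m w) =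
  E (fun w => I (tau m) w ^+ 2 * doobb m w) + 2 * 0 +
  E (fun w => (doobb m w * (I (tau m.+1) w - I (tau m) w)) * (I (tau m.+1) w - I (tau m) w)).
  rewrite -[X in 2 * X]z -EZ//; last exact: L2M.
  rewrite -ED//; [|exact: iIb|by apply: L1Z => //; exact: L2M].
  rewrite -ED//; [|apply: L1D => //; [exact: iIb|by apply: L1Z => //; exact: L2M]|exact: L2M].
  by apply: eq_E => w _; ring.
rewrite mulr0 addr0 lerDl; apply: E_ge0 => w _.
by rewrite -mulrA -expr2; have [->|->] := doobb01 m w; rewrite ?mul0r ?mul1r ?sqr_ge0.
Qed.

Lemma doob_prob m : l ^+ 2 * E (doobb m) <= E2 (I T).
Proof.
apply: (le_trans (doob_discrete m)).
have LI := (mI.1 _ (htau m)).2.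
have hT : t <= T <= T by rewrite tT lexx.
have LT := (mI.1 _ hT).2.
have mb := Fm_meas (htau m) (@doobb_Fm m).
have ib : L1 P setT (fun w => I (tau m) w ^+ 2 * doobb m w).
  have [K hK] := bbnd m.
  have := @L1bM _ _ _ P setT measurableT K (doobb m) _ mb (fun w _ => hK w) (L2_sq LI).
  by apply: eq_L1 => // w _; rewrite mulrC.
apply: (@le_trans _ _ (E2 (I (tau m)))).
  apply: E_le => //; first exact: L2_sq.
  by move=> w _; have [->|->] := doobb01 m w; rewrite ?mulr0 ?mulr1 ?sqr_ge0.
have LD := L2B measurableT LT LI.
have z : E (fun w => I (tau m) w * (I T w - I (tau m) w)) = 0.
  have /andP[h1 h2] := htau m.
  by apply: mI.2 => //; exact: (mI.1 _ (htau m)).1.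
rewrite /E2; have -> : E (fun w => I T w ^+ 2) =
  E (fun w => I (tau m) w ^+ 2) + 2 * 0 + E (fun w => (I T w - I (tau m) w) ^+ 2).
  rewrite -[X in 2 * X]z -EZ//; last exact: L2M.
  rewrite -ED//; [|exact: L2_sq|by apply: L1Z => //; exact: L2M].
  rewrite -ED//; [|apply: L1D => //; [exact: L2_sq|by apply: L1Z => //; exact: L2M]|exact: L2_sq].
  by apply: eq_E => w _; ring.
by rewrite mulr0 addr0 lerDl; apply: E_ge0 => *; exact: sqr_ge0.
Qed.

End DoobDiscrete.
End LinearIto.

(** * Continuous adapted processes *)

Section Grid.
Context (R : realType) (a b : R) (ab : a <= b).

(** The minimum freezes the grid at b past its last node, so that every index gives a point of
    [a, b]. The parameter N stands for N + 1 cells. *)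
Definition grid (N j : nat) : R := a + (b - a) * ((minn j N.+1)%:R / N.+1%:R).

Lemma grid0 N : grid N 0 = a.
Proof. by rewrite /grid min0n mul0r mulr0 addr0. Qed.

Lemma gridN N : grid N N.+1 = b.
Proof. by rewrite /grid minnn divff ?pnatr_eq0// mulr1 addrC subrK. Qed.

Lemma grid_le N i j : (i <= j)%N -> grid N i <= grid N j.
Proof.
move=> ij; rewrite /grid lerD2l ler_wpM2l ?subr_ge0// ler_pM2r ?invr_gt0 ?ltr0n//.
by rewrite ler_nat leq_min geq_minr andbT (leq_trans (geq_minl _ _)).
Qed.

Lemma grid_in N j : a <= grid N j <= b.
Proof.
rewrite -[leLHS](grid0 N) grid_le//= -[leRHS](gridN N) /grid.
rewrite lerD2l ler_wpM2l ?subr_ge0// ler_pM2r ?invr_gt0 ?ltr0n//.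
by rewrite ler_nat minnn geq_minr.
Qed.

Lemma grid_step N j : (j <= N)%N -> grid N j.+1 - grid N j = (b - a) / N.+1%:R.
Proof.
move=> jN; rewrite /grid (minn_idPl _)// (minn_idPl _) ?(leqW jN)// -natr1; field.
by rewrite addrC natr1 pnatr_eq0.
Qed.

Lemma grid_locate N s : a < s <= b -> exists2 j, (j <= N)%N & grid N j < s <= grid N j.+1.
Proof.
move=> /andP[as_ sb].
have ex : exists j, s <= grid N j by exists N.+1; rewrite gridN.
have := ex_minnP ex => -[[|j] hj jmin]; first by move: hj; rewrite grid0 leNgt as_.
have jN : (j <= N)%N by apply: (jmin N.+1); rewrite gridN.
exists j => //; rewrite hj andbT ltNge; apply/negP => /jmin.
by rewrite ltnn.
Qed.

(** Cells are left-open, so exactly one of them contains tau, and the sum has a single term. Its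
    left end is strictly before tau and its length tends to 0. *)
Lemma grid_cvg (G : R -> R -> R) (tau l : R) : a < tau <= b ->
  (forall e, 0 < e -> exists2 eta, 0 < eta & forall u v, a <= u -> u < tau -> tau <= v ->
    v <= b -> v - u < eta -> `|G u v - l| < e) ->
  (fun N => \sum_(j < N.+1) (if (grid N j < tau) && (tau <= grid N j.+1)
     then G (grid N j) (grid N j.+1) else 0)) @ \oo --> l.
Proof.
move=> htau hG; apply/cvgrPdist_lt => e e0; have [eta eta0 H] := hG e e0.
have : (b - a) / N.+1%:R @[N --> \oo] --> (b - a) * 0.
  by apply: cvgM; [exact: cvg_cst|exact: cvg_harmonic].
rewrite mulr0 => /cvgrPdist_lt/(_ eta eta0); apply: filterS => N.
rewrite sub0r normrN ger0_norm ?mulr_ge0 ?subr_ge0// => hN.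
have [j jN hj] := grid_locate N htau.
have jN' : (j < N.+1)%N by [].
rewrite (bigD1 (Ordinal jN'))//= hj big1 ?addr0 => [|i ij].
  rewrite distrC; have /andP[h1 h2] := hj; apply: H => //.
  - by have /andP[] := grid_in N j.
  - by have /andP[] := grid_in N j.+1.
  - by rewrite grid_step.
case: ifP => // /andP[i1 i2]; case/negP: ij; apply/eqP/val_inj => /=.
apply/eqP; rewrite eqn_leq; have /andP[h1 h2] := hj.
apply/andP; split; rewrite leqNgt; apply/negP => h.
  by have := lt_le_trans i1 (le_trans h2 (grid_le N h)); rewrite ltxx.
by have := lt_le_trans h1 (le_trans i2 (grid_le N h)); rewrite ltxx.
Qed.

Lemma grid_near N s : a <= s <= b -> exists2 j, (j <= N.+1)%N & `|grid N j - s| <= (b - a) / N.+1%:R.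
Proof.
move=> /andP[]; rewrite le_eqVlt => /predU1P[<- _|as_ sb].
  exists 0%N => //; rewrite grid0 subrr normr0 mulr_ge0 ?subr_ge0//.
have [j jN /andP[h1 h2]] := grid_locate N (introT andP (conj as_ sb)).
exists j.+1 => //; rewrite ger0_norm ?subr_ge0// -(grid_step jN) lerD2l lerNl opprK.
exact: ltW.
Qed.

End Grid.

Section ContinuousProcesses.
Context (R : realType) (d : nat) (t T : R) (B : brownian_basis d t T) (tT : t <= T).
Notation Om := (bb_Omega B).
Notation P := (bb_P B).
Notation W := (bb_W B).
Notation lam := (@lebesgue_measure R).
Notation mu := (lam \x P)%E.
Notation Dom := (@Dom R (bb_disp B) Om).
Notation E f := (Rintegral P setT f).
Notation Fm := (Fm (B := B)).
Notation mDom := (@measurable_Dom R (bb_disp B) Om _ _).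
Implicit Types (Z : R -> Om -> 'cV[R]_d) (I : R -> Om -> R) (V : R -> Om -> R).

(** On dyadic grids the exceptional sets increase, so the discrete bound passes to their union. By
    continuity, a path that exceeds l strictly somewhere is at least l at a node of some fine
    grid. *)
Lemma doob I (l : R) : martingale I -> (forall w, {within `[t, T], continuous (I ^~ w)}) ->
  0 < l -> exists A : set Om, [/\ measurable A, (P A <= (E2 (I T) / l ^+ 2)%:E)%E &
    forall w s, t <= s <= T -> l < `|I s w| -> A w].
Proof.
move=> mI cI l0.
(* [grid] with parameter N has N + 1 cells, so this parameter gives 2^m of them. *)
pose nn m := (2 ^ m).-1; have nnE m : (nn m).+1 = (2 ^ m)%N by rewrite prednK// expn_gt0.
pose tau m j := grid t T (nn m) j.
pose A m := [set w | exists2 j, (j <= 2 ^ m)%N & l <= `|I (tau m j) w|].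
have htau m j : t <= tau m j <= T by exact: grid_in.
have mA m : measurable (A m).
  rewrite (_ : A m = \bigcup_(j in [set j | (j <= 2 ^ m)%N])
      ((fun w => `|I (tau m j) w|) @^-1` `[l, +oo[)); last first.
    by apply/seteqP; split => w [j h1 h2]; exists j => //; move: h2; rewrite /= in_itv/= andbT.
  apply: bigcup_measurable => j _; rewrite -[X in measurable X]setTI.
  apply: (measurableT_comp (@normr_measurable _ _)) => //.
  exact: Fm_meas (htau m j) (mI.1 _ (htau m j)).1.
have PA m : (P (A m) <= (E2 (I T) / l ^+ 2)%:E)%E.
  have ntau j : tau m j <= tau m j.+1 by exact: grid_le.
  have h := doob_prob tT mI (htau m) ntau l0 (2 ^ m)%N.
  set bb := doobb _ _ _ _ in h.
  have mbb : measurable_fun setT bb.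
    apply: (Fm_meas (htau m (2 ^ m)%N)); exact: doobb_Fm.
  have ibb : L1 P setT bb.
    apply: (@L1_bounded _ _ _ P setT measurableT 1) => //; first exact: PT_lty.
    by move=> w _; have := doobb01 I (tau m) l (2 ^ m) w; rewrite -/bb => -[->|->]; rewrite ?normr0 ?normr1.
  apply: (@le_trans _ _ (E bb)%:E); last first.
    by rewrite lee_fin ler_pdivlMr ?exprn_gt0// mulrC.
  rewrite -(setIT (A m)) -integral_indic// -L1_EFin//.
  apply: ge0_le_integral => //.
  - by apply/measurable_EFinP; exact: measurable_indic.
  - by apply/measurable_EFinP.
  - move=> w _; rewrite lee_fin indicE.
    have [|_] := boolP (w \in A m); last first.
      by have := doobb01 I (tau m) l (2 ^ m) w; rewrite -/bb => -[->|->].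
    by rewrite inE => -[j jm hj]; rewrite /bb (doobb_ge _ hj).
(* Node j of level m is node 2 j of level m + 1. *)
have ndA : nondecreasing_seq A.
  apply/nondecreasing_seqP => m; apply/subsetPset => w [j jm hj]; exists (2 * j)%N.
    by rewrite expnS leq_mul2l.
  rewrite (_ : tau m.+1 (2 * j)%N = tau m j)//.
  rewrite /tau /grid !nnE; congr (_ + _ * _).
  rewrite expnS -minnMr !natrM; field.
  by rewrite pnatr_eq0 expn_eq0.
exists (\bigcup_m A m); split; first exact: bigcup_measurable.
- have c := nondecreasing_cvg_mu (mu := P) mA (bigcup_measurable (fun m _ => mA m)) ndA.
  rewrite -(cvg_lim _ c)//; apply: lime_le; first by apply/cvg_ex; eexists; exact: c.
  by apply: nearW => m; exact: PA.
- move=> w s hs ls.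
  (* The strict gap |I_s| - l is taken as tolerance: a node closer than eta still has |I| >= l. *)
  have [eta eta0 H] := (eps_within t T (I ^~ w)).1 (cI w) s hs (`|I s w| - l) ltac:(by rewrite subr_gt0).
  have : (T - t) / N.+1%:R @[N --> \oo] --> (T - t) * 0.
    by apply: cvgM; [exact: cvg_cst|exact: cvg_harmonic].
  rewrite mulr0 => /cvgrPdist_lt/(_ eta eta0)[N _ hN].
  have := hN (nn N); rewrite /= sub0r normrN ger0_norm ?mulr_ge0 ?subr_ge0//.
  have lN : (N <= nn N)%N by rewrite -ltnS nnE ltn_expl.
  move=> /(_ lN) hT; have [j jN hj] := grid_near tT (nn N) hs.
  exists N => //; exists j; first by rewrite -nnE.
  have := H _ (htau N j) (le_lt_trans hj hT).
  have := ler_norm (`|I s w| - `|I (tau N j) w|).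
  have := ler_dist_dist (I s w) (I (tau N j) w); rewrite distrC.
  by rewrite -/(tau N j); lra.
Qed.

Definition cproc V := (forall w, {within `[t, T], continuous (V ^~ w)}) /\
  forall s, t <= s <= T -> Fm s (V s).

(** V is the limit of step processes that take on each left-open cell of [t, s] the value at its
    left node. All nodes are at most s, so these are measurable for the Borel sets times F_s. The
    time t lies in no cell and gets a term of its own. *)
Lemma cproc_progressive V : cproc V -> progressive V.
Proof.
move=> [cV mV] s hs; have /andP[ts sT] := hs.
pose h N (p : measurableTypeR R * FT B s) : R :=
  \sum_(j < N.+1) (if (grid t s N j < p.1) && (p.1 <= grid t s N j.+1) then
     V (grid t s N j) p.2 else 0) + (if p.1 == t then V t p.2 else 0).
have mI2 (A : set R) (f : Om -> R) : measurable A -> Fm s f ->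
  measurable_fun setT (fun p : measurableTypeR R * FT B s => \1_A p.1 * f p.2).
  move=> mA mf; apply: measurable_funM.
    have m1 : measurable_fun setT (\1_A : measurableTypeR R -> R) by exact: measurable_indic.
    exact: (measurableT_comp m1 measurable_fst).
  exact: (measurableT_comp mf measurable_snd).
have mh N : measurable_fun setT (h N).
  rewrite (_ : h N = fun p => \sum_(j < N.+1) (\1_(`]grid t s N j, grid t s N j.+1]) p.1 * V (grid t s N j) p.2)
     + \1_[set t] p.1 * V t p.2).
    apply: measurable_funD; last first.
      by apply: mI2 => //; apply: Fm_mono ts _; apply: mV; rewrite lexx.
    apply: measurable_sum => j; apply: mI2 => //.
    have /andP[g1 g2] := grid_in ts N j.
    by apply: (Fm_mono g2); apply: mV; rewrite g1 (le_trans g2).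
  apply/funext => p; rewrite /h; congr (_ + _).
    apply: eq_bigr => j _; rewrite indicE mem_setE in_itv/=.
    by case: ifP => _; rewrite ?mul1r ?mul0r.
  rewrite indicE; have [pt|pt] := eqVneq p.1 t; first by rewrite mem_set// mul1r.
  by rewrite memNset ?mul0r//; exact/eqP.
have mF : measurable [set p : measurableTypeR R * FT B s | t <= p.1 <= s].
  rewrite (_ : [set _ | _] = `[t, s]%classic `*` setT); first exact: measurableX.
  by apply/seteqP; split => [p /= hh|p /= []]; rewrite /= in_itv/=.
apply: (measurable_fun_cvg (h := h)); first by move=> N; exact: measurable_funS (mh N).
move=> p hp; have /andP[tp ps] := hp.
move: (tp); rewrite le_eqVlt => /predU1P[tpe|ltp].
  apply: cvg_near_cst; apply: nearW => N; rewrite /h -tpe eqxx big1 ?add0r// => j _.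
  by case: ifP => // /andP[+ _]; have /andP[g1 g2] := grid_in ts N j; rewrite ltNge g1.
rewrite -[X in _ --> X]addr0; apply: cvgD; last first.
  by rewrite (gt_eqF ltp); exact: cvg_cst.
apply: (@grid_cvg _ t s ts (fun u _ => V u p.2)); first by rewrite ltp.
move=> e e0.
have hp1 : t <= p.1 <= T by rewrite tp (le_trans ps).
have [eta eta0 H] := (eps_within t T (V ^~ p.2)).1 (cV p.2) p.1 hp1 e e0.
exists eta => // u v tu up pv vs uv; apply: H; first by rewrite tu (ltW (lt_le_trans up (le_trans ps sT))).
by rewrite ltr0_norm ?subr_lt0//; lra.
Qed.

(** By Borel-Cantelli the sequence is eventually uniformly Cauchy outside a null set L. The limit is
    set to 0 on L, which keeps it adapted because F_s contains the null sets. *)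
Lemma climit (V : nat -> R -> Om -> R) (A : nat -> set Om) (C : R) :
  (forall k, cproc (V k)) -> (forall k, measurable (A k)) ->
  (forall k, (P (A k) <= (C * 2^-1 ^+ k)%:E)%E) ->
  (forall k w s, ~ A k w -> t <= s <= T -> `|V k.+1 s w - V k s w| <= 2^-1 ^+ k) ->
  exists V', cproc V' /\ {ae P, forall w, forall e, 0 < e -> exists N, forall k s,
     (N <= k)%N -> t <= s <= T -> `|V k s w - V' s w| <= e}.
Proof.
move=> cV mA PA dV.
have C0 : 0 <= C by have := le_trans (measure_ge0 P _) (PA 0%N); rewrite expr0 mulr1 lee_fin.
pose L := lim_sup_set A.
have mL : measurable L by apply: bigcap_measurableType => n _; exact: bigcup_measurable.
have PL : P L = 0%E.
  apply: lim_sup_set_cvg0 => //.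
  apply: (@le_lt_trans _ _ (\sum_(n <oo) (C * 2^-1 ^+ n)%:E)%E).
    by apply: lee_nneseries => // n _; exact: PA.
  have c := @cvg_geometric_series _ C (2^-1 : R).
  have {}c : series (geometric C 2^-1) @ \oo --> C * (1 - 2^-1)^-1 by apply: c; rewrite ger0_norm; lra.
  have -> : (\sum_(n <oo) (C * 2^-1 ^+ n)%:E = (C * (1 - 2^-1)^-1)%:E)%E; last exact: ltry.
  apply/cvg_lim => //; rewrite [X in X @ _ --> _](_ : _ = EFin \o series (geometric C 2^-1)).
    by apply: cvg_EFin => //; exact: nearW.
  by apply/funext => n; rewrite /= /series/= sumEFin.
have nL : P.-negligible L by exists L; split.
have good w : ~ L w -> exists N, forall k, (N <= k)%N -> ~ A k w.
  move=> /existsNP[n /not_implyP[_ h]]; exists n => k nk Ak; apply: h; exists k => //.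
(* The right-hand side is the sum of 2^-i over k <= i < k + j, written so that the induction on j
   closes. *)
have tail w N : (forall k, (N <= k)%N -> ~ A k w) -> forall k j s, (N <= k)%N -> t <= s <= T ->
    `|V (k + j)%N s w - V k s w| <= 2 * 2^-1 ^+ k - 2 * 2^-1 ^+ (k + j).
  move=> hN k j s Nk hs; elim: j => [|j IH]; first by rewrite addn0 !subrr normr0.
  have h := dV (k + j)%N w s (hN _ (leq_trans Nk (leq_addr _ _))) hs.
  rewrite addnS; apply: le_trans (ler_distD (V (k + j)%N s w) _ _) _.
  apply: le_trans (lerD h IH) _; rewrite exprS; lra.
have half_cvg : (fun k => 2^-1 ^+ k : R) @ \oo --> (0 : R) by apply: cvg_expr; rewrite ger0_norm; lra.
have half0 k : 0 <= 2^-1 ^+ k :> R by apply: exprn_ge0.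
have cvgV w s : ~ L w -> t <= s <= T -> cvgn (fun k => V k s w).
  move=> /good[N hN] hs; apply/cauchy_cvgP/cauchy_exP => e e0.
  have /cvgrPdist_lt/(_ (e / 4))[|M _ hM] := half_cvg; first by lra.
  pose K := maxn N M.
  have hK : 2^-1 ^+ K < e / 4.
    by have := hM K (leq_maxr _ _); rewrite sub0r normrN ger0_norm.
  have near j : (K <= j)%N -> `|V j s w - V K s w| <= 2 * 2^-1 ^+ K.
    move=> Kj; have := tail w N hN K (j - K)%N s (leq_maxl _ _) hs.
    rewrite subnKC// => h; apply: (le_trans h); rewrite lerBlDr lerDl mulr_ge0//.
  exists (V K s w), K => // j /= /near; rewrite /ball/= distrC => h; lra.
pose V' s w := if `[< L w >] then 0 else limn (fun k => V k s w).
have V'lim w s : ~ L w -> t <= s <= T -> V k s w @[k --> \oo] --> V' s w.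
  by move=> Lw hs; rewrite /V' asboolF//; exact: cvgV.
have unif w : ~ L w -> forall e, 0 < e -> exists N, forall k s,
     (N <= k)%N -> t <= s <= T -> `|V k s w - V' s w| <= e.
  move=> Lw e e0; have [N hN] := good w Lw.
  have /cvgrPdist_lt/(_ (e / 2))[|M _ hM] := half_cvg; first by lra.
  exists (maxn N M) => k s; rewrite geq_max => /andP[Nk Mk] hs.
  have hk : 2^-1 ^+ k < e / 2 by have := hM k Mk; rewrite sub0r normrN ger0_norm.
  have c : `|V k s w - V j s w| @[j --> \oo] --> `|V k s w - V' s w|.
    by apply: cvg_norm; apply: cvgB; [exact: cvg_cst|exact: V'lim].
  rewrite -(cvg_lim _ c)//; apply: limr_le; first by apply/cvg_ex; eexists; exact: c.
  exists k => // j /= kj; have := tail w N hN k (j - k)%N s Nk hs.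
  rewrite subnKC// distrC => h; apply: (le_trans h).
  by have := half0 j; lra.
exists V'; split; last first.
  by exists L; split => // w /= h; apply: contrapT => Lw; apply: h; exact: unif.
split.
- move=> w; apply/eps_within => s hs e e0.
  have [Lw|Lw] := pselect (L w).
    exists 1 => // u hu _; rewrite /V' asboolT//.
    by rewrite subrr normr0.
  have [N hN] := unif w Lw (e / 4) ltac:(lra).
  have [eta eta0 H] := (eps_within t T (V N ^~ w)).1 ((cV N).1 w) s hs (e / 4) ltac:(lra).
  exists eta => // u hu us; have := H u hu us.
  have := hN N u (leqnn _) hu; have := hN N s (leqnn _) hs.
  rewrite !ler_norml !ltr_norml => /andP[? ?] /andP[? ?] /andP[? ?].
  by apply/andP; split; lra.
- move=> s hs; have mLs : measurable (L : set (FT B s)) by exact: filtration_null.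
  have mLc : measurable (~` L : set (FT B s)) by exact: measurableC.
  apply: (@measurable_fun_cvg _ (FT B s) R setT (fun k w => \1_(~` L) w * V k s w) (V' s)).
    by move=> k; apply: measurable_funM; [exact: measurable_indic|exact: (cV k).2].
  move=> w _; rewrite indicE; have [Lw|Lw] := pselect (L w).
    rewrite memNset; last by move=> /(_ Lw).
    rewrite /V' asboolT//; under eq_fun do rewrite mul0r; exact: cvg_cst.
  by rewrite mem_set//; under eq_fun do rewrite mul1r; exact: V'lim.
Qed.

Lemma martingale_E2 I s : martingale I -> t <= s <= T -> E2 (I s) <= E2 (I T).
Proof.
move=> mI hs; have /andP[ts sT] := hs.
have LI := (mI.1 _ hs).2; have hT : t <= T <= T by rewrite tT lexx.
have LT := (mI.1 _ hT).2; have LD := L2B measurableT LT LI.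
have z := mI.2 s T (I s) ts sT (lexx T) (mI.1 _ hs).1 LI.
have [|_ e] := @E_lin3 _ _ _ P setT measurableT 1 2 1 (fun w => I T w ^+ 2) _ _ _ (L2_sq LI)
  (L2M measurableT LI LD) (L2_sq LD); first by move=> w _; ring.
rewrite /E2 e z mulr0 addr0 !mul1r lerDl; apply: E_ge0 => *; exact: sqr_ge0.
Qed.

Lemma simple_E2 (S : simple_process B) : E2 (simple_int S T) = n2 t T (simple_val S).
Proof.
have [_ h] := simple_incr_ok S (lexx t) tT (lexx T).
have := h (fun=> 1) (@Fm_cst _ _ _ _ B t 1) (ex_intro _ 1 (fun _ => _)).
move=> /(_ ltac:(by rewrite normr1)) e.
rewrite -[RHS](_ : \int[mu]_(p in Dom t T) (1 * enorm (simple_val S p.1 p.2) ^+ 2) = _); last first.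
  by apply: eq_E => w _; rewrite mul1r.
rewrite -e; apply: eq_E => w _; rewrite mul1r.
have -> : simple_int S t w = 0; last by rewrite subr0.
rewrite /simple_int big1// => i _; have [h1 h2 h3] := sp_order i.
by rewrite (min_idPl _) ?(le_trans h1)// (min_idPl _)// subrr dotv0r.
Qed.

Lemma simple_int_cproc (S : simple_process B) : cproc (simple_int S).
Proof.
split=> [w|s hs]; last exact: simple_int_Fm.
have cW a : {within `[t, T], continuous (fun s => W s w a 0)}.
  apply/subspace_continuousP => x hx.
  have /subspace_continuousP/(_ x hx) c := @bb_continuous _ _ _ _ B w.
  exact: (cvg_comp (W ^~ w) (fun M : 'cV[R]_d => M a 0) c (@coord_continuous _ _ _ a 0 (W x w))).
apply/subspace_continuousP => x hx.
suff : (\sum_i dotv (sp_coef (s := S) i w) (W (Num.min s (sp_hi i)) w - W (Num.min s (sp_lo i)) w))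
    @[s --> within `[t, T] (nbhs x)] -->
   (\sum_i dotv (sp_coef (s := S) i w) (W (Num.min x (sp_hi i)) w - W (Num.min x (sp_lo i)) w)) by [].
apply: cvg_sumr => i.
have [h1 h2 h3] := sp_order i.
have cm c a : t <= c <= T -> W (Num.min s c) w a 0 @[s --> within `[t, T] (nbhs x)] --> W (Num.min x c) w a 0.
  move=> hc; move: hx; rewrite /= in_itv/= => hx.
  have /andP[x1 x2] := hx; have /andP[c1 c2] := hc.
  have hm u : t <= u <= T -> t <= Num.min u c <= T.
    by move=> /andP[u1 u2]; rewrite le_min u1 c1/= ge_min u2.
  apply/cvgrPdist_lt => e e0.
  have [eta eta0 H] := (eps_within t T _).1 (cW a) (Num.min x c) (hm _ hx) e e0.
  rewrite near_withinE; apply/nbhs_ballP; exists eta => //= u; rewrite /ball/= => ux.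
  rewrite in_itv/= => hu; rewrite distrC; apply: H; first exact: hm.
  apply: le_lt_trans ux; rewrite [leRHS]distrC /Order.min.
  case: (ltrP u c) => g1; case: (ltrP x c) => g2; rewrite ?subrr ?normr0 ?normr_ge0//.
    by rewrite ler0_norm ?subr_le0 ?ler0_norm ?subr_le0; lra.
  by rewrite ger0_norm ?subr_ge0 ?ger0_norm ?subr_ge0; lra.
rewrite /dotv; apply: cvg_sumr => a; apply: cvgM; first exact: cvg_cst.
rewrite [X in X @ _ --> _](_ : _ = fun s => W (Num.min s (sp_hi i)) w a 0 - W (Num.min s (sp_lo i)) w a 0); last first.
  by apply/funext => s; rewrite !mxE.
rewrite [X in _ --> X](_ : _ = W (Num.min x (sp_hi i)) w a 0 - W (Num.min x (sp_lo i)) w a 0); last by rewrite !mxE.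
by apply: cvgB; apply: cm; apply/andP; split => //; [exact: le_trans h2|exact: le_trans h3].
Qed.

(** Squared errors 8^-k are played against thresholds 2^-k: Doob bounds the exceptional sets by 4
    (8^-k) / 4^-k = 4 (2^-k), which is summable, so the simple integrals converge uniformly on
    almost every path. Fatou then shows that the limit is also the L^2 limit. *)
Lemma ito_of_approx Z : (forall a, progressive (fun s w => Z s w a 0)) -> L2p Z ->
  (forall e, 0 < e -> exists S : simple_process B, n2 t T (fun s w => simple_val S s w - Z s w) <= e) ->
  exists I, is_ito Z I.
Proof.
move=> pZ ZL exS.
have ex (k : nat) : exists S : simple_process B, n2 t T (fun s w => simple_val S s w - Z s w) <= 8^-1 ^+ k.
  by apply: exS; rewrite exprn_gt0 ?invr_gt0.
have [S hf] := choice ex.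
have LSZ k := L2pB (L2p_simple (S k)) ZL.
have h80 k : 0 <= 8^-1 ^+ k :> R by rewrite exprn_ge0 ?invr_ge0.
have h8le k j : (k <= j)%N -> 8^-1 ^+ j <= 8^-1 ^+ k :> R.
  by move=> kj; apply: ler_wiXn2l => //; rewrite ?invr_ge0//; rewrite invf_le1//; lra.
have nS k j : (k <= j)%N ->
    E2 (simple_int (sp_lin (S j) (S k) (-1)) T) <= 4 * 8^-1 ^+ k.
  move=> kj; rewrite simple_E2.
  apply: (@le_trans _ _ (n2 t T (fun s w => (simple_val (S j) s w - Z s w) + (-1) *: (simple_val (S k) s w - Z s w)))).
    rewrite le_eqVlt; apply/orP; left; apply/eqP; apply: eq_E => p _.
    by rewrite sp_lin_val !scaleN1r opprB addrA subrK.
  apply: le_trans (n2D (lexx t) (lexx T) (LSZ j) (L2pZ (-1) (LSZ k))) _.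
  rewrite (n2Z (-1) (lexx t) (lexx T) (LSZ k)).
  have h1 := hf k; have h2 := le_trans (hf j) (h8le _ _ kj).
  rewrite [_ ^+ 2](_ : _ = 1); last by ring.
  move: h1 h2.
  by move: (n2 _ _ _) (n2 _ _ _) (8^-1 ^+ k) => u v x; lra.
have lin_int j k s w : simple_int (sp_lin (S j) (S k) (-1)) s w = simple_int (S j) s w - simple_int (S k) s w.
  by rewrite sp_lin_int mulN1r.
have half0 k : 0 < 2^-1 ^+ k :> R by rewrite exprn_gt0 ?invr_gt0.
have exA k : exists A : set Om, [/\ measurable A, (P A <= (4 * 2^-1 ^+ k)%:E)%E &
    forall w s, ~ A w -> t <= s <= T -> `|simple_int (S k.+1) s w - simple_int (S k) s w| <= 2^-1 ^+ k].
  have [A [mA PA hA]] := doob (simple_martingale (sp_lin (S k.+1) (S k) (-1)))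
    (simple_int_cproc _).1 (half0 k).
  exists A; split => //.
    apply: (le_trans PA); rewrite lee_fin ler_pdivrMr ?exprn_gt0//.
    apply: (le_trans (nS k k.+1 (leqnSn _))).
    have -> : 8^-1 = 2^-1 * 2^-1 ^+ 2 :> R by field.
    by rewrite exprMn -exprM mulrA mulnC exprM.
  move=> w s nA hs; rewrite leNgt -lin_int; apply/negP => h; apply: nA; exact: hA hs h.
have [A hA] := choice exA.
have [I [cI hI]] := @climit (fun k => simple_int (S k)) A 4 (fun k => simple_int_cproc (S k))
  (fun k => let: And3 h _ _ := hA k in h) (fun k => let: And3 _ h _ := hA k in h)
  (fun k w s => let: And3 _ _ h := hA k in h w s).
exists I; apply: (mk_ito tT) => //.
- exact: L2p_H2 pZ ZL.
- exact: cproc_progressive.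
- exact: cI.1.
exists S; split.
  apply: (@n2_squeeze _ _ (fun k => 8^-1 ^+ k)).
    by move=> k; rewrite n2_ge0 hf.
  by apply: cvg_expr; rewrite ger0_norm ?invr_ge0// invf_lt1//; lra.
move=> s hs.
have mIs : measurable_fun setT (I s) by exact: Fm_meas (cI.2 s hs).
have LS k := simple_int_L2 (S k) hs.
have key k : L2 P setT (fun w => simple_int (S k) s w - I s w) /\
    E2 (fun w => simple_int (S k) s w - I s w) <= 4 * 8^-1 ^+ k.
  apply: (@L2_fatou _ _ _ P setT measurableT (fun j w => simple_int (S k) s w - simple_int (S (k + j)%N) s w)).
  - by move=> j; exact: L2B.
  - move=> j; apply: le_trans (nS k (k + j)%N (leq_addr _ _)).
    apply: le_trans (martingale_E2 (simple_martingale _) hs).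
    rewrite le_eqVlt; apply/orP; left; apply/eqP; apply: eq_E => w _.
    by rewrite lin_int -sqrrN opprB.
  - by apply: measurable_funB => //; exact: L2_meas (LS k).
  - apply: filterS hI => w h _; apply: cvgB; first exact: cvg_cst.
    apply/cvgrPdist_le => e e0; have [N hN] := h e e0.
    by exists N => // j /= Nj; rewrite distrC; apply: hN => //; rewrite (leq_trans Nj)// leq_addl.
split.
  apply: eq_L2 (L2B measurableT (LS 0%N) (key 0%N).1) => // w _; ring.
apply: (@n2_squeeze _ _ (fun k => 4 * 8^-1 ^+ k)).
  by move=> k; rewrite (key k).2 andbT; apply: E_ge0 => *; exact: sqr_ge0.
rewrite -[X in _ --> X](mulr0 4); apply: cvgM; first exact: cvg_cst.
by apply: cvg_expr; rewrite ger0_norm ?invr_ge0// invf_lt1//; lra.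
Qed.

(** * Integrals of bounded continuous adapted integrands *)

Section ItoExistence.
Variables (Z : R -> Om -> 'cV[R]_d) (K : R).
Hypotheses (cZ : forall a, cproc (fun s w => Z s w a 0))
  (bZ : forall s w, t <= s <= T -> enorm (Z s w) <= K).

Let lo N (j : 'I_N.+1) := grid t T N j.
Let hi N (j : 'I_N.+1) := grid t T N j.+1.

Let lohi N (j : 'I_N.+1) : [/\ t <= lo j, lo j <= hi j & hi j <= T].
Proof.
have /andP[g1 _] := grid_in tT N j; have /andP[_ g2] := grid_in tT N j.+1.
by split => //; exact: grid_le.
Qed.

Let adapt N (j : 'I_N.+1) a : measurable_fun setT
    (fun w : g_sigma_algebraType (bb_gen (lo j)) => Z (lo j) w a 0).
Proof. by have := (cZ a).2 (lo j) (grid_in tT N j). Qed.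

Let bnded N (j : 'I_N.+1) : exists M : R, forall w, enorm (Z (lo j) w) <= M.
Proof. by exists K => w; apply: bZ; exact: grid_in. Qed.

Let SS N : simple_process B := @SimpleProcess _ _ _ _ B N.+1 _ _ (fun j w => Z (lo j) w)
  (@lohi N) (@adapt N) (@bnded N).

Let ZL : L2p Z.
Proof.
move=> a; apply: (@L2_bounded _ _ _ _ _ mDom K); first exact: mu_Dom.
  exact: (progressive_meas tT (cproc_progressive (cZ a))).
by move=> p hp; apply: le_trans (bZ p.2 hp); exact: abs_coord_le.
Qed.

(** Left-node values converge to Z by continuity of the paths; the squared differences of
    coordinates are dominated by (2 K)^2. *)
Let SS_cvg : n2 t T (fun s w => simple_val (SS N) s w - Z s w) @[N --> \oo] --> (0 : R).
Proof.
have LSZ N := L2pB (L2p_simple (SS N)) ZL.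
have val_le N s w a : t <= s <= T -> `|simple_val (SS N) s w a 0| <= K.
  move=> hs; have K0 : 0 <= K := le_trans (enorm_ge0 _) (bZ w hs).
  have /andP[ts sT] := hs; move: ts; rewrite le_eqVlt => /predU1P[se|lts].
    rewrite /simple_val big1 ?mxE ?normr0// => i _; rewrite -se /=.
    by have [h1 _ _] := lohi i; rewrite ltNge h1.
  have [j jN hj] := grid_locate N (introT andP (conj lts sT)).
  rewrite /simple_val (bigD1 (Ordinal (jN : (j < N.+1)%N)))//= /lo /hi /= hj big1 ?addr0.
    by apply: le_trans (abs_coord_le _ _ _) (bZ _ _); exact: grid_in.
  move=> i ij; case: ifP => // /andP[i1 i2]; case/negP: ij; apply/eqP/val_inj => /=.
  apply/eqP; rewrite eqn_leq; have /andP[h1 h2] := hj.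
  apply/andP; split; rewrite leqNgt; apply/negP => h.
    by have := lt_le_trans i1 (le_trans h2 (grid_le tT N h)); rewrite ltxx.
  by have := lt_le_trans h1 (le_trans i2 (grid_le tT N h)); rewrite ltxx.
have coordc a : (fun N => \int[mu]_(p in Dom t T)
   ((simple_val (SS N) p.1 p.2 - Z p.1 p.2) a 0) ^+ 2) @ \oo --> (0 : R).
  (* At time t the simple processes are 0 whatever Z_t is. This negligible time is removed before
     dominated convergence is used. *)
  pose F N (p : measurableTypeR R * Om) := if p.1 == t then 0 else
    ((simple_val (SS N) p.1 p.2 - Z p.1 p.2) a 0) ^+ 2.
  have m0 N : measurable_fun (Dom t T) (fun p : measurableTypeR R * Om =>
     ((simple_val (SS N) p.1 p.2 - Z p.1 p.2) a 0) ^+ 2).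
    exact: L1_meas (L2_sq (LSZ N a)).
  have mF N : measurable_fun (Dom t T) (F N).
    rewrite (_ : F N = fun p => \1_(~` [set t]) p.1 * ((simple_val (SS N) p.1 p.2 - Z p.1 p.2) a 0) ^+ 2).
      apply: measurable_funM => //; apply: measurable_funTS.
      have m1 : measurable_fun setT (\1_(~` [set t]) : measurableTypeR R -> R).
        by apply: measurable_indic; exact: measurableC.
      exact: (measurableT_comp m1 measurable_fst).
    apply/funext => p; rewrite /F indicE; have [pt|pt] := eqVneq p.1 t.
      by rewrite memNset ?mul0r//= => /(_ pt).
    by rewrite mem_set ?mul1r//=; exact/eqP.
  rewrite [X in X @ _ --> _](_ : _ = fun N => \int[mu]_(p in Dom t T) F N p); last first.
    apply/funext => N; apply: (@Dom_ae _ _ _ _ _ _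
      (fun s w => ((simple_val (SS N) s w - Z s w) a 0) ^+ 2) (fun s w => F N (s, w))).
    - exact: m0.
    - by apply: eq_measurable_fun (mF N) => -[].
    - by move=> tau w /andP[ttau _]; rewrite /F/= (gt_eqF ttau).
  have := @E_dct _ _ _ mu _ mDom F (fun=> 0) (fun=> (2 * K) ^+ 2) mF.
  rewrite E0 => /(_ (measurable_cst _)) h; apply: (h _ _ _).2.
  - apply: aeW => -[s w] /= hs; have /andP[ts sT] := hs; rewrite /F/=.
    move: ts => /=; rewrite le_eqVlt => /predU1P[<-|lts].
      by rewrite eqxx; exact: cvg_cst.
    rewrite (gt_eqF lts) -[X in _ --> X](_ : (Z s w a 0 - Z s w a 0) ^+ 2 = 0); last first.
      by rewrite subrr expr0n.
    have c : (fun N => simple_val (SS N) s w a 0) @ \oo --> Z s w a 0.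
      rewrite [X in X @ _ --> _](_ : _ = fun N => \sum_(j < N.+1)
         (if (grid t T N j < s) && (s <= grid t T N j.+1) then Z (grid t T N j) w a 0 else 0)).
        apply: (@grid_cvg _ t T tT (fun u _ => Z u w a 0)); first by rewrite lts.
        move=> e e0; have [eta eta0 H] := (eps_within t T _).1 ((cZ a).1 w) s hs e e0.
        exists eta => // u v tu up pv vs uv; apply: H; first by rewrite tu (ltW (lt_le_trans up _)).
        by rewrite ltr0_norm ?subr_lt0//; lra.
      apply/funext => N; rewrite /simple_val summxE; apply: eq_bigr => j _.
      by rewrite /lo /hi; case: ifP => // _; rewrite mxE.
    have c2 : (fun N => simple_val (SS N) s w a 0 - Z s w a 0) @ \oo --> Z s w a 0 - Z s w a 0.
      by apply: cvgB c _; exact: cvg_cst.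
    rewrite [X in X @ _ --> _](_ : _ = fun N => (simple_val (SS N) s w a 0 - Z s w a 0) *
       (simple_val (SS N) s w a 0 - Z s w a 0)); first by rewrite expr2; exact: cvgM.
    by apply/funext => N; rewrite expr2 !mxE.
  - apply: (@L1_bounded _ _ _ _ _ mDom ((2 * K) ^+ 2)) => //; first exact: mu_Dom.
    by move=> p _; rewrite ger0_norm ?sqr_ge0.
  - move=> N [s w] hs; rewrite /F/=; case: ifP => _; first by rewrite normr0 sqr_ge0.
    have h1 := val_le N s w a hs; have h2 := le_trans (abs_coord_le (Z s w) a 0) (bZ w hs).
    rewrite !mxE normrX; apply: lerXn2r; rewrite ?nnegrE//.
      by have := normr_ge0 (Z s w a 0); lra.
    by apply: le_trans (ler_normB _ _) _; lra.
rewrite [X in X @ _ --> _](_ : _ = fun N => \sum_a \int[mu]_(p in Dom t T)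
   ((simple_val (SS N) p.1 p.2 - Z p.1 p.2) a 0) ^+ 2).
  rewrite -[X in _ --> X](_ : \sum_(a < d) 0 = 0 :> R); last by rewrite big1.
  by apply: cvg_sumr => a; exact: coordc.
apply/funext => N; rewrite /n2 -E_sum; [|exact: mDom|by move=> a _; exact: L2_sq (LSZ N a)].
by apply: eq_E => p _; rewrite enormc_sq.
Qed.

Lemma bounded_approx e : 0 < e ->
  exists S : simple_process B, n2 t T (fun s w => simple_val S s w - Z s w) <= e.
Proof.
move=> e0; have /cvgrPdist_lt/(_ _ e0)[N _ hN] := SS_cvg.
exists (SS N); have := hN N (leqnn _); rewrite sub0r normrN => /ltW; apply: le_trans.
exact: ler_norm.
Qed.

Lemma ito_exists : exists I, is_ito Z I.
Proof.
apply: ito_of_approx => //; last exact: bounded_approx.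
by move=> a; exact: cproc_progressive.
Qed.

End ItoExistence.

End ContinuousProcesses.

(** * Paths *)

Section Paths.
Context (R : realType).
Notation lam := (@lebesgue_measure R).
Implicit Types (f g : R -> R) (a b : R).

Lemma itv_sub a b r s : a <= r -> s <= b -> (`[r, s]%classic : set R) `<=` `[a, b]%classic.
Proof. by move=> ar sb x; rewrite /= !in_itv/= => /andP[h1 h2]; rewrite (le_trans ar)// (le_trans h2). Qed.

Lemma cont_sub f a b r s : a <= r -> s <= b -> {within `[a, b], continuous f} ->
  {within `[r, s], continuous f}.
Proof. by move=> ar sb; apply: continuous_subspaceW; exact: itv_sub. Qed.

Lemma cont_L1 f a b r s : a <= r -> s <= b -> {within `[a, b], continuous f} -> L1 lam `[r, s] f.
Proof.
move=> ar sb cf; apply: continuous_compact_integrable; first exact: segment_compact.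
exact: cont_sub cf.
Qed.

Lemma L1_sub f a b r s : a <= r -> s <= b -> L1 lam `[a, b] f -> L1 lam `[r, s] f.
Proof. by move=> ar sb; apply: integrableS => //; exact: itv_sub. Qed.

Lemma cont_bounded f a b : {within `[a, b], continuous f} -> exists K, forall s, a <= s <= b -> `|f s| <= K.
Proof.
move=> cf; have [M [_ hM]] := compact_bounded (continuous_compact cf (@segment_compact _ a b)).
exists (M + 1) => s hs; apply: (hM (M + 1)); first by rewrite ltrDl.
by exists s => //; rewrite /= in_itv.
Qed.

Lemma lam_itv a b : a <= b -> lam `[a, b] = (b - a)%:E.
Proof.
rewrite le_eqVlt => /predU1P[<-|ab]; rewrite lebesgue_measure_itv/=.
  by rewrite lte_fin ltxx subrr.
by rewrite lte_fin ab EFinB.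
Qed.

Lemma Rint_cst a b (c : R) : a <= b -> Rintegral lam `[a, b] (fun=> c) = c * (b - a).
Proof. by move=> ab; rewrite Rintegral_cst//= lam_itv. Qed.

Lemma L1_cst a b (c : R) : L1 lam `[a, b] (fun=> c).
Proof. by apply: (@cont_L1 _ a b) => //; apply: continuous_subspaceT => x; exact: cvg_cst. Qed.

Lemma Rint_chasles f a b c : a <= b -> b <= c -> L1 lam `[a, c] f ->
  Rintegral lam `[a, c] f = Rintegral lam `[a, b] f + Rintegral lam `[b, c] f.
Proof.
move=> ab bc fi; have := Rintegral_itvB (f := f) (a := BLeft a) (b := BRight c) (x := b) fi.
rewrite !bnd_simp => /(_ ab bc) h; rewrite Rintegral_itv_obnd_cbnd in h; last first.
  apply: integrableS fi => // x; rewrite /= !in_itv/= => /andP[h1 h2].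
  by rewrite h2 andbT (le_trans ab)// ltW.
by rewrite -h addrC subrK.
Qed.

Lemma Rint_norm_le f a b K : a <= b -> L1 lam `[a, b] f -> (forall s, a <= s <= b -> `|f s| <= K) ->
  `|Rintegral lam `[a, b] f| <= K * (b - a).
Proof.
move=> ab fi fK; rewrite -(Rint_cst K ab); apply: le_trans (E_norm _ fi) _ => //.
apply: (@E_le _ _ _ lam `[a, b]%classic ltac:(exact: measurable_itv) _ _ (L1_norm fi) (L1_cst a b K)).
by move=> s; rewrite /= in_itv/= => /fK.
Qed.

Lemma Rint_CS f a b : a <= b -> measurable_fun `[a, b] f -> L1 lam `[a, b] (fun s => f s ^+ 2) ->
  Rintegral lam `[a, b] f ^+ 2 <= (b - a) * Rintegral lam `[a, b] (fun s => f s ^+ 2).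
Proof.
move=> ab mf fi.
have L2c : L2 lam `[a, b] (fun=> 1) by split => //; apply: eq_L1 (L1_cst a b 1) => // x _; rewrite expr1n.
have := @E_CS _ _ _ lam `[a, b]%classic ltac:(exact: measurable_itv) _ _ L2c (conj mf fi).
have -> : Rintegral lam `[a, b] (fun x => 1 * f x) = Rintegral lam `[a, b] f.
  by apply: eq_E => x _; rewrite mul1r.
have -> : Rintegral lam `[a, b] (fun x => 1 ^+ 2) = b - a :> R; last by [].
by rewrite expr1n (Rint_cst _ ab) mul1r.
Qed.

Lemma int_exp_le (l a s : R) : 0 < l -> a <= s ->
  Rintegral lam `[a, s] (fun r => expR (l * (r - a))) <= expR (l * (s - a)) / l.
Proof.
move=> l0; rewrite le_eqVlt => /predU1P[<-|as_].
  by rewrite set_itv1 Rintegral_set1 divr_ge0 ?expR_ge0// ltW.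
pose F (r : R) := expR (l * (r - a)) / l.
have dF r : is_derive r (1 : R) F (expR (l * (r - a))).
  have h : is_derive r (1 : R) (fun r => l * (r - a)) l.
    have h0 : is_derive r (1 : R) (l \*: (id - cst a)) (l *: (1 - 0)) by exact: _.
    by apply: is_derive_eq h0 _; rewrite subr0 /GRing.scale/= mulr1.
  have h2 : is_derive r (1:R) (fun r => expR (l * (r - a))) (l * expR (l * (r - a))).
    have h1 : is_derive r (1:R) (expR \o (fun r => l * (r - a))) (expR (l * (r - a)) * l).
      exact: is_derive1_comp.
    by apply: is_derive_eq h1 _; rewrite mulrC.
  have h3 : is_derive r (1:R) (l^-1 \*: (fun r => expR (l * (r - a)))) (l^-1 *: (l * expR (l * (r - a)))) by exact: _.
  have -> : F = l^-1 \*: (fun r => expR (l * (r - a))) by apply/funext => u; rewrite /F mulrC.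
  by apply: is_derive_eq h3 _; rewrite /GRing.scale/= mulrA mulVf ?mul1r// gt_eqF.
have cF : continuous F by move=> r; apply: differentiable_continuous; apply/derivable1_diffP; have [] := dF r.
rewrite /Rintegral (@continuous_FTC2 _ _ F a s as_).
- by rewrite -EFinB/= lerBlDr lerDl /F divr_ge0 ?expR_ge0// ltW.
- apply: continuous_subspaceT => r; apply: continuous_comp; last exact: continuous_expR.
  by apply: cvgM; [exact: cvg_cst|apply: cvgB; [exact: cvg_id|exact: cvg_cst]].
- split; last by apply: cvg_at_left_filter; exact: cF.
    by move=> r _; have [] := dF r.
  by apply: cvg_at_right_filter; exact: cF.
- by move=> r _; rewrite derive1E; have [_ ->] := dF r.
Qed.

Lemma exp_cont (l a : R) : continuous (fun r => expR (l * (r - a))).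
Proof.
move=> r; apply: continuous_comp; last exact: continuous_expR.
by apply: cvgM; [exact: cvg_cst|apply: cvgB; [exact: cvg_id|exact: cvg_cst]].
Qed.

(** Iteration in place of differentiation. Inserting a bound D exp (2 c (s - a)) into the inequality
    returns D / 2 exp (2 c (s - a)) + C, since 2 c is twice the rate. Starting from K, the k-th
    factor is 2 C + K 2^-k, and k tends to infinity. *)
Lemma gron (g : R -> R) (a b c C K : R) : 0 < c -> 0 <= C -> 0 <= K ->
  measurable_fun `[a, b] g ->
  (forall s, a <= s <= b -> 0 <= g s <= K) ->
  (forall s, a <= s <= b -> g s <= c * Rintegral lam `[a, s] g + C) ->
  forall s, a <= s <= b -> g s <= 2 * C * expR (2 * c * (s - a)).
Proof.
move=> c0 C0 K0 mg gK gc.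
have h0 k : 0 <= K * 2^-1 ^+ k by rewrite mulr_ge0// exprn_ge0// invr_ge0.
have e1 s : a <= s -> 1 <= expR (2 * c * (s - a)).
  by move=> as_; apply: le_trans (expR_ge1Dx _); rewrite lerDl !mulr_ge0 ?subr_ge0// ltW.
have it k s : a <= s <= b -> g s <= (2 * C + K * 2^-1 ^+ k) * expR (2 * c * (s - a)).
  elim: k s => [|k IH] s hs; have /andP[as_ sb] := hs.
    have /andP[_ h] := gK s hs; rewrite expr0 mulr1; apply: (le_trans h).
    by apply: (@le_trans _ _ (2 * C + K)); [rewrite lerDr mulr_ge0|rewrite ler_peMr ?e1// addr_ge0 ?mulr_ge0].
  apply: (le_trans (gc s hs)); set D := 2 * C + K * 2^-1 ^+ k in IH.
  have D0 : 0 <= D by rewrite addr_ge0 ?mulr_ge0 ?exprn_ge0 ?invr_ge0.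
  have ig : L1 lam `[a, s] g.
    have lf : (lam `[a, s] < +oo)%E by rewrite lam_itv// ltry.
    apply: (@L1_bounded _ _ _ lam `[a, s] (measurable_itv _) K g lf).
      by apply: measurable_funS mg => //; exact: itv_sub.
    move=> r; rewrite /= in_itv/= => /andP[r1 r2].
    by have /andP[? ?] := gK r (introT andP (conj r1 (le_trans r2 sb))); rewrite ger0_norm.
  have ie : L1 lam `[a, s] (fun r => expR (2 * c * (r - a))).
    by apply: (@cont_L1 _ a s) => //; apply: continuous_subspaceT; exact: exp_cont.
  have l0 : 0 < 2 * c by rewrite mulr_gt0.
  have h : Rintegral lam `[a, s] g <= D * (expR (2 * c * (s - a)) / (2 * c)).
    apply: (@le_trans _ _ (Rintegral lam `[a, s] (fun r => D * expR (2 * c * (r - a))))).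
      apply: E_le => //; first exact: L1Z.
      by move=> r; rewrite /= in_itv/= => /andP[r1 r2]; apply: IH; rewrite r1 (le_trans r2).
    by rewrite EZ// ler_wpM2l// int_exp_le.
  apply: (@le_trans _ _ (D / 2 * expR (2 * c * (s - a)) + C)).
    rewrite lerD2r; apply: le_trans (ler_wpM2l (ltW c0) h) _.
    rewrite le_eqVlt; apply/orP; left; apply/eqP; field.
    by rewrite gt_eqF.
  have : C * 1 <= C * expR (2 * c * (s - a)) by rewrite ler_wpM2l// e1.
  by rewrite /D exprS mulrCA; move: (expR _) (K * _) => e x; lra.
move=> s hs; have /andP[as_ sb] := hs.
have c1 : (fun k => (2 * C + K * 2^-1 ^+ k) * expR (2 * c * (s - a))) @ \oo -->
    (2 * C + K * 0) * expR (2 * c * (s - a)).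
  apply: cvgM; last exact: cvg_cst.
  apply: cvgD; first exact: cvg_cst.
  by apply: cvgM; [exact: cvg_cst|apply: cvg_expr; rewrite ger0_norm ?invr_ge0//; lra].
rewrite mulr0 addr0 in c1.
rewrite -(cvg_lim _ c1)//; apply: limr_ge; first by apply/cvg_ex; eexists; exact: c1.
by apply: nearW => k; exact: it.
Qed.

End Paths.

Lemma min_lip (R : realType) (c u x : R) : `|Num.min c u - Num.min c x| <= `|u - x|.
Proof.
rewrite /Order.min; case: (ltrP c u) => g1; case: (ltrP c x) => g2; rewrite ?subrr ?normr0 ?normr_ge0//.
  by rewrite ger0_norm ?subr_ge0 ?ger0_norm ?subr_ge0; lra.
by rewrite ler0_norm ?subr_le0 ?ler0_norm ?subr_le0; lra.
Qed.

Lemma max_lip (R : realType) (c u x : R) : `|Num.max c u - Num.max c x| <= `|u - x|.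
Proof.
rewrite /Order.max; case: (ltrP c u) => g1; case: (ltrP c x) => g2; rewrite ?subrr ?normr0 ?normr_ge0//.
  by rewrite ger0_norm ?subr_ge0 ?ger0_norm ?subr_ge0; lra.
by rewrite ler0_norm ?subr_le0 ?ler0_norm ?subr_le0; lra.
Qed.

(** * Joint continuity in time and space, and measurability of compositions *)

Section JointContinuity.
Context (R : realType) (n : nat).
Implicit Types (phi : R -> 'cV[R]_n -> R).

(** A scalar, coordinatewise epsilon form of continuity on [a, b] x R^n, so that continuity of paths
    can be fed in coordinate by coordinate. *)
Definition jcont (a b : R) phi := forall s (x : 'cV[R]_n), a <= s <= b -> forall e, 0 < e ->
  exists2 eta, 0 < eta & forall u (y : 'cV[R]_n), a <= u <= b -> `|u - s| < eta ->
    (forall i, `|y i 0 - x i 0| < eta) -> `|phi u y - phi s x| < e.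

Lemma jcont_sub a b r s phi : a <= r -> s <= b -> jcont a b phi -> jcont r s phi.
Proof.
move=> ar sb c u x /andP[ru us] e e0.
have [|eta eta0 H] := c u x _ e e0; first by rewrite (le_trans ar)// (le_trans us).
by exists eta => // v y /andP[rv vs]; apply: H; rewrite (le_trans ar)// (le_trans vs).
Qed.

Lemma jcont_within a b p q (F : R -> 'cV[R]_n -> 'M[R]_(p, q)) i j :
  {within [set u : R * 'cV[R]_n | a <= u.1 <= b], continuous (fun u => F u.1 u.2)} ->
  jcont a b (fun s x => F s x i j).
Proof.
move=> /subspace_continuousP c s x hs e e0.
have c2 := cvg_comp _ _ (c (s, x) hs) (@coord_continuous R p q i j (F s x)).
have /cvgrPdist_lt/(_ e e0) := c2; rewrite near_withinE.
move=> /nbhs_ballP[eta /= eta0 H]; exists eta => // u y hu us yx.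
have := H (u, y); rewrite /ball/=.
have by1 : ball s eta u by rewrite /ball/= distrC.
have by2 : ball x eta y.
  by split => // k l; rewrite (ord1 l) /ball/= distrC.
by move=> /(_ (conj by1 by2) hu) h; rewrite distrC.
Qed.

Lemma jcont_path phi a b (X : R -> 'cV[R]_n) : jcont a b phi ->
  (forall i, {within `[a, b], continuous (fun s => X s i 0)}) ->
  {within `[a, b], continuous (fun s => phi s (X s))}.
Proof.
move=> jc cX; apply/eps_within => s hs e e0.
have [eta eta0 H] := jc s (X s) hs e e0.
have ex i : exists ei : R, 0 < ei /\ forall u, a <= u <= b -> `|u - s| < ei -> `|X u i 0 - X s i 0| < eta.
  by have [ei ei0 h] := (eps_within a b _).1 (cX i) s hs eta eta0; exists ei; split.
have [f hf] := choice ex.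
exists (\big[Num.min/eta]_i f i) => [|u hu us].
  by elim/big_ind : _ => // [x y x0 y0|i _]; [rewrite lt_min x0|have [] := hf i].
apply: H => //; first by apply: lt_le_trans us _; exact: bigmin_le_id.
by move=> i; apply: (hf i).2 => //; apply: lt_le_trans us _; exact: bigmin_le_cond.
Qed.

Context d0 (Om : measurableType d0).

Let dy (k : nat) (r : R) : R := (Num.floor (r * 2 ^+ k))%:~R / 2 ^+ k.

Let dy_near k r : `|dy k r - r| <= 2^-1 ^+ k.
Proof.
have p0 : 0 < 2 ^+ k :> R by rewrite exprn_gt0.
have /andP[h1 h2] := floor_itv (r * 2 ^+ k).
rewrite distrC ger0_norm; last by rewrite subr_ge0 /dy ler_pdivrMr.
rewrite /dy exprVn -[X in X - _](mulfK (lt0r_neq0 p0)) -mulrBl ler_piMl ?invr_ge0 ?ltW//.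
by move: h2; rewrite intrD; lra.
Qed.

(** Rounding the arguments down to multiples of 2^-k leaves countably many values, hence a
    measurable function, and continuity lets k tend to infinity. The time is clamped because phi is
    controlled on [a, b] only. *)
Lemma jcont_meas phi a b (tau : Om -> R) (V : Om -> 'cV[R]_n) : a <= b -> jcont a b phi ->
  measurable_fun setT tau -> (forall i, measurable_fun setT (fun w => V w i 0)) ->
  measurable_fun setT (fun w => phi (Num.max a (Num.min b (tau w))) (V w)).
Proof.
move=> ab jc mt mV.
pose cl (r : R) := Num.max a (Num.min b r).
have cl_in r : a <= cl r <= b by rewrite le_max lexx/= ge_max ab/= ge_min lexx.
pose F k w := phi (cl (dy k (tau w))) (\col_i dy k (V w i 0)).
apply: (measurable_fun_cvg (h := F)) => [k|w _].
  move=> _ Y mY; rewrite setTI.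
  pose val (z : int * {ffun 'I_n -> int}) :=
    phi (cl (z.1%:~R / 2 ^+ k)) (\col_i ((z.2 i)%:~R / 2 ^+ k)).
  pose cell (z : int * {ffun 'I_n -> int}) := [set w | Num.floor (tau w * 2 ^+ k) = z.1 /\
    forall i, Num.floor (V w i 0 * 2 ^+ k) = z.2 i].
  rewrite (_ : F k @^-1` Y = \bigcup_(z in [set z | Y (val z)]) cell z).
    rewrite bigcup_mkcond; apply: countable_bigcupT_measurable => // z.
    case: ifP => // _.
    have mfl (f : Om -> R) (j : int) : measurable_fun setT f ->
        measurable [set w | Num.floor (f w * 2 ^+ k) = j].
      move=> mf; rewrite (_ : [set _ | _] = (fun w => f w * 2 ^+ k) @^-1` `[j%:~R, (j + 1)%:~R[).
        by rewrite -[X in measurable X]setTI; apply: measurable_funM.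
      apply/seteqP; split => w /=; rewrite in_itv/=; first by move=> <-; exact: floor_itv.
      exact: floor_def.
    rewrite (_ : cell z = [set w | Num.floor (tau w * 2 ^+ k) = z.1] `&`
       \bigcap_(i in [set: 'I_n]) [set w | Num.floor (V w i 0 * 2 ^+ k) = z.2 i]).
      apply: measurableI; first exact: mfl.
      by apply: fin_bigcap_measurable => // i _; exact: mfl.
    by apply/seteqP; split => w /= [h1 h2]; split => // i *; exact: h2.
  apply/seteqP; split => w /=.
    move=> h; exists (Num.floor (tau w * 2 ^+ k), [ffun i => Num.floor (V w i 0 * 2 ^+ k)]).
      rewrite /val/=; move: h; rewrite /F /dy; congr (Y (phi _ _)).
      by apply/colP => i; rewrite !mxE ffunE.
    by split => // i; rewrite ffunE.
  move=> [[z1 z2] hz [/= h1 h2]]; move: hz; rewrite /val/= -h1 /F /dy /=; congr (Y (phi _ _)).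
  by apply/colP => i; rewrite !mxE h2.
apply/cvgrPdist_lt => e e0; have [eta eta0 H] := jc (cl (tau w)) (V w) (cl_in _) e e0.
have c : (fun k => 2^-1 ^+ k : R) @ \oo --> (0 : R) by apply: cvg_expr; rewrite ger0_norm; lra.
have /cvgrPdist_lt/(_ eta eta0) := c; apply: filterS => k.
rewrite sub0r normrN ger0_norm ?exprn_ge0 ?invr_ge0// => hk.
rewrite distrC; apply: H => //.
  apply: le_lt_trans hk; apply: le_trans (dy_near k (tau w)).
  exact: le_trans (max_lip _ _ _) (min_lip _ _ _).
by move=> i; rewrite mxE; apply: le_lt_trans hk; exact: dy_near.
Qed.

End JointContinuity.

(** * Stochastic differential equations *)

Lemma sqrD2 (R : realType) (x y : R) : (x + y) ^+ 2 <= 2 * x ^+ 2 + 2 * y ^+ 2.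
Proof. by have := sqr_ge0 (x - y); nra. Qed.

Lemma geo0 (R : realType) (C q : R) : 0 <= q < 1 -> (fun k => C * q ^+ k) @ \oo --> (0 : R).
Proof.
move=> /andP[q0 q1]; rewrite -[X in _ --> X](mulr0 C).
by apply: cvgM; [exact: cvg_cst|apply: cvg_expr; rewrite ger0_norm].
Qed.

Section ProcessLemmas.
Context (R : realType) (d : nat) (t T : R) (B : brownian_basis d t T) (tT : t <= T).
Notation Om := (bb_Omega B).
Notation P := (bb_P B).
Notation W := (bb_W B).
Notation lam := (@lebesgue_measure R).
Notation mu := (lam \x P)%E.
Notation FDom s := (@Dom R _ (FT B s) t s).
Notation Dom := (@Dom R (bb_disp B) Om).
Notation E f := (Rintegral P setT f).
Notation Fm := (Fm (B := B)).
Notation mDom := (@measurable_Dom R (bb_disp B) Om _ _).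
Implicit Types (Z : R -> Om -> 'cV[R]_d) (I : R -> Om -> R) (V : R -> Om -> R).

Lemma chebyshev (Q : Om -> R) (l : R) : L1 P setT Q -> (forall w, 0 <= Q w) -> 0 < l ->
  exists A : set Om, [/\ measurable A, (P A <= (E Q / l)%:E)%E & forall w, l < Q w -> A w].
Proof.
move=> iQ Q0 l0; exists (Q @^-1` `]l, +oo[); have mQ := L1_meas iQ.
have mA : measurable (Q @^-1` `]l, +oo[) by rewrite -[X in measurable X]setTI; exact: mQ.
split => //; last by move=> w lw; rewrite /= in_itv/= lw.
rewrite -(setIT (Q @^-1` _)) -integral_indic// mulrC -(EZ measurableT _ iQ) -(L1_EFin measurableT (L1Z measurableT _ iQ)).
apply: ge0_le_integral => //.
- by apply/measurable_EFinP; exact: measurable_indic.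
- by apply/measurable_EFinP; exact: measurable_funM.
- move=> w _; rewrite lee_fin indicE.
  have [|_] := boolP (w \in _); last by rewrite mulr_ge0 ?invr_ge0// ltW.
  by rewrite inE/= in_itv/= andbT => lQ; rewrite mulrC ler_pdivlMr// mul1r ltW.
Qed.

Lemma cont_within_eq (f g : R -> R) : (forall s, t <= s <= T -> f s = g s) ->
  {within `[t, T], continuous f} -> {within `[t, T], continuous g}.
Proof.
move=> fg /eps_within cf; apply/eps_within => s hs e e0.
have [eta eta0 H] := cf s hs e e0; exists eta => // u hu us.
by rewrite -!fg//; exact: H.
Qed.

(** The nodes of all grids are countably many, so equality holds at all of them at once outside a
    null set; they are dense, and continuity does the rest. *)
Lemma indist V V' : {ae P, forall w, {within `[t, T], continuous (V ^~ w)}} ->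
  {ae P, forall w, {within `[t, T], continuous (V' ^~ w)}} ->
  (forall s, t <= s <= T -> {ae P, forall w, V s w = V' s w}) ->
  {ae P, forall w, forall s, t <= s <= T -> V s w = V' s w}.
Proof.
move=> cV cV' h.
have : {ae P, forall w, forall N j, V (grid t T N j) w = V' (grid t T N j) w}.
  by apply: ae_foralln => N; apply: ae_foralln => j; apply: h; exact: grid_in.
move: cV cV'; apply: filterS3 => w c1 c2 hw s hs.
apply/eqP; rewrite -subr_eq0 -normr_le0; apply/ler_addgt0Pr => e e0; rewrite add0r.
have c3 := cont_lin (c := -1) c1 c2.
have [eta eta0 H] := (eps_within t T _).1 c3 s hs e e0.
have : (T - t) / N.+1%:R @[N --> \oo] --> (T - t) * 0.
  by apply: cvgM; [exact: cvg_cst|exact: cvg_harmonic].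
rewrite mulr0 => /cvgrPdist_lt/(_ eta eta0)[N _ hN].
have := hN N (leqnn _); rewrite /= sub0r normrN ger0_norm ?mulr_ge0 ?subr_ge0// => hT.
have [j jN hj] := grid_near tT N hs.
have := H _ (grid_in tT N j) (le_lt_trans hj hT).
by rewrite hw !mulN1r subrr sub0r normrN => /ltW.
Qed.

Lemma cproc_lin c V V' : cproc V -> cproc V' -> cproc (fun s w => V s w + c * V' s w).
Proof.
move=> [cV mV] [cV' mV']; split => [w|s hs]; first exact: cont_lin.
by apply: measurable_funD; [exact: mV|apply: measurable_funM => //; exact: mV'].
Qed.

Lemma cproc_cst c : cproc (B := B) (fun _ _ => c).
Proof.
split => [w|s hs]; last exact: Fm_cst.
by apply: continuous_subspaceT => x; exact: cvg_cst.
Qed.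

Lemma eq_cproc V V' : (forall s w, V s w = V' s w) -> cproc V -> cproc V'.
Proof. by move=> h; have -> : V = V' by apply/funext => s; apply/funext => w. Qed.

(** Adaptedness is Tonelli's theorem for the Borel sets times F_s. It concerns nonnegative
    integrands, hence the writing of V as |V| - (|V| - V). *)
Lemma cproc_int V : cproc V -> cproc (fun s w => Rintegral lam `[t, s] (V ^~ w)).
Proof.
move=> cV; split => [w|s hs].
  by apply: parameterized_integral_continuous => //; exact: cont_L1 (cV.1 w).
have pV := cproc_progressive tT cV; have /andP[ts sT] := hs.
have mV : measurable_fun (FDom s) (fun p => V p.1 p.2) by exact: pV hs.
(* An auxiliary probability on (Omega, F_s): [Dom_tonelli] is invoked there for the measurability of
   the partial integral, which then holds with respect to F_s itself. *)
pose Q : probability (FT B s) R := dirac (point : FT B s).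
have iV w : L1 lam `[t, s] (V ^~ w) by exact: cont_L1 (cV.1 w).
have key (f : R -> Om -> R) : measurable_fun (FDom s) (fun p => f p.1 p.2) ->
    (forall p, 0 <= f p.1 p.2) -> (forall w, L1 lam `[t, s] (f ^~ w)) ->
    Fm s (fun w => Rintegral lam `[t, s] (f ^~ w)).
  move=> mf f0 fi.
  have [_ [_ [h _]]] := @Dom_tonelli R _ (FT B s) Q f t s mf (fun p _ => f0 p).
  have h2 : measurable_fun [set: FT B s] (fine \o (fun w : FT B s => \int[lam]_(tau in `[t, s]) (f tau w)%:E)%E).
    by apply: measurableT_comp => //; exact: measurable_fine.
  exact: h2.
have m1 := key (fun tau w => `|V tau w|) (measurableT_comp (@normr_measurable _ _) mV)
  (fun _ => normr_ge0 _) (fun w => L1_norm (iV w)).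
have m2 : Fm s (fun w => Rintegral lam `[t, s] (fun tau => `|V tau w| - V tau w)).
  apply: (key (fun tau w => `|V tau w| - V tau w)).
  - by apply: measurable_funB => //; exact: (measurableT_comp (@normr_measurable _ _) mV).
  - by move=> p; rewrite subr_ge0 ler_norm.
  - by move=> w; apply: L1B => //; exact: L1_norm.
rewrite (_ : (fun w => _) = fun w => Rintegral lam `[t, s] (fun tau => `|V tau w|) -
   Rintegral lam `[t, s] (fun tau => `|V tau w| - V tau w)); first exact: measurable_funB.
apply/funext => w; rewrite EB//; first by rewrite opprB addrC subrK.
exact: L1_norm.
Qed.

(** A bound exponential in time reproduces itself under integration with a gain 1 / l. This gain
    makes the Picard step a contraction for large l. *)
Lemma L2_unif V (C l : R) : 0 <= C -> 0 < l ->
  measurable_fun (Dom t T) (fun p : measurableTypeR R * Om => V p.1 p.2) ->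
  (forall s, t <= s <= T -> L2 P setT (V s) /\ E2 (V s) <= C * expR (l * (s - t))) ->
  L2 mu (Dom t T) (fun p : measurableTypeR R * Om => V p.1 p.2) /\
  forall s, t <= s <= T -> \int[mu]_(p in Dom t s) (V p.1 p.2 ^+ 2) <= C / l * expR (l * (s - t)).
Proof.
move=> C0 l0 mV hV.
have key s : t <= s <= T -> (\int[mu]_(p in Dom t s) (V p.1 p.2 ^+ 2)%:E <= (C / l * expR (l * (s - t)))%:E)%E.
  move=> hs; have /andP[ts sT] := hs.
  have mV2 : measurable_fun (Dom t s) (fun p => V p.1 p.2 ^+ 2).
    by apply: measurable_funX; apply: measurable_funS mV; [exact: mDom|exact: Dom_sub].
  have [_ [e [_ m]]] := @Dom_tonelli R _ _ P (fun s w => V s w ^+ 2) t s mV2 (fun p _ => sqr_ge0 _).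
  rewrite -e; have ie : L1 lam `[t, s] (fun r => C * expR (l * (r - t))).
    apply: (@cont_L1 _ _ t s) => //; apply: continuous_subspaceT => r.
    by apply: cvgM; [exact: cvg_cst|exact: exp_cont].
  apply: (@le_trans _ _ (\int[lam]_(r in `[t, s]) (C * expR (l * (r - t)))%:E)%E).
    apply: ge0_le_integral => //.
    - by move=> r _; apply: integral_ge0 => w _; rewrite lee_fin sqr_ge0.
    - by apply/measurable_EFinP; exact: L1_meas ie.
    - move=> r; rewrite /= in_itv/= => /andP[r1 r2].
      have [Lr hr] := hV r (introT andP (conj r1 (le_trans r2 sT))).
      by rewrite (L1_EFin measurableT (L2_sq Lr)) lee_fin.
  rewrite L1_EFin// lee_fin EZ//; last first.
    by apply: (@cont_L1 _ _ t s) => //; apply: continuous_subspaceT; exact: exp_cont.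
  rewrite -mulrA ler_wpM2l// mulrC; exact: int_exp_le.
have hT : t <= T <= T by rewrite tT lexx.
have LV := @L2P _ _ R mu (Dom t T) (fun p => V p.1 p.2) mV (le_lt_trans (key T hT) (ltry _)).
split => // s hs; have /andP[ts sT] := hs; rewrite -lee_fin -L1_EFin; first exact: key.
  exact: mDom.
by apply: (L1_Dom (f := fun s w => V s w ^+ 2) (lexx t) sT); exact: L2_sq LV.
Qed.

Lemma ito_E2_0 Z I s : is_ito Z I -> t <= s <= T -> L2 P setT (I s) /\ E2 (I s) = n2 t s Z.
Proof.
move=> iZ hs; have /andP[ts sT] := hs.
have [LZ FI _] := ito_approx tT iZ; split; first exact: (FI s hs).2.
rewrite -(ito_E2 tT iZ (lexx t) ts sT).
have ht : t <= t <= T by rewrite lexx.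
have mm r : t <= r <= T -> measurable_fun setT (I r) by move=> hr; exact: L2_meas (FI r hr).2.
apply: E_ae => //.
- by apply: measurable_funX; exact: mm.
- by apply: measurable_funX; apply: measurable_funB; exact: mm.
- by apply: filterS (ito_start tT iZ) => w h _; rewrite h subr0.
Qed.

Lemma ito_cproc Z I : is_ito Z I -> cproc I.
Proof. by move=> [_ pI cI _]; split => // s hs; exact: progressive_Fm. Qed.

End ProcessLemmas.

Section SDE.
Context (R : realType) (d : nat) (t T : R) (B : brownian_basis d t T) (tT : t <= T).
Context (n : nat) (beta : R -> 'cV[R]_n -> 'cV[R]_n) (sigma : R -> 'cV[R]_n -> 'M[R]_(n, d)).
Context (x0 : 'cV[R]_n) (L : R).
Notation Om := (bb_Omega B).
Notation P := (bb_P B).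
Notation lam := (@lebesgue_measure R).
Notation mu := (lam \x P)%E.
Notation Dom := (@Dom R (bb_disp B) Om).
Notation E f := (Rintegral P setT f).
Notation Fm := (Fm (B := B)).
Notation mDom := (@measurable_Dom R (bb_disp B) Om _ _).
Notation sg i X := (fun s w => (row i (sigma s (X s w)))^T).
Implicit Types (X : R -> Om -> 'cV[R]_n) (I : 'I_n -> R -> Om -> R).

Hypotheses (L0 : 0 < L)
  (jb : forall i, jcont t T (fun s x => beta s x i 0))
  (js : forall i j, jcont t T (fun s x => sigma s x i j))
  (lb : forall s x y i, t <= s <= T -> (beta s x i 0 - beta s y i 0) ^+ 2 <= L * enorm (x - y) ^+ 2)
  (ls : forall s x y i, t <= s <= T ->
     enorm ((row i (sigma s x))^T - (row i (sigma s y))^T) ^+ 2 <= L * enorm (x - y) ^+ 2)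
  (bs : forall s x i, t <= s <= T -> enorm (row i (sigma s x))^T <= L).

Definition vproc X := forall i, cproc (fun s w => X s w i 0).
Definition L2v X := forall i, L2 mu (Dom t T) (fun p => X p.1 p.2 i 0).

Lemma comp_cproc phi X : jcont t T phi -> vproc X -> cproc (fun s w => phi s (X s w)).
Proof.
move=> jc vX; split => [w|s hs].
  by apply: jcont_path => // i; exact: (vX i).1.
have mX i : measurable_fun [set: FT B s] (fun w => X s w i 0) by exact: (vX i).2.
have := @jcont_meas R n _ (FT B s) phi t T (fun=> s) (X s) tT jc (measurable_cst _) mX.
apply: eq_measurable_fun => w _; congr (phi _ _); have /andP[ts sT] := hs.
by rewrite (min_idPr sT) (max_idPr ts).
Qed.

Lemma L2v_enorm X : L2v X -> L1 mu (Dom t T) (fun p => enorm (X p.1 p.2) ^+ 2).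
Proof.
move=> LX; apply: (@eq_L1 _ _ _ _ _ mDom (fun p => \sum_i X p.1 p.2 i 0 ^+ 2)).
  by move=> p _; rewrite enormc_sq.
by apply: L1_sum => [|i _]; [exact: mDom|exact: L2_sq (LX i)].
Qed.

Lemma L2v_lin c X X' : L2v X -> L2v X' -> L2v (fun s w => X s w + c *: X' s w).
Proof.
move=> LX LX' i; have := L2D mDom (LX i) (L2Z mDom c (LX' i)).
by apply: eq_L2 => [|p _]; [exact: mDom|rewrite !mxE].
Qed.

Lemma L2vB X X' : L2v X -> L2v X' -> L2v (fun s w => X s w - X' s w).
Proof.
move=> LX /(L2v_lin (-1) LX); rewrite /L2v => h i; apply: eq_L2 (h i) => [|p _]; first exact: mDom.
by rewrite scaleN1r.
Qed.

Lemma vproc_meas X : vproc X -> forall i, measurable_fun (Dom t T) (fun p => X p.1 p.2 i 0).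
Proof. by move=> vX i; exact: (progressive_meas tT (cproc_progressive tT (vX i))). Qed.

Lemma ito_diff i X X' (I I' : R -> Om -> R) s : t <= s <= T ->
  is_ito (sg i X) I -> is_ito (sg i X') I' -> L1 mu (Dom t T) (fun p => enorm (X p.1 p.2 - X' p.1 p.2) ^+ 2) ->
  L2 P setT (fun w => I s w - I' s w) /\
  E2 (fun w => I s w - I' s w) <= L * \int[mu]_(p in Dom t s) (enorm (X p.1 p.2 - X' p.1 p.2) ^+ 2).
Proof.
move=> hs iI iI' iX; have iJ := is_ito_lin tT (-1) iI iI'; have /andP[ts sT] := hs.
have [LJ e] := ito_E2_0 tT iJ hs.
split; first by apply: eq_L2 LJ => // w _; rewrite mulN1r.
have -> : E2 (fun w => I s w - I' s w) = E2 (fun w => I s w + -1 * I' s w).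
  by apply: eq_E => w _; rewrite mulN1r.
rewrite e -(EZ mDom); last exact: (L1_Dom (f := fun s w => enorm (X s w - X' s w) ^+ 2) (lexx t) sT).
have [LZ _ _] := ito_approx tT iJ.
apply: E_le; first exact: mDom.
- exact: L2p_L1 LZ.
- by apply: L1Z; [exact: mDom|exact: (L1_Dom (f := fun s w => enorm (X s w - X' s w) ^+ 2) (lexx t) sT)].
move=> p /andP[p1 p2]; rewrite scaleN1r; apply: ls; by rewrite p1 (le_trans p2).
Qed.

Lemma drift_sq (f h : R -> R) s : t <= s <= T -> measurable_fun `[t, T] f -> L1 lam `[t, T] h ->
  (forall r, t <= r <= T -> f r ^+ 2 <= L * h r) ->
  Rintegral lam `[t, s] f ^+ 2 <= (T - t) * L * Rintegral lam `[t, s] h.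
Proof.
move=> /andP[ts sT] mf ih fh.
have mfs : measurable_fun `[t, s] f by apply: measurable_funS mf => //; exact: itv_sub.
have ihs : L1 lam `[t, s] h by apply: L1_sub ih.
have if2 : L1 lam `[t, s] (fun r => f r ^+ 2).
  apply: (@L1_le _ _ _ lam `[t, s] _ _ (fun r => L * h r)) => //.
  - exact: measurable_funX.
  - exact: L1Z.
  - move=> r; rewrite /= in_itv/= => /andP[r1 r2]; rewrite ger0_norm ?sqr_ge0// fh// r1.
    exact: le_trans sT.
have le2 : (s - t) * Rintegral lam `[t, s] (fun r => f r ^+ 2) <= (T - t) * L * Rintegral lam `[t, s] h.
  rewrite -mulrA; apply: ler_pM; rewrite ?subr_ge0//.
  - by apply: E_ge0 => *; exact: sqr_ge0.
  - by rewrite lerD2r.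
  - rewrite -(EZ _ L ihs)//; apply: E_le => //; first exact: L1Z.
    by move=> r; rewrite /= in_itv/= => /andP[r1 r2]; rewrite fh// r1 (le_trans r2).
apply: le_trans le2; exact: Rint_CS.
Qed.

Lemma vproc_enorm_L1 X X' w : vproc X -> vproc X' -> L1 lam `[t, T] (fun r => enorm (X r w - X' r w) ^+ 2).
Proof.
move=> vX vX'.
have h : L1 lam `[t, T] (fun r => \sum_i (X r w i 0 + -1 * X' r w i 0) ^+ 2).
  apply: L1_sum => // i _; apply: (@cont_L1 _ _ t T) => //.
  have c := cont_lin (c := -1) ((vX i).1 w) ((vX' i).1 w).
  move: c => /subspace_continuousP c; apply/subspace_continuousP => x hx.
  exact: (cvgM (c x hx) (c x hx)).
apply: eq_L1 h => // r _.
by rewrite enormc_sq; apply: eq_bigr => i _; rewrite !mxE mulN1r.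
Qed.

(** The Ito integrals are passed as data, since they are specified by the relation [is_ito] and not
    computed from X. *)
Definition picard (I : 'I_n -> R -> Om -> R) X : R -> Om -> 'cV[R]_n := fun s w =>
  \col_i (x0 i 0 + Rintegral lam `[t, s] (fun r => beta r (X r w) i 0) + I i s w).

Lemma picard_vproc I X : vproc X -> (forall i, is_ito (sg i X) (I i)) -> vproc (picard I X).
Proof.
move=> vX iI i; have c1 := cproc_int tT (comp_cproc (jb i) vX).
have c2 := ito_cproc (iI i); have := cproc_lin 1 (cproc_lin 1 (cproc_cst B (x0 i 0)) c1) c2.
by apply: eq_cproc => s w; rewrite /picard mxE !mul1r.
Qed.

(** The two factors 2 come from squaring drift plus integral; the drift carries T - t from
    Cauchy-Schwarz in time, the integral carries L from the isometry. *)
Let K := 2 * ((T - t) * L) + 2 * L.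

Lemma picard_diff I I' X X' s i : vproc X -> vproc X' -> L2v (fun s w => X s w - X' s w) ->
  (forall i, is_ito (sg i X) (I i)) -> (forall i, is_ito (sg i X') (I' i)) -> t <= s <= T ->
  L2 P setT (fun w => picard I X s w i 0 - picard I' X' s w i 0) /\
  E2 (fun w => picard I X s w i 0 - picard I' X' s w i 0) <=
    K * \int[mu]_(p in Dom t s) (enorm (X p.1 p.2 - X' p.1 p.2) ^+ 2).
Proof.
move=> vX vX' LX iI iI' hs; have /andP[ts sT] := hs.
have iX := L2v_enorm LX.
have [LJ EJ] := ito_diff hs (iI i) (iI' i) iX.
have cb := comp_cproc (jb i) vX; have cb' := comp_cproc (jb i) vX'.
pose D w := Rintegral lam `[t, s] (fun r => beta r (X r w) i 0 - beta r (X' r w) i 0).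
have eD w : picard I X s w i 0 - picard I' X' s w i 0 = D w + (I i s w - I' i s w).
  rewrite /picard !mxE /D EB//; [ring|exact: cont_L1 (lexx t) sT (cb.1 w)|exact: cont_L1 (lexx t) sT (cb'.1 w)].
have iQ := L1_Dom (f := fun s w => enorm (X s w - X' s w) ^+ 2) (lexx t) sT iX.
have [iQ' [eQ _]] := Dom_fubini (f := fun r w => enorm (X r w - X' r w) ^+ 2) iQ.
have DQ w : D w ^+ 2 <= (T - t) * L * Rintegral lam `[t, s] (fun r => enorm (X r w - X' r w) ^+ 2).
  apply: (@drift_sq (fun r => beta r (X r w) i 0 - beta r (X' r w) i 0)
    (fun r => enorm (X r w - X' r w) ^+ 2) s hs).
  - apply: measurable_funB; [exact: L1_meas (cont_L1 (lexx t) (lexx T) (cb.1 w))|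
      exact: L1_meas (cont_L1 (lexx t) (lexx T) (cb'.1 w))].
  - exact: vproc_enorm_L1.
  - by move=> r hr; exact: lb.
have mY : measurable_fun setT (fun w => picard I X s w i 0 - picard I' X' s w i 0).
  apply: measurable_funB; [exact: Fm_meas ((picard_vproc vX iI i).2 s hs)|
    exact: Fm_meas ((picard_vproc vX' iI' i).2 s hs)].
have iQ2 := L1Z measurableT ((T - t) * L) iQ'.
have L2Y : L2 P setT (fun w => picard I X s w i 0 - picard I' X' s w i 0).
  split => //; apply: (L1_le measurableT _ (L1D measurableT (L1Z measurableT 2 iQ2) (L1Z measurableT 2 (L2_sq LJ)))).
    exact: measurable_funX.
  move=> w _; rewrite ger0_norm ?sqr_ge0// eD; apply: le_trans (sqrD2 _ _) _.
  by rewrite lerD2r ler_wpM2l// DQ.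
split => //.
apply: le_trans (E_le_lin2 measurableT (a := 2) (b := 2) (L2_sq L2Y) iQ2 (L2_sq LJ) _) _.
  move=> w _; rewrite eD; apply: le_trans (sqrD2 _ _) _.
  by rewrite lerD2r ler_wpM2l// DQ.
apply: (@le_trans _ _ (2 * ((T - t) * L * \int[mu]_(p in Dom t s) (enorm (X p.1 p.2 - X' p.1 p.2) ^+ 2)) +
  2 * (L * \int[mu]_(p in Dom t s) (enorm (X p.1 p.2 - X' p.1 p.2) ^+ 2)))).
  by apply: lerD; rewrite ler_wpM2l// (EZ measurableT _ iQ') eQ.
by rewrite le_eqVlt; apply/orP; left; apply/eqP; rewrite /K; ring.
Qed.

Lemma row_itoable i X : vproc X -> exists J : R -> Om -> R, is_ito (sg i X) J.
Proof.
move=> vX; apply: (@ito_exists _ _ _ _ B tT _ L).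
  move=> a; have := comp_cproc (js i a) vX.
  by apply: eq_cproc => s w; rewrite !mxE.
by move=> s w hs; exact: bs.
Qed.

Lemma picard_step X : vproc X -> exists I, forall i, is_ito (sg i X) (I i).
Proof. by move=> vX; have [J hJ] := choice (fun i => row_itoable i vX); exists J. Qed.

Lemma enorm_int (X : R -> Om -> 'cV[R]_n) s : t <= s <= T -> L2v X ->
  \int[mu]_(p in Dom t s) (enorm (X p.1 p.2) ^+ 2) = \sum_i \int[mu]_(p in Dom t s) (X p.1 p.2 i 0 ^+ 2).
Proof.
move=> /andP[ts sT] LX; rewrite -E_sum; first by apply: eq_E => p _; rewrite enormc_sq.
  exact: mDom.
by move=> i _; apply: (L1_Dom (f := fun s w => X s w i 0 ^+ 2) (lexx t) sT); exact: L2_sq (LX i).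
Qed.

Lemma enorm_int_le X C l : 0 <= C -> 0 < l ->
  (forall i, measurable_fun (Dom t T) (fun p => X p.1 p.2 i 0)) ->
  (forall s i, t <= s <= T -> L2 P setT (fun w => X s w i 0) /\ E2 (fun w => X s w i 0) <= C * expR (l * (s - t))) ->
  L2v X /\ forall s, t <= s <= T ->
    \int[mu]_(p in Dom t s) (enorm (X p.1 p.2) ^+ 2) <= n%:R * (C / l) * expR (l * (s - t)).
Proof.
move=> C0 l0 mX hX.
have h i := @L2_unif _ _ _ _ B tT (fun s w => X s w i 0) C l C0 l0 (mX i) (fun s hs => hX s i hs).
have LX : L2v X by move=> i; have [] := h i.
split => // s hs; rewrite enorm_int//.
apply: (@le_trans _ _ (\sum_(i < n) C / l * expR (l * (s - t)))).
  by apply: ler_sum => i _; have [_ ] := h i; exact.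
rewrite (_ : \sum_(i < n) _ = n%:R * (C / l) * expR (l * (s - t)))//.
by rewrite sumr_const card_ord -[RHS]mulrA mulr_natl.
Qed.

Lemma coordB X X' s i : (fun w => (X s w - X' s w) i 0) = (fun w => X s w i 0 - X' s w i 0).
Proof. by apply/funext => w; rewrite !mxE. Qed.

Lemma vproc_measB X X' : vproc X -> vproc X' -> forall i,
  measurable_fun (Dom t T) (fun p => (X p.1 p.2 - X' p.1 p.2) i 0).
Proof.
move=> vX vX' i; under eq_fun do rewrite !mxE.
by apply: measurable_funB; exact: vproc_meas.
Qed.

Lemma Dom_mono (f : R -> Om -> R) s : t <= s <= T -> L1 mu (Dom t T) (fun p => f p.1 p.2) ->
  (forall p, 0 <= f p.1 p.2) ->
  \int[mu]_(p in Dom t s) f p.1 p.2 <= \int[mu]_(p in Dom t T) f p.1 p.2.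
Proof.
move=> /andP[ts sT] fi f0; rewrite (Dom_split ts sT fi).
rewrite lerDl; exact: E_ge0.
Qed.

(** * Existence by Picard iteration *)

Section PicardLimit.
Variables (II : (R -> Om -> 'cV[R]_n) -> 'I_n -> R -> Om -> R)
  (hII : forall X, vproc X -> forall i, is_ito (sg i X) (II X i)).
Let nxt X := picard (II X) X.
Let XX k := iter k nxt (fun _ _ => x0).

Let vXX k : vproc (XX k).
Proof.
elim: k => [|k IH]; first by move=> i; exact: cproc_cst.
by apply: picard_vproc => //; exact: hII.
Qed.

Let iXX k := hII (vXX k).

Let XXS k s w i : XX k.+1 s w i 0 = x0 i 0 +
  Rintegral lam `[t, s] (fun r => beta r (XX k r w) i 0) + II (XX k) i s w.
Proof. by rewrite /XX/= /nxt /picard mxE. Qed.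

Let hb i : {within `[t, T], continuous (fun s => beta s x0 i 0)}.
Proof.
apply: (@jcont_path _ _ (fun s x => beta s x i 0) t T (fun=> x0) (jb i)) => j.
by apply: continuous_subspaceT => x; exact: cvg_cst.
Qed.

Let ex_base : exists C0, 0 <= C0 /\ forall s i, t <= s <= T ->
    L2 P setT (fun w => XX 1%N s w i 0 - XX 0%N s w i 0) /\ E2 (fun w => XX 1%N s w i 0 - XX 0%N s w i 0) <= C0.
Proof.
have [f hf] := choice (fun i => cont_bounded (@hb i)).
pose S := \sum_i `|f i| * (T - t).
have S0 i : `|f i| * (T - t) <= S.
  rewrite /S (bigD1 i)//= lerDl sumr_ge0// => j _; rewrite mulr_ge0// subr_ge0//.
pose N := \sum_i n2 t T (sg i (XX 0%N)).
have N0 i : n2 t T (sg i (XX 0%N)) <= N.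
  rewrite /N (bigD1 i)//= lerDl sumr_ge0// => j _; apply: n2_ge0.
exists (2 * S ^+ 2 + 2 * N); split.
  have Nge : 0 <= N by apply: sumr_ge0 => j _; exact: n2_ge0.
  by rewrite addr_ge0// mulr_ge0// sqr_ge0.
move=> s i hs; have /andP[ts sT] := hs.
have iI := iXX 0%N i; have [LI eI] := ito_E2_0 tT iI hs.
have [LZ _ _] := ito_approx tT iI.
have nI : E2 (II (XX 0%N) i s) <= N.
  by rewrite eI; apply: le_trans (N0 i); exact: (n2_mono (lexx t) sT LZ).
have eD w : XX 1%N s w i 0 - XX 0%N s w i 0 =
    Rintegral lam `[t, s] (fun r => beta r x0 i 0) + II (XX 0%N) i s w.
  by rewrite /XX/= /nxt /picard mxE; ring.
set c := Rintegral lam _ _ in eD.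
have c2 : c ^+ 2 <= S ^+ 2.
  rewrite -[c ^+ 2](real_normK (num_real c)) lerXn2r ?nnegrE//.
    by apply: le_trans (S0 i); rewrite mulr_ge0// subr_ge0.
  apply: le_trans (S0 i); apply: (@le_trans _ _ (f i * (s - t))).
    apply: Rint_norm_le => //; first by apply: (@cont_L1 _ _ t T).
    by move=> r /andP[r1 r2]; apply: hf; rewrite r1 (le_trans r2).
  apply: ler_pM; rewrite ?subr_ge0 ?lerD2r ?ler_norm//.
  by apply: le_trans (hf i s hs).
have Lc : L2 P setT (fun=> c) by apply: (@L2_bounded _ _ _ P setT measurableT `|c|); rewrite ?PT_lty.
have LY : L2 P setT (fun w => XX 1%N s w i 0 - XX 0%N s w i 0).
  by apply: eq_L2 (L2D measurableT Lc LI) => // w _; rewrite eD.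
split => //.
apply: le_trans (E_le_lin2 measurableT (a := 2) (b := 2) (L2_sq LY) (L2_sq Lc) (L2_sq LI) _) _.
  by move=> w _; rewrite eD; exact: sqrD2.
rewrite (_ : E (fun=> c ^+ 2) = c ^+ 2); last first.
  by rewrite Rintegral_cst//= probability_setT mulr1.
by apply: lerD; rewrite ler_wpM2l.
Qed.

Let C0 := sval (cid ex_base).
Let C00 : 0 <= C0. Proof. by have [] := svalP (cid ex_base). Qed.
Let base := (svalP (cid ex_base)).2.

Let K0 : 0 <= K.
Proof. by rewrite /K addr_ge0 ?mulr_ge0 ?subr_ge0// ltW. Qed.
(** Since 8 K n <= l, one Picard step divides the mean square, measured against exp (l (s - t)), by
    8. The 1 keeps l positive. *)
Let l := 8 * (K * n%:R) + 1.
Let l0 : 0 < l.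
Proof. have h : 0 <= K * n%:R by rewrite mulr_ge0.
by rewrite /l; lra. Qed.
Let h80 k : 0 <= 8^-1 ^+ k :> R. Proof. by rewrite exprn_ge0// invr_ge0. Qed.

Let inv k : forall s i, t <= s <= T -> L2 P setT (fun w => XX k.+1 s w i 0 - XX k s w i 0) /\
    E2 (fun w => XX k.+1 s w i 0 - XX k s w i 0) <= (C0 * 8^-1 ^+ k) * expR (l * (s - t)).
Proof.
elim: k => [|k IH] s i hs.
  have [h1 h2] := @base s i hs; split => //; apply: (le_trans h2); rewrite expr0 mulr1.
  rewrite ler_peMr//; apply: le_trans (expR_ge1Dx _).
  by have /andP[ts _] := hs; rewrite lerDl mulr_ge0 ?subr_ge0// ltW.
have hh s' i' : t <= s' <= T -> L2 P setT (fun w => (XX k.+1 s' w - XX k s' w) i' 0) /\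
    E2 (fun w => (XX k.+1 s' w - XX k s' w) i' 0) <= (C0 * 8^-1 ^+ k) * expR (l * (s' - t)).
  by rewrite coordB; exact: IH.
have [LD hD] := @enorm_int_le (fun s w => XX k.+1 s w - XX k s w) (C0 * 8^-1 ^+ k) l
  (mulr_ge0 C00 (h80 k)) l0 (vproc_measB (vXX k.+1) (vXX k)) hh.
have [LY EY] := picard_diff i (vXX k.+1) (vXX k) LD (iXX k.+1) (iXX k) hs.
split => //; apply: (le_trans EY); apply: le_trans (ler_wpM2l K0 (hD s hs)) _.
rewrite (mulrA K); apply: ler_wpM2r; first exact: expR_ge0.
have e8 : C0 * (8^-1 * 8^-1 ^+ k) = 8^-1 * (C0 * 8^-1 ^+ k) by ring.
rewrite exprS e8; have := mulr_ge0 C00 (h80 k); move: (C0 * 8^-1 ^+ k) => c c0.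
rewrite (_ : K * (n%:R * (c / l)) = K * n%:R * c / l); last by ring.
rewrite ler_pdivrMr// /l; have : 0 <= K * n%:R by rewrite mulr_ge0.
by move: (K * n%:R) => a a0; lra.
Qed.

Let M := n%:R * (C0 / l) * expR (l * (T - t)).
Let M0 : 0 <= M.
Proof.
apply: mulr_ge0; last exact: expR_ge0.
by apply: mulr_ge0 => //; apply: divr_ge0 => //; exact: ltW.
Qed.
Let hT : t <= T <= T. Proof. by rewrite tT lexx. Qed.

Let invD k : L2v (fun s w => XX k.+1 s w - XX k s w) /\
    \int[mu]_(p in Dom t T) (enorm (XX k.+1 p.1 p.2 - XX k p.1 p.2) ^+ 2) <= M * 8^-1 ^+ k.
Proof.
have hh s' i' : t <= s' <= T -> L2 P setT (fun w => (XX k.+1 s' w - XX k s' w) i' 0) /\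
    E2 (fun w => (XX k.+1 s' w - XX k s' w) i' 0) <= (C0 * 8^-1 ^+ k) * expR (l * (s' - t)).
  by rewrite coordB; exact: inv.
have [LD hD] := @enorm_int_le (fun s w => XX k.+1 s w - XX k s w) (C0 * 8^-1 ^+ k) l
  (mulr_ge0 C00 (h80 k)) l0 (vproc_measB (vXX k.+1) (vXX k)) hh.
split => //; apply: (le_trans (hD T hT)); rewrite le_eqVlt; apply/orP; left; apply/eqP.
by rewrite /M; ring.
Qed.

Let half0 k : 0 < 2^-1 ^+ k :> R.
Proof. by rewrite exprn_gt0 ?invr_gt0. Qed.

Let pow k : 8^-1 ^+ k / (2^-1 ^+ k.+1) ^+ 2 = 4 * 2^-1 ^+ k :> R.
Proof.
have -> : 8^-1 = 2^-1 * 2^-1 ^+ 2 :> R by field.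
rewrite exprMn [2^-1 ^+ k.+1]exprS -exprM mulnC exprM.
by move: (half0 k); move: (2^-1 ^+ k) => x x0'; field; rewrite gt_eqF.
Qed.

(** The drift part and the integral part of an increment are each allowed 2^-(k+1); dividing the
    mean squares of order 8^-k by the square of this threshold leaves 4 (2^-k), as computed in
    [pow]. *)
Let C1 := ((T - t) * L + L) * M * 4.

(** Chebyshev for the drift part and Doob for the martingale part. The two exceptional sets together
    have the geometric probabilities that [climit] requires. *)
Let exA i k : exists A : set Om, [/\ measurable A, (P A <= (C1 * 2^-1 ^+ k)%:E)%E &
    forall w s, ~ A w -> t <= s <= T -> `|XX k.+2 s w i 0 - XX k.+1 s w i 0| <= 2^-1 ^+ k].
Proof.
have [LD hD] := invD k; have iD := L2v_enorm LD.
pose Q w := (T - t) * L * Rintegral lam `[t, T] (fun r => enorm (XX k.+1 r w - XX k r w) ^+ 2).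
have [iQ' [eQ _]] := Dom_fubini (f := fun r w => enorm (XX k.+1 r w - XX k r w) ^+ 2) iD.
have iQ : L1 P setT Q by exact: L1Z.
have Q0 w : 0 <= Q w.
  rewrite /Q mulr_ge0 ?mulr_ge0 ?subr_ge0 ?(ltW L0)//.
  by apply: E_ge0 => *; exact: sqr_ge0.
have e0 : 0 < (2^-1 ^+ k.+1) ^+ 2 :> R by rewrite exprn_gt0.
have [A1 [mA1 PA1 hA1]] := chebyshev iQ Q0 e0.
have iJ := is_ito_lin tT (-1) (iXX k.+1 i) (iXX k i).
have [A2 [mA2 PA2 hA2]] := doob tT (ito_martingale tT iJ) (ito_cproc iJ).1 (half0 k.+1).
exists (A1 `|` A2); split; first exact: measurableU.
  apply: le_trans (measureU2 _ mA1 mA2) _ => //; apply: le_trans (leeD PA1 PA2) _.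
  rewrite -EFinD lee_fin -mulrDl.
  have eQ2 : E Q <= (T - t) * L * (M * 8^-1 ^+ k).
    by rewrite /Q (EZ measurableT _ iQ') eQ ler_wpM2l// mulr_ge0 ?subr_ge0// ltW.
  have [_ eJ] := ito_diff hT (iXX k.+1 i) (iXX k i) iD.
  have eJ2 : E2 (fun w => II (XX k.+1) i T w + -1 * II (XX k) i T w) <= L * (M * 8^-1 ^+ k).
    apply: le_trans (ler_wpM2l (ltW L0) hD); apply: le_trans eJ.
    by rewrite le_eqVlt; apply/orP; left; apply/eqP; apply: eq_E => w _; rewrite mulN1r.
  apply: (@le_trans _ _ (((T - t) * L * (M * 8^-1 ^+ k) + L * (M * 8^-1 ^+ k)) / (2^-1 ^+ k.+1) ^+ 2)).
    by rewrite ler_pM2r ?invr_gt0// lerD.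
  rewrite le_eqVlt; apply/orP; left; apply/eqP.
  transitivity (((T - t) * L + L) * M * (8^-1 ^+ k / (2^-1 ^+ k.+1) ^+ 2)); first by ring.
  by rewrite pow /C1; ring.
move=> w s nA hs; have /andP[ts sT] := hs.
have hJ : `|II (XX k.+1) i s w + -1 * II (XX k) i s w| <= 2^-1 ^+ k.+1.
  by rewrite leNgt; apply/negP => h; apply: nA; right; exact: hA2 hs h.
have hQ : Q w <= (2^-1 ^+ k.+1) ^+ 2.
  by rewrite leNgt; apply/negP => h; apply: nA; left; exact: hA1.
have cb := comp_cproc (jb i) (vXX k.+1); have cb' := comp_cproc (jb i) (vXX k).
pose D := Rintegral lam `[t, s] (fun r => beta r (XX k.+1 r w) i 0 - beta r (XX k r w) i 0).
have eD : XX k.+2 s w i 0 - XX k.+1 s w i 0 = D + (II (XX k.+1) i s w + -1 * II (XX k) i s w).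
  rewrite (XXS k.+1) (XXS k) /D EB//.
  - by ring.
  - exact: cont_L1 (lexx t) sT (cb.1 w).
  - exact: cont_L1 (lexx t) sT (cb'.1 w).
have iE := vproc_enorm_L1 w (vXX k.+1) (vXX k).
have hD2 : D ^+ 2 <= (2^-1 ^+ k.+1) ^+ 2.
  apply: le_trans hQ.
  apply: le_trans (@drift_sq (fun r => beta r (XX k.+1 r w) i 0 - beta r (XX k r w) i 0)
    (fun r => enorm (XX k.+1 r w - XX k r w) ^+ 2) s hs _ iE _) _.
  - apply: measurable_funB; [exact: L1_meas (cont_L1 (lexx t) (lexx T) (cb.1 w))|
      exact: L1_meas (cont_L1 (lexx t) (lexx T) (cb'.1 w))].
  - by move=> r hr; exact: lb.
  - rewrite /Q ler_wpM2l ?mulr_ge0 ?subr_ge0 ?(ltW L0)// (Rint_chasles ts sT iE) lerDl.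
    by apply: E_ge0 => *; exact: sqr_ge0.
have hDn : `|D| <= 2^-1 ^+ k.+1.
  by rewrite -(@ler_pXn2r _ 2)// ?nnegrE ?(ltW (half0 _))// real_normK ?num_real.
rewrite eD; apply: le_trans (ler_normD _ _) _; apply: le_trans (lerD hDn hJ) _.
by rewrite exprS -mulrDl; apply: ler_piMl; [exact: ltW|lra].
Qed.

Let exV i : exists V', cproc V' /\ {ae P, forall w, forall e, 0 < e -> exists N, forall k s,
     (N <= k)%N -> t <= s <= T -> `|XX k.+1 s w i 0 - V' s w| <= e}.
Proof.
have [A hA] := choice (exA i).
exact: (@climit _ _ _ _ _ (fun k s w => XX k.+1 s w i 0) A C1 (fun k => vXX k.+1 i)
(fun k => let: And3 h _ _ := hA k in h) (fun k => let: And3 _ h _ := hA k in h)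
(fun k w s => let: And3 _ _ h := hA k in h w s)).
Qed.

Let V i := sval (cid (exV i)).
Let hV i := svalP (cid (exV i)).
Let X s w : 'cV[R]_n := \col_i V i s w.

Let vX : vproc X.
Proof. by move=> i; apply: eq_cproc (hV i).1 => s w; rewrite mxE. Qed.

Let C := C0 * expR (l * (T - t)).
Let C00' : 0 <= C. Proof. by rewrite mulr_ge0// expR_ge0. Qed.

Let stepC k s i : t <= s <= T -> L2 P setT (fun w => XX k.+1 s w i 0 - XX k s w i 0) /\
    E2 (fun w => XX k.+1 s w i 0 - XX k s w i 0) <= C * 8^-1 ^+ k.
Proof.
move=> hs; have [h1 h2] := @inv k s i hs; split => //; apply: (le_trans h2).
rewrite /C mulrAC ler_wpM2r// ler_wpM2l// ler_expR ler_wpM2l ?(ltW l0)// lerD2r.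
by have /andP[] := hs.
Qed.

Let tail j : forall k s i, t <= s <= T -> L2 P setT (fun w => XX (k + j)%N s w i 0 - XX k s w i 0) /\
    E2 (fun w => XX (k + j)%N s w i 0 - XX k s w i 0) <= 3 * C * 8^-1 ^+ k.
Proof.
elim: j => [|j IH] k s i hs.
  have z : (fun w => XX (k + 0)%N s w i 0 - XX k s w i 0) = (fun=> 0).
    by apply/funext => w; rewrite addn0 subrr.
  rewrite z; split; first exact: L20.
  rewrite (_ : E2 _ = 0) ?mulr_ge0//.
  by rewrite -[RHS](E0 P setT); apply: eq_E => w _; rewrite expr0n.
have [h1 h2] := IH k.+1 s i hs; have [h3 h4] := @stepC k s i hs.
have eS w : XX (k + j.+1)%N s w i 0 - XX k s w i 0 =
  (XX (k.+1 + j)%N s w i 0 - XX k.+1 s w i 0) + (XX k.+1 s w i 0 - XX k s w i 0).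
  by rewrite addSnnS; ring.
have LY : L2 P setT (fun w => XX (k + j.+1)%N s w i 0 - XX k s w i 0).
  by apply: eq_L2 (L2D measurableT h1 h3) => // w _; rewrite eS.
split => //.
apply: le_trans (E_le_lin2 measurableT (a := 2) (b := 2) (L2_sq LY) (L2_sq h1) (L2_sq h3) _) _.
  by move=> w _; rewrite eS; exact: sqrD2.
move: h2 h4; rewrite exprS /E2; have := mulr_ge0 C00' (h80 k).
by move: (E _) (E _) (8^-1 ^+ k) C => u v x c; lra.
Qed.

Let near k s i : t <= s <= T -> L2 P setT (fun w => XX k.+1 s w i 0 - X s w i 0) /\
    E2 (fun w => XX k.+1 s w i 0 - X s w i 0) <= 3 * C * 8^-1 ^+ k.
Proof.
move=> hs; have mXs : measurable_fun setT (fun w => X s w i 0) by exact: Fm_meas ((vX i).2 s hs).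
have mXX j : measurable_fun setT (fun w => XX j s w i 0) by exact: Fm_meas ((vXX j i).2 s hs).
apply: (@L2_fatou _ _ _ P setT measurableT (fun j w => XX k.+1 s w i 0 - XX (k.+1 + j)%N s w i 0)).
- move=> j; apply: eq_L2 (L2N measurableT (@tail j k.+1 s i hs).1) => // w _.
  by rewrite opprB.
- move=> j; have [_ h] := @tail j k.+1 s i hs.
  apply: le_trans (_ : _ <= 3 * C * 8^-1 ^+ k.+1) _; last first.
    rewrite ler_wpM2l ?mulr_ge0// exprS ler_piMl//; lra.
  apply: le_trans h; rewrite le_eqVlt; apply/orP; left; apply/eqP; apply: eq_E => w _.
  by rewrite -sqrrN opprB.
- exact: measurable_funB.
- apply: filterS (hV i).2 => w h _; apply: cvgB; first exact: cvg_cst.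
  rewrite mxE; apply/cvgrPdist_le => e e0; have [N hN] := h e e0.
  by exists N => // j /= Nj; rewrite distrC; apply: (hN (k + j)%N s _ hs); rewrite (leq_trans Nj)// leq_addl.
Qed.

Let LXX k : (forall s i, t <= s <= T -> L2 P setT (fun w => XX k s w i 0)) /\ L2v (XX k).
Proof.
elim: k => [|k [IH1 IH2]].
  by split=> [s i hs|i]; [apply: (@L2_bounded _ _ _ P setT measurableT `|x0 i 0|); rewrite ?PT_lty|
    apply: (@L2_bounded _ _ _ _ _ mDom `|x0 i 0|) => //; exact: mu_Dom].
split=> [s i hs|].
  apply: eq_L2 (L2D measurableT (IH1 s i hs) (@stepC k s i hs).1) => // w _; ring.
move=> i; apply: eq_L2 (L2v_lin 1 IH2 (invD k).1 i) => [|p _]; first exact: mDom.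
by rewrite !mxE; ring.
Qed.

Let nearD k : L2v (fun s w => XX k.+1 s w - X s w) /\
    \int[mu]_(p in Dom t T) (enorm (XX k.+1 p.1 p.2 - X p.1 p.2) ^+ 2) <= (n%:R * (3 * C) * expR (T - t)) * 8^-1 ^+ k.
Proof.
(* A bound uniform in time is weakened to an exponential one of rate 1, the form in which
   [enorm_int_le] integrates it. *)
have hh s' i' : t <= s' <= T -> L2 P setT (fun w => (XX k.+1 s' w - X s' w) i' 0) /\
    E2 (fun w => (XX k.+1 s' w - X s' w) i' 0) <= (3 * C * 8^-1 ^+ k) * expR (1 * (s' - t)).
  rewrite coordB => hs; have [h1 h2] := @near k s' i' hs; split => //; apply: (le_trans h2).
  rewrite ler_peMr ?mulr_ge0//; apply: le_trans (expR_ge1Dx _).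
  by rewrite mul1r lerDl subr_ge0; have /andP[] := hs.
have c3 : 0 <= 3 * C * 8^-1 ^+ k by rewrite !mulr_ge0.
have [LD hD] := @enorm_int_le (fun s w => XX k.+1 s w - X s w) (3 * C * 8^-1 ^+ k) 1
  c3 ltr01 (vproc_measB (vXX k.+1) vX) hh.
split => //; apply: (le_trans (hD T hT)); rewrite le_eqVlt; apply/orP; left; apply/eqP.
by rewrite mul1r divr1; ring.
Qed.

(** The limit and its own Picard image are both close to the iterate k + 2, so their mean square
    distance is at most a constant times 8^-k for every k. Equality at each time is then upgraded to
    whole paths by continuity. *)
Lemma picard_limit : exists X I, [/\ vproc X, L2v X,
  forall i, is_ito (sg i X) (I i),
  forall s i, t <= s <= T -> L2 P setT (fun w => X s w i 0) &
  {ae P, forall w, forall s i, t <= s <= T -> X s w i 0 = picard I X s w i 0}].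
Proof.
have LX s i : t <= s <= T -> L2 P setT (fun w => X s w i 0).
  move=> hs; apply: eq_L2 (L2B measurableT ((LXX 1%N).1 s i hs) (@near 0%N s i hs).1) => // w _; ring.
have LvX : L2v X.
  move=> i; apply: eq_L2 (L2vB (LXX 1%N).2 (nearD 0%N).1 i) => [|p _]; first exact: mDom.
  by rewrite !mxE; ring.
have [I hI] := picard_step vX.
exists X, I; split => //.
have vP := picard_vproc vX hI.
have same s i : t <= s <= T -> {ae P, forall w, X s w i 0 = picard I X s w i 0}.
  move=> hs; have /andP[ts sT] := hs.
  have hk k := picard_diff i vX (vXX k.+1) (L2vB LvX (LXX k.+1).2) hI (iXX k.+1) hs.
  have LD : L2 P setT (fun w => X s w i 0 - picard I X s w i 0).
    apply: eq_L2 (L2N measurableT (L2D measurableT (hk 0%N).1 (@near 1%N s i hs).1)) => // w _; rewrite -[picard (II (XX 1%N)) _]/(XX 2); ring.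
  suff e0 : E2 (fun w => X s w i 0 - picard I X s w i 0) = 0.
    by apply: filterS (ae_E2_0 LD e0) => w /eqP; rewrite subr_eq0 => /eqP.
  apply/eqP; rewrite eq_le; apply/andP; split; last by apply: E_ge0 => *; exact: sqr_ge0.
  pose N := n%:R * (3 * C) * expR (T - t).
  have N0 : 0 <= N by rewrite /N !mulr_ge0 ?expR_ge0.
  have bound k : E2 (fun w => X s w i 0 - picard I X s w i 0) <= (2 * (K * N) + 2 * (3 * C)) * 8^-1 ^+ k.
    apply: le_trans (E_le_lin2 measurableT (a := 2) (b := 2) (L2_sq LD) (L2_sq (hk k).1) (L2_sq (@near k.+1 s i hs).1) _) _.
      move=> w _; rewrite -[picard (II (XX k.+1)) _]/(XX k.+2).
      have := sqrD2 (picard I X s w i 0 - XX k.+2 s w i 0) (XX k.+2 s w i 0 - X s w i 0).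
      apply: le_trans; rewrite le_eqVlt; apply/orP; left; apply/eqP; ring.
    have -> : (2 * (K * N) + 2 * (3 * C)) * 8^-1 ^+ k = 2 * (K * (N * 8^-1 ^+ k)) + 2 * (3 * C * 8^-1 ^+ k) by ring.
    apply: lerD; rewrite ler_wpM2l//.
      apply: (le_trans (hk k).2); rewrite ler_wpM2l//.
      have [LD2 hD2] := nearD k; have iE := L2v_enorm LD2.
      have eq1 : \int[mu]_(p in Dom t s) (enorm (X p.1 p.2 - XX k.+1 p.1 p.2) ^+ 2) =
         \int[mu]_(p in Dom t s) (enorm (XX k.+1 p.1 p.2 - X p.1 p.2) ^+ 2).
        apply: eq_E => p _; rewrite !enormc_sq; apply: eq_bigr => a _.
        by rewrite !mxE -sqrrN opprB.
      rewrite eq1; apply: le_trans hD2.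
      apply: (@Dom_mono (fun r w => enorm (XX k.+1 r w - X r w) ^+ 2) s hs iE) => p; exact: sqr_ge0.
    have [_ h] := @near k.+1 s i hs; apply: (le_trans h).
    by rewrite ler_wpM2l ?mulr_ge0// exprS ler_piMl//; lra.
  have c := geo0 (2 * (K * N) + 2 * (3 * C)) (q := 8^-1 : R).
  have {}c := c ltac:(apply/andP; split; lra).
  rewrite -(cvg_lim _ c)//; apply: limr_ge; first by apply/cvg_ex; eexists; exact: c.
  by apply: nearW => k; exact: bound.
have aei i : {ae P, forall w, forall s, t <= s <= T -> X s w i 0 = picard I X s w i 0}.
  apply: (indist tT (V := fun s w => X s w i 0) (V' := fun s w => picard I X s w i 0)).
  - by apply: aeW => w; exact: (vX i).1.
  - by apply: aeW => w; exact: (vP i).1.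
  - by move=> s hs; exact: same.
have : {ae P, forall w, forall i s, t <= s <= T -> X s w i 0 = picard I X s w i 0}.
  by apply: filter_forall.
by apply: filterS => w h s i hs; exact: h.
Qed.

End PicardLimit.

Lemma sde_exists : exists X I, [/\ vproc X, L2v X,
  forall i, is_ito (sg i X) (I i),
  forall s i, t <= s <= T -> L2 P setT (fun w => X s w i 0) &
  {ae P, forall w, forall s i, t <= s <= T -> X s w i 0 = picard I X s w i 0}].
Proof.
(* Choice wants integrals for every X; outside [vproc] the requirement is void and the zero
   processes serve. *)
have exI : forall X, exists I, vproc X -> forall i, is_ito (sg i X) (I i).
  move=> X; have [vX|nX] := pselect (vproc X); last by exists (fun _ _ _ => 0).
  by have [I hI] := picard_step vX; exists I.
have [II hII] := choice exI; exact: picard_limit hII.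
Qed.

(** * Uniqueness among all progressive solutions *)

Section Uniqueness.
Variables (X X' : R -> Om -> 'cV[R]_n) (I I' : 'I_n -> R -> Om -> R).
Hypotheses (pX : forall i, progressive (fun s w => X s w i 0))
  (iX : forall i, is_ito (sg i X) (I i))
  (bX : forall i, path_integrable (fun s w => beta s (X s w) i 0))
  (eX : {ae P, forall w, forall s i, t <= s <= T -> X s w i 0 = picard I X s w i 0})
  (vX' : vproc X') (iX' : forall i, is_ito (sg i X') (I' i))
  (eX' : {ae P, forall w, forall s i, t <= s <= T -> X' s w i 0 = picard I' X' s w i 0}).
Let q s w := enorm (X s w - X' s w) ^+ 2.
Let J i s w := I i s w + -1 * I' i s w.
Let j s w := \sum_i J i s w ^+ 2.
Let c := n%:R * (2 * ((T - t) * L)) + 1.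

Let c0 : 0 < c.
Proof. by rewrite /c ltr_wpDl// mulr_ge0// mulr_ge0// mulr_ge0 ?subr_ge0// ltW. Qed.

Let iJ i := is_ito_lin tT (-1) (iX i) (iX' i).

Let cJ i w : {within `[t, T], continuous (J i ^~ w)}.
Proof. exact: (ito_cproc (iJ i)).1 w. Qed.

Let cj w : {within `[t, T], continuous (j ^~ w)}.
Proof.
apply/subspace_continuousP => x hx; rewrite /j; apply: cvg_sumr => i.
have /subspace_continuousP/(_ x hx) h := @cJ i w.
exact: (cvgM h h).
Qed.

Let q_sum s w : q s w = \sum_i (X s w i 0 - X' s w i 0) ^+ 2.
Proof. by rewrite /q enormc_sq; apply: eq_bigr => i _; rewrite !mxE. Qed.

Let q0 s w : 0 <= q s w. Proof. exact: sqr_ge0. Qed.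
Let j0 s w : 0 <= j s w. Proof. by apply: sumr_ge0 => i _; exact: sqr_ge0. Qed.

Let good : {ae P, forall w, (forall i, {within `[t, T], continuous (fun s => X s w i 0)}) /\
  (forall s i, t <= s <= T -> (X s w i 0 - X' s w i 0) ^+ 2 <=
     2 * ((T - t) * L * Rintegral lam `[t, s] (q ^~ w)) + 2 * J i s w ^+ 2)}.
Proof.
have bX' : {ae P, forall w, forall i, L1 lam `[t, T] (fun s => beta s (X s w) i 0)}.
  by apply: filter_forall => i; exact: bX.
move: bX' eX eX'; apply: filterS3 => w bw ew ew'.
(* X is only assumed progressive; its paths are continuous, almost surely, because the right-hand
   side of the equation is. *)
have cX i : {within `[t, T], continuous (fun s => X s w i 0)}.
  apply: (@cont_within_eq _ _ _ (fun s => (x0 i 0 + 1 * Rintegral lam `[t, s] (fun r => beta r (X r w) i 0)) + 1 * I i s w)).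
    by move=> s hs; rewrite ew// /picard mxE !mul1r.
  apply: cont_lin; last exact: (ito_cproc (iX i)).1 w.
  apply: cont_lin; first by apply: continuous_subspaceT => x; exact: cvg_cst.
  exact: parameterized_integral_continuous tT (bw i).
split => // s i hs; have /andP[ts sT] := hs.
have cX' a : {within `[t, T], continuous (fun s => X' s w a 0)} by exact: (vX' a).1.
have cb' : {within `[t, T], continuous (fun s => beta s (X' s w) i 0)}.
  exact: (@jcont_path _ _ (fun s x => beta s x i 0) t T (X' ^~ w) (jb i) cX').
have iq : L1 lam `[t, T] (q ^~ w).
  have h : L1 lam `[t, T] (fun r => \sum_i (X r w i 0 + -1 * X' r w i 0) ^+ 2).
    apply: L1_sum => // a _; apply: (@cont_L1 _ _ t T) => //.
    have := cont_lin (c := -1) (cX a) (cX' a).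
    move=> /subspace_continuousP cc; apply/subspace_continuousP => x hx.
    exact: (cvgM (cc x hx) (cc x hx)).
  apply: eq_L1 h => // r _.
  by rewrite q_sum; apply: eq_bigr => a _; rewrite mulN1r.
have ib' : L1 lam `[t, T] (fun s => beta s (X' s w) i 0) by apply: (@cont_L1 _ _ t T).
rewrite (ew s i hs) (ew' s i hs) /picard !mxE.
pose A := Rintegral lam `[t, s] (fun r => beta r (X r w) i 0).
pose A' := Rintegral lam `[t, s] (fun r => beta r (X' r w) i 0).
rewrite -/A -/A'.
have -> : x0 i 0 + A + I i s w - (x0 i 0 + A' + I' i s w) = (A - A') + J i s w by rewrite /J; ring.
apply: le_trans (sqrD2 _ _) _; rewrite lerD2r ler_wpM2l//.
rewrite /A /A' -EB//; [|exact: L1_sub (lexx t) sT _|exact: L1_sub (lexx t) sT _].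
apply: (@drift_sq (fun r => beta r (X r w) i 0 - beta r (X' r w) i 0) (q ^~ w) s hs).
- by apply: measurable_funB; [exact: L1_meas (bw i)|exact: L1_meas ib'].
- exact: iq.
- by move=> r hr; exact: lb.
Qed.

(** The competitor X is not known to be square-integrable, so expectations cannot be taken yet.
    Pathwise, G_s, the integral of q up to s, satisfies G <= c (integral of G) + 2 (integral of j),
    and Gronwall bounds it by the integral of j. The latter is made of Ito integrals and has finite
    expectation, so q becomes integrable without stopping times. *)
Let q_path : {ae P, forall w, {within `[t, T], continuous (q ^~ w)} /\
   Rintegral lam `[t, T] (q ^~ w) <= 4 * expR (2 * c * (T - t)) * Rintegral lam `[t, T] (j ^~ w)}.
Proof.
move: good; apply: filterS => w [cX hq].
have cq : {within `[t, T], continuous (q ^~ w)}.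
  rewrite (_ : q ^~ w = fun s => \sum_i (X s w i 0 + -1 * X' s w i 0) ^+ 2); last first.
    by apply/funext => s; rewrite q_sum; apply: eq_bigr => i _; rewrite mulN1r.
  apply/subspace_continuousP => x hx; apply: cvg_sumr => i.
  have /subspace_continuousP/(_ x hx) h := cont_lin (c := -1) (cX i) ((vX' i).1 w).
  exact: (cvgM h h).
split => //.
have iq := cont_L1 (lexx t) (lexx T) cq; have ij := cont_L1 (lexx t) (lexx T) (@cj w).
pose G s := Rintegral lam `[t, s] (q ^~ w).
have qle s : t <= s <= T -> q s w <= c * G s + 2 * j s w.
  move=> hs; rewrite q_sum; apply: (@le_trans _ _ (\sum_(i < n) (2 * ((T - t) * L * G s) + 2 * J i s w ^+ 2))).
    by apply: ler_sum => i _; exact: hq.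
  rewrite big_split/= -[X in _ + X <= _]mulr_sumr; apply: lerD; last exact: lexx.
  rewrite sumr_const card_ord -[leLHS]mulr_natl /c [leRHS]mulrDl mul1r.
  apply: (@le_trans _ _ (n%:R * (2 * ((T - t) * L)) * G s)); last by rewrite lerDl; exact: E_ge0.
  by rewrite le_eqVlt; apply/orP; left; apply/eqP; ring.
have cG : {within `[t, T], continuous G} by exact: parameterized_integral_continuous.
have hT : t <= T <= T by rewrite tT lexx.
have := @gron R G t T c (2 * Rintegral lam `[t, T] (j ^~ w)) (G T) c0 _ _ _ _ _ T hT.
rewrite (_ : 2 * (2 * _) * _ = 4 * expR (2 * c * (T - t)) * Rintegral lam `[t, T] (j ^~ w)); last by ring.
apply.
- by rewrite mulr_ge0//; apply: E_ge0.
- exact: E_ge0.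
- exact: L1_meas (cont_L1 (lexx t) (lexx T) cG).
- move=> s /andP[ts sT]; apply/andP; split; first exact: E_ge0.
  by rewrite /G (Rint_chasles ts sT iq) lerDl; exact: E_ge0.
- move=> s /andP[ts sT].
  have iG : L1 lam `[t, s] G by apply: cont_L1 cG.
  have ijs : L1 lam `[t, s] (j ^~ w) by apply: L1_sub ij.
  have iqs : L1 lam `[t, s] (q ^~ w) by apply: L1_sub iq.
  apply: (@le_trans _ _ (c * Rintegral lam `[t, s] G + 2 * Rintegral lam `[t, s] (j ^~ w))).
    apply: (@E_le_lin2 _ _ _ lam `[t, s]%classic ltac:(exact: measurable_itv) c 2 (q ^~ w) G (j ^~ w)) => //.
    by move=> r; rewrite /= in_itv/= => /andP[r1 r2]; apply: qle; rewrite r1 (le_trans r2).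
  rewrite lerD2l ler_wpM2l// (Rint_chasles ts sT ij) lerDl; exact: E_ge0.
Qed.

Let mq : measurable_fun (Dom t T) (fun p : measurableTypeR R * Om => q p.1 p.2).
Proof.
have h : measurable_fun (Dom t T) (fun p : measurableTypeR R * Om => \sum_i (X p.1 p.2 i 0 - X' p.1 p.2 i 0) ^+ 2).
  apply: measurable_sum => i; apply: measurable_funX; apply: measurable_funB.
    exact: (progressive_meas tT (pX i)).
  exact: vproc_meas.
by apply: eq_measurable_fun h => p _; rewrite q_sum.
Qed.

Let jL1 : L1 mu (Dom t T) (fun p => j p.1 p.2).
Proof.
apply: L1_sum => [|i _]; first exact: mDom.
have mI := ito_martingale tT (iJ i).
have e2 s : t <= s <= T -> L2 P setT (J i s) /\ E2 (J i s) <= E2 (J i T) * expR (1 * (s - t)).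
  move=> hs; have /andP[ts sT] := hs; have [LJ _] := ito_E2_0 tT (iJ i) hs; split => //.
  apply: le_trans (martingale_E2 tT mI hs) _.
  rewrite ler_peMr//; first by apply: E_ge0 => *; exact: sqr_ge0.
  by apply: le_trans (expR_ge1Dx _); rewrite mul1r lerDl subr_ge0.
have pJ : progressive (J i) by have [] := iJ i.
have e0 : 0 <= E2 (J i T) by apply: E_ge0 => *; exact: sqr_ge0.
have [h _] := L2_unif tT e0 ltr01 (progressive_meas tT pJ) e2.
exact: L2_sq h.
Qed.

Let qL1 : L1 mu (Dom t T) (fun p => q p.1 p.2).
Proof.
apply: (L1P mq); first by move=> p _; exact: q0.
have [e [_ [m _]]] := Dom_tonelli P mq (fun p _ => q0 p.1 p.2).
rewrite -e; have [ij [ej _]] := Dom_fubini jL1.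
pose a := 4 * expR (2 * c * (T - t)).
have ia := L1Z measurableT a ij.
apply: le_lt_trans (ltry (E (fun w => a * Rintegral lam `[t, T] (j ^~ w)))).
rewrite -(L1_EFin measurableT ia).
apply: ae_ge0_le_integral => //.
- by move=> w _; apply: integral_ge0 => s _; rewrite lee_fin.
- move=> w _; rewrite lee_fin /a mulr_ge0 ?mulr_ge0 ?expR_ge0//; exact: E_ge0.
- by apply/measurable_EFinP; exact: L1_meas ia.
- move: q_path; apply: filterS => w [cq h] _.
  by rewrite L1_EFin ?lee_fin//; exact: cont_L1 (lexx t) (lexx T) cq.
Qed.

Let deltaE i s : t <= s <= T -> L2 P setT (fun w => X s w i 0 - X' s w i 0) /\
  E2 (fun w => X s w i 0 - X' s w i 0) <= K * \int[mu]_(p in Dom t s) q p.1 p.2.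
Proof.
move=> hs; have /andP[ts sT] := hs.
have qs := L1_Dom (f := q) (lexx t) sT qL1.
have [iq [eq _]] := Dom_fubini qs.
have [LJ EJ] := ito_diff hs (iX i) (iX' i) qL1.
have mXs : measurable_fun setT (fun w => X s w i 0) by exact: Fm_meas hs (progressive_Fm hs (pX i)).
have mXs' : measurable_fun setT (fun w => X' s w i 0) by exact: Fm_meas hs ((vX' i).2 s hs).
have iq2 := L1Z measurableT ((T - t) * L) iq.
pose b w := 2 * ((T - t) * L * Rintegral lam `[t, s] (q ^~ w)) + 2 * (I i s w - I' i s w) ^+ 2.
have ib : L1 P setT b by apply: L1D => //; apply: L1Z => //; exact: L2_sq LJ.
have le1 : {ae P, forall w, setT w -> `|(X s w i 0 - X' s w i 0) ^+ 2| <= b w}.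
  move: good; apply: filterS => w [_ h] _; rewrite ger0_norm ?sqr_ge0//; apply: le_trans (h s i hs) _.
  by rewrite /J mulN1r.
have LD : L2 P setT (fun w => X s w i 0 - X' s w i 0).
  split; first exact: measurable_funB.
  by apply: (L1_le_ae measurableT _ ib le1); apply: measurable_funX; exact: measurable_funB.
split => //.
apply: (@le_trans _ _ (E b)).
  rewrite -lee_fin -!L1_EFin//; last exact: L2_sq LD.
  apply: ae_ge0_le_integral => //.
  - by move=> w _; rewrite lee_fin sqr_ge0.
  - by apply/measurable_EFinP; exact: L1_meas (L2_sq LD).
  - move=> w _; rewrite lee_fin /b; apply: addr_ge0; apply: mulr_ge0 => //; last exact: sqr_ge0.
    by apply: mulr_ge0; [rewrite mulr_ge0 ?subr_ge0 ?(ltW L0)|exact: E_ge0].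
  - by apply/measurable_EFinP; exact: L1_meas ib.
  - by move: le1; apply: filterS => w h _; rewrite lee_fin; apply: le_trans (h Logic.I); exact: ler_norm.
rewrite /b ED//; [|exact: L1Z|by apply: L1Z => //; exact: L2_sq LJ].
rewrite !EZ//; [|exact: L2_sq LJ].
rewrite eq; apply: (@le_trans _ _ (2 * ((T - t) * L * \int[mu]_(p in Dom t s) q p.1 p.2) +
  2 * (L * \int[mu]_(p in Dom t s) q p.1 p.2))).
  by rewrite lerD2l ler_wpM2l//; exact: EJ.
by rewrite le_eqVlt; apply/orP; left; apply/eqP; rewrite /K; ring.
Qed.

(** With q integrable, a second Gronwall argument, now for expectations and with additive constant
    0, gives E q_s = 0 at each time; continuity of paths concludes. *)
Lemma sde_unique : {ae P, forall w, forall s, t <= s <= T -> X s w = X' s w}.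
Proof.
pose g s := E (q s).
have iqs s : t <= s <= T -> L1 P setT (q s) /\ g s = \sum_i E2 (fun w => X s w i 0 - X' s w i 0).
  move=> hs.
  have h : L1 P setT (fun w => \sum_i (X s w i 0 - X' s w i 0) ^+ 2).
    by apply: L1_sum => // i _; exact: L2_sq (deltaE i hs).1.
  split; first by apply: eq_L1 h => // w _; rewrite q_sum.
  rewrite -E_sum//; first by apply: eq_E => w _; rewrite q_sum.
  by move=> i _; exact: L2_sq (deltaE i hs).1.
have K0 : 0 <= K by rewrite /K addr_ge0 ?mulr_ge0 ?subr_ge0// ltW.
have Q0 s : 0 <= \int[mu]_(p in Dom t s) q p.1 p.2 by apply: E_ge0 => p _; exact: q0.
have gle s : t <= s <= T -> g s <= n%:R * K * \int[mu]_(p in Dom t s) q p.1 p.2.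
  move=> hs; have [_ ->] := iqs s hs.
  apply: (@le_trans _ _ (\sum_(i < n) (K * \int[mu]_(p in Dom t s) q p.1 p.2))).
    by apply: ler_sum => i _; exact: (deltaE i hs).2.
  by rewrite sumr_const card_ord -[leRHS]mulrA mulr_natl.
have g0 s : 0 <= g s by apply: E_ge0 => w _; exact: q0.
have [_ [e [_ mg]]] := Dom_tonelli P mq (fun p _ => q0 p.1 p.2).
have mg' : measurable_fun `[t, T] g.
  have h2 : measurable_fun `[t, T] (fine \o (fun s => \int[P]_w (q s w)%:E)%E).
    by apply: measurableT_comp => //; exact: measurable_fine.
  exact: h2.
have geq s : t <= s <= T -> \int[mu]_(p in Dom t s) q p.1 p.2 = Rintegral lam `[t, s] g.
  move=> hs; have /andP[ts sT] := hs.
  have mqs : measurable_fun (Dom t s) (fun p : measurableTypeR R * Om => q p.1 p.2).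
    by apply: measurable_funS mq; [exact: mDom|exact: Dom_sub].
  have [_ [e2 _]] := Dom_tonelli P mqs (fun p _ => q0 p.1 p.2).
  rewrite /Rintegral -e2; congr fine; apply: eq_integral => r; rewrite inE/= in_itv/= => /andP[r1 r2].
  by rewrite L1_EFin//; apply: (iqs r _).1; rewrite r1 (le_trans r2).
have nK0 : 0 <= n%:R * K by rewrite mulr_ge0.
have gz s : t <= s <= T -> g s = 0.
  move=> hs; apply/eqP; rewrite eq_le g0 andbT.
  (* [gron] takes a positive rate, hence the + 1; the additive constant is 0. *)
  have := @gron R g t T (n%:R * K + 1) 0 (n%:R * K * \int[mu]_(p in Dom t T) q p.1 p.2) _ (lexx 0) _ mg' _ _ s hs.
  rewrite mulr0 mul0r; apply.
  - by rewrite ltr_wpDl.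
  - by rewrite mulr_ge0.
  - move=> r hr; rewrite g0/=; apply: le_trans (gle r hr) _; rewrite ler_wpM2l//.
    by apply: (Dom_mono hr qL1) => p; exact: q0.
  - move=> r hr; rewrite addr0 -(geq r hr) mulrDl mul1r; apply: le_trans (gle r hr) _.
    by rewrite lerDl.
have ae0 i s : t <= s <= T -> {ae P, forall w, X s w i 0 = X' s w i 0}.
  move=> hs; have [_ eg] := iqs s hs.
  have e0 : E2 (fun w => X s w i 0 - X' s w i 0) = 0.
    have := gz s hs; rewrite eg => /eqP; rewrite psumr_eq0; last by move=> k _; apply: E_ge0 => *; exact: sqr_ge0.
    by move=> /allP/(_ i); rewrite mem_index_enum => /(_ isT)/eqP.
  by apply: filterS (ae_E2_0 (deltaE i hs).1 e0) => w /eqP; rewrite subr_eq0 => /eqP.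
have : {ae P, forall w, forall i s, t <= s <= T -> X s w i 0 = X' s w i 0}.
  apply: filter_forall => i; apply: (indist tT (V := fun s w => X s w i 0) (V' := fun s w => X' s w i 0)).
  - by move: good; apply: filterS => w [h _]; exact: h.
  - by apply: aeW => w; exact: (vX' i).1.
  - by move=> s hs; exact: ae0.
by apply: filterS => w h s hs; apply/colP => i; exact: h.
Qed.

End Uniqueness.
End SDE.

(** * Dynkin's formula *)

Lemma cvg_le (R : realType) (u v : nat -> R) (a b : R) : u @ \oo --> a -> v @ \oo --> b ->
  (forall k, u k <= v k) -> a <= b.
Proof.
move=> ua vb uv; rewrite -(cvg_lim _ ua)// -(cvg_lim _ vb)//.
by apply: ler_lim; [exact: cvgP ua|exact: cvgP vb|exact: nearW].
Qed.

Lemma E_le_ae d (T : measurableType d) (R : realType) (mu : measure T R) (D : set T) (f g : T -> R) :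
  measurable D -> L1 mu D f -> L1 mu D g -> {ae mu, forall x, D x -> f x <= g x} ->
  Rintegral mu D f <= Rintegral mu D g.
Proof.
move=> mD fi gi [A [mA A0 hA]]; rewrite -subr_ge0 -(EB mD gi fi).
have -> : Rintegral mu D (fun x => g x - f x) = Rintegral mu D (fun x => `|g x - f x|).
  apply: E_ae => //; [exact: L1_meas (L1B mD gi fi)|exact: L1_meas (L1_norm (L1B mD gi fi))|].
  exists A; split=> // x /= nx; apply: hA => /= h; apply: nx => Dx.
  by rewrite ger0_norm// subr_ge0; exact: h.
by apply: E_ge0.
Qed.

Section Quadratic.
Context (R : realType) (N : nat).
Implicit Types (x y c : 'I_N -> R) (q : 'I_N -> 'I_N -> R).

Lemma sum2_add c : \sum_a \sum_b (c a + c b) = 2 * N%:R * \sum_a c a.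
Proof.
have -> : \sum_a \sum_b (c a + c b) = \sum_a (N%:R * c a + \sum_b c b).
  by apply: eq_bigr => a _; rewrite big_split/= sumr_const card_ord mulr_natl.
by rewrite big_split/= -mulr_sumr sumr_const card_ord -mulr_natl; ring.
Qed.

Lemma norm_sum2_le (f g : 'I_N -> 'I_N -> R) : (forall a b, `|f a b| <= g a b) ->
  `|\sum_a \sum_b f a b| <= \sum_a \sum_b g a b.
Proof.
move=> h; apply: le_trans (ler_norm_sum _ _ _) _; apply: ler_sum => a _.
by apply: le_trans (ler_norm_sum _ _ _) _; apply: ler_sum => b _.
Qed.

Lemma quad_le q K x : (forall a b, `|q a b| <= K) ->
  `|\sum_a \sum_b q a b * (x a * x b)| <= K * N%:R * \sum_a x a ^+ 2.
Proof.
move=> qK; apply: (@le_trans _ _ (\sum_a \sum_b (K / 2 * x a ^+ 2 + K / 2 * x b ^+ 2))).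
  apply: norm_sum2_le => a b; rewrite normrM -mulrDr.
  have K0 : 0 <= K := le_trans (normr_ge0 _) (qK a b).
  rewrite -mulrA ler_pM//; rewrite normrM -[x a ^+ 2]real_normK ?num_real// -[x b ^+ 2]real_normK ?num_real//.
  by have := sqr_ge0 (`|x a| - `|x b|); nra.
by rewrite (sum2_add (fun a => K / 2 * x a ^+ 2)) -mulr_sumr le_eqVlt; apply/orP; left; apply/eqP; field.
Qed.

(** Young's inequality with a free parameter puts an arbitrarily small weight th on y. In the
    application x is the drift part of an increment, which is negligible, and y its martingale part,
    which is of the order of the mesh in mean square and is not. *)
Lemma quad_diff_le q K x y (th : R) : 0 < th -> (forall a b, `|q a b| <= K) ->
  `|\sum_a \sum_b q a b * ((x a + y a) * (x b + y b) - y a * y b)| <=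
  K * N%:R * ((1 + th^-1) * \sum_a x a ^+ 2 + th * \sum_a y a ^+ 2).
Proof.
move=> th0 qK; pose c a := K / 2 * ((1 + th^-1) * x a ^+ 2 + th * y a ^+ 2).
have am (u v : R) : `|u * v| <= 2^-1 * (th^-1 * u ^+ 2 + th * v ^+ 2).
  rewrite normrM -[u ^+ 2]real_normK ?num_real// -[v ^+ 2]real_normK ?num_real//.
  have e : th^-1 * `|u| ^+ 2 + th * `|v| ^+ 2 - 2 * (`|u| * `|v|) = th^-1 * (`|u| - th * `|v|) ^+ 2.
    by field; rewrite gt_eqF.
  have : 0 <= th^-1 * (`|u| - th * `|v|) ^+ 2 by rewrite mulr_ge0 ?sqr_ge0// invr_ge0 ltW.
  by rewrite -e; lra.
apply: (@le_trans _ _ (\sum_a \sum_b (c a + c b))).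
  apply: norm_sum2_le => a b; rewrite normrM.
  have K0 : 0 <= K := le_trans (normr_ge0 _) (qK a b).
  rewrite /c -mulrDr -mulrA; apply: ler_pM => //.
  have -> : (x a + y a) * (x b + y b) - y a * y b = x a * y b + x b * y a + x a * x b by ring.
  apply: le_trans (ler_normD _ _) _; apply: le_trans (lerD (ler_normD _ _) (lexx _)) _.
  have := am (x a) (y b); have := am (x b) (y a).
  have : `|x a * x b| <= 2^-1 * (x a ^+ 2 + x b ^+ 2).
    rewrite normrM -[x a ^+ 2]real_normK ?num_real// -[x b ^+ 2]real_normK ?num_real//.
    by have := sqr_ge0 (`|x a| - `|x b|); nra.
  by move: (`|x a * x b|) (`|x a * y b|) (`|x b * y a|) => u v w; lra.
rewrite (sum2_add c) /c -mulr_sumr big_split/= -!mulr_sumr.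
by rewrite le_eqVlt; apply/orP; left; apply/eqP; field; rewrite gt_eqF.
Qed.

End Quadratic.

(** * Square-integrable integrands and Riemann sums in time *)

Section DynkinPrep.
Context (R : realType) (d : nat) (t T : R) (B : brownian_basis d t T) (tT : t <= T).
Notation Om := (bb_Omega B).
Notation P := (bb_P B).
Notation W := (bb_W B).
Notation lam := (@lebesgue_measure R).
Notation mu := (lam \x P)%E.
Notation Dom := (@Dom R (bb_disp B) Om).
Notation E f := (Rintegral P setT f).
Notation Fm := (Fm (B := B)).
Notation mDom := (@measurable_Dom R (bb_disp B) Om _ _).
Implicit Types (Z : R -> Om -> 'cV[R]_d) (I : R -> Om -> R) (V : R -> Om -> R).

(** The continuous functions y / max (1 / (k + 1), y^2) vanish at 0, in agreement with the
    convention that the inverse of 0 is 0, and equal 1 / y as soon as y^2 is at least 1 / (k +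
    1). *)
Lemma meas_inv d0 (S : measurableType d0) (D : set S) (f : S -> R) :
  measurable_fun D f -> measurable_fun D (fun x => (f x)^-1).
Proof.
move=> mf; pose g k (y : R) := y * (Num.max k.+1%:R^-1 (y ^+ 2))^-1.
have cg k : continuous (g k).
  move=> y; apply: cvgM; first exact: cvg_id.
  apply: cvgV; first by rewrite gt_eqF// lt_max invr_gt0 ltr0n.
  apply/cvgrPdist_lt => e e0; have /cvgrPdist_lt/(_ e e0) := @exprn_continuous R 2 y.
  by apply: filterS => z; apply: le_lt_trans; exact: max_lip.
apply: (measurable_fun_cvg (h := fun k x => g k (f x))).
  by move=> k; apply: measurableT_comp mf; exact: continuous_measurable_fun.
move=> x _; have [fx|fx] := eqVneq (f x) 0.
  by rewrite fx invr0 /g; under eq_fun do rewrite mul0r; exact: cvg_cst.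
have f2 : 0 < f x ^+ 2 by rewrite exprn_even_gt0.
have /cvgrPdist_lt/(_ _ f2) := @cvg_harmonic R => h.
apply: cvg_near_cst; apply: filterS h => k; rewrite sub0r normrN /= ger0_norm ?invr_ge0// => hk.
rewrite /g max_r; last exact: ltW.
by rewrite expr2 invfM mulrA divff// mul1r.
Qed.

Lemma ae_neq (c : R) : {ae mu, forall p, p.1 != c}.
Proof.
exists ([set c] `*` setT); split.
- exact: measurableX.
- by rewrite product_measure1E//= lebesgue_measure_set1 mul0e.
- by move=> p /= /negP; rewrite negbK => /eqP ->.
Qed.

Lemma simple_val_progressive (S : simple_process B) a : progressive (fun s w => simple_val S s w a 0).
Proof.
move=> s hs; have /andP[ts sT] := hs.
have -> : (fun p : measurableTypeR R * g_sigma_algebraType (bb_gen s) => simple_val S p.1 p.2 a 0) =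
  (fun p => \sum_i (\1_(`]sp_lo i, sp_hi i]) p.1 * sp_coef (s := S) i p.2 a 0)).
  apply/funext => p; rewrite /simple_val summxE; apply: eq_bigr => i _.
  by rewrite indicE mem_setE in_itv/=; case: ifP => _; rewrite ?mul1r// mul0r mxE.
apply: measurable_sum => i.
have mF : measurable ([set p | t <= p.1 <= s] : set (measurableTypeR R * FT B s)).
  rewrite (_ : [set p | _] = `[t, s]%classic `*` setT); first exact: measurableX.
  by apply/seteqP; split => [p /= hh|p /= []]; rewrite /= in_itv/=.
have [slo|los] := lerP s (sp_lo i).
  have h0 : measurable_fun ([set p | t <= p.1 <= s] : set (measurableTypeR R * FT B s)) (fun=> 0 : R).
    exact: measurable_cst.
  apply: eq_measurable_fun h0 => p; rewrite inE/= => /andP[_ ps].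
  rewrite indicE memNset ?mul0r//= in_itv/= => /andP[h _].
  by have := lt_le_trans h (le_trans ps slo); rewrite ltxx.
apply: measurable_funTS; apply: measurable_funM.
  have m1 : measurable_fun setT (\1_(`]sp_lo i, sp_hi i]) : measurableTypeR R -> R) by exact: measurable_indic.
  exact: (measurableT_comp m1 measurable_fst).
have m2 : Fm s (fun w => sp_coef (s := S) i w a 0) by apply: (Fm_mono (ltW los)); exact: sp_adapted.
exact: (measurableT_comp m2 measurable_snd).
Qed.

Lemma simple_is_ito (S : simple_process B) : is_ito (simple_val S) (simple_int S).
Proof.
apply: (mk_ito tT).
- by apply: L2p_H2; [exact: simple_val_progressive|exact: L2p_simple].
- exact: (cproc_progressive tT (simple_int_cproc S)).
- exact: (simple_int_cproc S).1.
exists (fun=> S); split.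
  rewrite (_ : (fun=> _) = fun=> 0); first exact: cvg_cst.
  apply/funext => k; rewrite -[RHS](E0 mu (Dom t T)); apply: eq_E => p _.
  by rewrite subrr enormc_sq big1// => i _; rewrite mxE expr0n.
move=> s hs; split; first exact: simple_int_L2.
exact: E2_cst.
Qed.

(** Coordinates are truncated at level k, the truncation is approximated by the bounded case, and
    dominated convergence removes the truncation. *)
Lemma ito_exists_L2 Z : (forall a, cproc (fun s w => Z s w a 0)) -> L2p Z -> exists I, is_ito Z I.
Proof.
move=> cZ LZ; have pZ a := cproc_progressive tT (cZ a).
pose cl (k : nat) (x : R) := Num.max (- k%:R) (Num.min k%:R x).
have k0 (k : nat) : - k%:R <= 0 :> R by rewrite oppr_le0.
have clb k x : `|cl k x| <= k%:R.
  rewrite ler_norml /cl le_max lexx/= ge_max ge_min lexx/= (le_trans (k0 k))//.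
have cl0 k : cl k 0 = 0 by rewrite /cl (min_idPr _)// (max_idPr _).
have clle k x : `|cl k x| <= `|x|.
  have := le_trans (max_lip (- k%:R) (Num.min k%:R x) (Num.min k%:R 0)) (min_lip k%:R x 0).
  by rewrite -/(cl k x) -/(cl k 0) cl0 !subr0.
pose ZK k s w : 'cV[R]_d := \col_a cl k (Z s w a 0).
have cZK k a : cproc (fun s w => ZK k s w a 0).
  split => [w|s hs].
    apply: (@cont_within_eq _ _ _ (fun s => cl k (Z s w a 0))); first by move=> s _; rewrite mxE.
    apply/eps_within => s hs e e0; have [eta eta0 H] := (eps_within t T _).1 ((cZ a).1 w) s hs e e0.
    exists eta => // u hu us; apply: le_lt_trans (H u hu us).
    exact: le_trans (max_lip _ _ _) (min_lip _ _ _).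
  rewrite (_ : (fun w => _) = fun w => cl k (Z s w a 0)); last by apply/funext => w; rewrite mxE.
  apply: measurable_maxr => //; apply: measurable_minr => //; exact: (cZ a).2.
have LZK k : L2p (ZK k).
  move=> a; apply: (L2_le mDom _ (LZ a)); first exact: (progressive_meas tT (cproc_progressive tT (cZK k a))).
  by move=> p _; rewrite mxE clle.
have bZK k s w : t <= s <= T -> enorm (ZK k s w) <= Num.sqrt (\sum_(i < d) \sum_(j < 1) k%:R ^+ 2).
  move=> _; apply: ler_wsqrtr; apply: ler_sum => i _; apply: ler_sum => j _.
  by rewrite (ord1 j) mxE -real_normK ?num_real// lerXn2r ?nnegrE.
have lim : n2 t T (fun s w => ZK k s w - Z s w) @[k --> \oo] --> (0 : R).
  have h := @E_dct _ _ _ mu (Dom t T) mDom (fun k p => enorm (ZK k p.1 p.2 - Z p.1 p.2) ^+ 2) (fun=> 0)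
    (fun p => 4 * enorm (Z p.1 p.2) ^+ 2).
  rewrite E0 in h; apply: (h _ _ _ _ _).2.
  - by move=> k; apply: L1_meas (L2p_L1 (lexx t) (lexx T) (L2pB (LZK k) LZ)).
  - exact: measurable_cst.
  - apply: aeW => p _; have [k hk] : exists k : nat, forall a, `|Z p.1 p.2 a 0| <= k%:R.
      exists (Num.Def.archi_bound (enorm (Z p.1 p.2))) => a; apply: le_trans (abs_coord_le _ _ _) _.
      exact/ltW/archi_boundP/enorm_ge0.
    apply: cvg_near_cst; exists k => // j /= kj.
    suff -> : ZK j p.1 p.2 = Z p.1 p.2 by rewrite subrr enormc_sq big1// => i _; rewrite mxE expr0n.
    apply/colP => a; rewrite mxE /cl.
    have : `|Z p.1 p.2 a 0| <= j%:R by apply: (le_trans (hk a)); rewrite ler_nat.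
    by rewrite ler_norml => /andP[h1 h2]; rewrite (min_idPr h2) (max_idPr h1).
  - by apply: L1Z; [exact: mDom|exact: L2p_L1 LZ].
  - move=> k p _; rewrite ger0_norm ?sqr_ge0// !enormc_sq mulr_sumr; apply: ler_sum => a _.
    rewrite !mxE -[_ ^+ 2]real_normK ?num_real// -[X in 4 * X]real_normK ?num_real//.
    have -> : 4 * `|Z p.1 p.2 a 0| ^+ 2 = (2 * `|Z p.1 p.2 a 0|) ^+ 2 by ring.
    rewrite lerXn2r ?nnegrE ?mulr_ge0//; apply: le_trans (ler_normB _ _) _.
    by have := clle k (Z p.1 p.2 a 0); lra.
apply: (ito_of_approx tT pZ LZ) => e e0.
have e4 : 0 < e / 4 by lra.
have /cvgrPdist_lt/(_ _ e4)[k _ hk] := lim.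
have {}hk := hk k (leqnn _); rewrite /= sub0r normrN in hk.
have [S hS] := bounded_approx tT (cZK k) (@bZK k) e4.
exists S; have LSZ := L2pB (L2p_simple S) (LZK k).
apply: (@le_trans _ _ (n2 t T (fun s w => (simple_val S s w - ZK k s w) + (ZK k s w - Z s w)))).
  by rewrite le_eqVlt; apply/orP; left; apply/eqP; apply: eq_E => p _; rewrite addrA subrK.
apply: le_trans (n2D (lexx t) (lexx T) LSZ (L2pB (LZK k) LZ)) _.
have := le_lt_trans (ler_norm _) hk; move: hS; move: (n2 _ _ _) (n2 _ _ _) => x y; lra.
Qed.

Lemma Rint_E2 (f : R -> Om -> R) u v : t <= u -> u <= v -> v <= T ->
  L2 mu (Dom t T) (fun p => f p.1 p.2) ->
  L2 P setT (fun w => Rintegral lam `[u, v] (f ^~ w)) /\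
  E2 (fun w => Rintegral lam `[u, v] (f ^~ w)) <= (v - u) * \int[mu]_(p in Dom u v) (f p.1 p.2 ^+ 2).
Proof.
move=> tu uv vT Lf; have Luv := L2_Dom (f := f) tu vT Lf.
have L1uv : L1 mu (Dom u v) (fun p => f p.1 p.2) by apply: L2_L1 Luv; [exact: mDom|exact: mu_Dom].
have [i1 [_ ae1]] := Dom_fubini (f := f) L1uv.
have iq := L2_sq Luv.
have [i2 [e2 ae2]] := Dom_fubini (f := fun r w => f r w ^+ 2) iq.
have ic := L1Z measurableT (v - u) i2.
have le1 : {ae P, forall w, setT w -> `|Rintegral lam `[u, v] (f ^~ w) ^+ 2| <= (v - u) * Rintegral lam `[u, v] (fun r => f r w ^+ 2)}.
  move: ae1 ae2; apply: filterS2 => w h1 h2 _; rewrite ger0_norm ?sqr_ge0//.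
  by apply: Rint_CS => //; exact: L1_meas h1.
have Lbe : L2 P setT (fun w => Rintegral lam `[u, v] (f ^~ w)).
  split; first exact: L1_meas i1.
  by apply: (L1_le_ae measurableT _ ic le1); apply: measurable_funX; exact: L1_meas i1.
split => //; rewrite -e2 -(EZ measurableT _ i2); apply: E_le_ae => //; first exact: L2_sq Lbe.
by move: le1; apply: filterS => w h _; apply: le_trans (h Logic.I); exact: ler_norm.
Qed.

Section Step.
Context (e : R) (te : t < e) (eT : e <= T).

Lemma grid_Dom_split (f : R -> Om -> R) k j : (j <= k.+1)%N -> L1 mu (Dom t e) (fun p => f p.1 p.2) ->
  \int[mu]_(p in Dom t (grid t e k j)) f p.1 p.2 =
  \sum_(i < j) \int[mu]_(p in Dom (grid t e k i) (grid t e k i.+1)) f p.1 p.2.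
Proof.
move=> jk fi; have te' := ltW te; elim: j jk => [|j IH] jk.
  rewrite big_ord0 grid0 (@Dom_ae _ _ _ _ _ _ f (fun _ _ => 0)) ?E0//.
  - apply: measurable_funS (L1_meas fi); [exact: mDom|exact: Dom_sub].
  - by move=> tau w /andP[h1 h2]; have := lt_le_trans h1 h2; rewrite ltxx.
rewrite big_ord_recr/= -IH ?(leq_trans _ jk)// -Dom_split//.
- by have /andP[] := grid_in te' k j.
- exact: grid_le.
- apply: integrableS fi; try exact: mDom.
  by apply: Dom_sub => //; have /andP[] := grid_in te' k j.+1.
Qed.

(** Riemann sums whose weight F may depend on both ends of the cell. Seen as one integrand on the
    whole strip, they are dominated by |K| |f| and converge at every point with tau > t. *)
Lemma stp_cvg (F : R -> R -> Om -> R) (f phi : R -> Om -> R) K :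
  (forall u v, t <= u -> u < v -> v <= e -> measurable_fun setT (F u v)) ->
  (forall u v w, t <= u -> u < v -> v <= e -> `|F u v w| <= K) ->
  L1 mu (Dom t e) (fun p => f p.1 p.2) ->
  measurable_fun (Dom t e) (fun p : measurableTypeR R * Om => phi p.1 p.2) ->
  (forall tau w, t < tau <= e -> forall eps, 0 < eps -> exists2 eta, 0 < eta & forall u v,
     t <= u -> u < tau -> tau <= v -> v <= e -> v - u < eta -> `|F u v w - phi tau w| < eps) ->
  (fun k => \sum_(j < k.+1) \int[mu]_(p in Dom (grid t e k j) (grid t e k j.+1))
     (F (grid t e k j) (grid t e k j.+1) p.2 * f p.1 p.2)) @ \oo -->
  \int[mu]_(p in Dom t e) (phi p.1 p.2 * f p.1 p.2).
Proof.
move=> mF bF fi mphi cF; have te' := ltW te.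
pose g k (s : R) w := (\sum_(j < k.+1) (if (grid t e k j < s) && (s <= grid t e k j.+1)
   then F (grid t e k j) (grid t e k j.+1) w else 0)) * f s w.
have step k j : (j < k.+1)%N -> grid t e k j < grid t e k j.+1.
  by move=> jk; rewrite -subr_gt0 grid_step// divr_gt0 ?subr_gt0.
have gj k (j : 'I_k.+1) s w : grid t e k j < s -> s <= grid t e k j.+1 ->
    g k s w = F (grid t e k j) (grid t e k j.+1) w * f s w.
  move=> h1 h2; rewrite /g (bigD1 j)//= h1 h2 big1 ?addr0// => i ij.
  case: ifP => // /andP[i1 i2]; case/negP: ij; apply/eqP/val_inj => /=.
  apply/eqP; rewrite eqn_leq; apply/andP; split; rewrite leqNgt; apply/negP => h.
    by have := lt_le_trans i1 (le_trans h2 (grid_le te' k h)); rewrite ltxx.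
  by have := lt_le_trans h1 (le_trans i2 (grid_le te' k h)); rewrite ltxx.
have mg k : measurable_fun (Dom t e) (fun p : measurableTypeR R * Om => g k p.1 p.2).
  apply: measurable_funM; last exact: L1_meas fi.
  apply: measurable_sum => j; apply: measurable_funTS.
  rewrite (_ : (fun p => _) = fun p : measurableTypeR R * Om => \1_(`]grid t e k j, grid t e k j.+1]) p.1 *
    F (grid t e k j) (grid t e k j.+1) p.2).
    apply: measurable_funM.
      have m1 : measurable_fun setT (\1_(`]grid t e k j, grid t e k j.+1]) : measurableTypeR R -> R) by exact: measurable_indic.
      exact: (measurableT_comp m1 measurable_fst).
    have m2 : measurable_fun setT (F (grid t e k j) (grid t e k j.+1)).
      by apply: mF; [have /andP[] := grid_in te' k j|exact: step|have /andP[] := grid_in te' k j.+1].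
    exact: (measurableT_comp m2 measurable_snd).
  apply/funext => p; rewrite indicE mem_setE in_itv/=.
  by case: ifP => _; rewrite ?mul1r ?mul0r.
have gb k s w : `|g k s w| <= `|K| * `|f s w|.
  rewrite normrM ler_wpM2r//.
  have [/andP[h1 h2]|nh] := boolP ((t < s) && (s <= e)); last first.
    rewrite big1 ?normr0// => j _; case: ifP => // /andP[j1 j2]; case/negP: nh.
    have /andP[a1 _] := grid_in te' k j; have /andP[_ a2] := grid_in te' k j.+1.
    by rewrite (le_lt_trans a1 j1) (le_trans j2).
  have [j jk /andP[j1 j2]] := grid_locate k (introT andP (conj h1 h2)).
  have jk' : (j < k.+1)%N by [].
  rewrite (bigD1 (Ordinal jk'))//= j1 j2 big1 ?addr0 => [|i ij].
    apply: le_trans (ler_norm K); apply: bF; [by have /andP[] := grid_in te' k j|exact: step|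
      by have /andP[] := grid_in te' k j.+1].
  case: ifP => // /andP[i1 i2]; case/negP: ij; apply/eqP/val_inj => /=.
  apply/eqP; rewrite eqn_leq; apply/andP; split; rewrite leqNgt; apply/negP => h.
    by have := lt_le_trans i1 (le_trans j2 (grid_le te' k h)); rewrite ltxx.
  by have := lt_le_trans j1 (le_trans i2 (grid_le te' k h)); rewrite ltxx.
have iKf : L1 mu (Dom t e) (fun p => `|K| * `|f p.1 p.2|) by apply: L1Z; [exact: mDom|exact: L1_norm].
have gi k : L1 mu (Dom t e) (fun p => g k p.1 p.2).
  by apply: (L1_le mDom (mg k) iKf) => p _; exact: gb.
rewrite [X in X @ _ --> _](_ : _ = fun k => \int[mu]_(p in Dom t e) g k p.1 p.2); last first.
  apply/funext => k; rewrite -[X in Dom t X](gridN t e k) (grid_Dom_split (leqnn _) (gi k)).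
  apply: eq_bigr => j _; apply/esym; apply: (@Dom_ae _ _ _ _ _ _ (g k)
    (fun s w => F (grid t e k j) (grid t e k j.+1) w * f s w)).
  - by apply: measurable_funS (mg k); [exact: mDom|apply: Dom_sub; [have /andP[] := grid_in te' k j|
      have /andP[] := grid_in te' k j.+1]].
  - apply: measurable_funM.
      have m2 : measurable_fun setT (F (grid t e k j) (grid t e k j.+1)).
        by apply: mF; [have /andP[] := grid_in te' k j|exact: step|have /andP[] := grid_in te' k j.+1].
      by apply: measurable_funTS; exact: (measurableT_comp m2 measurable_snd).
    by apply: measurable_funS (L1_meas fi); [exact: mDom|apply: Dom_sub; [have /andP[] := grid_in te' k j|
      have /andP[] := grid_in te' k j.+1]].
  - by move=> s w /andP[h1 h2]; exact: gj.
apply: (@E_dct _ _ _ mu _ mDom (fun k p => g k p.1 p.2) (fun p => phi p.1 p.2 * f p.1 p.2)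
  (fun p => `|K| * `|f p.1 p.2|) mg _ _ iKf _).2.
- by apply: measurable_funM => //; exact: L1_meas fi.
- have [A [mA A0 hA]] := ae_neq t; exists A; split=> // p /= np; apply: hA => /= pt; apply: np => /andP[p1 p2].
  have p1' : t < p.1 by rewrite lt_neqAle eq_sym pt.
  apply: cvgM; last exact: cvg_cst.
  apply: (@grid_cvg _ t e te' (fun u v => F u v p.2)); first by rewrite p1'.
  by move=> eps eps0; apply: cF => //; rewrite p1'.
- by move=> k p _; exact: gb.
Qed.

End Step.
End DynkinPrep.

Section Dynkin.
Context (R : realType) (d : nat) (t T : R) (B : brownian_basis d t T) (tT : t <= T).
Context (N : nat) (V : R -> bb_Omega B -> 'cV[R]_N) (b : 'I_N -> R -> bb_Omega B -> R)
  (H : 'I_N -> R -> bb_Omega B -> 'cV[R]_d) (I : 'I_N -> R -> bb_Omega B -> R).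
Context (Phi Ft : R -> 'cV[R]_N -> R) (G : 'I_N -> R -> 'cV[R]_N -> R)
  (Q : 'I_N -> 'I_N -> R -> 'cV[R]_N -> R) (K : R).
Notation Om := (bb_Omega B).
Notation P := (bb_P B).
Notation W := (bb_W B).
Notation lam := (@lebesgue_measure R).
Notation mu := (lam \x P)%E.
Notation Dom := (@Dom R (bb_disp B) Om).
Notation E f := (Rintegral P setT f).
Notation Fm := (Fm (B := B)).
Notation mDom := (@measurable_Dom R (bb_disp B) Om _ _).

Hypotheses (vV : vproc V) (Lb : forall a, L2 mu (Dom t T) (fun p => b a p.1 p.2))
  (iI : forall a, is_ito (H a) (I a))
  (eV : {ae P, forall w, forall s a, t <= s <= T ->
     V s w a 0 = V t w a 0 + Rintegral lam `[t, s] (b a ^~ w) + I a s w})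
  (jPhi : jcont t T Phi) (jFt : jcont t T Ft) (jG : forall a, jcont t T (G a))
  (jQ : forall a c, jcont t T (Q a c))
  (bPhi : forall s x, t <= s <= T -> `|Phi s x| <= K)
  (bFt : forall s x, t <= s < T -> `|Ft s x| <= K)
  (bG : forall a s x, t <= s <= T -> `|G a s x| <= K)
  (bQ : forall a c s x, t <= s <= T -> `|Q a c s x| <= K)
  (mvt : forall (u v : R) (y : 'cV[R]_N), t <= u -> u < v -> v <= T -> exists2 r, u < r < v &
     Phi v y - Phi u y = Ft r y * (v - u))
  (taylor : forall (u : R) (x y : 'cV[R]_N), t <= u <= T -> exists2 xi : 'cV[R]_N,
     forall a, `|xi a 0 - x a 0| <= `|y a 0 - x a 0| &
     Phi u y - Phi u x = \sum_a G a u x * (y a 0 - x a 0) +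
       2^-1 * \sum_a \sum_c Q a c u xi * ((y a 0 - x a 0) * (y c 0 - x c 0))).

Let nd u v w := \sum_a (V v w a 0 - V u w a 0) ^+ 2.
Let Rm u v w := Phi u (V v w) - Phi u (V u w) - \sum_a G a u (V u w) * (V v w a 0 - V u w a 0) -
  2^-1 * \sum_a \sum_c Q a c u (V u w) * ((V v w a 0 - V u w a 0) * (V v w c 0 - V u w c 0)).
(** Second-order Taylor remainder relative to the squared increment. It is bounded by 2 K N and
    tends to 0 along each path with the mesh, by continuity of the second derivatives [Q]; it is 0
    by convention where the increment vanishes. *)
Let er u v w := `|Rm u v w| / nd u v w.

Let nd0 u v w : 0 <= nd u v w.
Proof. by apply: sumr_ge0 => a _; exact: sqr_ge0. Qed.

Let K0 (s : R) (x : 'cV[R]_N) : t <= s <= T -> 0 <= K.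
Proof. by move=> hs; exact: le_trans (normr_ge0 _) (bPhi x hs). Qed.

Let Rm_bound u v w C (hu : t <= u <= T) : 0 <= C ->
  (forall xi : 'cV[R]_N, (forall a, `|xi a 0 - V u w a 0| <= `|V v w a 0 - V u w a 0|) ->
   forall a c, `|Q a c u xi - Q a c u (V u w)| <= C) ->
  `|Rm u v w| <= C * N%:R * nd u v w.
Proof.
move=> C0 hC; have [xi hxi e] := taylor (V u w) (V v w) hu.
rewrite /Rm e (_ : _ - _ - _ = 2^-1 * \sum_a \sum_c (Q a c u xi - Q a c u (V u w)) *
   ((V v w a 0 - V u w a 0) * (V v w c 0 - V u w c 0))).
  rewrite normrM ger0_norm ?invr_ge0//.
  apply: (@le_trans _ _ (1 * (C * N%:R * nd u v w))); last by rewrite mul1r.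
  apply: ler_pM => //; first by rewrite invf_le1//; lra.
  exact: (@quad_le _ _ (fun a c => Q a c u xi - Q a c u (V u w)) C (fun a => V v w a 0 - V u w a 0) (hC xi hxi)).
have -> : \sum_a \sum_c (Q a c u xi - Q a c u (V u w)) * ((V v w a 0 - V u w a 0) * (V v w c 0 - V u w c 0)) =
  \sum_a \sum_c Q a c u xi * ((V v w a 0 - V u w a 0) * (V v w c 0 - V u w c 0)) -
  \sum_a \sum_c Q a c u (V u w) * ((V v w a 0 - V u w a 0) * (V v w c 0 - V u w c 0)).
  rewrite -sumrB; apply: eq_bigr => a _; rewrite -sumrB; apply: eq_bigr => c _; ring.
ring.
Qed.

Let er_bound u v w C (hu : t <= u <= T) : 0 <= C ->
  (forall xi : 'cV[R]_N, (forall a, `|xi a 0 - V u w a 0| <= `|V v w a 0 - V u w a 0|) ->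
   forall a c, `|Q a c u xi - Q a c u (V u w)| <= C) ->
  0 <= er u v w <= C * N%:R.
Proof.
move=> C0 hC; rewrite /er divr_ge0//=.
have [n0|n0] := eqVneq (nd u v w) 0; first by rewrite n0 invr0 mulr0 mulr_ge0.
by rewrite ler_pdivrMr ?lt_neqAle ?nd0 ?[0 == _]eq_sym ?n0//; exact: Rm_bound.
Qed.

Let er_le u v w : t <= u <= T -> 0 <= er u v w <= 2 * K * N%:R.
Proof.
move=> hu; have k0 := K0 0 hu.
apply: er_bound => //; first by rewrite mulr_ge0.
move=> xi _ a c; apply: le_trans (ler_normB _ _) _.
by have := bQ a c xi hu; have := bQ a c (V u w) hu; lra.
Qed.

Let Rm_le u v w : t <= u <= T -> `|Rm u v w| <= er u v w * nd u v w.
Proof.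
move=> hu; have k0 := K0 0 hu.
have [n0|n0] := eqVneq (nd u v w) 0; last by rewrite /er divfK.
rewrite n0 mulr0 -[leRHS](mulr0 (2 * K * N%:R)) -n0; apply: Rm_bound => //.
  by rewrite mulr_ge0.
move=> xi _ a c; apply: le_trans (ler_normB _ _) _.
by have := bQ a c xi hu; have := bQ a c (V u w) hu; lra.
Qed.

Let mV s a : t <= s <= T -> measurable_fun setT (fun w => V s w a 0).
Proof. by move=> hs; exact: Fm_meas hs ((vV a).2 s hs). Qed.

Let mcomp phi u v : jcont t T phi -> t <= u <= T -> t <= v <= T -> measurable_fun setT (fun w => phi u (V v w)).
Proof.
move=> jc /andP[u1 u2] hv.
have := @jcont_meas R N _ Om phi t T (fun=> u) (V v) tT jc (measurable_cst _) (fun a => mV a hv).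
by apply: eq_measurable_fun => w _; rewrite (min_idPr u2) (max_idPr u1).
Qed.

Let m_er u v : t <= u <= T -> t <= v <= T -> measurable_fun setT (er u v).
Proof.
move=> hu hv.
have mD a : measurable_fun setT (fun w => V v w a 0 - V u w a 0) by apply: measurable_funB; exact: mV.
apply: measurable_funM; last by apply: meas_inv; apply: measurable_sum => a; exact: measurable_funX.
apply: measurableT_comp => //.
apply: measurable_funB; last first.
  apply: measurable_funM => //; apply: measurable_sum => a; apply: measurable_sum => c.
  by apply: measurable_funM; [exact: (mcomp (jQ a c))|exact: measurable_funM].
apply: measurable_funB; last first.
  by apply: measurable_sum => a; apply: measurable_funM; [exact: (mcomp (jG a))|exact: mD].
by apply: measurable_funB; exact: (mcomp jPhi).
Qed.

Let near_V w tau eps : t <= tau <= T -> 0 < eps -> exists2 eta, 0 < eta &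
  forall s, t <= s <= T -> `|s - tau| < eta -> forall a, `|V s w a 0 - V tau w a 0| < eps.
Proof.
move=> ht e0.
have ex a : exists ei : R, 0 < ei /\ forall u, t <= u <= T -> `|u - tau| < ei -> `|V u w a 0 - V tau w a 0| < eps.
  by have [ei ei0 h] := (eps_within t T _).1 ((vV a).1 w) tau ht eps e0; exists ei; split.
have [f hf] := choice ex.
exists (\big[Num.min/1]_a f a) => [|u hu us a].
  by elim/big_ind : _ => // [x y x0 y0|a _]; [rewrite lt_min x0|have [] := hf a].
by apply: (hf a).2 => //; apply: lt_le_trans us _; exact: bigmin_le_cond.
Qed.

Let er_cvg e tau w : e <= T -> t < tau <= e -> forall eps, 0 < eps -> exists2 eta, 0 < eta & forall u v,
     t <= u -> u < tau -> tau <= v -> v <= e -> v - u < eta -> `|er u v w ^+ 2 - 0| < eps.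
Proof.
move=> eT /andP[ttau taue] eps eps0.
have ht : t <= tau <= T by rewrite (ltW ttau) (le_trans taue).
(* Chosen so that 2 eps1 N < min (1, eps): then [er] is below both 1 and eps, and so is its
   square. *)
pose eps1 := Num.min 1 eps / (2 * (N%:R + 1)).
have N1 : 0 < N%:R + 1 :> R by rewrite ltr_wpDl.
have m0 : 0 < Num.min 1 eps by rewrite lt_min ltr01.
have eps10 : 0 < eps1 by rewrite divr_gt0// mulr_gt0.
have ex (ac : 'I_N * 'I_N) : exists ei : R, 0 < ei /\ forall u (y : 'cV[R]_N), t <= u <= T -> `|u - tau| < ei ->
    (forall i, `|y i 0 - V tau w i 0| < ei) -> `|Q ac.1 ac.2 u y - Q ac.1 ac.2 tau (V tau w)| < eps1.
  by have [ei ei0 h] := jQ ac.1 ac.2 (V tau w) ht eps10; exists ei; split.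
have [f hf] := choice ex.
pose ei := \big[Num.min/1]_ac f ac.
have ei0 : 0 < ei by rewrite /ei; elim/big_ind : _ => // [x y x0 y0|ac _]; [rewrite lt_min x0|have [] := hf ac].
(* Both ends of the cell are within ei / 4 of V_tau, so xi is within ei / 2 of V_u and within 3 ei /
   4 of V_tau. *)
have ei4 : 0 < ei / 4 by lra.
have [eta eta0 hV] := near_V w ht ei4.
exists (Num.min eta ei) => [|u v tu ut tv ve]; first by rewrite lt_min eta0.
rewrite lt_min => /andP[uv1 uv2].
have hu : t <= u <= T by rewrite tu (le_trans (ltW ut))// (le_trans taue).
have hv : t <= v <= T by rewrite (le_trans (ltW ttau))//= (le_trans ve).
have du : `|u - tau| < eta by rewrite ltr0_norm ?subr_lt0//; lra.
have dv : `|v - tau| < eta by rewrite ger0_norm ?subr_ge0//; lra.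
have du' : `|u - tau| < ei by rewrite ltr0_norm ?subr_lt0//; lra.
have qn (y : 'cV[R]_N) : (forall i, `|y i 0 - V tau w i 0| < ei) -> forall a c, `|Q a c u y - Q a c tau (V tau w)| < eps1.
  move=> hy a c; apply: (hf (a, c)).2 => //.
    by apply: lt_le_trans du' _; exact: bigmin_le_cond.
  by move=> i; apply: lt_le_trans (hy i) _; exact: bigmin_le_cond.
have eb : 0 <= er u v w <= (2 * eps1) * N%:R.
  apply: er_bound => //; first by rewrite mulr_ge0// ltW.
  move=> xi hxi a c.
  have n1 i : `|V u w i 0 - V tau w i 0| < ei by apply: lt_trans (hV u hu du i) _; lra.
  have n2 i : `|xi i 0 - V tau w i 0| < ei.
    have h1 := hV u hu du i; have h2 := hV v hv dv i; have h3 := hxi i.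
    have := ler_distD (V u w i 0) (xi i 0) (V tau w i 0).
    have := ler_distD (V tau w i 0) (V v w i 0) (V u w i 0).
    by rewrite [`|V tau w i 0 - V u w i 0|]distrC; lra.
  have := qn _ n1 a c; have := qn _ n2 a c.
  have := ler_distD (Q a c tau (V tau w)) (Q a c u xi) (Q a c u (V u w)).
  by rewrite [`|Q a c tau _ - Q a c u (V u w)|]distrC; lra.
have /andP[e0 e1] := eb.
have e2 : er u v w < Num.min 1 eps.
  apply: le_lt_trans e1 _.
  have -> : 2 * eps1 * N%:R = Num.min 1 eps * (N%:R / (N%:R + 1)).
    by rewrite /eps1; field; rewrite gt_eqF.
  by rewrite gtr_pMr// ltr_pdivrMr// mul1r ltrDl.
move: e2; rewrite lt_min => /andP[e2 e3].
rewrite subr0 ger0_norm ?sqr_ge0//; apply: le_lt_trans e3.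
by rewrite expr2 ler_piMl// ltW.
Qed.

Section OneStep.
Variables (S : 'I_N -> simple_process B) (KS th eta u v : R).
Hypotheses (KS0 : 0 <= KS)
  (hS : forall a r s, t <= r -> r <= s -> s <= T ->
   L1 P setT (fun w => (simple_int (S a) s w - simple_int (S a) r w) ^+ 4) /\
   E (fun w => (simple_int (S a) s w - simple_int (S a) r w) ^+ 4) <= KS * (s - r) ^+ 2)
  (th0 : 0 < th) (eta0 : 0 < eta) (tu : t <= u) (uv : u < v) (vT : v <= T).
Let hu : t <= u <= T. Proof. by rewrite tu (le_trans (ltW uv)). Qed.
Let hv : t <= v <= T. Proof. by rewrite (le_trans tu (ltW uv)). Qed.
Let be a w := Rintegral lam `[u, v] (b a ^~ w).
Let io a w := I a v w - I a u w.
Let si a w := simple_int (S a) v w - simple_int (S a) u w.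
Let C1 := 2 * (2 * K * N%:R) + 2^-1 * (K * N%:R) * (1 + th^-1).
Let C2 := 2^-1 * (K * N%:R) * th.
Let C3 := 4 * (2 * K * N%:R).
Let kk : 0 <= K. Proof. exact: K0 0 hu. Qed.

Let Lbuv a : L2 mu (Dom u v) (fun p => b a p.1 p.2).
Proof. exact: (L2_Dom (f := b a) tu vT (Lb a)). Qed.

Let L1buv a : L1 mu (Dom u v) (fun p => b a p.1 p.2).
Proof. by apply: L2_L1 (Lbuv a); [exact: mDom|exact: mu_Dom]. Qed.

Let be_sq a : L2 P setT (be a) /\ E2 (be a) <= (v - u) * \int[mu]_(p in Dom u v) (b a p.1 p.2 ^+ 2).
Proof. exact: (Rint_E2 tu (ltW uv) vT (Lb a)). Qed.

Let L_io a : L2 P setT (io a) /\ E2 (io a) = n2 u v (H a).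
Proof.
have [_ FI _] := ito_approx tT (iI a).
split; first by apply: L2B => //; [exact: (FI v hv).2|exact: (FI u hu).2].
by rewrite -(ito_E2 tT (iI a) tu (ltW uv) vT).
Qed.

Let L_is a : L2 P setT (fun w => io a w - si a w) /\
   E2 (fun w => io a w - si a w) = n2 u v (fun s w => H a s w - simple_val (S a) s w).
Proof.
have iJ := is_ito_lin tT (-1) (iI a) (simple_is_ito tT (S a)).
have [_ FI _] := ito_approx tT iJ.
have e w : (I a v w + -1 * simple_int (S a) v w) - (I a u w + -1 * simple_int (S a) u w) = io a w - si a w.
  by rewrite /io /si; ring.
split.
  by apply: eq_L2 (L2B measurableT (FI v hv).2 (FI u hu).2) => // w _.
transitivity (n2 u v (fun s w => H a s w + -1 *: simple_val (S a) s w)).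
  by rewrite -(ito_E2 tT iJ tu (ltW uv) vT); apply: eq_E => w _; rewrite -e.
by apply: eq_E => p _; rewrite scaleN1r.
Qed.

Let bd w := C1 * (\sum_a be a w ^+ 2) + C2 * (\sum_a io a w ^+ 2) + C3 * (\sum_a (io a w - si a w) ^+ 2) +
  N%:R * (v - u) / eta * er u v w ^+ 2 + 4 * eta / (v - u) * \sum_a si a w ^+ 4.

Let X w := Phi u (V v w) - Phi u (V u w) - \sum_a G a u (V u w) * (be a w + io a w) -
  2^-1 * \sum_a \sum_c Q a c u (V u w) * (io a w * io c w).

(** The Taylor remainder is at most [er] times the squared increment. A general Ito increment io has
    no fourth moment at hand, so it is replaced by the simple integral si at the price of |io -
    si|^2. The product of er and si^2 is then split by Young: (v - u) er^2 / eta vanishes with the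
    mesh, and eta si^4 / (v - u) adds up to order eta by the fourth-moment bound. *)
Let X_le : {ae P, forall w, setT w -> `|X w| <= bd w}.
Proof.
have aeb : {ae P, forall w, forall a, L1 lam `[t, T] (b a ^~ w)}.
  apply: filter_forall => a.
  have iT : L1 mu (Dom t T) (fun p => b a p.1 p.2) by apply: L2_L1 (Lb a); [exact: mDom|exact: mu_Dom].
  by have [_ []] := Dom_fubini (f := b a) iT.
move: aeb eV; apply: filterS2 => w hb hw _.
have uT := le_trans (ltW uv) vT.
have dV a : V v w a 0 - V u w a 0 = be a w + io a w.
  rewrite (hw v a hv) (hw u a hu) /be /io.
  rewrite (Rint_chasles tu (ltW uv) (L1_sub (lexx t) vT (hb a))); ring.
have -> : X w = Rm u v w + 2^-1 * \sum_a \sum_c Q a c u (V u w) * ((be a w + io a w) * (be c w + io c w) - io a w * io c w).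
  rewrite /Rm /X.
  have -> : \sum_a \sum_c Q a c u (V u w) * ((be a w + io a w) * (be c w + io c w) - io a w * io c w) =
    \sum_a \sum_c Q a c u (V u w) * ((V v w a 0 - V u w a 0) * (V v w c 0 - V u w c 0)) -
    \sum_a \sum_c Q a c u (V u w) * (io a w * io c w).
    rewrite -sumrB; apply: eq_bigr => a _; rewrite -sumrB; apply: eq_bigr => c _.
    by rewrite !dV; ring.
  have -> : \sum_a G a u (V u w) * (V v w a 0 - V u w a 0) = \sum_a G a u (V u w) * (be a w + io a w).
    by apply: eq_bigr => a _; rewrite dV.
  ring.
apply: le_trans (ler_normD _ _) _.
have h1 := Rm_le v w hu; have /andP[er0 er1] := er_le v w hu.
have h2 := quad_diff_le (q := fun a c => Q a c u (V u w)) (be ^~ w) (io ^~ w) th0 (fun a c => bQ a c (V u w) hu).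
have h3 : nd u v w <= 2 * (\sum_a be a w ^+ 2) + 2 * (\sum_a io a w ^+ 2).
  rewrite !mulr_sumr -big_split/=; apply: ler_sum => a _; rewrite dV; exact: sqrD2.
have h4 : \sum_a io a w ^+ 2 <= 2 * (\sum_a (io a w - si a w) ^+ 2) + 2 * (\sum_a si a w ^+ 2).
  rewrite !mulr_sumr -big_split/=; apply: ler_sum => a _.
  by rewrite -{1}(subrK (si a w) (io a w)); exact: sqrD2.
have uv0 : 0 < v - u by rewrite subr_gt0.
have h5 : er u v w * (\sum_a si a w ^+ 2) <= N%:R * (v - u) / (4 * eta) * er u v w ^+ 2 + eta / (v - u) * \sum_a si a w ^+ 4.
  have -> : N%:R * (v - u) / (4 * eta) * er u v w ^+ 2 = \sum_(a < N) ((v - u) / (4 * eta) * er u v w ^+ 2).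
    by rewrite sumr_const card_ord -[RHS]mulr_natl; ring.
  rewrite !mulr_sumr -big_split/=; apply: ler_sum => a _.
  have : 0 <= eta / (v - u) * (si a w ^+ 2 - (v - u) / (2 * eta) * er u v w) ^+ 2.
    by rewrite mulr_ge0 ?sqr_ge0// divr_ge0// ltW.
  have -> : eta / (v - u) * (si a w ^+ 2 - (v - u) / (2 * eta) * er u v w) ^+ 2 =
    eta / (v - u) * si a w ^+ 4 - er u v w * si a w ^+ 2 + (v - u) / (4 * eta) * er u v w ^+ 2.
    by field; rewrite !gt_eqF.
  by lra.
have s0 (f : 'I_N -> R) : 0 <= \sum_a f a ^+ 2 by apply: sumr_ge0 => a _; exact: sqr_ge0.
have sb0 := s0 (be ^~ w); have si0 := s0 (io ^~ w); have ss0 := s0 (fun a => io a w - si a w).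
have q1 : er u v w * nd u v w <= 2 * (2 * K * N%:R) * (\sum_a be a w ^+ 2) +
    (4 * (2 * K * N%:R) * (\sum_a (io a w - si a w) ^+ 2) + 4 * (er u v w * (\sum_a si a w ^+ 2))).
  apply: le_trans (ler_wpM2l er0 h3) _; rewrite mulrDr; apply: lerD.
    by rewrite mulrCA -[leRHS]mulrA ler_wpM2l// ler_wpM2r.
  rewrite mulrCA; apply: le_trans (ler_wpM2l (_ : 0 <= 2) (ler_wpM2l er0 h4)) _ => //.
  rewrite mulrDr; have := ler_wpM2r ss0 er1.
  by move: (er u v w) (\sum_a (io a w - si a w) ^+ 2) (\sum_a si a w ^+ 2) => x y z; lra.
have q2 : `|2^-1 * \sum_a \sum_c Q a c u (V u w) * ((be a w + io a w) * (be c w + io c w) - io a w * io c w)| <=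
   2^-1 * (K * N%:R) * (1 + th^-1) * (\sum_a be a w ^+ 2) + C2 * (\sum_a io a w ^+ 2).
  rewrite normrM ger0_norm ?invr_ge0//; apply: le_trans (ler_wpM2l _ h2) _; first by rewrite invr_ge0.
  by rewrite le_eqVlt; apply/orP; left; apply/eqP; rewrite /C2; ring.
apply: le_trans (lerD (le_trans h1 q1) q2) _; rewrite /bd /C1 /C3.
have -> : N%:R * (v - u) / eta * er u v w ^+ 2 = 4 * (N%:R * (v - u) / (4 * eta) * er u v w ^+ 2).
  by field; rewrite gt_eqF.
have -> : 4 * eta / (v - u) * \sum_a si a w ^+ 4 = 4 * (eta / (v - u) * \sum_a si a w ^+ 4) by ring.
move: h5; move: (er u v w * (\sum_a si a w ^+ 2)) (N%:R * (v - u) / (4 * eta) * er u v w ^+ 2)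
  (eta / (v - u) * \sum_a si a w ^+ 4) => x y z; lra.
Qed.

Let L_er : L2 P setT (er u v).
Proof.
apply: (@L2_bounded _ _ _ P setT measurableT (2 * K * N%:R)); first exact: PT_lty.
  exact: m_er.
by move=> w _; have /andP[h1 h2] := er_le v w hu; rewrite ger0_norm.
Qed.

Let i_be : L1 P setT (fun w => \sum_a be a w ^+ 2).
Proof. by apply: L1_sum => // a _; exact: L2_sq (be_sq a).1. Qed.
Let i_io : L1 P setT (fun w => \sum_a io a w ^+ 2).
Proof. by apply: L1_sum => // a _; exact: L2_sq (L_io a).1. Qed.
Let i_is : L1 P setT (fun w => \sum_a (io a w - si a w) ^+ 2).
Proof. by apply: L1_sum => // a _; exact: L2_sq (L_is a).1. Qed.
Let i_si : L1 P setT (fun w => \sum_a si a w ^+ 4).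
Proof. by apply: L1_sum => // a _; exact: (hS a tu (ltW uv) vT).1. Qed.

Let i_bd : L1 P setT bd.
Proof.
by rewrite /bd; repeat apply: L1D => //; apply: L1Z => //; exact: L2_sq L_er.
Qed.

Let E_bd : E bd <= C1 * ((v - u) * \sum_a \int[mu]_(p in Dom u v) (b a p.1 p.2 ^+ 2)) + C2 * (\sum_a n2 u v (H a)) +
  C3 * (\sum_a n2 u v (fun s w => H a s w - simple_val (S a) s w)) +
  N%:R / eta * ((v - u) * E2 (er u v)) + 4 * eta * (N%:R * KS) * (v - u).
Proof.
have uv0 : 0 < v - u by rewrite subr_gt0.
have c1 : 0 <= C1.
  by rewrite /C1 addr_ge0 ?mulr_ge0 ?invr_ge0 ?addr_ge0 ?invr_ge0 ?(ltW th0)// kk.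
have c2 : 0 <= C2 by rewrite /C2 !mulr_ge0 ?invr_ge0 ?(ltW th0)// kk.
have c3 : 0 <= C3 by rewrite /C3 !mulr_ge0// kk.
rewrite /bd.
have j1 := L1Z measurableT C1 i_be; have j2 := L1Z measurableT C2 i_io; have j3 := L1Z measurableT C3 i_is.
have j4 := L1Z measurableT (N%:R * (v - u) / eta) (L2_sq L_er).
have j5 := L1Z measurableT (4 * eta / (v - u)) i_si.
have j12 := L1D measurableT j1 j2; have j123 := L1D measurableT j12 j3; have j1234 := L1D measurableT j123 j4.
rewrite (ED measurableT j1234 j5) (ED measurableT j123 j4) (ED measurableT j12 j3) (ED measurableT j1 j2).
rewrite (EZ measurableT _ i_be) (EZ measurableT _ i_io) (EZ measurableT _ i_is) (EZ measurableT _ (L2_sq L_er)) (EZ measurableT _ i_si).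
apply: lerD; [apply: lerD; [apply: lerD; [apply: lerD|]|]|].
- rewrite ler_wpM2l// mulr_sumr (E_sum measurableT); last by move=> a _; exact: L2_sq (be_sq a).1.
  by apply: ler_sum => a _; have [_] := be_sq a.
- rewrite ler_wpM2l// (E_sum measurableT); last by move=> a _; exact: L2_sq (L_io a).1.
  by apply: ler_sum => a _; rewrite -(L_io a).2.
- rewrite ler_wpM2l// (E_sum measurableT); last by move=> a _; exact: L2_sq (L_is a).1.
  by apply: ler_sum => a _; rewrite -(L_is a).2.
- by rewrite le_eqVlt; apply/orP; left; apply/eqP; rewrite /E2; ring.
- rewrite (E_sum measurableT); last by move=> a _; exact: (hS a tu (ltW uv) vT).1.
  apply: (@le_trans _ _ (4 * eta / (v - u) * \sum_(a < N) (KS * (v - u) ^+ 2))).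
    rewrite ler_wpM2l ?divr_ge0 ?mulr_ge0 ?(ltW eta0) ?(ltW uv0)//.
    by apply: ler_sum => a _; exact: (hS a tu (ltW uv) vT).2.
  rewrite sumr_const card_ord -mulr_natl le_eqVlt; apply/orP; left; apply/eqP; field.
  by rewrite gt_eqF.
Qed.

Let mVu phi : jcont t T phi -> (forall s x, t <= s <= T -> `|phi s x| <= K) ->
  [/\ Fm u (fun w => phi u (V u w)), bnd (fun w => phi u (V u w)) & measurable_fun setT (fun w => phi u (V u w))].
Proof.
move=> jc bc; have h := (comp_cproc tT jc vV).2 u hu; split => //; last exact: Fm_meas hu h.
by exists K => w; exact: bc.
Qed.

(** In expectation the first-order Ito term vanishes as a martingale increment and the second-order
    one becomes a bracket, since their coefficients are taken at the left end u and are bounded and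
    F_u-measurable. *)
Lemma one_step : `|E (fun w => Phi v (V v w)) - E (fun w => Phi u (V u w)) -
   (E (fun w => Phi v (V v w) - Phi u (V v w)) +
    \sum_a \int[mu]_(p in Dom u v) (G a u (V u p.2) * b a p.1 p.2) +
    2^-1 * \sum_a \sum_c \int[mu]_(p in Dom u v) (Q a c u (V u p.2) * dotv (H a p.1 p.2) (H c p.1 p.2)))| <=
  C1 * ((v - u) * \sum_a \int[mu]_(p in Dom u v) (b a p.1 p.2 ^+ 2)) + C2 * (\sum_a n2 u v (H a)) +
  C3 * (\sum_a n2 u v (fun s w => H a s w - simple_val (S a) s w)) +
  N%:R / eta * ((v - u) * E2 (er u v)) + 4 * eta * (N%:R * KS) * (v - u).
Proof.
have iPhi r s : t <= r <= T -> t <= s <= T -> L1 P setT (fun w => Phi r (V s w)).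
  move=> hr hs; apply: (@L1_bounded _ _ _ P setT measurableT K); [exact: PT_lty|exact: mcomp jPhi hr hs|].
  by move=> w _; exact: bPhi.
have [_ FI _] := all_and3 (fun a => ito_approx tT (iI a)).
have iGb a : L1 P setT (fun w => G a u (V u w) * be a w) /\
    E (fun w => G a u (V u w) * be a w) = \int[mu]_(p in Dom u v) (G a u (V u p.2) * b a p.1 p.2).
  have [_ [C hC] mG] := mVu (jG a) (bG a).
  have iGD : L1 mu (Dom u v) (fun p => G a u (V u p.2) * b a p.1 p.2).
    apply: (@L1bM _ _ _ mu (Dom u v) mDom C (fun p => G a u (V u p.2)) (fun p => b a p.1 p.2)).
    - exact: (measurable_snd_Dom (f := fun w => G a u (V u w))).
    - by move=> p _; exact: hC.
    - exact: L1buv.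
  have [i1 [e1 _]] := Dom_fubini (f := fun r w => G a u (V u w) * b a r w) iGD.
  have [_ [_ ae1]] := Dom_fubini (f := b a) (L1buv a).
  have i2 : L1 P setT (fun w => G a u (V u w) * be a w).
    apply: (@L1bM _ _ _ P setT measurableT C) => //.
    exact: (L2_L1 measurableT (PT_lty B) (be_sq a).1).
  split => //; rewrite -e1; apply: E_ae => //; [exact: L1_meas i2|exact: L1_meas i1|].
  by move: ae1; apply: filterS => w h _; rewrite EZ.
have iGi a : L1 P setT (fun w => G a u (V u w) * io a w) /\ E (fun w => G a u (V u w) * io a w) = 0.
  have [FG bGu mG] := mVu (jG a) (bG a).
  have [C hC] := bGu.
  split; first by apply: (@L1bM _ _ _ P setT measurableT C) => //; exact: (L2_L1 measurableT (PT_lty B) (L_io a).1).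
  by apply: (ito_martingale tT (iI a)).2 => //; [exact: ltW|exact: L2_bnd].
have iQ a c : L1 P setT (fun w => Q a c u (V u w) * (io a w * io c w)) /\
   E (fun w => Q a c u (V u w) * (io a w * io c w)) =
   \int[mu]_(p in Dom u v) (Q a c u (V u p.2) * dotv (H a p.1 p.2) (H c p.1 p.2)).
  have [FQ bQu mQ] := mVu (jQ a c) (bQ a c).
  have [C hC] := bQu.
  split; last exact: (ito_bracket2 tT (iI a) (iI c) tu (ltW uv) vT FQ bQu).
  by apply: (@L1bM _ _ _ P setT measurableT C) => //; exact: L2M (L_io a).1 (L_io c).1.
have iS1 : L1 P setT (fun w => \sum_a G a u (V u w) * (be a w + io a w)) /\
  E (fun w => \sum_a G a u (V u w) * (be a w + io a w)) = \sum_a \int[mu]_(p in Dom u v) (G a u (V u p.2) * b a p.1 p.2).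
  have h a : L1 P setT (fun w => G a u (V u w) * (be a w + io a w)) /\
     E (fun w => G a u (V u w) * (be a w + io a w)) = \int[mu]_(p in Dom u v) (G a u (V u p.2) * b a p.1 p.2).
    have [i1 e1] := iGb a; have [i2 e2] := iGi a.
    split; first by apply: eq_L1 (L1D measurableT i1 i2) => // w _; rewrite [RHS]mulrDr.
    rewrite -e1 -[RHS]addr0 -e2 -(ED measurableT i1 i2); apply: eq_E => w _; exact: mulrDr.
  split; first by apply: L1_sum => // a _; exact: (h a).1.
  rewrite (E_sum measurableT); last by move=> a _; exact: (h a).1.
  by apply: eq_bigr => a _; exact: (h a).2.
have iS2 : L1 P setT (fun w => \sum_a \sum_c Q a c u (V u w) * (io a w * io c w)) /\
  E (fun w => \sum_a \sum_c Q a c u (V u w) * (io a w * io c w)) =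
  \sum_a \sum_c \int[mu]_(p in Dom u v) (Q a c u (V u p.2) * dotv (H a p.1 p.2) (H c p.1 p.2)).
  split; first by apply: L1_sum => // a _; apply: L1_sum => // c _; exact: (iQ a c).1.
  rewrite (E_sum measurableT); last by move=> a _; apply: L1_sum => // c _; exact: (iQ a c).1.
  apply: eq_bigr => a _; rewrite (E_sum measurableT); last by move=> c _; exact: (iQ a c).1.
  by apply: eq_bigr => c _; exact: (iQ a c).2.
have i1 := iPhi v v hv hv; have i2 := iPhi u u hu hu; have i3 := iPhi u v hu hv.
have i23 := L1B measurableT i3 i2; have iA := L1B measurableT i23 iS1.1.
have iB := L1Z measurableT 2^-1 iS2.1.
have iX : L1 P setT X by exact: (L1B measurableT iA iB).
have EX : E X = E (fun w => Phi v (V v w)) - E (fun w => Phi u (V u w)) -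
   (E (fun w => Phi v (V v w) - Phi u (V v w)) +
    \sum_a \int[mu]_(p in Dom u v) (G a u (V u p.2) * b a p.1 p.2) +
    2^-1 * \sum_a \sum_c \int[mu]_(p in Dom u v) (Q a c u (V u p.2) * dotv (H a p.1 p.2) (H c p.1 p.2))).
  rewrite /X (EB measurableT iA iB) (EB measurableT i23 iS1.1) (EB measurableT i3 i2) (EZ measurableT _ iS2.1).
  by rewrite iS1.2 iS2.2 (EB measurableT i1 i3); ring.
rewrite -EX; apply: le_trans E_bd; apply: le_trans (E_norm measurableT iX) _.
have inX := L1_norm iX.
rewrite -lee_fin -!L1_EFin//.
apply: ae_ge0_le_integral => //.
- by apply/measurable_EFinP; exact: L1_meas inX.
- move=> w _; rewrite lee_fin /bd; have uv0 : 0 < v - u by rewrite subr_gt0.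
  have s0 (f : 'I_N -> R) : 0 <= \sum_a f a ^+ 2 by apply: sumr_ge0 => a _; exact: sqr_ge0.
  have s4 : 0 <= \sum_a si a w ^+ 4 by apply: sumr_ge0 => a _; rewrite exprn_even_ge0.
  have c1 : 0 <= C1.
    by rewrite /C1 addr_ge0 ?mulr_ge0 ?invr_ge0 ?addr_ge0 ?invr_ge0 ?(ltW th0)// kk.
  have c2 : 0 <= C2 by rewrite /C2 !mulr_ge0 ?invr_ge0 ?(ltW th0)// kk.
  have c3 : 0 <= C3 by rewrite /C3 !mulr_ge0// kk.
  have c4 : 0 <= N%:R * (v - u) / eta by rewrite divr_ge0 ?mulr_ge0// ltW.
  have c5 : 0 <= 4 * eta / (v - u) by rewrite divr_ge0 ?mulr_ge0// ltW.
  by rewrite !addr_ge0// mulr_ge0// sqr_ge0.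
- by apply/measurable_EFinP; exact: L1_meas i_bd.
Qed.

End OneStep.

(** * Passage to the limit as the mesh tends to 0 *)

Section Limit.
Variables (e : R).
Hypotheses (te : t < e) (eT : e <= T).
Let te' := ltW te.
Let g k j := grid t e k j.
Let gin k j : t <= g k j <= e.
Proof. exact: grid_in te' k j. Qed.
Let gstep k (j : 'I_k.+1) : g k j.+1 - g k j = (e - t) / k.+1%:R.
Proof. by apply: grid_step; rewrite -ltnS. Qed.
Let glt k (j : 'I_k.+1) : g k j < g k j.+1.
Proof. by rewrite -subr_gt0 gstep divr_gt0// subr_gt0. Qed.

Let LH a : L2p (H a). Proof. by have [] := ito_approx tT (iI a). Qed.
Let Lbe a : L2 mu (Dom t e) (fun p => b a p.1 p.2).
Proof. exact: (L2_Dom (f := b a) (lexx t) eT (Lb a)). Qed.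
Let L1be a : L1 mu (Dom t e) (fun p => b a p.1 p.2).
Proof. by apply: L2_L1 (Lbe a); [exact: mDom|exact: mu_Dom]. Qed.
Let L1dot a c : L1 mu (Dom t e) (fun p => dotv (H a p.1 p.2) (H c p.1 p.2)).
Proof.
apply: (@L1_Dom _ _ _ _ _ t e (fun s w => dotv (H a s w) (H c s w)) (lexx t) eT).
by apply: L1_sum => [|i _]; [exact: mDom|apply: L2M; [exact: mDom|exact: LH|exact: LH]].
Qed.

Let mcomp2 phi : jcont t T phi -> measurable_fun (Dom t e) (fun p : measurableTypeR R * Om => phi p.1 (V p.1 p.2)).
Proof.
move=> jc; apply: measurable_funS (progressive_meas tT (cproc_progressive tT (comp_cproc tT jc vV))).
  exact: mDom.
exact: Dom_sub.
Qed.

Let cvg_left phi f : jcont t T phi -> (forall s x, t <= s <= T -> `|phi s x| <= K) ->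
  L1 mu (Dom t e) (fun p => f p.1 p.2) ->
  (fun k => \sum_(j < k.+1) \int[mu]_(p in Dom (g k j) (g k j.+1)) (phi (g k j) (V (g k j) p.2) * f p.1 p.2)) @ \oo -->
  \int[mu]_(p in Dom t e) (phi p.1 (V p.1 p.2) * f p.1 p.2).
Proof.
move=> jc bc fi; apply: (@stp_cvg _ _ _ _ B _ te (fun u _ w => phi u (V u w)) f (fun s w => phi s (V s w)) K) => //.
- move=> u v tu uv ve; apply: mcomp => //; rewrite tu (le_trans (ltW uv))// (le_trans ve)//.
- move=> u v w tu uv ve; apply: bc; rewrite tu (le_trans (ltW uv))// (le_trans ve)//.
- exact: mcomp2.
move=> tau w /andP[t1 t2] eps eps0.
have ht : t <= tau <= T by rewrite (ltW t1) (le_trans t2).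
have [ei ei0 hei] := jc _ (V tau w) ht _ eps0.
have [eta eta0 heta] := near_V w ht ei0.
exists (Num.min eta ei) => [|u v tu ut tv ve]; first by rewrite lt_min eta0.
rewrite lt_min => /andP[uv1 uv2].
have hu : t <= u <= T by rewrite tu (le_trans (ltW ut))// (le_trans t2).
have du x : v - u < x -> `|u - tau| < x by move=> hx; rewrite ltr0_norm ?subr_lt0//; lra.
by apply: hei => //; [exact: du|move=> i; apply: heta => //; exact: du].
Qed.

(** By the mean value hypothesis the difference quotient in time is [Ft] at an intermediate time r <
    v, hence bounded by K even though [bFt] stops short of T, and it converges by joint
    continuity. *)
Let cvg_time : (fun k => \sum_(j < k.+1) E (fun w => Phi (g k j.+1) (V (g k j.+1) w) - Phi (g k j) (V (g k j.+1) w))) @ \oo -->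
  \int[mu]_(p in Dom t e) Ft p.1 (V p.1 p.2).
Proof.
pose F u v w := (Phi v (V v w) - Phi u (V v w)) / (v - u).
have FE u v w : t <= u -> u < v -> v <= e -> exists2 r, u < r < v & F u v w = Ft r (V v w).
  move=> tu uv ve; have [r hr er1] := mvt (V v w) tu uv (le_trans ve eT).
  by exists r => //; rewrite /F er1 mulfK// subr_eq0 gt_eqF.
have i1 : L1 mu (Dom t e) (fun=> 1) by apply: L1_bounded => [||//|? _]; [exact: mDom|exact: mu_Dom|exact: lexx].
have mF u v : t <= u -> u < v -> v <= e -> measurable_fun setT (F u v).
  move=> tu uv ve; apply: measurable_funM => //.
  have hu : t <= u <= T by rewrite tu (le_trans (ltW uv))// (le_trans ve).
  have hv : t <= v <= T by rewrite (le_trans tu (ltW uv)) (le_trans ve).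
  by apply: measurable_funB; exact: mcomp.
have bF u v w : t <= u -> u < v -> v <= e -> `|F u v w| <= K.
  move=> tu uv ve; have [r /andP[r1 r2] ->] := FE u v w tu uv ve.
  by apply: bFt; rewrite (le_trans tu (ltW r1)) (lt_le_trans r2)// (le_trans ve).
have := @stp_cvg _ _ _ _ B _ te F (fun _ _ => 1) (fun s w => Ft s (V s w)) K mF bF i1 (mcomp2 jFt).
have -> : \int[mu]_(p in Dom t e) (Ft p.1 (V p.1 p.2) * 1) = \int[mu]_(p in Dom t e) Ft p.1 (V p.1 p.2).
  by apply: eq_E => p _; rewrite mulr1.
have -> : (fun k => \sum_(j < k.+1) E (fun w => Phi (g k j.+1) (V (g k j.+1) w) - Phi (g k j) (V (g k j.+1) w))) =
  (fun k => \sum_(j < k.+1) \int[mu]_(p in Dom (g k j) (g k j.+1)) (F (g k j) (g k j.+1) p.2 * 1)).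
  apply/funext => k; apply: eq_bigr => j _.
  have /andP[u1 _] := gin k j; have /andP[_ v2] := gin k j.+1.
  transitivity (\int[mu]_(p in Dom (g k j) (g k j.+1)) F (g k j) (g k j.+1) p.2); last first.
    by apply: eq_E => p _; rewrite mulr1.
  have iF : L1 P setT (F (g k j) (g k j.+1)).
    apply: (@L1_bounded _ _ _ P setT measurableT K); [exact: PT_lty|exact: mF|].
    by move=> w _; exact: bF.
  rewrite (E_param (ltW (glt j)) iF) -(EZ measurableT _ iF); apply: eq_E => w _.
  by rewrite /F mulrC divfK// subr_eq0 gt_eqF// glt.
apply; move=> tau w /andP[t1 t2] eps eps0.
have ht : t <= tau <= T by rewrite (ltW t1) (le_trans t2).
have [ei ei0 hei] := jFt (V tau w) ht eps0.
have [eta eta0 heta] := near_V w ht ei0.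
exists (Num.min eta ei) => [|u v tu ut tv ve]; first by rewrite lt_min eta0.
rewrite lt_min => /andP[uv1 uv2].
have uv := lt_le_trans ut tv.
have [r /andP[r1 r2] ->] := FE u v w tu uv ve.
have hr : t <= r <= T by rewrite (le_trans tu (ltW r1)) (le_trans (ltW r2))// (le_trans ve).
have hv : t <= v <= T by rewrite (le_trans tu (ltW uv)) (le_trans ve).
apply: hei => //; first by rewrite ltr_norml; apply/andP; split; lra.
by move=> i; apply: heta => //; rewrite ger0_norm ?subr_ge0//; lra.
Qed.

Let RHS := \int[mu]_(p in Dom t e) Ft p.1 (V p.1 p.2) +
  \sum_a \int[mu]_(p in Dom t e) (G a p.1 (V p.1 p.2) * b a p.1 p.2) +
  2^-1 * \sum_a \sum_c \int[mu]_(p in Dom t e) (Q a c p.1 (V p.1 p.2) * dotv (H a p.1 p.2) (H c p.1 p.2)).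
Let LHS := E (fun w => Phi e (V e w)) - E (fun w => Phi t (V t w)).
Let A k := \sum_(j < k.+1) (E (fun w => Phi (g k j.+1) (V (g k j.+1) w) - Phi (g k j) (V (g k j.+1) w)) +
    \sum_a \int[mu]_(p in Dom (g k j) (g k j.+1)) (G a (g k j) (V (g k j) p.2) * b a p.1 p.2) +
    2^-1 * \sum_a \sum_c \int[mu]_(p in Dom (g k j) (g k j.+1)) (Q a c (g k j) (V (g k j) p.2) * dotv (H a p.1 p.2) (H c p.1 p.2))).

Let A_cvg : A @ \oo --> RHS.
Proof.
have -> : A = (fun k => \sum_(j < k.+1) E (fun w => Phi (g k j.+1) (V (g k j.+1) w) - Phi (g k j) (V (g k j.+1) w)) +
    \sum_a \sum_(j < k.+1) \int[mu]_(p in Dom (g k j) (g k j.+1)) (G a (g k j) (V (g k j) p.2) * b a p.1 p.2) +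
    2^-1 * \sum_a \sum_c \sum_(j < k.+1) \int[mu]_(p in Dom (g k j) (g k j.+1)) (Q a c (g k j) (V (g k j) p.2) * dotv (H a p.1 p.2) (H c p.1 p.2))).
  apply/funext => k; rewrite /A !big_split/= -mulr_sumr; congr (_ + _ + _ * _); first exact: exchange_big.
  rewrite exchange_big/=; apply: eq_bigr => a _; exact: exchange_big.
apply: cvgD; [apply: cvgD; [exact: cvg_time|]|].
  by apply: cvg_sumr => a; exact: (cvg_left (f := b a) (jG a) (bG a) (L1be a)).
apply: cvgM; [exact: cvg_cst|apply: cvg_sumr => a; apply: cvg_sumr => c].
exact: (cvg_left (f := fun s w => dotv (H a s w) (H c s w)) (jQ a c) (bQ a c) (L1dot a c)).
Qed.

Let Er_cvg : (fun k => \sum_(j < k.+1) ((g k j.+1 - g k j) * E2 (er (g k j) (g k j.+1)))) @ \oo --> (0 : R).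
Proof.
have i1 : L1 mu (Dom t e) (fun=> 1) by apply: L1_bounded => [||//|? _]; [exact: mDom|exact: mu_Dom|exact: lexx].
have er2 u v w : t <= u <= T -> `|er u v w ^+ 2| <= (2 * K * N%:R) ^+ 2.
  move=> hu; have /andP[e0 e1] := er_le v w hu; rewrite ger0_norm ?sqr_ge0//.
  by rewrite ler_sqr// nnegrE (le_trans e0).
have mer u v : t <= u -> u < v -> v <= e -> measurable_fun setT (fun w => er u v w ^+ 2).
  move=> tu uv ve; apply: measurable_funX; apply: m_er.
    by rewrite tu (le_trans (ltW uv))// (le_trans ve).
  by rewrite (le_trans tu (ltW uv)) (le_trans ve).
have ber u v w : t <= u -> u < v -> v <= e -> `|er u v w ^+ 2| <= (2 * K * N%:R) ^+ 2.
  by move=> tu uv ve; apply: er2; rewrite tu (le_trans (ltW uv))// (le_trans ve).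
have := @stp_cvg _ _ _ _ B _ te (fun u v w => er u v w ^+ 2) (fun _ _ => 1) (fun _ _ => 0) _ mer ber i1 (measurable_cst _)
  (fun tau w h => @er_cvg e tau w eT h).
rewrite [X in _ --> X -> _](_ : _ = 0); last by rewrite -[X in _ = X](E0 mu (Dom t e)); apply: eq_E => p _; rewrite mul0r.
suff -> : (fun k => \sum_(j < k.+1) ((g k j.+1 - g k j) * E2 (er (g k j) (g k j.+1)))) =
  (fun k => \sum_(j < k.+1) \int[mu]_(p in Dom (g k j) (g k j.+1)) (er (g k j) (g k j.+1) p.2 ^+ 2 * 1)) by [].
apply/funext => k; apply: eq_bigr => j _.
have /andP[u1 _] := gin k j; have /andP[_ v2] := gin k j.+1.
rewrite -(E_param (ltW (glt j))); first by apply: eq_E => p _; rewrite mulr1.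
apply: (@L1_bounded _ _ _ P setT measurableT ((2 * K * N%:R) ^+ 2)); [exact: PT_lty|exact: mer|].
by move=> w _; exact: ber.
Qed.

(** The mesh tends to 0 while S, th and eta stay fixed. The drift and [er] terms disappear; the
    three terms left do not depend on the mesh. *)
Let bound (S : 'I_N -> simple_process B) (KS th eta : R) : 0 <= KS ->
  (forall a r s, t <= r -> r <= s -> s <= T ->
   L1 P setT (fun w => (simple_int (S a) s w - simple_int (S a) r w) ^+ 4) /\
   E (fun w => (simple_int (S a) s w - simple_int (S a) r w) ^+ 4) <= KS * (s - r) ^+ 2) ->
  0 < th -> 0 < eta ->
  `|LHS - RHS| <= 2^-1 * (K * N%:R) * th * (\sum_a n2 t e (H a)) +
    4 * (2 * K * N%:R) * (\sum_a n2 t e (fun s w => H a s w - simple_val (S a) s w)) +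
    4 * eta * (N%:R * KS) * (e - t).
Proof.
move=> KS0 hS th0 eta0.
set x1 := 2^-1 * (K * N%:R) * th * _; set x2 := 4 * (2 * K * N%:R) * _; set x3 := 4 * eta * _ * _.
pose Cb := (2 * (2 * K * N%:R) + 2^-1 * (K * N%:R) * (1 + th^-1)) * \sum_a \int[mu]_(p in Dom t e) (b a p.1 p.2 ^+ 2).
pose Bk k := Cb * ((e - t) / k.+1%:R) + x1 + x2 +
  N%:R / eta * \sum_(j < k.+1) ((g k j.+1 - g k j) * E2 (er (g k j) (g k j.+1))) + x3.
have Bk_cvg : Bk @ \oo --> x1 + x2 + x3.
  rewrite (_ : x1 + x2 + x3 = Cb * ((e - t) * 0) + x1 + x2 + N%:R / eta * 0 + x3); last by ring.
  apply: cvgD; last exact: cvg_cst.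
  apply: cvgD; last by apply: cvgM; [exact: cvg_cst|exact: Er_cvg].
  apply: cvgD; last exact: cvg_cst.
  apply: cvgD; last exact: cvg_cst.
  apply: cvgM; first exact: cvg_cst.
  by apply: cvgM; [exact: cvg_cst|exact: cvg_harmonic].
have LA : (fun k => `|LHS - A k|) @ \oo --> `|LHS - RHS| by apply: cvg_norm; apply: cvgB; [exact: cvg_cst|exact: A_cvg].
apply: (cvg_le LA Bk_cvg) => k.
have -> : LHS = \sum_(j < k.+1) (E (fun w => Phi (g k j.+1) (V (g k j.+1) w)) - E (fun w => Phi (g k j) (V (g k j) w))).
  rewrite -(big_mkord xpredT (fun j => E (fun w => Phi (g k j.+1) (V (g k j.+1) w)) - E (fun w => Phi (g k j) (V (g k j) w)))).
  by rewrite telescope_sumr// /g grid0 gridN.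
rewrite /A -sumrB; apply: le_trans (ler_norm_sum _ _ _) _.
pose LS a : L2p (fun s w => H a s w - simple_val (S a) s w) := L2pB (LH a) (L2p_simple (S a)).
have -> : Bk k = \sum_(j < k.+1) ((2 * (2 * K * N%:R) + 2^-1 * (K * N%:R) * (1 + th^-1)) *
     ((g k j.+1 - g k j) * \sum_a \int[mu]_(p in Dom (g k j) (g k j.+1)) (b a p.1 p.2 ^+ 2)) +
  2^-1 * (K * N%:R) * th * (\sum_a n2 (g k j) (g k j.+1) (H a)) +
  4 * (2 * K * N%:R) * (\sum_a n2 (g k j) (g k j.+1) (fun s w => H a s w - simple_val (S a) s w)) +
  N%:R / eta * ((g k j.+1 - g k j) * E2 (er (g k j) (g k j.+1))) + 4 * eta * (N%:R * KS) * (g k j.+1 - g k j)).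
  have tot f : L1 mu (Dom t e) (fun p => f p.1 p.2) ->
      \int[mu]_(p in Dom t e) f p.1 p.2 = \sum_(j < k.+1) \int[mu]_(p in Dom (g k j) (g k j.+1)) f p.1 p.2.
    by move=> fi; rewrite -(grid_Dom_split te (leqnn _) fi) gridN.
  rewrite /Bk !big_split/= -!mulr_sumr; congr (_ + _ + _ + _ + _).
  - rewrite /Cb -mulrA; congr (_ * _).
    apply/esym; under eq_bigr do rewrite gstep.
    rewrite -mulr_sumr mulrC; congr (_ * _); rewrite exchange_big/=; apply: eq_bigr => a _.
    apply/esym; exact: (tot (fun s w => b a s w ^+ 2) (L2_sq (Lbe a))).
  - rewrite /x1; congr (_ * _); rewrite exchange_big/=; apply: eq_bigr => a _.
    exact: (tot (fun s w => enorm (H a s w) ^+ 2) (L2p_L1 (lexx t) eT (LH a))).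
  - rewrite /x2; congr (_ * _); rewrite exchange_big/=; apply: eq_bigr => a _.
    exact: (tot (fun s w => enorm (H a s w - simple_val (S a) s w) ^+ 2) (L2p_L1 (lexx t) eT (LS a))).
  - rewrite /x3; congr (_ * _); rewrite -(big_mkord xpredT (fun j => g k j.+1 - g k j)).
    by rewrite telescope_sumr// /g grid0 gridN.
apply: ler_sum => j _.
have /andP[u1 _] := gin k j; have /andP[_ v2] := gin k j.+1.
exact: (one_step hS th0 eta0 u1 (glt j) (le_trans v2 eT)).
Qed.

Let small (c eps : R) : 0 <= c -> 0 < eps -> exists2 x, 0 < x & c * x <= eps.
Proof.
move=> c0 e0; exists (eps / (c + 1)); first by rewrite divr_gt0// ltr_wpDl.
by rewrite mulrCA ger_pMr// ler_pdivrMr ?ltr_wpDl// mul1r lerDl.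
Qed.

(** The three remaining errors are made small in a definite order: th, then the simple processes S,
    then eta, which depends on the fourth-moment constants of S. *)
Lemma dynkin_formula :
  E (fun w => Phi e (V e w)) - E (fun w => Phi t (V t w)) =
  \int[mu]_(p in Dom t e) Ft p.1 (V p.1 p.2) +
  \sum_a \int[mu]_(p in Dom t e) (G a p.1 (V p.1 p.2) * b a p.1 p.2) +
  2^-1 * \sum_a \sum_c \int[mu]_(p in Dom t e) (Q a c p.1 (V p.1 p.2) * dotv (H a p.1 p.2) (H c p.1 p.2)).
Proof.
rewrite -/RHS -/LHS.
have K_0 : 0 <= K by apply: (K0 (s := t) 0); rewrite lexx.
apply/eqP; rewrite -subr_eq0 -normr_le0; apply/ler_addgt0Pr => eps eps0; rewrite add0r.
have e3 : 0 < eps / 3 by lra.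
have sH0 : 0 <= \sum_a n2 t e (H a) by apply: sumr_ge0 => a _; exact: n2_ge0.
have [|th th0 hth] := small _ e3 (c := 2^-1 * (K * N%:R) * \sum_a n2 t e (H a)).
  by rewrite !mulr_ge0 ?invr_ge0.
have [|y y0 hy] := small _ e3 (c := 4 * (2 * K * N%:R) * N%:R); first by rewrite !mulr_ge0.
have ex a : exists S : simple_process B, n2 t e (fun s w => H a s w - simple_val S s w) <= y.
  have [_ _ [S [S1 _]]] := ito_approx tT (iI a).
  have [k _ hk] := cvgr0_norm_lt _ S1 _ y0.
  exists (S k); have := hk k (leqnn k) => /= hk'.
  apply: le_trans (ltW (le_lt_trans (ler_norm _) hk')).
  have LS := L2pB (L2p_simple (S k)) (LH a).
  apply: le_trans (n2_mono (lexx t) eT LS).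
  by rewrite le_eqVlt; apply/orP; left; apply/eqP; apply: eq_E => p _; rewrite !enormc_sq; apply: eq_bigr => i _; rewrite !mxE; ring.
have [S hS] := choice ex.
have ex4 a : exists KS : R, 0 <= KS /\ forall r s, t <= r -> r <= s -> s <= T ->
   L1 P setT (fun w => (simple_int (S a) s w - simple_int (S a) r w) ^+ 4) /\
   E (fun w => (simple_int (S a) s w - simple_int (S a) r w) ^+ 4) <= KS * (s - r) ^+ 2.
  have [KS [KS0 h]] := simple_int_fourth (S a); exists KS; split => // r s h1 h2 h3.
  exact: (h r s h1 h2 h3).2.
have [f hf] := choice ex4.
have f0 : 0 <= \sum_a f a by apply: sumr_ge0 => a _; exact: (hf a).1.
have [|eta eta0 heta] := small _ e3 (c := 4 * (N%:R * \sum_a f a) * (e - t)).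
  by rewrite !mulr_ge0// subr_ge0.
apply: le_trans (bound f0 _ th0 eta0 (S := S)) _.
  move=> a r s tr rs sT; have [h1 h2] := (hf a).2 r s tr rs sT; split => //; apply: le_trans h2 _.
  by rewrite ler_wpM2r ?sqr_ge0// (bigD1 a)//= lerDl; apply: sumr_ge0 => c _; exact: (hf c).1.
have h2 : 4 * (2 * K * N%:R) * (\sum_a n2 t e (fun s w => H a s w - simple_val (S a) s w)) <= eps / 3.
  apply: le_trans hy; rewrite -[leRHS]mulrA ler_wpM2l ?mulr_ge0//.
  rewrite mulr_natl -[X in _ *+ X](card_ord N) -sumr_const; apply: ler_sum => a _; exact: hS.
move: h2 hth heta; rewrite (_ : 4 * eta * (N%:R * \sum_a f a) * (e - t) = 4 * (N%:R * \sum_a f a) * (e - t) * eta); last by ring.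
rewrite (_ : 2^-1 * (K * N%:R) * th * \sum_a n2 t e (H a) = 2^-1 * (K * N%:R) * (\sum_a n2 t e (H a)) * th); last by ring.
move: (_ * th) (4 * (2 * K * N%:R) * _) (_ * eta) => p q r; lra.
Qed.
End Limit.

End Dynkin.

(** * Differential calculus *)

Section JointContinuity.
Context (R : realType) (n : nat) (a b : R).
Implicit Types phi psi : R -> 'cV[R]_n -> R.

Lemma jcontE phi : jcont a b phi <-> forall s x, a <= s <= b ->
  phi u.1 u.2 @[u --> within [set u : R * 'cV[R]_n | a <= u.1 <= b] (nbhs (s, x))] --> phi s x.
Proof.
split=> [jc s x hs|h s x hs e e0].
  apply/cvgrPdist_lt => e e0; have [eta eta0 H] := jc s x hs e e0.
  rewrite near_withinE; apply/nbhs_ballP; exists eta => // -[u y] [/= h1 h2] hu.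
  rewrite distrC; apply: H => //; first by rewrite distrC.
  by move=> i; rewrite distrC; exact: (h2.2 i 0).
have /cvgrPdist_lt/(_ e e0) := h s x hs; rewrite near_withinE => /nbhs_ballP[eta /= eta0 H].
exists eta => // u y hu us yx; rewrite distrC; apply: (H (u, y)) => //; split => /=.
  by rewrite /ball/= distrC.
by split => // i j; rewrite ord1 /ball/= distrC.
Qed.

Lemma jcont_cst c : jcont (n := n) a b (fun _ _ => c).
Proof. by apply/jcontE => s x _; exact: cvg_cst. Qed.

Lemma jcontD phi psi : jcont a b phi -> jcont a b psi -> jcont a b (fun s x => phi s x + psi s x).
Proof. by move=> /jcontE h1 /jcontE h2; apply/jcontE => s x hs; apply: cvgD; [exact: h1|exact: h2]. Qed.

Lemma jcontN phi : jcont a b phi -> jcont a b (fun s x => - phi s x).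
Proof. by move=> /jcontE h1; apply/jcontE => s x hs; apply: cvgN; exact: h1. Qed.

Lemma jcontM phi psi : jcont a b phi -> jcont a b psi -> jcont a b (fun s x => phi s x * psi s x).
Proof. by move=> /jcontE h1 /jcontE h2; apply/jcontE => s x hs; apply: cvgM; [exact: h1|exact: h2]. Qed.

Lemma jcont_sum (I : Type) (r : seq I) (F : I -> R -> 'cV[R]_n -> R) :
  (forall i, jcont a b (F i)) -> jcont a b (fun s x => \sum_(i <- r) F i s x).
Proof. by move=> h; apply/jcontE => s x hs; apply: cvg_sumr => i; move/jcontE: (h i); exact. Qed.

Lemma jcont_comp (f : R -> R) phi : continuous f -> jcont a b phi -> jcont a b (fun s x => f (phi s x)).
Proof. by move=> cf /jcontE h; apply/jcontE => s x hs; apply: continuous_cvg; [exact: cf|exact: h]. Qed.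

Lemma jcont_coord (i : 'I_n) : jcont a b (fun _ (x : 'cV[R]_n) => x i 0).
Proof. by move=> s x hs e e0; exists e => // u y _ _ h; exact: h. Qed.

Lemma jcont_scalar (F : R -> 'cV[R]_n -> R) :
  {within [set u : R * 'cV[R]_n | a <= u.1 <= b], continuous (fun u => F u.1 u.2)} -> jcont a b F.
Proof. by move=> /subspace_continuousP h; apply/jcontE => s x hs; exact: (h (s, x)). Qed.

End JointContinuity.

Section Calculus.
Context (R : realType).
Implicit Types (f g : R -> R) (a l : R).

Lemma derive_eps f a l : is_derive a (1 : R) f l <-> forall e, 0 < e ->
  exists2 eta, 0 < eta & forall h, `|h| < eta -> `|f (a + h) - f a - h * l| <= e * `|h|.
Proof.
have key h e : h != 0 -> (`|l - h^-1 *: (f (h *: 1 + a) - f a)| <= e) = (`|f (a + h) - f a - h * l| <= e * `|h|).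
  move=> h0; rewrite -ler_pdivrMr ?normr_gt0// -normrV ?unitfE// -normrM distrC.
  congr (`|_| <= _); rewrite /GRing.scale/= mulr1 [h + a]addrC; field.
  exact: h0.
split=> [[/cvg_ex[l' /= c] dl] e e0|H].
  have ll : l' = l by rewrite -dl; apply/esym; exact: cvg_lim.
  move: c; rewrite ll => /cvgrPdist_le/(_ e e0); rewrite near_withinE => /nbhs_ballP[eta /= eta0 hh].
  exists eta => // h hl; have [->|h0] := eqVneq h 0; first by rewrite addr0 subrr sub0r mul0r oppr0 normr0 mulr0.
  by rewrite -key//; apply: hh => //; rewrite /ball/= sub0r normrN.
have c : h^-1 *: (f (h *: 1 + a) - f a) @[h --> (0 : R)^'] --> l.
  apply/cvgrPdist_le => e e0; have [eta eta0 hh] := H e e0.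
  rewrite near_withinE; apply/nbhs_ballP; exists eta => // h; rewrite /ball/= sub0r normrN => hl h0.
  by rewrite key//; exact: hh.
by apply: DeriveDef; [exact: cvgP c|exact: cvg_lim c].
Qed.

Lemma derive_shift f a l : is_derive (0 : R) (1 : R) (fun h => f (a + h)) l -> is_derive a (1 : R) f l.
Proof.
move=> /derive_eps H; apply/derive_eps => e e0; have [eta eta0 h] := H e e0; exists eta => // u hu.
by have := h u hu; rewrite add0r addr0.
Qed.

(** Later turns the Lipschitz bound on the gradient into a bound on the Hessian. *)
Lemma derive_le f K l : (forall h, `|f h - f 0| <= K * `|h|) -> is_derive (0 : R) (1 : R) f l -> `|l| <= K.
Proof.
move=> fK /derive_eps H; apply/ler_addgt0Pr => e e0; have [eta eta0 h] := H e e0.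
have h0 : 0 < eta / 2 by rewrite divr_gt0.
have := h (eta / 2); rewrite add0r gtr0_norm// => /(_ _)/wrap[|h1]; first by lra.
have := fK (eta / 2); rewrite (gtr0_norm h0) => h2.
have : `|eta / 2 * l| <= (K + e) * (eta / 2).
  have := ler_distD (f (eta / 2) - f 0) (eta / 2 * l) 0.
  by rewrite !subr0 [`|eta / 2 * l - _|]distrC; lra.
by rewrite normrM (gtr0_norm h0) mulrC ler_pM2r.
Qed.

Lemma derive_continuous f f1 : (forall x, is_derive x (1 : R) f (f1 x)) -> continuous f.
Proof. by move=> h x; apply: differentiable_continuous; apply/derivable1_diffP; have [] := h x. Qed.

Lemma mvt_sym f f1 c : (forall x, is_derive x (1 : R) f (f1 x)) ->
  exists2 r, `|r| <= `|c| & f c - f 0 = f1 r * c.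
Proof.
move=> hf; have cf := derive_continuous hf.
have [c0|c0|<-] := ltrgtP 0 c; last by exists 0; rewrite ?subrr ?mulr0.
  have [r] := MVT c0 (fun x _ => hf x) (continuous_subspaceT cf).
  rewrite in_itv/= subr0 => /andP[r1 r2] e; exists r => //.
  by rewrite !gtr0_norm// ltW.
have [r] := MVT c0 (fun x _ => hf x) (continuous_subspaceT cf).
rewrite in_itv/= sub0r => /andP[r1 r2] e; exists r; last by rewrite -opprB e; ring.
by rewrite !ltr0_norm// lerN2 ltW.
Qed.

(* Rolle's theorem for the remainder [f 1 - f x - f1 x (1 - x) - c (1 - x)^2]. *)
Lemma taylor2 f f1 f2 : (forall x, is_derive x (1 : R) f (f1 x)) -> (forall x, is_derive x (1 : R) f1 (f2 x)) ->
  exists2 r, 0 < r < 1 & f 1 = f 0 + f1 0 + 2^-1 * f2 r.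
Proof.
move=> h1 h2; pose c := f 1 - f 0 - f1 0.
pose k (x : R) : R := 1 - x.
have hk (x : R) : is_derive x (1 : R) k (- 1).
  by apply/derive_eps => e e0; exists 1 => // h _; rewrite /k (_ : 1 - (x + h) - (1 - x) - h * -1 = 0); [rewrite normr0 mulr_ge0// ltW|ring].
pose g := f + f1 * k + cst c * (k * k).
have hg (x : R) : is_derive x (1 : R) g (f2 x * (1 - x) - 2 * c * (1 - x)).
  have H := is_deriveD (is_deriveD (h1 x) (is_deriveM (h2 x) (hk x)))
    (is_deriveM (is_derive_cst c x (1 : R)) (is_deriveM (hk x) (hk x))).
  by apply: (is_derive_eq H); rewrite /GRing.scale/= /cst /k; ring.
have [r] := MVT ltr01 (fun x _ => hg x) (continuous_subspaceT (derive_continuous hg)).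
have -> : g 1 = f 1 by rewrite /g !fctE /cst/= /k subrr !(mulr0, addr0).
have -> : g 0 = f 1 by rewrite /g !fctE /cst/= /k subr0 /c !mulr1; ring.
rewrite in_itv/= subrr subr0 mulr1 => /andP[r1 r2] e; exists r; first by rewrite r1 r2.
have : (1 - r) * (f2 r - 2 * c) = 0 by rewrite [RHS]e; ring.
move/eqP; rewrite mulf_eq0 subr_eq0 gt_eqF//= subr_eq0 => /eqP ->; rewrite /c; lra.
Qed.

Section LineDerivative.
Variables (n : nat) (f : 'cV[R]_n -> R) (p : 'I_n -> 'cV[R]_n -> R).
Hypotheses (hp : forall x i, is_derive (0 : R) (1 : R) (fun h => f (x + h *: delta_mx i 0)) (p i x))
  (cp : forall i (x : 'cV[R]_n) (e : R), 0 < e -> exists2 eta : R, 0 < eta & forall y : 'cV[R]_n,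
     (forall k, `|y k 0 - x k 0| < eta) -> `|p i y - p i x| < e).

Let dp x i h : is_derive h (1 : R) (fun h => f (x + h *: delta_mx i 0)) (p i (x + h *: delta_mx i 0)).
Proof.
have H := hp (x + h *: delta_mx i 0) i.
have e : (fun u => f (x + h *: delta_mx i 0 + u *: delta_mx i 0)) = (fun u => f (x + (h + u) *: delta_mx i 0)).
  by apply/funext => u; rewrite -addrA -scalerDl.
rewrite e in H; exact: (derive_shift (f := fun h => f (x + h *: delta_mx i 0)) H).
Qed.

(** The displacement h v is made one coordinate at a time. The mean value theorem on each step and
    continuity of the partial derivatives give the directional derivative. *)
Lemma line_derive x v : is_derive (0 : R) (1 : R) (fun h => f (x + h *: v)) (\sum_i p i x * v i 0).
Proof.
apply/derive_eps => e e0.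
pose S := 1 + \sum_i `|v i 0|.
have S0 : 0 < S by rewrite ltr_wpDr// sumr_ge0.
have vS i : `|v i 0| < S.
  by rewrite /S (bigD1 i)//= addrCA ltrDl ltr_wpDr// sumr_ge0.
have e1 : 0 < e / S by rewrite divr_gt0.
have ex i : exists eta : R, 0 < eta /\ forall y : 'cV[R]_n, (forall k, `|y k 0 - x k 0| < eta) -> `|p i y - p i x| < e / S.
  by have [eta eta0 h] := cp i x e1; exists eta.
have [F hF] := choice ex.
pose eta := \big[Num.min/1]_i F i.
have eta0 : 0 < eta by rewrite /eta; elim/big_ind : _ => // [y z y0 z0|i _]; [rewrite lt_min y0|have [] := hF i].
exists (eta / S) => [|h]; first by rewrite divr_gt0.
rewrite ltr_pdivlMr// => hS; rewrite add0r scale0r addr0.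
pose w k : 'cV[R]_n := \col_i (if (i < k)%N then v i 0 else 0).
have wS (k : 'I_n) : w k.+1 = w k + v k 0 *: delta_mx k 0.
  apply/matrixP => i j; rewrite !mxE ord1 ltnS leq_eqVlt; have [->|ik] := eqVneq i k.
    by rewrite eqxx ltnn eqxx mulr1 add0r.
  rewrite -val_eqE in ik; rewrite (negbTE ik)/= mulr0 addr0//.
have -> : f (x + h *: v) - f x = \sum_(k < n) (f (x + h *: w k.+1) - f (x + h *: w k)).
  rewrite -(big_mkord xpredT (fun k => f (x + h *: w k.+1) - f (x + h *: w k))) telescope_sumr//.
  congr (f (x + h *: _) - f _); first by apply/matrixP => i j; rewrite !mxE ltn_ord ord1.
  by rewrite -[LHS]addr0; congr (_ + _); apply/matrixP => i j; rewrite !mxE ltn0 mulr0.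
rewrite mulr_sumr -sumrB; apply: le_trans (ler_norm_sum _ _ _) _.
apply: (@le_trans _ _ (\sum_(k < n) (e / S * `|h| * `|v k 0|))); last first.
  rewrite -mulr_sumr mulrAC ler_wpM2r// mulrAC ler_pdivrMr// ler_wpM2l ?(ltW e0)//.
  by rewrite /S lerDr.
apply: ler_sum => k _.
have [r hr er] := mvt_sym (h * v k 0) (dp (x + h *: w k) k).
have -> : x + h *: w k.+1 = x + h *: w k + (h * v k 0) *: delta_mx k 0.
  by rewrite wS scalerDr scalerA addrA.
move: er; rewrite scale0r addr0 => ->.
have -> : p k (x + h *: w k + r *: delta_mx k 0) * (h * v k 0) - h * (p k x * v k 0) =
  (p k (x + h *: w k + r *: delta_mx k 0) - p k x) * h * v k 0 by ring.
rewrite !normrM ler_wpM2r// ler_wpM2r//; apply/ltW/(hF k).2 => i.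
apply: (@lt_le_trans _ _ eta); last exact: bigmin_le_cond.
apply: le_lt_trans hS; have -> : (x + h *: w k + r *: delta_mx k 0) i 0 - x i 0 =
    h * (if (i < k)%N then v i 0 else 0) + r * (i == k)%:R by rewrite !mxE eqxx andbT; ring.
apply: (@le_trans _ _ (`|h| * `|v i 0|)); last by rewrite ler_wpM2l// ltW.
have [->|ik] := eqVneq i k; first by rewrite ltnn mulr0 add0r mulr1 -normrM.
by rewrite mulr0 addr0; case: ifP => _; rewrite ?mulr0 ?normr0 ?mulr_ge0// normrM.
Qed.

End LineDerivative.

End Calculus.

Section RealDerivatives.
Context (R : realType).
Implicit Types (f g : R -> R) (x l : R).

Lemma derive_ext f g x l l' : (forall c, f c = g c) -> l = l' ->
  is_derive x (1 : R) f l -> is_derive x (1 : R) g l'.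
Proof. by move=> /funext -> ->. Qed.

Lemma der_cst (c : R) x : is_derive x (1 : R) (fun=> c) 0.
Proof. exact: is_derive_cst. Qed.

Lemma derD f g x l l' : is_derive x (1 : R) f l -> is_derive x (1 : R) g l' ->
  is_derive x (1 : R) (fun c => f c + g c) (l + l').
Proof. by move=> df dg; exact: is_deriveD. Qed.

Lemma derN f x l : is_derive x (1 : R) f l -> is_derive x (1 : R) (fun c => - f c) (- l).
Proof. by move=> df; exact: is_deriveN. Qed.

Lemma derM f g x l l' : is_derive x (1 : R) f l -> is_derive x (1 : R) g l' ->
  is_derive x (1 : R) (fun c => f c * g c) (l * g x + f x * l').
Proof. by move=> df dg; apply: derive_ext (is_deriveM df dg) => //; rewrite addrC [g x *: l]mulrC. Qed.

Lemma der_sum n (f : 'I_n -> R -> R) x (l : 'I_n -> R) : (forall i, is_derive x (1 : R) (f i) (l i)) ->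
  is_derive x (1 : R) (fun c => \sum_i f i c) (\sum_i l i).
Proof. by move=> df; apply: derive_ext (is_derive_sum df) => // c; rewrite fct_sumE. Qed.

End RealDerivatives.

Section ExpTaylor.
Context (R : realType) (N : nat) (h : 'cV[R]_N -> R) (h1 : 'I_N -> 'cV[R]_N -> R) (h2 : 'I_N -> 'I_N -> 'cV[R]_N -> R).
Hypotheses (dh : forall x v, is_derive (0 : R) (1 : R) (fun c => h (x + c *: v)) (\sum_a h1 a x * v a 0))
  (dh1 : forall a x v, is_derive (0 : R) (1 : R) (fun c => h1 a (x + c *: v)) (\sum_c h2 a c x * v c 0)).

Lemma derive_line (f : 'cV[R]_N -> R) (f1 : 'cV[R]_N -> R) (v : 'cV[R]_N) :
  (forall x, is_derive (0 : R) (1 : R) (fun c => f (x + c *: v)) (f1 x)) ->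
  forall x c, is_derive c (1 : R) (fun c => f (x + c *: v)) (f1 (x + c *: v)).
Proof.
move=> H x c; apply/derive_eps => e e0; have [eta eta0 h'] := (derive_eps _ _ _).1 (H (x + c *: v)) e e0.
by exists eta => // u hu; have := h' u hu; rewrite add0r scale0r addr0 scalerDl addrA.
Qed.

Lemma derive_expN (f : R -> R) x l : is_derive x (1 : R) f l ->
  is_derive x (1 : R) (fun y => expR (- f y)) (- l * expR (- f x)).
Proof.
move=> df; have H := @is_derive1_comp R expR (fun y => - f y) x _ _ (is_derive_expR _) (is_deriveN df).
by apply: is_derive_eq; rewrite mulrC.
Qed.

(** [taylor2] on the segment from x to y. Being a one-dimensional expansion, it gives the same
    intermediate point xi for all pairs (a, c), as Dynkin's formula requires. *)
Lemma exp_taylor (x y : 'cV[R]_N) : exists2 xi : 'cV[R]_N, forall a, `|xi a 0 - x a 0| <= `|y a 0 - x a 0| &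
  expR (- h y) - expR (- h x) = \sum_a (- h1 a x * expR (- h x)) * (y a 0 - x a 0) +
    2^-1 * \sum_a \sum_c ((h1 a xi * h1 c xi - h2 a c xi) * expR (- h xi)) * ((y a 0 - x a 0) * (y c 0 - x c 0)).
Proof.
pose v := y - x; pose F c := expR (- h (x + c *: v)).
pose S z := \sum_a h1 a z * v a 0; pose S2 z := \sum_a (\sum_c h2 a c z * v c 0) * v a 0.
have dF c : is_derive c (1 : R) F (- S (x + c *: v) * F c).
  apply: (@derive_expN (fun c => h (x + c *: v))); apply: (@derive_line h S v) => z; exact: dh.
have dS c : is_derive c (1 : R) (fun c => S (x + c *: v)) (S2 (x + c *: v)).
  have H a : is_derive c (1 : R) (fun c => h1 a (x + c *: v) * v a 0) ((\sum_c' h2 a c' (x + c *: v) * v c' 0) * v a 0).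
    have H1 := @derive_line (h1 a) (fun z => \sum_c h2 a c z * v c 0) v (fun z => dh1 a z v) x c.
    by apply: derive_ext (derM H1 (der_cst (v a 0) c)) => //; rewrite mulr0 addr0.
  exact: der_sum H.
have dF1 c : is_derive c (1 : R) (fun c => - S (x + c *: v) * F c)
    ((S (x + c *: v) ^+ 2 - S2 (x + c *: v)) * F c).
  by apply: derive_ext (derM (derN (dS c)) (dF c)) => //; ring.
have [r /andP[r0 r1]] := taylor2 dF dF1.
rewrite /F scale1r scale0r addr0 [x + v]addrC subrK => e.
exists (x + r *: v) => [a|].
  by rewrite !mxE addrAC subrr add0r normrM (ger0_norm (ltW r0)) ler_piMl// ltW.
have Dv a : y a 0 - x a 0 = v a 0 by rewrite !mxE.
rewrite e; set z := x + r *: v.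
have -> : \sum_a - h1 a x * expR (- h x) * (y a 0 - x a 0) = - S x * expR (- h x).
  by rewrite mulNr mulr_suml -sumrN; apply: eq_bigr => a _; rewrite Dv; ring.
have -> : \sum_a \sum_c (h1 a z * h1 c z - h2 a c z) * expR (- h z) * ((y a 0 - x a 0) * (y c 0 - x c 0)) =
   (S z ^+ 2 - S2 z) * expR (- h z).
  have -> : S z ^+ 2 - S2 z = \sum_a \sum_c (h1 a z * h1 c z - h2 a c z) * (v a 0 * v c 0).
    rewrite expr2 {1}/S mulr_suml -sumrB; apply: eq_bigr => a _; rewrite /S mulr_sumr mulr_suml -sumrB.
    by apply: eq_bigr => c _; ring.
  rewrite mulr_suml; apply: eq_bigr => a _; rewrite mulr_suml; apply: eq_bigr => c _; rewrite !Dv; ring.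
by ring.
Qed.

End ExpTaylor.

Section Extend.
Variables (A : Type) (n : nat).
(** Prepends a coordinate: index 0 will carry the scalar process Y, the other indices the state
    X. *)
Definition fcons (z : A) (f : 'I_n -> A) (a : 'I_n.+1) : A := if unlift ord0 a is Some i then f i else z.
Lemma fcons0 z f : fcons z f ord0 = z. Proof. by rewrite /fcons unlift_none. Qed.
Lemma fconsS z f i : fcons z f (lift ord0 i) = f i. Proof. by rewrite /fcons liftK. Qed.
Lemma fconsP (P : 'I_n.+1 -> Prop) : P ord0 -> (forall i, P (lift ord0 i)) -> forall a, P a.
Proof. by move=> h0 hS a; case: (unliftP ord0 a) => [i ->|->]. Qed.
End Extend.

(** * The Gaussian test function and its bounded derivatives *)

Section TestFunction.
Context (R : realType) (n : nat) (t T K eps : R).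
Context (w wt : R -> 'cV[R]_n -> R) (wx : R -> 'cV[R]_n -> 'cV[R]_n) (wxx : R -> 'cV[R]_n -> 'M[R]_n).
Hypotheses
  (jw : jcont t T w) (jwt : jcont t T wt) (jwx : forall i, jcont t T (fun s x => wx s x i 0))
  (jwxx : forall i j, jcont t T (fun s x => wxx s x i j))
  (dw : forall s x v, t <= s <= T -> is_derive (0 : R) (1 : R) (fun c => w s (x + c *: v)) (\sum_i wx s x i 0 * v i 0))
  (dwx : forall s i x v, t <= s <= T ->
     is_derive (0 : R) (1 : R) (fun c => wx s (x + c *: v) i 0) (\sum_j wxx s x i j * v j 0))
  (dwt : forall s x, t < s < T -> is_derive s (1 : R) (w ^~ x) (wt s x))
  (K1 : 1 <= K) (eps0 : 0 < eps)
  (bwx : forall s x i, t <= s <= T -> wx s x i 0 ^+ 2 <= K * (1 + \sum_j x j 0 ^+ 2))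
  (bwxx : forall s x i j, t <= s <= T -> `|wxx s x i j| <= K)
  (bwt : forall s x, t <= s < T -> `|wt s x| <= K * (1 + \sum_j x j 0 ^+ 2)).
Implicit Types (s : R) (v z : 'cV[R]_n.+1).

Definition px v : 'cV[R]_n := \col_i v (lift ord0 i) 0.
(* On R^(1+n), with v = (y, x), the function exp (- ((y - w s x)^2 + eps |x|^2)) and its derivatives:
   the Gaussian factors make them bounded although w only has quadratic growth. *)
Definition tf_U s v := v 0 0 - w s (px v).
Definition tf_q v := \sum_i (px v) i 0 ^+ 2.
Definition tf_g s v := fcons 1 (fun i => - wx s (px v) i 0).
Definition tf_r v := fcons 0 (fun i => 2 * px v i 0).
Definition tf_k s v a c := fcons 0 (fun i => fcons 0 (fun j => - wxx s (px v) i j) c) a.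
Definition tf_d a c : R := fcons 0 (fun i : 'I_n => fcons 0 (fun j => 2 * (i == j)%:R) c) a.
Definition tf_h s v := tf_U s v ^+ 2 + eps * tf_q v.
Definition tf_h1 s a v := 2 * tf_U s v * tf_g s v a + eps * tf_r v a.
Definition tf_h2 s a c v := 2 * tf_g s v a * tf_g s v c + 2 * tf_U s v * tf_k s v a c + eps * tf_d a c.
Definition tf s v := expR (- tf_h s v).
Definition tf_t s v := 2 * tf_U s v * wt s (px v) * tf s v.
Definition tf_G a s v := - tf_h1 s a v * tf s v.
Definition tf_Q a c s v := (tf_h1 s a v * tf_h1 s c v - tf_h2 s a c v) * tf s v.

Let jpx phi : jcont t T phi -> jcont t T (fun s v => phi s (px v)).
Proof.
move=> jc s v hs e e0; have [eta eta0 H] := jc s (px v) hs e e0.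
by exists eta => // u y hu us yv; apply: H => // i; rewrite !mxE.
Qed.

Let jU : jcont t T tf_U.
Proof. by apply: jcontD; [exact: jcont_coord|exact: jcontN (jpx jw)]. Qed.

Let jg a : jcont t T (fun s v => tf_g s v a).
Proof.
elim/fconsP: a => [|i]; rewrite /tf_g.
  by under eq_fun do under eq_fun do rewrite fcons0; exact: jcont_cst.
by under eq_fun do under eq_fun do rewrite fconsS; exact/jcontN/(jpx (jwx i)).
Qed.

Let jr a : jcont t T (fun _ v => tf_r v a).
Proof.
elim/fconsP: a => [|i]; rewrite /tf_r.
  by under eq_fun do under eq_fun do rewrite fcons0; exact: jcont_cst.
under eq_fun do under eq_fun do rewrite fconsS mxE.
by apply: jcontM; [exact: jcont_cst|exact: jcont_coord].
Qed.

Let jk a c : jcont t T (fun s v => tf_k s v a c).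
Proof.
elim/fconsP: a => [|i]; rewrite /tf_k.
  by under eq_fun do under eq_fun do rewrite fcons0; exact: jcont_cst.
rewrite (_ : (fun s v => _) = (fun s v => fcons 0 (fun j => - wxx s (px v) i j) c)); last first.
  by apply/funext => s; apply/funext => v; rewrite fconsS.
elim/fconsP: c => [|j].
  by under eq_fun do under eq_fun do rewrite fcons0; exact: jcont_cst.
by under eq_fun do under eq_fun do rewrite fconsS; apply/jcontN/(jpx (jwxx i j)).
Qed.

Lemma tf_jcont : jcont t T tf.
Proof.
apply: jcont_comp; first exact: continuous_expR.
apply/jcontN/jcontD; first by apply: (jcontM jU jU).
apply: jcontM; first exact: jcont_cst.
apply: jcont_sum => i; rewrite (_ : (fun _ _ => _) = (fun (_ : R) v => v (lift ord0 i) 0 * v (lift ord0 i) 0)).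
  by apply: jcontM; exact: jcont_coord.
by apply/funext => s; apply/funext => v; rewrite !mxE.
Qed.

Let jh1 a : jcont t T (fun s v => tf_h1 s a v).
Proof.
apply: jcontD; last by apply: jcontM; [exact: jcont_cst|exact: jr].
by apply: jcontM (jg a); apply: jcontM jU; exact: jcont_cst.
Qed.

Lemma tf_t_jcont : jcont t T tf_t.
Proof.
apply: jcontM tf_jcont; apply: jcontM; last exact: jpx jwt.
by apply: jcontM jU; exact: jcont_cst.
Qed.

Lemma tf_G_jcont a : jcont t T (tf_G a).
Proof. by apply: jcontM tf_jcont; apply: jcontN; exact: jh1. Qed.

Lemma tf_Q_jcont a c : jcont t T (tf_Q a c).
Proof.
apply: jcontM tf_jcont; apply: jcontD; first exact: jcontM.
apply: jcontN; apply: jcontD; last exact: jcont_cst.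
apply: jcontD; first by apply: jcontM (jg c); apply: jcontM (jg a); exact: jcont_cst.
by apply: jcontM (jk a c); apply: jcontM jU; exact: jcont_cst.
Qed.

Let pxD v z c : px (v + c *: z) = px v + c *: px z.
Proof. by apply/matrixP => i j; rewrite !mxE. Qed.

Let sum_ex (y : R) (f : 'I_n -> R) z : \sum_a fcons y f a * z a 0 = y * z 0 0 + \sum_i f i * px z i 0.
Proof.
rewrite big_ord_recl fcons0; congr (_ + _); apply: eq_bigr => i _; by rewrite fconsS mxE.
Qed.

Let coord_lin (y z : R) : is_derive (0 : R) (1 : R) (fun c => y + c * z) z.
Proof.
apply/derive_eps => e e0; exists 1 => // c _.
by rewrite (_ : y + (0 + c) * z - (y + 0 * z) - c * z = 0); [rewrite normr0 mulr_ge0// ltW|ring].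
Qed.

Let dU s v z : t <= s <= T -> is_derive (0 : R) (1 : R) (fun c => tf_U s (v + c *: z)) (\sum_a tf_g s v a * z a 0).
Proof.
move=> hs; apply: derive_ext (derD (coord_lin (v 0 0) (z 0 0)) (derN (dw (px v) (px z) hs))) => [c|].
  by rewrite /tf_U pxD !mxE.
rewrite sum_ex mul1r; congr (_ + _); rewrite -sumrN.
by apply: eq_bigr => i _; rewrite mulNr.
Qed.

Let dq v z : is_derive (0 : R) (1 : R) (fun c => tf_q (v + c *: z)) (\sum_a tf_r v a * z a 0).
Proof.
have H i := let d := coord_lin (px v i 0) (px z i 0) in derM d d.
apply: derive_ext (der_sum H) => [c|].
  by apply: eq_bigr => i _; rewrite pxD !mxE.
rewrite sum_ex mul0r add0r; apply: eq_bigr => i _.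
by ring.
Qed.

Let dh s v z : t <= s <= T -> is_derive (0 : R) (1 : R) (fun c => tf_h s (v + c *: z)) (\sum_a tf_h1 s a v * z a 0).
Proof.
move=> hs; have d := dU v z hs.
apply: derive_ext (derD (derM d d) (derM (der_cst eps 0) (dq v z))) => //.
rewrite mul0r add0r scale0r addr0 mulr_suml !mulr_sumr -!big_split/=.
by apply: eq_bigr => a _; rewrite /tf_h1; ring.
Qed.

Let dg s a v z : t <= s <= T -> is_derive (0 : R) (1 : R) (fun c => tf_g s (v + c *: z) a) (\sum_c tf_k s v a c * z c 0).
Proof.
move=> hs; rewrite /tf_g /tf_k; elim/fconsP: a => [|i].
  under eq_fun do rewrite fcons0; rewrite big1 => [|c _]; last by rewrite fcons0 mul0r.
  exact: is_derive_cst.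
apply: derive_ext (derN (dwx i (px v) (px z) hs)) => [c|]; first by rewrite fconsS pxD.
under [RHS]eq_bigr do rewrite fconsS.
by rewrite sum_ex mul0r add0r -sumrN; apply: eq_bigr => j _; rewrite mulNr.
Qed.

Let dr a v z : is_derive (0 : R) (1 : R) (fun c => tf_r (v + c *: z) a) (\sum_c tf_d a c * z c 0).
Proof.
rewrite /tf_r /tf_d; elim/fconsP: a => [|i].
  under eq_fun do rewrite fcons0; rewrite big1 => [|c _]; last by rewrite fcons0 mul0r.
  exact: is_derive_cst.
under [X in is_derive _ _ _ X]eq_bigr do rewrite fconsS.
rewrite sum_ex mul0r add0r (bigD1 i)//= eqxx big1 ?addr0 => [|j ji]; last by rewrite eq_sym (negbTE ji) mulr0 mul0r.
apply: derive_ext (coord_lin (2 * px v i 0) (2 * px z i 0)) => [c|]; last by rewrite mulr1.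
by rewrite fconsS pxD !mxE; ring.
Qed.

Let dh1 s a v z : t <= s <= T -> is_derive (0 : R) (1 : R) (fun c => tf_h1 s a (v + c *: z)) (\sum_c tf_h2 s a c v * z c 0).
Proof.
move=> hs.
apply: derive_ext (derD (derM (derM (der_cst 2 0) (dU v z hs)) (dg a v z hs))
  (derM (der_cst eps 0) (dr a v z))) => //.
rewrite !(mul0r, add0r, scale0r, addr0).
transitivity (\sum_c (2 * (tf_g s v c * z c 0) * tf_g s v a + 2 * tf_U s v * (tf_k s v a c * z c 0) + eps * (tf_d a c * z c 0))).
  by rewrite !big_split/= -!mulr_sumr -mulr_suml -mulr_sumr.
by apply: eq_bigr => c _; rewrite /tf_h2; ring.
Qed.

Lemma tf_taylor u (x y : 'cV[R]_n.+1) : t <= u <= T -> exists2 xi : 'cV[R]_n.+1,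
    forall a, `|xi a 0 - x a 0| <= `|y a 0 - x a 0| &
     tf u y - tf u x = \sum_a tf_G a u x * (y a 0 - x a 0) +
       2^-1 * \sum_a \sum_c tf_Q a c u xi * ((y a 0 - x a 0) * (y c 0 - x c 0)).
Proof. by move=> hu; apply: exp_taylor => *; [exact: dh|exact: dh1]. Qed.

Lemma tf_mvt (u v : R) (y : 'cV[R]_n.+1) : t <= u -> u < v -> v <= T -> exists2 r, u < r < v &
     tf v y - tf u y = tf_t r y * (v - u).
Proof.
move=> tu uv vT.
have d s : s \in `]u, v[ -> is_derive s (1 : R) (tf ^~ y) (tf_t s y).
  rewrite in_itv/= => /andP[us sv].
  have ds : is_derive s (1 : R) (w ^~ (px y)) (wt s (px y)) by apply: dwt; rewrite (le_lt_trans tu us) (lt_le_trans sv).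
  have d1 := derD (der_cst (y 0 0) s) (derN ds).
  have d2 := derD (derM d1 d1) (der_cst (eps * tf_q y) s).
  apply: derive_ext (derive_expN d2) => //.
  by rewrite /tf_t /tf /tf_h /tf_U -expr2; ring.
have c : {within `[u, v], continuous (tf ^~ y)}.
  apply: cont_sub tu vT _; apply: (jcont_path (X := fun=> y) tf_jcont) => i; apply: continuous_subspaceT => ?; exact: cvg_cst.
have [r ruv e] := MVT uv d c; exists r => //; by move: ruv; rewrite in_itv.
Qed.

Let q0 v : 0 <= tf_q v. Proof. by apply: sumr_ge0 => i _; exact: sqr_ge0. Qed.
(** Each derivative of [tf] is [tf] times a factor that this polynomial dominates up to a
    constant. *)
Let Bd s v := (1 + tf_U s v ^+ 2) * (1 + tf_q v).
Let m := 1 + eps^-1.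

(** (1 + U^2) (1 + eps q) <= exp (U^2 + eps q), and replacing 1 + q by 1 + eps q costs the factor 1
    + 1 / eps. *)
Let Bd_tf s v : Bd s v * tf s v <= m.
Proof.
rewrite /tf expRN ler_pdivrMr ?expR_gt0// /tf_h expRD.
apply: (@le_trans _ _ ((1 + tf_U s v ^+ 2) * (m * (1 + eps * tf_q v)))).
  rewrite /Bd ler_wpM2l ?addr_ge0 ?sqr_ge0// (_ : m * (1 + eps * tf_q v) = 1 + tf_q v + (eps * tf_q v + eps^-1)).
    by rewrite lerDl addr_ge0 ?invr_ge0 ?mulr_ge0 ?(ltW eps0).
  by rewrite /m; field; rewrite gt_eqF.
rewrite mulrCA ler_wpM2l ?addr_ge0 ?invr_ge0 ?(ltW eps0)//.
by apply: ler_pM; rewrite ?addr_ge0 ?sqr_ge0 ?mulr_ge0 ?(ltW eps0)// expR_ge1Dx.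
Qed.

Let BdE s v : Bd s v = 1 + tf_U s v ^+ 2 + tf_q v + tf_U s v ^+ 2 * tf_q v.
Proof. by rewrite /Bd; ring. Qed.

Let U0 s v : 0 <= tf_U s v ^+ 2. Proof. exact: sqr_ge0. Qed.
Let Uq0 s v : 0 <= tf_U s v ^+ 2 * tf_q v. Proof. exact: mulr_ge0. Qed.

Let U_le s v : 2 * `|tf_U s v| <= Bd s v.
Proof.
have := sqr_ge0 (1 - `|tf_U s v|); rewrite sqrrB real_normK ?num_real// BdE.
have := q0 v; have := Uq0 s v; rewrite expr1n mul1r; lra.
Qed.

Let g_sq s v a : t <= s <= T -> tf_g s v a ^+ 2 <= K * (1 + tf_q v).
Proof.
move=> hs; elim/fconsP: a => [|i]; rewrite /tf_g ?fcons0 ?fconsS.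
  rewrite expr1n; have := q0 v; have := K1; nra.
by rewrite sqrrN; exact: bwx.
Qed.

Let r_sq v a : tf_r v a ^+ 2 <= 4 * tf_q v.
Proof.
elim/fconsP: a => [|i]; rewrite /tf_r ?fcons0 ?fconsS; first by rewrite expr0n/= mulr_ge0.
rewrite exprMn /tf_q (bigD1 i)//= -natrX ler_wpM2l// lerDl; apply: sumr_ge0 => *; exact: sqr_ge0.
Qed.

(** One constant for all derivatives. The second ones decide: 8 K and 8 eps^2 from the product of
    two first derivatives of [tf_h], 2 K from the product of two [tf_g], K from [tf_U] times [tf_k],
    and 2 eps from the Hessian of eps |x|^2. The 1 serves [tf] itself and the bound |y| <= 1 + y^2
    for the gradient. *)
Let Kt := 1 + 11 * K + 8 * eps ^+ 2 + 2 * eps.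
Let cK := 8 * K + 8 * eps ^+ 2.

Let h1_sq s v a : t <= s <= T -> tf_h1 s a v ^+ 2 <= cK * Bd s v.
Proof.
move=> hs; have h1 := g_sq v a hs; have h2 := r_sq v a.
apply: le_trans (sqrD2 _ _) _.
have -> : 2 * (2 * tf_U s v * tf_g s v a) ^+ 2 + 2 * (eps * tf_r v a) ^+ 2 =
  8 * (tf_U s v ^+ 2 * tf_g s v a ^+ 2) + 2 * eps ^+ 2 * tf_r v a ^+ 2 by ring.
rewrite /cK [leRHS]mulrDl -[8 * K * _]mulrA; apply: lerD.
  rewrite ler_wpM2l// (_ : K * Bd s v = (1 + tf_U s v ^+ 2) * (K * (1 + tf_q v))); last by rewrite /Bd; ring.
  by rewrite ler_pM ?sqr_ge0// lerDr.
rewrite (_ : 8 * _ * _ = 2 * eps ^+ 2 * (4 * Bd s v)); last by ring.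
apply: ler_wpM2l; first by rewrite mulr_ge0 ?sqr_ge0.
apply: le_trans h2 _; rewrite BdE.
have := U0 s v; have := Uq0 s v; lra.
Qed.

Let tf0 s v : 0 <= tf s v. Proof. exact: expR_ge0. Qed.

Let bnd_tf s v x : `|x| <= Kt * Bd s v -> `|x * tf s v| <= Kt * m.
Proof.
move=> h; rewrite normrM (ger0_norm (tf0 s v)); apply: le_trans (ler_wpM2r (tf0 s v) h) _.
rewrite -[leLHS]mulrA ler_wpM2l//; have := K1; have := eps0; have := sqr_ge0 eps; rewrite /Kt; lra.
Qed.

Let Bd1 s v : 1 <= Bd s v.
Proof. by rewrite BdE; have := q0 v; have := U0 s v; have := Uq0 s v; lra. Qed.

Let K0 : 0 <= K. Proof. by have := K1; lra. Qed.
Let Bd0 s v : 0 <= Bd s v. Proof. exact: le_trans (Bd1 s v). Qed.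
Let KtE s v : Kt * Bd s v = Bd s v + 11 * (K * Bd s v) + 8 * (eps ^+ 2 * Bd s v) + 2 * (eps * Bd s v).
Proof. by rewrite /Kt; ring. Qed.
Let cKE s v : cK * Bd s v = 8 * (K * Bd s v) + 8 * (eps ^+ 2 * Bd s v).
Proof. by rewrite /cK; ring. Qed.
Let KB0 s v : 0 <= K * Bd s v. Proof. exact: mulr_ge0. Qed.
Let eB0 s v : 0 <= eps * Bd s v. Proof. by rewrite mulr_ge0 ?(ltW eps0). Qed.
Let e2B0 s v : 0 <= eps ^+ 2 * Bd s v. Proof. by rewrite mulr_ge0 ?sqr_ge0. Qed.

Let cKt s v : 0 <= cK * Bd s v.
Proof.
by rewrite cKE; have := KB0 s v; have := e2B0 s v; lra.
Qed.

Lemma tf_bound s v : t <= s <= T -> `|tf s v| <= Kt * m.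
Proof.
move=> _; rewrite -[tf s v]mul1r; apply: bnd_tf; rewrite normr1.
have := Bd1 s v; have := KB0 s v; have := eB0 s v; have := e2B0 s v; rewrite KtE; lra.
Qed.

Lemma tf_t_bound s v : t <= s < T -> `|tf_t s v| <= Kt * m.
Proof.
move=> hs; apply: bnd_tf; rewrite normrM.
have h1 := bwt (px v) hs.
have h2 : `|2 * tf_U s v| <= 1 + tf_U s v ^+ 2.
  have := sqr_ge0 (1 - `|tf_U s v|); rewrite sqrrB real_normK ?num_real// normrM ger0_norm// expr1n mul1r; lra.
have := ler_pM (normr_ge0 _) (normr_ge0 _) h2 h1.
rewrite (_ : _ * (K * _) = K * Bd s v); last by rewrite /Bd /tf_q; ring.
have : 0 <= K * Bd s v by rewrite mulr_ge0//; have := Bd1 s v; lra.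
rewrite /Kt /cK; have := K1; have := eps0; have := sqr_ge0 eps; nra.
Qed.

Lemma tf_G_bound a s v : t <= s <= T -> `|tf_G a s v| <= Kt * m.
Proof.
move=> hs; apply: bnd_tf; rewrite normrN; have h := h1_sq v a hs; have b1 := Bd1 s v.
have : `|tf_h1 s a v| <= 1 + cK * Bd s v.
  apply: le_trans (lerD (lexx 1) h); have := sqr_ge0 (1 - `|tf_h1 s a v|); rewrite sqrrB real_normK ?num_real//.
  by have := normr_ge0 (tf_h1 s a v); rewrite expr1n mul1r; lra.
by rewrite KtE cKE; have := KB0 s v; have := eB0 s v; have := e2B0 s v; lra.
Qed.

Lemma tf_Q_bound a c s v : t <= s <= T -> `|tf_Q a c s v| <= Kt * m.
Proof.
move=> hs; apply: bnd_tf; have ha := h1_sq v a hs; have hc := h1_sq v c hs; have b1 := Bd1 s v.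
have ga := g_sq v a hs; have gc := g_sq v c hs.
have amgm (x y : R) : `|2 * (x * y)| <= x ^+ 2 + y ^+ 2.
  by rewrite ler_norml; apply/andP; split; [have := sqr_ge0 (x + y)|have := sqr_ge0 (x - y)]; nra.
have p1 := amgm (tf_h1 s a v) (tf_h1 s c v); have p2 := amgm (tf_g s v a) (tf_g s v c).
have KB : K * (1 + tf_q v) <= K * Bd s v.
  by rewrite ler_wpM2l// BdE; have := U0 s v; have := Uq0 s v; lra.
have p3 : `|2 * tf_U s v * tf_k s v a c| <= K * Bd s v.
  rewrite normrM [K * _]mulrC; apply: ler_pM => //; first by rewrite normrM ger0_norm//; exact: U_le.
  rewrite /tf_k; elim/fconsP: (a) => [|i]; rewrite ?fcons0 ?fconsS ?normr0//.
  by elim/fconsP: (c) => [|j]; rewrite ?fcons0 ?fconsS ?normr0 ?normrN//; exact: bwxx.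
have p4 : `|eps * tf_d a c| <= 2 * (eps * Bd s v).
  rewrite normrM (gtr0_norm eps0) [leRHS]mulrCA ler_wpM2l ?(ltW eps0)//; apply: (@le_trans _ _ 2); last lra.
  rewrite /tf_d; elim/fconsP: (a) => [|i]; rewrite ?fcons0 ?fconsS ?normr0//.
  by elim/fconsP: (c) => [|j]; rewrite ?fcons0 ?fconsS ?normr0//; case: (_ == _); rewrite ?mulr1 ?mulr0 ?normr0// ger0_norm.
rewrite /tf_h2.
have tri (x y z u : R) : `|x - (y + z + u)| <= `|x| + `|y| + `|z| + `|u|.
  apply: le_trans (ler_normB _ _) _; have := ler_normD (y + z) u; have := ler_normD y z; lra.
apply: le_trans (tri _ _ _ _) _; rewrite -[2 * tf_g s v a * _]mulrA.
rewrite normrM ger0_norm// in p1.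
have k0 := KB0 s v; have e0 := e2B0 s v; have e1 := eB0 s v; rewrite KtE; rewrite cKE in ha hc.
lra.
Qed.

End TestFunction.

Lemma tf_le1 (R : realType) n (eps : R) w s (v : 'cV[R]_n.+1) : 0 <= eps -> tf eps w s v <= 1.
Proof.
move=> eps0; rewrite /tf -expR0 ler_expR oppr_le0 addr_ge0 ?sqr_ge0 ?mulr_ge0//.
by apply: sumr_ge0 => i _; exact: sqr_ge0.
Qed.

(** * Ito's formula *)

(** The quadratic form of a Gram matrix is a sum of squares: nonnegative, and zero when the
    combination of the vectors vanishes. Both facts are used in [Gam_ge]. *)
Lemma dotv_quad (R : realType) (d N : nat) (q : 'I_N -> R) (H : 'I_N -> 'cV[R]_d) :
  \sum_a \sum_c q a * q c * dotv (H a) (H c) = \sum_k (\sum_a q a * H a k 0) ^+ 2.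
Proof.
transitivity (\sum_a \sum_c \sum_k (q a * H a k 0) * (q c * H c k 0)).
  apply: eq_bigr => a _; apply: eq_bigr => c _; rewrite /dotv mulr_sumr.
  by apply: eq_bigr => k _; ring.
under eq_bigr do rewrite exchange_big/=.
rewrite exchange_big/=; apply: eq_bigr => k _; rewrite expr2 mulr_suml.
by apply: eq_bigr => a _; rewrite mulr_sumr.
Qed.

Section ItoFormula.
Context (R : realType) (d : nat) (t T : R) (B : brownian_basis d t T) (tT : t <= T) (n : nat) (K : R).
Context (w wt psi : R -> 'cV[R]_n -> R) (wx beta : R -> 'cV[R]_n -> 'cV[R]_n) (wxx : R -> 'cV[R]_n -> 'M[R]_n)
  (sigma : R -> 'cV[R]_n -> 'M[R]_(n, d)) (x0 : 'cV[R]_n)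
  (X : R -> bb_Omega B -> 'cV[R]_n) (I : 'I_n -> R -> bb_Omega B -> R).
Notation Om := (bb_Omega B).
Notation P := (bb_P B).
Notation lam := (@lebesgue_measure R).
Notation mu := (lam \x P)%E.
Notation Dom := (@Dom R (bb_disp B) Om).
Notation E f := (Rintegral P setT f).
Notation mDom := (@measurable_Dom R (bb_disp B) Om _ _).
Let sg i s v := (row i (sigma s (X s v)))^T.
Let Z s v := (sigma s (X s v))^T *m wx s (X s v).
Hypotheses
  (jw : jcont t T w) (jwt : jcont t T wt) (jwx : forall i, jcont t T (fun s x => wx s x i 0))
  (jwxx : forall i j, jcont t T (fun s x => wxx s x i j))
  (dw : forall s x v, t <= s <= T -> is_derive (0 : R) (1 : R) (fun c => w s (x + c *: v)) (\sum_i wx s x i 0 * v i 0))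
  (dwx : forall s i x v, t <= s <= T ->
     is_derive (0 : R) (1 : R) (fun c => wx s (x + c *: v) i 0) (\sum_j wxx s x i j * v j 0))
  (dwt : forall s x, t < s < T -> is_derive s (1 : R) (w ^~ x) (wt s x))
  (K1 : 1 <= K)
  (bwx : forall s x i, t <= s <= T -> wx s x i 0 ^+ 2 <= K * (1 + \sum_j x j 0 ^+ 2))
  (bwxx : forall s x i j, t <= s <= T -> `|wxx s x i j| <= K)
  (bwt : forall s x, t <= s < T -> `|wt s x| <= K * (1 + \sum_j x j 0 ^+ 2))
  (jpsi : jcont t T psi) (js : forall i j, jcont t T (fun s x => sigma s x i j))
  (geq : forall s x, t <= s < T -> wt s x + \sum_i beta s x i 0 * wx s x i 0 +
     2^-1 * \sum_i \sum_j wxx s x i j * dotv (row i (sigma s x))^T (row j (sigma s x))^T = psi s x)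
  (vX : vproc X) (LX : L2v X)
  (Lpsi : L2 mu (Dom t T) (fun p => psi p.1 (X p.1 p.2)))
  (Lb : forall i, L2 mu (Dom t T) (fun p => beta p.1 (X p.1 p.2) i 0))
  (iI : forall i, is_ito (sg i) (I i))
  (eX : {ae P, forall v, forall s i, t <= s <= T -> X s v i 0 = picard beta x0 I X s v i 0})
  (LZ : L2p Z).

Let cZ a : cproc (fun s v => Z s v a 0).
Proof.
apply: (@eq_cproc _ _ _ _ _ (fun s v => (fun s x => \sum_i sigma s x i a * wx s x i 0) s (X s v))).
  by move=> s v; rewrite /Z mxE; apply: eq_bigr => i _; rewrite !mxE.
have jc : jcont t T (fun s x => \sum_i sigma s x i a * wx s x i 0) by apply: jcont_sum => i; exact: jcontM.
exact: (comp_cproc tT jc vX).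
Qed.

Let J := sval (cid (ito_exists_L2 tT cZ LZ)).
Let iJ : is_ito Z J := svalP (cid (ito_exists_L2 tT cZ LZ)).
Let Y s v := w t x0 + Rintegral lam `[t, s] (fun r => psi r (X r v)) + J s v.

Let cY : cproc Y.
Proof.
have c1 := cproc_int tT (comp_cproc tT jpsi vX).
have c2 := cproc_lin 1 (cproc_lin 1 (cproc_cst B (w t x0)) c1) (ito_cproc iJ).
by apply: eq_cproc c2 => s v; rewrite !mul1r.
Qed.

Let V s v : 'cV[R]_n.+1 := \col_a fcons (Y s v) (fun i => X s v i 0) a.
Let b := fcons (fun s v => psi s (X s v)) (fun i s v => beta s (X s v) i 0).
Let H := fcons Z sg.
Let II := fcons J I.

Let pxV s v : px (V s v) = X s v.
Proof. by apply/matrixP => i j; rewrite !mxE fconsS ord1. Qed.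

Let vV : vproc V.
Proof.
elim/fconsP => [|i].
  by apply: eq_cproc cY => s v; rewrite mxE fcons0.
by apply: eq_cproc (vX i) => s v; rewrite mxE fconsS.
Qed.

Let Lbb a : L2 mu (Dom t T) (fun p => b a p.1 p.2).
Proof. by elim/fconsP: a => [|i]; rewrite /b ?fcons0 ?fconsS. Qed.

Let iII a : is_ito (H a) (II a).
Proof. by elim/fconsP: a => [|i]; rewrite /H /II ?fcons0 ?fconsS. Qed.

Let Rtt (f : R -> R) : Rintegral lam `[t, t] f = 0.
Proof. by rewrite set_itv1 Rintegral_set1. Qed.

Let ht : t <= t <= T. Proof. by rewrite lexx. Qed.

Let start : {ae P, forall v, J t v = 0 /\ forall i, I i t v = 0}.
Proof.
have h : {ae P, forall v, forall i, I i t v = 0} by apply: filter_forall => i; exact: ito_start tT _ _ (iI i).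
by move: (ito_start tT iJ) h; apply: filterS2 => v h1 h2.
Qed.

Let eV : {ae P, forall v, forall s a, t <= s <= T ->
     V s v a 0 = V t v a 0 + Rintegral lam `[t, s] (b a ^~ v) + II a s v}.
Proof.
move: start eX; apply: filterS2 => v [J0 I0] hX s a hs; rewrite !mxE /b /II.
elim/fconsP: a => [|i]; rewrite ?fcons0 ?fconsS.
  by rewrite /Y Rtt J0 !addr0.
by rewrite !hX// !mxE Rtt I0 !addr0.
Qed.

Let rows s v := \sum_i enorm (sg i s v) ^+ 2.
Let D s v := \sum_i (X s v i 0 ^+ 2 + beta s (X s v) i 0 ^+ 2 + enorm (sg i s v) ^+ 2).

Let Gam eps s v := tf_t eps w wt s (V s v) + \sum_a tf_G eps w wx a s (V s v) * b a s v +
  2^-1 * \sum_a \sum_c tf_Q eps w wx wxx a c s (V s v) * dotv (H a s v) (H c s v).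

(** All terms linear in U combine into 2 U times the equation [geq] and cancel; the martingale part
    of U is Z - sigma^T w_x = 0. What remains is [tf] times half a sum of squares minus eps (2 <x,
    beta> + |sigma|^2), and [tf] lies between 0 and 1. *)
Let Gam_ge eps s v : 0 < eps -> t <= s < T -> - eps * D s v <= Gam eps s v.
Proof.
move=> eps0 hs; set U := tf_U w s (V s v); set F := tf eps w s (V s v).
pose x := X s v.
have S1 : \sum_a tf_h1 eps w wx s a (V s v) * b a s v =
    2 * U * (psi s x - \sum_i beta s x i 0 * wx s x i 0) + eps * \sum_i 2 * (x i 0 * beta s x i 0).
  rewrite big_ord_recl /tf_h1 /tf_g /tf_r /b !fcons0 mulr0 addr0 mulr1 -/U [_ * (psi s x - _)]mulrBr -[RHS]addrA; congr (_ + _).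
  rewrite mulr_sumr mulr_sumr -sumrN -big_split/=; apply: eq_bigr => i _; rewrite !fconsS pxV -/x; ring.
have S3 : \sum_a \sum_c tf_h2 eps w wx wxx s a c (V s v) * dotv (H a s v) (H c s v) =
   - 2 * U * (\sum_i \sum_j wxx s x i j * dotv (sg i s v) (sg j s v)) + eps * (2 * rows s v).
  transitivity (2 * (\sum_a \sum_c tf_g wx s (V s v) a * tf_g wx s (V s v) c * dotv (H a s v) (H c s v)) +
     2 * U * (\sum_a \sum_c tf_k wxx s (V s v) a c * dotv (H a s v) (H c s v)) +
     eps * \sum_a \sum_c @tf_d R n a c * dotv (H a s v) (H c s v)).
    rewrite !mulr_sumr -!big_split/=; apply: eq_bigr => a _; rewrite !mulr_sumr -!big_split/=.
    by apply: eq_bigr => c _; rewrite /tf_h2 -/U; ring.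
  (* The combination of the integrands with weights [tf_g] is the integrand of U, which is zero by
     definition of Z. *)
  rewrite dotv_quad big1 ?mulr0 ?add0r => [|k _]; last first.
    rewrite big_ord_recl /tf_g /H !fcons0 mul1r.
    under eq_bigr do rewrite !fconsS.
    rewrite /Z /sg pxV mxE -big_split/= big1 ?expr0n// => i _; rewrite !mxE; ring.
  congr (_ + _ * _).
    rewrite !mulNr -mulrN; congr (_ * _).
    rewrite big_ord_recl big1 ?add0r => [|c _]; last by rewrite /tf_k fcons0 mul0r.
    rewrite -sumrN; apply: eq_bigr => i _; rewrite big_ord_recl /tf_k fconsS fcons0 mul0r add0r -sumrN.
    by apply: eq_bigr => j _; rewrite /H !fconsS pxV mulNr.
  rewrite big_ord_recl big1 ?add0r => [|c _]; last by rewrite /tf_d fcons0 mul0r.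
  rewrite /rows mulr_sumr; apply: eq_bigr => i _; rewrite big_ord_recl /tf_d fconsS fcons0 mul0r add0r (bigD1 i)//=.
  rewrite !fconsS eqxx big1 ?addr0 => [|j ji]; last by rewrite !fconsS eq_sym (negbTE ji) mulr0 mul0r.
  rewrite mulr1 enormc_sq /dotv; congr (_ * _); apply: eq_bigr => k _; by rewrite /H fconsS expr2.
pose S2 := \sum_k (\sum_a tf_h1 eps w wx s a (V s v) * H a s v k 0) ^+ 2.
have S20 : 0 <= S2 by apply: sumr_ge0 => k _; exact: sqr_ge0.
have -> : Gam eps s v = F * (2^-1 * S2 - eps * (\sum_i 2 * (x i 0 * beta s x i 0) + rows s v)).
  have eQ : \sum_a \sum_c tf_Q eps w wx wxx a c s (V s v) * dotv (H a s v) (H c s v) = F * (S2 -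
     \sum_a \sum_c tf_h2 eps w wx wxx s a c (V s v) * dotv (H a s v) (H c s v)).
    rewrite /S2 -dotv_quad -sumrB mulr_sumr; apply: eq_bigr => a _; rewrite -sumrB mulr_sumr.
    by apply: eq_bigr => c _; rewrite /tf_Q -/F; ring.
  have eG : \sum_a tf_G eps w wx a s (V s v) * b a s v = - F * \sum_a tf_h1 eps w wx s a (V s v) * b a s v.
    by rewrite mulr_sumr; apply: eq_bigr => a _; rewrite /tf_G -/F; ring.
  rewrite /Gam eQ eG S1 S3 /tf_t -/U -/F pxV -/x -(geq _ hs) /sg -/x; by field.
have F0 : 0 <= F by exact: expR_ge0.
have F1 : F <= 1 by apply: tf_le1; exact: ltW.
have DE : \sum_i 2 * (x i 0 * beta s x i 0) + rows s v <= D s v.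
  rewrite /rows -big_split/=; apply: ler_sum => i _; rewrite lerD2r -/x.
  by have := sqr_ge0 (x i 0 - beta s x i 0); nra.
have D0 : 0 <= D s v by apply: sumr_ge0 => i _; rewrite !addr_ge0 ?sqr_ge0.
have FS : 0 <= F * (2^-1 * S2) by rewrite !mulr_ge0 ?invr_ge0.
rewrite mulrBr; apply: (@le_trans _ _ (- (F * (eps * (\sum_i 2 * (x i 0 * beta s x i 0) + rows s v))))); last by lra.
rewrite mulNr lerN2; apply: (@le_trans _ _ (F * (eps * D s v))); first by rewrite ler_wpM2l// ler_wpM2l// ltW.
by rewrite ler_piMl// mulr_ge0// ltW.
Qed.

Let L1D' : L1 mu (Dom t T) (fun p => D p.1 p.2).
Proof.
apply: L1_sum => [|i _]; first exact: mDom.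
apply: L1D; [exact: mDom| |].
  apply: L1D; [exact: mDom|exact: L2_sq (LX i)|exact: L2_sq (Lb i)].
have [Lsg _ _] := ito_approx tT (iI i).
exact: (L2p_L1 (lexx t) (lexx T) Lsg).
Qed.

Let L1_tf r e : 0 <= r -> t <= e <= T -> L1 P setT (fun v => tf r w e (V e v)).
Proof.
move=> r0 he; apply: (@L1_bounded _ _ _ P setT measurableT 1); [exact: PT_lty| |].
  exact: Fm_meas he ((comp_cproc tT (tf_jcont r jw) vV).2 e he).
by move=> v _; rewrite ger0_norm ?expR_ge0//; exact: tf_le1.
Qed.

(** At time t one has U = 0 and X = x0, so the expectation starts at exp (- eps |x0|^2) >= 1 - eps
    |x0|^2; by [Gam_ge] it then loses at most eps times the integral of D. Dropping eps |X|^2 from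
    the exponent at the end only increases it. *)
Let low eps e : 0 < eps -> t < e -> e <= T ->
  1 - eps * (\sum_i x0 i 0 ^+ 2 + \int[mu]_(p in Dom t T) D p.1 p.2) <= E (fun v => tf 0 w e (V e v)).
Proof.
move=> eps0 te eT; have te' := ltW te.
have he : t <= e <= T by rewrite te' eT.
have dyn := dynkin_formula tT vV Lbb iII eV (tf_jcont eps jw) (tf_t_jcont eps jw jwt) (tf_G_jcont eps jw jwx)
  (tf_Q_jcont eps jw jwx jwxx) (tf_bound w K1 eps0) (tf_t_bound w K1 eps0 bwt)
  (tf_G_bound w K1 eps0 bwx) (tf_Q_bound w K1 eps0 bwx bwxx)
  (tf_mvt eps jw dwt) (tf_taylor eps dw dwx) te eT.
have mc (phi : R -> 'cV[R]_n.+1 -> R) : jcont t T phi -> measurable_fun (Dom t e) (fun p : measurableTypeR R * Om => phi p.1 (V p.1 p.2)).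
  move=> jc; apply: measurable_funS (progressive_meas tT (cproc_progressive tT (comp_cproc tT jc vV))).
    exact: mDom.
  exact: Dom_sub.
(* The equation and the bound on w_t are available before T only; the slice at time T is
   negligible. *)
have [A [mA A0 hA]] := ae_neq B T.
have ae_lt (Q : measurableTypeR R * Om -> Prop) : (forall p, t <= p.1 < T -> Q p) -> {ae mu, forall p, Dom t e p -> Q p}.
  move=> hQ; exists A; split=> // p /= np; apply: hA => /= pT; apply: np => /andP[p1 p2]; apply: hQ.
  by rewrite p1 lt_neqAle pT (le_trans p2).
have inT p : Dom t e p -> t <= p.1 <= T by move=> /andP[-> p2]; exact: le_trans eT.
have it : L1 mu (Dom t e) (fun p => tf_t eps w wt p.1 (V p.1 p.2)).
  apply: (L1_le_ae mDom (mc _ (tf_t_jcont eps jw jwt)) (g := fun=> (1 + 11 * K + 8 * eps ^+ 2 + 2 * eps) * (1 + eps^-1))).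
    by apply: L1_bounded => [||//|? _]; [exact: mDom|exact: mu_Dom|exact: lexx].
  by apply: ae_lt => p hp; exact: (tf_t_bound w K1 eps0 bwt).
have iG a : L1 mu (Dom t e) (fun p => tf_G eps w wx a p.1 (V p.1 p.2) * b a p.1 p.2).
  apply: (@L1bM _ _ _ mu (Dom t e) mDom _ (fun p => tf_G eps w wx a p.1 (V p.1 p.2)) (fun p => b a p.1 p.2)
    (mc _ (tf_G_jcont eps jw jwx a))).
    by move=> p hp; exact: (tf_G_bound w K1 eps0 bwx a _ (inT p hp)).
  by apply: L2_L1 (L2_Dom (f := b a) (lexx t) eT (Lbb a)); [exact: mDom|exact: mu_Dom].
have iQ a c : L1 mu (Dom t e) (fun p => tf_Q eps w wx wxx a c p.1 (V p.1 p.2) * dotv (H a p.1 p.2) (H c p.1 p.2)).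
  apply: (@L1bM _ _ _ mu (Dom t e) mDom _ (fun p => tf_Q eps w wx wxx a c p.1 (V p.1 p.2)) (fun p => dotv (H a p.1 p.2) (H c p.1 p.2))
    (mc _ (tf_Q_jcont eps jw jwx jwxx a c))).
    by move=> p hp; exact: (tf_Q_bound w K1 eps0 bwx bwxx a c _ (inT p hp)).
  have [La _ _] := ito_approx tT (iII a); have [Lc _ _] := ito_approx tT (iII c).
  apply: (@L1_Dom _ _ _ _ _ t e (fun s v => dotv (H a s v) (H c s v)) (lexx t) eT).
  by apply: L1_sum => [|i _]; [exact: mDom|apply: L2M; [exact: mDom|exact: La|exact: Lc]].
have iGs : L1 mu (Dom t e) (fun p => \sum_a tf_G eps w wx a p.1 (V p.1 p.2) * b a p.1 p.2).
  by apply: L1_sum => [|a _]; [exact: mDom|exact: iG].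
have iQ1 a : L1 mu (Dom t e) (fun p => \sum_c tf_Q eps w wx wxx a c p.1 (V p.1 p.2) * dotv (H a p.1 p.2) (H c p.1 p.2)).
  by apply: L1_sum => [|c _]; [exact: mDom|exact: iQ].
have iQs : L1 mu (Dom t e) (fun p => \sum_a \sum_c tf_Q eps w wx wxx a c p.1 (V p.1 p.2) * dotv (H a p.1 p.2) (H c p.1 p.2)).
  by apply: L1_sum => [|a _]; [exact: mDom|exact: iQ1].
have itG := L1D mDom it iGs; have iQz := L1Z mDom 2^-1 iQs.
have iGam : L1 mu (Dom t e) (fun p => Gam eps p.1 p.2) by exact: (L1D mDom itG iQz).
have EGam : \int[mu]_(p in Dom t e) Gam eps p.1 p.2 = E (fun v => tf eps w e (V e v)) - E (fun v => tf eps w t (V t v)).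
  rewrite dyn /Gam (ED mDom itG iQz) (ED mDom it iGs) (EZ mDom _ iQs) (E_sum mDom) => [|a _]; last exact: iG.
  congr (_ + _ * _); rewrite (E_sum mDom) => [|a _]; last exact: iQ1.
  by apply: eq_bigr => a _; rewrite (E_sum mDom) => [|c _]; last exact: iQ.
have iDe : L1 mu (Dom t e) (fun p => D p.1 p.2) by exact: (L1_Dom (f := D) (lexx t) eT L1D').
have h1 : - eps * \int[mu]_(p in Dom t e) D p.1 p.2 <= \int[mu]_(p in Dom t e) Gam eps p.1 p.2.
  rewrite -(EZ mDom _ iDe); apply: E_le_ae; [exact: mDom|exact: (L1Z mDom _ iDe)|exact: iGam|].
  by apply: ae_lt => p hp; exact: Gam_ge.
have h2 : \int[mu]_(p in Dom t e) D p.1 p.2 <= \int[mu]_(p in Dom t T) D p.1 p.2.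
  apply: (Dom_mono (f := D) he L1D') => p; apply: sumr_ge0 => i _; rewrite !addr_ge0 ?sqr_ge0//.
have h3 : 1 - eps * \sum_i x0 i 0 ^+ 2 <= E (fun v => tf eps w t (V t v)).
  have -> : E (fun v => tf eps w t (V t v)) = E (fun=> expR (- (eps * \sum_i x0 i 0 ^+ 2))).
    apply: E_ae => //; first exact: Fm_meas ht ((comp_cproc tT (tf_jcont eps jw) vV).2 t ht).
    move: start eX; apply: filterS2 => v [J0 I0] hX _.
    have Xx : X t v = x0 by apply/matrixP => i j; rewrite ord1 hX// mxE Rtt I0 !addr0.
    rewrite /tf /tf_h /tf_U /tf_q !pxV !Xx mxE fcons0 /Y Rtt J0 !addr0 subrr expr0n/= add0r//.
  rewrite Rintegral_cst//= probability_setT/= mulr1.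
  by have := expR_ge1Dx (- (eps * \sum_i x0 i 0 ^+ 2)).
have h4 : E (fun v => tf eps w e (V e v)) <= E (fun v => tf 0 w e (V e v)).
  apply: E_le => //; [exact: L1_tf (ltW eps0) he|exact: L1_tf|].
  move=> v _; rewrite /tf ler_expR lerN2 lerD2l mul0r mulr_ge0 ?(ltW eps0)//.
  by apply: sumr_ge0 => i _; exact: sqr_ge0.
move: h1; rewrite EGam; have := ler_wpM2l (ltW eps0) h2; move: h3 h4.
have fin (a e1 e2 e3 x y z : R) : 1 - a * x <= e1 -> e2 <= e3 -> a * y <= a * z -> - a * y <= e2 - e1 -> 1 - a * (x + z) <= e3.
  move=> q1 q2 q3 q4; apply: le_trans q2; rewrite mulrDr opprD addrA; apply: le_trans (lerB q1 q3) _.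
  by rewrite -lerBrDl -mulNr.
exact: fin.
Qed.

(** The lower bound [low] is enough because exp (- U^2) <= 1: an expectation of at least 1 - eps c
    for all eps > 0 forces U = 0 almost surely, first at each time and then along paths. *)
Lemma ito_formula : exists J', is_ito Z J' /\ {ae P, forall v, forall s, t <= s <= T ->
  w s (X s v) = w t x0 + Rintegral lam `[t, s] (fun r => psi r (X r v)) + J' s v}.
Proof.
exists J; split => //.
apply: indist.
- exact: tT.
- by apply: aeW => v; have [c _] := comp_cproc tT jw vX; exact: c.
- by apply: aeW => v; have [c _] := cY; exact: c.
move=> s /andP[ts sT]; have [ts'|] := ltrP t s; last first.
  move=> st; have -> : s = t by apply/eqP; rewrite eq_le st ts.
  move: start eX; apply: filterS2 => v [J0 I0] hX.
  rewrite -/(Y t v) /Y Rtt J0 !addr0; congr (w t _); apply/matrixP => i j.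
  by rewrite ord1 hX// mxE Rtt I0 !addr0.
have hs : t <= s <= T by rewrite ts.
pose f v := 1 - tf 0 w s (V s v).
have f01 v : 0 <= f v <= 1.
  by rewrite subr_ge0 tf_le1//= /f lerBlDr lerDl expR_ge0.
have mf : measurable_fun setT f.
  by apply: measurable_funB => //; exact: Fm_meas hs ((comp_cproc tT (tf_jcont 0 jw) vV).2 s hs).
have Lf : L2 P setT f.
  apply: (@L2_bounded _ _ _ P setT measurableT 1) => //; first exact: PT_lty.
  by move=> v _; have /andP[f0 f1] := f01 v; rewrite ger0_norm.
have if1 := L2_L1 measurableT (PT_lty B) Lf.
have Ef : E f <= 0.
  have [c0 hc] : exists c, forall eps, 0 < eps -> E f <= eps * c.
    exists (\sum_i x0 i 0 ^+ 2 + \int[mu]_(p in Dom t T) D p.1 p.2) => eps eps0.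
    have i1 := L1_tf (lexx 0) hs.
    rewrite /f (EB measurableT) => [||//]; last by apply: L1_bounded => [||//|? _]; [exact: measurableT|exact: PT_lty|exact: lexx].
    rewrite Rintegral_cst//= probability_setT/= mulr1.
    by have := low eps0 ts' sT; lra.
  apply/ler_addgt0Pr => eps eps0; rewrite add0r.
  have c1 : 0 < `|c0| + 1 by rewrite ltr_wpDl.
  apply: le_trans (hc _ (divr_gt0 eps0 c1)) _.
  rewrite mulrAC ler_pdivrMr// ler_wpM2l ?(ltW eps0)//; have := ler_norm c0; lra.
have E2f : E2 f = 0.
  apply/eqP; rewrite eq_le; apply/andP; split; last by apply: E_ge0 => *; exact: sqr_ge0.
  apply: le_trans Ef; apply: E_le => //; first exact: L2_sq Lf.
  by move=> v _; have /andP[f0 f1] := f01 v; rewrite expr2 ler_piMl.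
move: (ae_E2_0 Lf E2f); apply: filterS => v; rewrite /f => /eqP; rewrite subr_eq0 => /eqP.
rewrite /tf -{1}expR0 => /expR_inj/esym/eqP; rewrite oppr_eq0 /tf_h mul0r addr0 sqrf_eq0 subr_eq0 => /eqP.
by rewrite pxV mxE fcons0 => <-.
Qed.

End ItoFormula.

(** * Weighted energy estimate *)

Section Energy.
Context (R : realType) (d : nat) (t T : R) (B : brownian_basis d t T) (tT : t <= T) (N : nat) (kap : R).
Notation Om := (bb_Omega B).
Notation P := (bb_P B).
Notation lam := (@lebesgue_measure R).
Notation mu := (lam \x P)%E.
Notation Dom := (@Dom R (bb_disp B) Om).
Notation E f := (Rintegral P setT f).
Notation mDom := (@measurable_Dom R (bb_disp B) Om _ _).
Notation Fm := (Fm (B := B)).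
Let h := (T - t) / N.+1%:R.
Let g := grid t T N.

(* A discretisation of E \int_t^T e^{kap (s - t)} |Z_s|^2 ds. *)
Definition wnorm (Z : R -> Om -> 'cV[R]_d) := \sum_(j < N.+1) (1 + kap * h) ^+ j * n2 (g j) (g j.+1) Z.

Hypothesis kap0 : 0 < kap.

Let gin j : t <= g j <= T. Proof. exact: grid_in. Qed.
Let gstep (j : 'I_N.+1) : g j.+1 - g j = h. Proof. by apply: grid_step; rewrite -ltnS. Qed.
Let h0 : 0 <= h. Proof. by rewrite divr_ge0// subr_ge0. Qed.
Let gle (j : 'I_N.+1) : g j <= g j.+1. Proof. by rewrite -subr_ge0 gstep. Qed.
Let m1 : 1 <= 1 + kap * h. Proof. by rewrite lerDl mulr_ge0// ltW. Qed.
Let mj0 j : 0 <= (1 + kap * h) ^+ j. Proof. by rewrite exprn_ge0// (le_trans _ m1). Qed.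

Lemma wnorm_ge0 Z : 0 <= wnorm Z.
Proof. by apply: sumr_ge0 => j _; rewrite mulr_ge0// n2_ge0. Qed.

Lemma wnormD Z Z' : L2p Z -> L2p Z' -> wnorm (fun s w => Z s w + Z' s w) <= 2 * wnorm Z + 2 * wnorm Z'.
Proof.
move=> LZ LZ'; rewrite !mulr_sumr -big_split/=; apply: ler_sum => j _.
have /andP[u1 _] := gin j; have /andP[_ v2] := gin j.+1.
by rewrite !(mulrCA 2) -mulrDr ler_wpM2l//; exact: n2D.
Qed.

Hypothesis lt_tT : t < T.

Let n2_tot (Z : R -> Om -> 'cV[R]_d) : L2p Z -> n2 t T Z = \sum_(j < N.+1) n2 (g j) (g j.+1) Z.
Proof.
move=> LZ; have := @grid_Dom_split _ _ _ _ B T lt_tT (fun s w => enorm (Z s w) ^+ 2) N N.+1 (leqnn _) (L2p_L1 (lexx t) (lexx T) LZ).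
by rewrite gridN.
Qed.

(** (1 + kap h)^(N + 1) <= exp (kap h (N + 1)) = exp (kap (T - t)). *)
Lemma wnorm_le (Z : R -> Om -> 'cV[R]_d) : L2p Z -> wnorm Z <= expR (kap * (T - t)) * n2 t T Z.
Proof.
move=> LZ; rewrite (n2_tot LZ) mulr_sumr; apply: ler_sum => j _; rewrite ler_wpM2r ?n2_ge0//.
apply: (@le_trans _ _ ((1 + kap * h) ^+ N.+1)); first by rewrite ler_weXn2l// ltnW.
have -> : kap * (T - t) = kap * h *+ N.+1 by rewrite -mulr_natr /h -mulrA divfK// pnatr_eq0.
rewrite -mulr_natl expRM_natl; apply: lerXn2r; rewrite ?nnegrE ?expR_ge0//; first exact: le_trans m1.
exact: expR_ge1Dx.
Qed.

(** On a cell [r, s] one has delta_r + (I_s - I_r) = delta_s + (integral of A). Squaring,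
    orthogonality removes the cross term on the left; on the right Young with parameter kap h gives
    (1 + kap h) E delta_s^2 plus (1 + 1 / (kap h)) h = h + 1 / kap times the integral of A^2.
    Multiplying by (1 + kap h)^j makes the delta terms telescope, down to delta_T = 0. *)
Lemma energy (zeta eta : R -> Om -> 'cV[R]_d) (I A delta : R -> Om -> R) (L : R) :
  is_ito zeta I -> L2 mu (Dom t T) (fun p => A p.1 p.2) -> L2p eta ->
  (forall s, t <= s <= T -> Fm s (delta s)) ->
  {ae P, forall w, forall s, t <= s <= T -> delta s w = Rintegral lam `[s, T] (A ^~ w) - (I T w - I s w)} ->
  (forall s w, t <= s <= T -> A s w ^+ 2 <= L * (enorm (zeta s w) ^+ 2 + enorm (eta s w) ^+ 2)) ->
  E2 (delta t) + wnorm zeta <= (h + kap^-1) * L * (wnorm zeta + wnorm eta).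
Proof.
move=> iI LA Leta Fd ed bA.
have [Lz FI _] := ito_approx tT iI.
have hT : t <= T <= T by rewrite tT lexx.
have Ld s : t <= s <= T -> L2 P setT (delta s).
  move=> hs; have /andP[ts sT] := hs; have [L1i _] := Rint_E2 ts sT (lexx T) LA.
  have L2i : L2 P setT (fun w => Rintegral lam `[s, T] (A ^~ w) - (I T w - I s w)).
    by apply: L2B => //; apply: L2B => //; [exact: (FI T hT).2|exact: (FI s hs).2].
  have ae : {ae P, forall w, setT w -> `|delta s w ^+ 2| <= (Rintegral lam `[s, T] (A ^~ w) - (I T w - I s w)) ^+ 2}.
    by move: ed; apply: filterS => w hw _; rewrite hw// ger0_norm ?sqr_ge0.
  have md := Fm_meas hs (Fd s hs).
  by split => //; apply: (L1_le_ae measurableT _ (L2_sq L2i) ae); exact: measurable_funX.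
have aeA : {ae P, forall w, L1 lam `[t, T] (A ^~ w)}.
  by have [] := Dom_fubini (f := A) (L2_L1 mDom (mu_Dom P t T) LA) => _ [].
have A2 r s : t <= r -> s <= T -> \int[mu]_(p in Dom r s) (A p.1 p.2 ^+ 2) <= L * (n2 r s zeta + n2 r s eta).
  move=> tr sT; have i1 := L2p_L1 tr sT Lz; have i2 := L2p_L1 tr sT Leta.
  rewrite -(ED mDom i1 i2) -(EZ mDom _ (L1D mDom i1 i2)); apply: E_le; first exact: mDom.
  - exact: L2_sq (L2_Dom (f := A) tr sT LA).
  - exact: (L1Z mDom _ (L1D mDom i1 i2)).
  - by move=> p /andP[p1 p2]; apply: bA; rewrite (le_trans tr)// (le_trans p2).
have hp : 0 < h by rewrite divr_gt0// subr_gt0.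
have step (j : 'I_N.+1) : E2 (delta (g j)) + n2 (g j) (g j.+1) zeta <= (1 + kap * h) * E2 (delta (g j.+1)) +
    (h + kap^-1) * L * (n2 (g j) (g j.+1) zeta + n2 (g j) (g j.+1) eta).
  have hr := gin j; have hs := gin j.+1; have /andP[tr rT] := hr; have /andP[ts sT] := hs.
  have rs := gle j; set r := g j in hr tr rT rs *; set s := g j.+1 in hs ts sT rs *.
  have [Li Ei] := Rint_E2 tr rs sT LA.
  have LdI : L2 P setT (fun w => I s w - I r w) by apply: L2B => //; [exact: (FI s hs).2|exact: (FI r hr).2].
  have e1 : E2 (delta r) + n2 r s zeta = E2 (fun w => delta s w + Rintegral lam `[r, s] (A ^~ w)).
    have ix := L2_sq (Ld r hr); have iy := L2_sq LdI; have ixy := L1Z measurableT 2 (L2M measurableT (Ld r hr) LdI).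
    have -> : E2 (fun w => delta s w + Rintegral lam `[r, s] (A ^~ w)) =
        E (fun w => delta r w ^+ 2 + 2 * (delta r w * (I s w - I r w)) + (I s w - I r w) ^+ 2).
      apply: E_ae => //.
      - exact: L1_meas (L2_sq (L2D measurableT (Ld s hs) Li)).
      - exact: L1_meas (L1D measurableT (L1D measurableT ix ixy) iy).
      move: ed aeA; apply: filterS2 => w hw iA _.
      have -> : delta s w + Rintegral lam `[r, s] (A ^~ w) = delta r w + (I s w - I r w).
        by rewrite !hw// (Rint_chasles rs sT (L1_sub tr (lexx T) iA)); ring.
      ring.
    rewrite (ED measurableT (L1D measurableT ix ixy) iy) (ED measurableT ix ixy) (EZ measurableT _ (L2M measurableT (Ld r hr) LdI)).
    rewrite ((ito_martingale tT iI).2 r s _ tr rs sT (Fd r hr) (Ld r hr)) mulr0 addr0; congr (_ + _).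
    by rewrite -(ito_E2 tT iI tr rs sT).
  rewrite e1; have j1 := L1Z measurableT (1 + kap * h) (L2_sq (Ld s hs)).
  have j2 := L1Z measurableT (1 + (kap * h)^-1) (L2_sq Li).
  apply: (@le_trans _ _ ((1 + kap * h) * E2 (delta s) + (1 + (kap * h)^-1) * E2 (fun w => Rintegral lam `[r, s] (A ^~ w)))).
    rewrite -(EZ measurableT _ (L2_sq (Ld s hs))) -(EZ measurableT _ (L2_sq Li)) -(ED measurableT j1 j2).
    apply: E_le => //; [exact: L2_sq (L2D measurableT (Ld s hs) Li)|exact: (L1D measurableT j1 j2)|].
    move=> w _; move: (delta s w) (Rintegral _ _ _) => x y.
    have kh : 0 < kap * h by rewrite mulr_gt0.
    rewrite -subr_ge0 (_ : _ - _ = kap * h * (x - y / (kap * h)) ^+ 2); first by rewrite mulr_ge0 ?sqr_ge0 ?ltW.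
    by field; rewrite !gt_eqF.
  rewrite lerD2l; apply: (@le_trans _ _ ((1 + (kap * h)^-1) * (h * (L * (n2 r s zeta + n2 r s eta))))).
    apply: ler_wpM2l; first by rewrite addr_ge0 // invr_ge0 mulr_ge0 // ltW.
    apply: le_trans Ei _; rewrite /s /r gstep; apply: ler_wpM2l => //; exact: A2.
  by rewrite le_eqVlt; apply/orP; left; apply/eqP; field; rewrite !gt_eqF.
have dT : E2 (delta (g N.+1)) = 0.
  rewrite /g gridN -(E0 P setT); apply: E_ae => //; first by apply: measurable_funX; exact: Fm_meas hT (Fd T hT).
  by move: ed; apply: filterS => w hw _; rewrite hw// set_itv1 Rintegral_set1 subrr subr0 expr0n.
have -> : E2 (delta t) = \sum_(j < N.+1) ((1 + kap * h) ^+ j * E2 (delta (g j)) - (1 + kap * h) ^+ j.+1 * E2 (delta (g j.+1))).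
  under eq_bigr do rewrite -opprB; rewrite sumrN.
  rewrite -(big_mkord xpredT (fun j => (1 + kap * h) ^+ j.+1 * E2 (delta (g j.+1)) - (1 + kap * h) ^+ j * E2 (delta (g j)))).
  by rewrite telescope_sumr// dT mulr0 sub0r opprK expr0 mul1r /g grid0.
rewrite /wnorm -!big_split/= mulr_sumr; apply: ler_sum => j _.
have := ler_wpM2l (mj0 j) (step j); rewrite exprSr !mulrDr.
rewrite -subr_ge0 => H; rewrite -subr_ge0; apply: le_trans H _; rewrite le_eqVlt; apply/orP; left; apply/eqP; ring.
Qed.

End Energy.

(** * Functions of linear growth and Lipschitz functions *)

Lemma enorm_le_sum (R : realType) p q (M : 'M[R]_(p, q)) : enorm M <= \sum_i \sum_j `|M i j|.
Proof.
pose K (a b : R) := 0 <= b /\ a <= b ^+ 2.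
have KD a b a' b' : K a b -> K a' b' -> K (a + a') (b + b').
  by move=> [h1 h2] [h3 h4]; split; [exact: addr_ge0|nra].
have [h0 h1] : K (\sum_i \sum_j M i j ^+ 2) (\sum_i \sum_j `|M i j|).
  have K0 : K 0 0 by split=> //; rewrite expr0n.
  apply: (big_ind2 K K0) => [*|i _]; first exact: KD.
  apply: (big_ind2 K K0) => [*|j _]; first exact: KD.
  by split => //; rewrite real_normK ?num_real.
by rewrite /enorm -(ger0_norm h0) -sqrtr_sqr ler_wsqrtr.
Qed.

Lemma enorm0 (R : realType) p q : enorm (0 : 'M[R]_(p, q)) = 0.
Proof. by rewrite /enorm big1 ?sqrtr0// => i _; rewrite big1// => j _; rewrite mxE expr0n. Qed.

Section Classes.
Context (R : realType) (n : nat) (T : R).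
Implicit Types phi psi : R -> 'cV[R]_n -> R.

(** Scalar classes on [0, T] x R^n: [bdc] bounded, [lgc] continuous of linear growth, [lpc]
    continuous and Lipschitz in space. [lpcM] takes both factors bounded, whereas a bounded factor
    times one of linear growth stays in [lgc]; sigma^T w_x is handled in the latter way. *)
Definition bdc phi := exists2 C, 0 <= C & forall s x, 0 <= s <= T -> `|phi s x| <= C.
Definition lgc phi := jcont 0 T phi /\
  exists2 C, 0 <= C & forall s x, 0 <= s <= T -> `|phi s x| <= C * (1 + enorm x).
Definition lpc phi := jcont 0 T phi /\
  exists2 C, 0 <= C & forall s x y, 0 <= s <= T -> `|phi s x - phi s y| <= C * enorm (x - y).

Lemma lgcD phi psi : lgc phi -> lgc psi -> lgc (fun s x => phi s x + psi s x).
Proof.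
move=> [j1 [C C0 h1]] [j2 [D D0 h2]]; split; first exact: jcontD.
exists (C + D) => [|s x hs]; first exact: addr_ge0.
by rewrite mulrDl; apply: le_trans (ler_normD _ _) _; apply: lerD; [exact: h1|exact: h2].
Qed.

Lemma lgcN phi : lgc phi -> lgc (fun s x => - phi s x).
Proof. by move=> [j1 [C C0 h1]]; split; [exact: jcontN|exists C => // s x hs; rewrite normrN; exact: h1]. Qed.

Lemma lgc_sum (J : Type) (r : seq J) (F : J -> R -> 'cV[R]_n -> R) :
  (forall i, lgc (F i)) -> lgc (fun s x => \sum_(i <- r) F i s x).
Proof.
move=> h; elim: r => [|i r IH].
  rewrite (_ : (fun s x => _) = (fun _ _ => 0)); last by apply/funext => s; apply/funext => x; rewrite big_nil.
  by split; [exact: jcont_cst|exists 0 => // s x _; rewrite normr0 mul0r].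
rewrite (_ : (fun s x => _) = (fun s x => F i s x + \sum_(j <- r) F j s x)); first exact: lgcD.
by apply/funext => s; apply/funext => x; rewrite big_cons.
Qed.

Lemma lgcM phi psi : jcont 0 T phi -> bdc phi -> lgc psi -> lgc (fun s x => phi s x * psi s x).
Proof.
move=> j1 [C C0 h1] [j2 [D D0 h2]]; split; first exact: jcontM.
exists (C * D) => [|s x hs]; first exact: mulr_ge0.
by rewrite normrM -mulrA; apply: ler_pM => //; [exact: h1|exact: h2].
Qed.

Lemma lpcD phi psi : lpc phi -> lpc psi -> lpc (fun s x => phi s x + psi s x).
Proof.
move=> [j1 [C C0 h1]] [j2 [D D0 h2]]; split; first exact: jcontD.
exists (C + D) => [|s x y hs]; first exact: addr_ge0.
by rewrite mulrDl opprD addrACA; apply: le_trans (ler_normD _ _) _; apply: lerD; [exact: h1|exact: h2].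
Qed.

Lemma lpc_sum (J : Type) (r : seq J) (F : J -> R -> 'cV[R]_n -> R) :
  (forall i, lpc (F i)) -> lpc (fun s x => \sum_(i <- r) F i s x).
Proof.
move=> h; elim: r => [|i r IH].
  rewrite (_ : (fun s x => _) = (fun _ _ => 0)); last by apply/funext => s; apply/funext => x; rewrite big_nil.
  by split; [exact: jcont_cst|exists 0 => // s x y _; rewrite subrr normr0 mul0r].
rewrite (_ : (fun s x => _) = (fun s x => F i s x + \sum_(j <- r) F j s x)); first exact: lpcD.
by apply/funext => s; apply/funext => x; rewrite big_cons.
Qed.

Lemma lpcM phi psi : lpc phi -> bdc phi -> lpc psi -> bdc psi -> lpc (fun s x => phi s x * psi s x).
Proof.
move=> [j1 [C C0 h1]] [D D0 h2] [j3 [C' C0' h3]] [D' D0' h4]; split; first exact: jcontM.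
exists (C * D' + D * C') => [|s x y hs]; first by rewrite addr_ge0 ?mulr_ge0.
rewrite (_ : _ - _ = (phi s x - phi s y) * psi s x + phi s y * (psi s x - psi s y)); last by ring.
apply: le_trans (ler_normD _ _) _; rewrite !normrM mulrDl; apply: lerD.
  by rewrite mulrAC; apply: ler_pM => //; [exact: h1|exact: h4].
by rewrite -mulrA; apply: ler_pM => //; [exact: h2|exact: h3].
Qed.

Lemma lpc_lgc phi C : lpc phi -> (forall s, 0 <= s <= T -> `|phi s 0| <= C) -> lgc phi.
Proof.
move=> [j1 [D D0 h]] h0; split => //; exists (`|C| + D) => [|s x hs]; first exact: addr_ge0.
have h1 := h s x 0 hs; have h2 := h0 s hs; rewrite subr0 in h1.
have := ler_norm C; have := ler_distD (phi s 0) (phi s x) 0; rewrite !subr0.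
have := mulr_ge0 (normr_ge0 C) (enorm_ge0 x); rewrite mulrDl !mulrDr !mulr1; lra.
Qed.

Section Composition.
Variables (l p q : nat) (E3 : set 'cV[R]_l) (F : R -> 'cV[R]_n -> 'cV[R]_l -> 'M[R]_(p, q))
  (alpha : R -> 'cV[R]_n -> 'cV[R]_l).
Hypotheses (hF : UniLip `[0, T] setT E3 F) (hal : forall s x, 0 <= s <= T -> E3 (alpha s x)).

Lemma comp_jcont i j : (forall k, jcont 0 T (fun s x => alpha s x k 0)) -> jcont 0 T (fun s x => F s x (alpha s x) i j).
Proof.
move=> ja; have [/subspace_continuousP c _] := hF.
move=> s x hs e e0.
have c1 := c ((s, x), alpha s x) (conj hs (conj Logic.I (hal x hs))).
have c2 := cvg_comp _ _ c1 (@coord_continuous R p q i j (F s x (alpha s x))).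
have /cvgrPdist_lt/(_ e e0) := c2; rewrite near_withinE => /nbhs_ballP[eta /= eta0 H].
have ex k : exists ei : R, 0 < ei /\ forall u (y : 'cV[R]_n), 0 <= u <= T -> `|u - s| < ei ->
    (forall i, `|y i 0 - x i 0| < ei) -> `|alpha u y k 0 - alpha s x k 0| < eta.
  by have [ei ei0 h] := ja k s x hs eta eta0; exists ei.
have [f hf] := choice ex.
exists (Num.min eta (\big[Num.min/1]_k f k)) => [|u y hu].
  by rewrite lt_min eta0/=; elim/big_ind : _ => // [y z y0 z0|k _]; [rewrite lt_min y0|have [] := hf k].
rewrite lt_min => /andP[us1 us2] yx; rewrite distrC; apply: (H ((u, y), alpha u y)); last by split => //; split => //; exact: hal.
split; [split|] => /=.
- by rewrite /ball/= distrC.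
- by split => // k m; rewrite ord1 /ball/= distrC; have := yx k; rewrite lt_min => /andP[].
- split => // k m; rewrite ord1 /ball/= distrC; apply: (hf k).2 => //.
    by apply: lt_le_trans us2 _; exact: bigmin_le_cond.
  move=> r; have := yx r; rewrite lt_min => /andP[_ h]; apply: lt_le_trans h _; exact: bigmin_le_cond.
Qed.

Lemma comp_lpc i j : (forall k, lpc (fun s x => alpha s x k 0)) -> lpc (fun s x => F s x (alpha s x) i j).
Proof.
move=> la; split; first by apply: comp_jcont => k; exact: (la k).1.
have [_ [L hL]] := hF.
have [f hf] := choice (fun k => let: ex_intro2 C C0 h := (la k).2 in ex_intro
  (fun C => 0 <= C /\ forall s x y, 0 <= s <= T -> `|alpha s x k 0 - alpha s y k 0| <= C * enorm (x - y)) C (conj C0 h)).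
have f0 : 0 <= \sum_k f k by apply: sumr_ge0 => k _; exact: (hf k).1.
exists (`|L| * (1 + \sum_k f k)) => [|s x y hs]; first by rewrite mulr_ge0// addr_ge0.
have := abs_coord_le (F s x (alpha s x) - F s y (alpha s y)) i j; rewrite !mxE => h; apply: le_trans h _.
have ha : enorm (alpha s x - alpha s y) <= (\sum_k f k) * enorm (x - y).
  apply: le_trans (enorm_le_sum _) _; rewrite mulr_suml; apply: ler_sum => k _.
  by rewrite big_ord1 !mxE; exact: (hf k).2.
apply: le_trans (hL s x y _ _ hs Logic.I Logic.I (hal x hs) (hal y hs)) _.
have h1 := ler_wpM2r (enorm_ge0 (x - y)) (ler_norm L); have h2 := ler_wpM2r (enorm_ge0 (alpha s x - alpha s y)) (ler_norm L).
have h3 := ler_wpM2l (normr_ge0 L) ha.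
by rewrite mulrDr mulr1 mulrDl -mulrA; lra.
Qed.

Lemma comp_lgc i j C : E3 0 -> (forall s, 0 <= s <= T -> `|F s 0 0 i j| <= C) ->
  (forall k, lgc (fun s x => alpha s x k 0)) -> lgc (fun s x => F s x (alpha s x) i j).
Proof.
move=> h0 hC la; split; first by apply: comp_jcont => k; exact: (la k).1.
have [_ [L hL]] := hF.
have [f hf] := choice (fun k => let: ex_intro2 C C0 h := (la k).2 in ex_intro
  (fun C => 0 <= C /\ forall s x, 0 <= s <= T -> `|alpha s x k 0| <= C * (1 + enorm x)) C (conj C0 h)).
have f0 : 0 <= \sum_k f k by apply: sumr_ge0 => k _; exact: (hf k).1.
exists (`|C| + `|L| * (1 + \sum_k f k)) => [|s x hs]; first by rewrite addr_ge0// mulr_ge0// addr_ge0.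
have := abs_coord_le (F s x (alpha s x) - F s 0 0) i j; rewrite !mxE => h1.
have h2 := hL s x 0 _ _ hs Logic.I Logic.I (hal x hs) h0; rewrite !subr0 in h2.
have ha : enorm (alpha s x) <= (\sum_k f k) * (1 + enorm x).
  apply: le_trans (enorm_le_sum _) _; rewrite mulr_suml; apply: ler_sum => k _.
  by rewrite big_ord1; exact: (hf k).2.
have e0 := enorm_ge0 x; have hC' := le_trans (hC s hs) (ler_norm C).
have h3 := ler_wpM2r e0 (ler_norm L); have h4 := ler_wpM2r (enorm_ge0 (alpha s x)) (ler_norm L).
have h5 := ler_wpM2l (normr_ge0 L) ha.
have h6 := ler_distD (F s 0 0 i j) (F s x (alpha s x) i j) 0; rewrite !subr0 in h6.
have h7 := mulr_ge0 (normr_ge0 C) e0; have h8 := normr_ge0 L.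
have -> : (`|C| + `|L| * (1 + \sum_k f k)) * (1 + enorm x) = `|C| + `|C| * enorm x + `|L| + `|L| * enorm x +
  `|L| * ((\sum_k f k) * (1 + enorm x)) by ring.
lra.
Qed.

End Composition.

Lemma Cb_lpc p q (phi : R -> 'cV[R]_n -> 'M[R]_(p, q)) : UniLipb2 `[0, T] setT phi ->
  forall i j, lpc (fun s x => phi s x i j).
Proof.
move=> [hF _] i j.
apply: (@comp_lpc 1 p q setT (fun s x _ => phi s x) (fun _ _ => 0) hF (fun _ _ _ => Logic.I)) => k; split; first by under eq_fun do under eq_fun do rewrite mxE; exact: jcont_cst.
by exists 0 => // s x y _; rewrite !mxE subrr normr0 mul0r.
Qed.

Lemma Cb_lgc p q (phi : R -> 'cV[R]_n -> 'M[R]_(p, q)) : UniLipb2 `[0, T] setT phi ->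
  forall i j, lgc (fun s x => phi s x i j).
Proof.
move=> h i j; have [_ [L hL]] := h; apply: (@lpc_lgc _ L); first exact: Cb_lpc.
by move=> s hs; apply: le_trans (abs_coord_le _ _ _) (hL s hs).
Qed.

Lemma lpc_Cb p q (phi : R -> 'cV[R]_n -> 'M[R]_(p, q)) C : (forall i j, lpc (fun s x => phi s x i j)) ->
  (forall s, 0 <= s <= T -> enorm (phi s 0) <= C) -> UniLipb2 `[0, T] setT phi.
Proof.
move=> h h0; split; last by exists C => s hs; exact: h0.
split.
  apply/subspace_continuousP => -[[s x] z] [/= hs _]; apply/cvg_ballP => e e0.
  have ex (ij : 'I_p * 'I_q) : exists ei : R, 0 < ei /\ forall u (y : 'cV[R]_n), 0 <= u <= T -> `|u - s| < ei ->
      (forall i, `|y i 0 - x i 0| < ei) -> `|phi u y ij.1 ij.2 - phi s x ij.1 ij.2| < e.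
    by have [ei ei0 h'] := (h ij.1 ij.2).1 s x hs e e0; exists ei.
  have [f hf] := choice ex.
  rewrite near_withinE; apply/nbhs_ballP; exists (\big[Num.min/1]_ij f ij).
    by rewrite /=; elim/big_ind : _ => // [y y' y0 z0|k _]; [rewrite lt_min y0|have [] := hf k].
  move=> [[u y] z'] [/= [/= b1 b2] _] [hu _]; split => // i j; rewrite /ball/= distrC.
  apply: (hf (i, j)).2 => //.
    by rewrite distrC; apply: lt_le_trans b1 _; exact: bigmin_le_cond.
  by move=> k; rewrite distrC; apply: lt_le_trans (b2.2 k 0) _; exact: bigmin_le_cond.
have [f hf] := choice (fun ij : 'I_p * 'I_q => let: ex_intro2 C C0 h := (h ij.1 ij.2).2 in ex_intro
  (fun C => 0 <= C /\ forall s x y, 0 <= s <= T -> `|phi s x ij.1 ij.2 - phi s y ij.1 ij.2| <= C * enorm (x - y)) C (conj C0 h)).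
exists (\sum_i \sum_j f (i, j)) => s x x' y y' hs _ _ _ _.
have f0 : 0 <= \sum_i \sum_j f (i, j) by apply: sumr_ge0 => i _; apply: sumr_ge0 => j _; exact: (hf (i, j)).1.
apply: le_trans (enorm_le_sum _) _; apply: ler_wpDr; first by rewrite mulr_ge0// enorm_ge0.
rewrite mulr_suml; apply: ler_sum => i _; rewrite mulr_suml; apply: ler_sum => j _.
by rewrite !mxE; exact: (hf (i, j)).2.
Qed.

Section Smooth.
Variables (w wt : R -> 'cV[R]_n -> R) (wx : R -> 'cV[R]_n -> 'cV[R]_n) (wxx : R -> 'cV[R]_n -> 'M[R]_n).
Hypotheses (hw : is_C12 T w wt wx wxx) (hx : UniLipb2 `[0, T] setT wx).

Lemma smooth_jcont : [/\ jcont 0 T w, jcont 0 T wt, forall i, jcont 0 T (fun s x => wx s x i 0) &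
  forall i j, jcont 0 T (fun s x => wxx s x i j)].
Proof.
have [_ [c1 c2 c3 c4]] := hw; split; [exact: jcont_scalar|exact: jcont_scalar| |].
  by move=> i; exact: (jcont_within (F := wx)).
by move=> i j; exact: (jcont_within (F := wxx)).
Qed.

Lemma jcont_fix (phi : R -> 'cV[R]_n -> R) (s : R) (x : 'cV[R]_n) (e : R) : jcont 0 T phi -> 0 <= s <= T -> 0 < e -> exists2 eta : R, 0 < eta &
  forall y : 'cV[R]_n, (forall k, `|y k 0 - x k 0| < eta) -> `|phi s y - phi s x| < e.
Proof.
move=> jc hs e0; have [eta eta0 H] := jc s x hs e e0; exists eta => // y; apply: H => //.
by rewrite subrr normr0.
Qed.

Lemma smooth_dx s x v : 0 <= s <= T -> is_derive (0 : R) (1 : R) (fun c => w s (x + c *: v)) (\sum_i wx s x i 0 * v i 0).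
Proof.
move=> hs; have [_ _ jx _] := smooth_jcont; have [hd _] := hw.
apply: (@line_derive _ _ (w s) (fun i x => wx s x i 0)) => [y i|i y e e0]; last exact: (jcont_fix _ (jx i)).
by have [_ h _] := hd s y hs; exact: h.
Qed.

Lemma smooth_dxx s i x v : 0 <= s <= T ->
  is_derive (0 : R) (1 : R) (fun c => wx s (x + c *: v) i 0) (\sum_j wxx s x i j * v j 0).
Proof.
move=> hs; have [_ _ _ jxx] := smooth_jcont; have [hd _] := hw.
apply: (@line_derive _ _ (fun x => wx s x i 0) (fun j x => wxx s x i j)) => [y j|j y e e0]; last exact: (jcont_fix _ (jxx i j)).
by have [_ _ h] := hd s y hs; exact: h.
Qed.

Lemma smooth_dt s x : 0 < s < T -> is_derive s (1 : R) (w ^~ x) (wt s x).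
Proof.
move=> /andP[s0 sT]; have [hd _] := hw.
have [|c _ _] := hd s x; first by rewrite !ltW.
apply/derive_eps => e e0; have /cvgrPdist_le/(_ e e0) := c.
rewrite near_withinE near_withinE => /nbhs_ballP[eta /= eta0 H].
exists (Num.min eta (Num.min s (T - s))) => [|h]; first by rewrite !lt_min eta0 s0 subr_gt0.
rewrite !lt_min => /and3P[h1 h2 h3].
have [->|h0] := eqVneq h 0; first by rewrite addr0 subrr sub0r mul0r oppr0 normr0 mulr0.
move: h2 h3; rewrite !ltr_norml => /andP[a1 a2] /andP[a3 a4].
have n0 : s + h != s by rewrite -subr_eq0 addrAC subrr add0r.
have inI : s + h \in `[0, T] by rewrite in_itv/=; apply/andP; split; lra.
have bl : ball s eta (s + h) by rewrite /ball/= opprD addrA subrr sub0r normrN.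
have := H (s + h) bl n0 inI.
rewrite [s + h - s]addrAC subrr add0r => hh.
rewrite (_ : _ - _ - _ = - (wt s x - (w (s + h) x - w s x) / h) * h); last by field.
by rewrite normrM normrN ler_wpM2r.
Qed.

(** The gradient is Lipschitz with bounded values at 0, hence of linear growth; a Lipschitz gradient
    has a bounded Hessian by [derive_le]. *)
Lemma smooth_bounds : exists2 K, 1 <= K & (forall s x i, 0 <= s <= T -> wx s x i 0 ^+ 2 <= K * (1 + \sum_j x j 0 ^+ 2)) /\
  (forall s x i j, 0 <= s <= T -> `|wxx s x i j| <= K).
Proof.
have lg i := Cb_lgc hx i 0; have [[_ [L hL]] _] := hx.
have [f hf] := choice (fun i => let: ex_intro2 C C0 h := (lg i).2 in ex_intro
  (fun C => 0 <= C /\ forall s x, 0 <= s <= T -> `|wx s x i 0| <= C * (1 + enorm x)) C (conj C0 h)).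
have f0 : 0 <= \sum_k f k by apply: sumr_ge0 => k _; exact: (hf k).1.
exists (1 + 2 * (\sum_k f k) ^+ 2 + `|L|) => [|]; first by rewrite -addrA lerDl addr_ge0// mulr_ge0// sqr_ge0.
split => [s x i hs|s x i j hs].
  have h1 : `|wx s x i 0| <= (\sum_k f k) * (1 + enorm x).
    apply: le_trans ((hf i).2 s x hs) _; rewrite ler_wpM2r ?addr_ge0 ?enorm_ge0// (bigD1 i)//= lerDl.
    by apply: sumr_ge0 => k _; exact: (hf k).1.
  rewrite -real_normK ?num_real// -enormc_sq.
  have h2 : `|wx s x i 0| ^+ 2 <= ((\sum_k f k) * (1 + enorm x)) ^+ 2.
    by rewrite ler_sqr ?nnegrE// mulr_ge0// addr_ge0// enorm_ge0.
  apply: le_trans h2 _; rewrite exprMn.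
  have h3 : (1 + enorm x) ^+ 2 <= 2 * (1 + enorm x ^+ 2) by have := sqr_ge0 (1 - enorm x); nra.
  apply: le_trans (ler_wpM2l (sqr_ge0 _) h3) _.
  rewrite mulrA [_ * 2]mulrC ler_wpM2r ?addr_ge0 ?sqr_ge0//; have := normr_ge0 L; lra.
have [hd _] := hw; have [_ _ hxx] := hd s x hs.
suff bd (h : R) : `|wx s (x + h *: delta_mx j 0) i 0 - wx s (x + 0 *: delta_mx j 0) i 0| <= (1 + 2 * (\sum_k f k) ^+ 2 + `|L|) * `|h|.
  exact: derive_le bd (hxx i j).
rewrite scale0r addr0.
have := abs_coord_le (wx s (x + h *: delta_mx j 0) - wx s x) i 0; rewrite !mxE => h1; apply: le_trans h1 _.
apply: le_trans (hL s _ _ 0 0 hs Logic.I Logic.I Logic.I Logic.I) _.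
rewrite subrr enorm0 mulr0 addr0 addrAC subrr add0r.
have -> : enorm (h *: (delta_mx j 0 : 'cV[R]_n)) = `|h|.
  have e : enorm (h *: (delta_mx j 0 : 'cV[R]_n)) ^+ 2 = `|h| ^+ 2.
    rewrite enormc_sq (bigD1 j)//= big1 ?addr0 => [|k kj]; last by rewrite !mxE (negbTE kj) mulr0 expr0n.
    by rewrite !mxE !eqxx mulr1 real_normK ?num_real.
  by apply/eqP; rewrite -(eqrXn2 (n := 2)) ?enorm_ge0// e.
have := ler_norm L; have := mulr_ge0 (sqr_ge0 (\sum_k f k)) (normr_ge0 h) => h3 h4.
rewrite ler_wpM2r//; have := sqr_ge0 (\sum_k f k); lra.
Qed.

End Smooth.
End Classes.

Section ClassExtra.
Context (R : realType) (n : nat) (T : R).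
Implicit Types phi psi : R -> 'cV[R]_n -> R.

Lemma eq_jcont phi psi : (forall s x, 0 <= s <= T -> phi s x = psi s x) -> jcont 0 T phi -> jcont 0 T psi.
Proof.
move=> e jc s x hs c c0; have [eta eta0 H] := jc s x hs c c0; exists eta => // u y hu us yx.
by rewrite -!e//; exact: H.
Qed.

Lemma eq_lgc phi psi : (forall s x, 0 <= s <= T -> phi s x = psi s x) -> lgc T phi -> lgc T psi.
Proof.
move=> e [jc [C C0 h]]; split; first exact: eq_jcont jc.
by exists C => // s x hs; rewrite -e//; exact: h.
Qed.

Lemma eq_lpc phi psi : (forall s x, 0 <= s <= T -> phi s x = psi s x) -> lpc T phi -> lpc T psi.
Proof.
move=> e [jc [C C0 h]]; split; first exact: eq_jcont jc.
by exists C => // s x y hs; rewrite -!e//; exact: h.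
Qed.

Definition qgc phi := exists2 C, 0 <= C & forall s x, 0 <= s <= T -> `|phi s x| <= C * (1 + \sum_j x j 0 ^+ 2).

Lemma qgcD phi psi : qgc phi -> qgc psi -> qgc (fun s x => phi s x + psi s x).
Proof.
move=> [C C0 h1] [D D0 h2]; exists (C + D) => [|s x hs]; first exact: addr_ge0.
by rewrite mulrDl; apply: le_trans (ler_normD _ _) _; apply: lerD; [exact: h1|exact: h2].
Qed.

Lemma qgc_sum (J : Type) (r : seq J) (F : J -> R -> 'cV[R]_n -> R) :
  (forall i, qgc (F i)) -> qgc (fun s x => \sum_(i <- r) F i s x).
Proof.
move=> h; elim: r => [|i r [C C0 IH]].
  by exists 0 => // s x _; rewrite big_nil normr0 mul0r.
by have [D D0 hD] := qgcD (h i) (ex_intro2 _ _ C C0 IH); exists D => // s x hs; rewrite big_cons; exact: hD.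
Qed.

Lemma lgcM_qgc phi psi : lgc T phi -> lgc T psi -> qgc (fun s x => phi s x * psi s x).
Proof.
move=> [_ [C C0 h1]] [_ [D D0 h2]]; exists (2 * (C * D)) => [|s x hs]; first by rewrite !mulr_ge0.
rewrite normrM -enormc_sq; apply: le_trans (ler_pM (normr_ge0 _) (normr_ge0 _) (h1 s x hs) (h2 s x hs)) _.
have -> : C * (1 + enorm x) * (D * (1 + enorm x)) = C * D * (1 + enorm x) ^+ 2 by ring.
rewrite (_ : 2 * (C * D) * _ = C * D * (2 * (1 + enorm x ^+ 2))); last by ring.
apply: ler_wpM2l; first exact: mulr_ge0.
by have := sqr_ge0 (1 - enorm x); nra.
Qed.

Lemma bdc_qgc phi : bdc T phi -> qgc phi.
Proof.
move=> [C C0 h]; exists C => // s x hs; apply: le_trans (h s x hs) _.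
by rewrite ler_peMr// lerDl; apply: sumr_ge0 => j _; exact: sqr_ge0.
Qed.

Lemma bdcM phi psi : bdc T phi -> bdc T psi -> bdc T (fun s x => phi s x * psi s x).
Proof.
move=> [C C0 h1] [D D0 h2]; exists (C * D) => [|s x hs]; first exact: mulr_ge0.
by rewrite normrM; apply: ler_pM => //; [exact: h1|exact: h2].
Qed.

Lemma lgc_qgc phi : lgc T phi -> qgc phi.
Proof.
move=> h; have h1 : lgc T (fun _ (_ : 'cV[R]_n) => 1).
  split; first exact: jcont_cst.
  by exists 1 => // s x _; rewrite normr1 mul1r lerDl enorm_ge0.
have [C C0 hC] := lgcM_qgc h h1; exists C => // s x hs; have := hC s x hs; by rewrite mulr1.
Qed.

End ClassExtra.

(** The state of the statement equals a measurable process only almost surely; completeness makes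
    the functions integrated along it measurable as well. *)
Lemma complete_measurable d (Om : measurableType d) (R : realType) (P : probability Om R) (f g : Om -> \bar R) :
  measure_is_complete P -> measurable_fun setT f -> {ae P, forall w, f w = g w} -> measurable_fun setT g.
Proof.
move=> cP mf fg _ Y mY; rewrite setTI.
have nE : P.-negligible (~` [set w | f w = g w]) by [].
set E := ~` _ in nE.
have -> : g @^-1` Y = (f @^-1` Y `\` E) `|` (g @^-1` Y `&` E).
  apply/seteqP; split => w /=.
    move=> Yg; have [e|ne] := pselect (f w = g w); last by right.
    by left; split; [rewrite /= e|move=> /(_ e)].
  move=> [[Yf /contrapT e]|[]//]; by rewrite -e.
apply: measurableU.
  by apply: measurableD; [rewrite -[X in measurable X]setTI; exact: mf|exact: cP].
by apply: cP; apply: negligibleS nE; exact: subIsetr.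
Qed.

(** * Coefficients, states and linear problems of the control model *)

Section App.
Context (R : realType) (n m d : nat) (M : model R n m d).
Let T := horizon M.
Let A := actions M.
Context (L : R).
Hypotheses (hM : standing M)
  (uB : UniLip `[0, T] setT A (fun t x _ => drift_bar M t x))
  (uH : UniLip `[0, T] setT A (drift_hat M))
  (uS : UniLip `[0, T] setT A (fun t x _ => vol M t x))
  (uC : UniLip `[0, T] setT A (fun t x a => (cost M t x a)%:M : 'M[R]_1))
  (b0 : forall t, 0 <= t <= T -> enorm (drift_bar M t 0) + enorm (argmu M t 0 0) + `|cost M t 0 0| <= L)
  (bL : forall t x a, 0 <= t <= T -> A a -> enorm (drift_hat M t x a) + enorm (vol M t x) <= L).
Implicit Types alpha : policy R n m.

Lemma horizon_ge0 : 0 <= T. Proof. by case: hM. Qed.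
Let A0 : A 0. Proof. by case: hM. Qed.
Let bh s x a : 0 <= s <= T -> A a -> enorm (drift_hat M s x a) <= L.
Proof. by move=> hs ha; have := bL x hs ha; have := enorm_ge0 (vol M s x); lra. Qed.
Let bv s x : 0 <= s <= T -> enorm (vol M s x) <= L.
Proof. by move=> hs; have := bL x hs A0; have := enorm_ge0 (drift_hat M s x 0); lra. Qed.

Lemma hat_jcont alpha a : valued_in M alpha -> (forall k, jcont 0 T (fun s x => alpha s x k 0)) ->
  jcont 0 T (fun s x => drift_hat M s x (alpha s x) a 0).
Proof. by move=> hv; exact: comp_jcont uH hv a 0. Qed.

Lemma hat_bdc alpha a : valued_in M alpha -> bdc T (fun s x => drift_hat M s x (alpha s x) a 0).
Proof.
move=> hv; exists `|L| => // s x hs; apply: le_trans (abs_coord_le _ _ _) _.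
by apply: le_trans (bh x hs (hv s x hs)) (ler_norm _).
Qed.

Let lpc0 l k : lpc T (fun _ (_ : 'cV[R]_n) => (0 : 'cV[R]_l) k 0).
Proof.
split; first by under eq_fun do under eq_fun do rewrite mxE; exact: jcont_cst.
by exists 0 => // s x y _; rewrite subrr normr0 mul0r.
Qed.

Lemma vol_lpc i a : lpc T (fun s x => vol M s x i a).
Proof. exact: (@comp_lpc _ _ _ _ _ _ _ (fun s x _ => vol M s x) (fun _ _ => 0) uS (fun _ _ _ => A0) i a (lpc0 (l := m))). Qed.

Lemma vol_bdc i a : bdc T (fun s x => vol M s x i a).
Proof.
exists `|L| => // s x hs; apply: le_trans (abs_coord_le _ _ _) _.
by apply: le_trans (bv x hs) (ler_norm _).
Qed.

Let bar_lpc i : lpc T (fun s x => drift_bar M s x i 0).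
Proof. exact: (@comp_lpc _ _ _ _ _ _ _ (fun s x _ => drift_bar M s x) (fun _ _ => 0) uB (fun _ _ _ => A0) i 0 (lpc0 (l := m))). Qed.

Let bar_lgc i : lgc T (fun s x => drift_bar M s x i 0).
Proof.
apply: (lpc_lgc (C := L) (bar_lpc i)) => s hs; apply: le_trans (abs_coord_le _ _ _) _.
by have := b0 hs; have := enorm_ge0 (argmu M s 0 0); have := normr_ge0 (cost M s 0 0); lra.
Qed.

Lemma cost_lgc alpha : valued_in M alpha -> (forall k, lgc T (fun s x => alpha s x k 0)) -> lgc T (along (cost M) alpha).
Proof.
move=> hv la; apply: (@eq_lgc _ _ _ (fun s x => ((cost M s x (alpha s x))%:M : 'M[R]_1) 0 0)).
  by move=> s x _; rewrite mxE eqxx mulr1n.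
apply: (comp_lgc (C := L) (i := 0) (j := 0) uC hv A0) => // s hs; rewrite mxE eqxx mulr1n.
by have := b0 hs; have := enorm_ge0 (argmu M s 0 0); have := enorm_ge0 (drift_bar M s 0); lra.
Qed.

Let driftE alpha s x i : valued_in M alpha -> 0 <= s <= T -> drift_bar M s x i 0 +
  \sum_j vol M s x i j * drift_hat M s x (alpha s x) j 0 = along (drift M) alpha s x i 0.
Proof. by move=> hv hs; case: hM => _ _ _ hd _; rewrite /along hd//; [rewrite !mxE|exact: hv]. Qed.

Lemma drift_lpc alpha i : valued_in M alpha -> (forall k, lpc T (fun s x => alpha s x k 0)) ->
  lpc T (fun s x => along (drift M) alpha s x i 0).
Proof.
move=> hv la; apply: eq_lpc (fun s x hs => driftE x i hv hs) _; apply: lpcD; first exact: bar_lpc.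
apply: lpc_sum => j; apply: lpcM; [exact: vol_lpc|exact: vol_bdc|exact: (comp_lpc uH hv)|exact: hat_bdc].
Qed.

Lemma drift_lgc alpha i : valued_in M alpha -> (forall k, jcont 0 T (fun s x => alpha s x k 0)) ->
  lgc T (fun s x => along (drift M) alpha s x i 0).
Proof.
move=> hv la; apply: eq_lgc (fun s x hs => driftE x i hv hs) _; apply: lgcD; first exact: bar_lgc.
apply: lgc_sum => j; apply: lgcM; [exact: (vol_lpc _ _).1|exact: vol_bdc|].
split; first exact: hat_jcont.
have [C C0 hC] := hat_bdc j hv; exists C => // s x hs; apply: le_trans (hC s x hs) _.
by rewrite ler_peMr// lerDl enorm_ge0.
Qed.

Lemma sde_consts alpha : valued_in M alpha -> (forall k, lpc T (fun s x => alpha s x k 0)) ->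
  exists K, [/\ 0 < K, forall s x y i, 0 <= s <= T ->
     (along (drift M) alpha s x i 0 - along (drift M) alpha s y i 0) ^+ 2 <= K * enorm (x - y) ^+ 2,
   forall s x y i, 0 <= s <= T ->
     enorm ((row i (vol M s x))^T - (row i (vol M s y))^T) ^+ 2 <= K * enorm (x - y) ^+ 2 &
   forall s x i, 0 <= s <= T -> enorm (row i (vol M s x))^T <= K].
Proof.
move=> hv la.
have [f hf] := choice (fun i => let: ex_intro2 C C0 h := (drift_lpc i hv la).2 in ex_intro
  (fun C => 0 <= C /\ forall s x y, 0 <= s <= T -> `|along (drift M) alpha s x i 0 - along (drift M) alpha s y i 0| <= C * enorm (x - y)) C (conj C0 h)).
have [g hg] := choice (fun ia : 'I_n * 'I_d => let: ex_intro2 C C0 h := (vol_lpc ia.1 ia.2).2 in ex_intro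
  (fun C => 0 <= C /\ forall s x y, 0 <= s <= T -> `|vol M s x ia.1 ia.2 - vol M s y ia.1 ia.2| <= C * enorm (x - y)) C (conj C0 h)).
have f0 : 0 <= \sum_i f i ^+ 2 by apply: sumr_ge0 => i _; exact: sqr_ge0.
have g0 : 0 <= \sum_i \sum_a g (i, a) ^+ 2 by apply: sumr_ge0 => i _; apply: sumr_ge0 => a _; exact: sqr_ge0.
have sq (x c e : R) : 0 <= c -> 0 <= e -> `|x| <= c * e -> x ^+ 2 <= c ^+ 2 * e ^+ 2.
  by move=> c0 e0 h; rewrite -exprMn -real_normK ?num_real// ler_sqr// ?nnegrE// mulr_ge0.
exists (1 + \sum_i f i ^+ 2 + \sum_i \sum_a g (i, a) ^+ 2 + `|L|); split.
- have := normr_ge0 L; lra.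
- move=> s x y i hs; apply: le_trans (sq _ _ _ (hf i).1 (enorm_ge0 _) ((hf i).2 s x y hs)) _.
  rewrite ler_wpM2r ?sqr_ge0//.
  have : f i ^+ 2 <= \sum_i f i ^+ 2 by rewrite (bigD1 i)//= lerDl; apply: sumr_ge0 => *; exact: sqr_ge0.
  by have := normr_ge0 L; lra.
- move=> s x y i hs; rewrite enormc_sq.
  apply: (@le_trans _ _ ((\sum_a g (i, a) ^+ 2) * enorm (x - y) ^+ 2)).
    rewrite mulr_suml; apply: ler_sum => a _; rewrite !mxE.
    exact: (sq _ _ _ (hg (i, a)).1 (enorm_ge0 _) ((hg (i, a)).2 s x y hs)).
  rewrite ler_wpM2r ?sqr_ge0//.
  have : \sum_a g (i, a) ^+ 2 <= \sum_i \sum_a g (i, a) ^+ 2.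
    by rewrite [leRHS](bigD1 i)//= lerDl; apply: sumr_ge0 => *; apply: sumr_ge0 => *; exact: sqr_ge0.
  by have := normr_ge0 L; lra.
- move=> s x i hs; have h1 := bv x hs; have h2 := ler_norm L.
  suff : enorm (row i (vol M s x))^T <= enorm (vol M s x) by lra.
  rewrite -ler_sqr ?nnegrE ?enorm_ge0// enormc_sq enorm_sq (bigD1 i)//= ler_wpDr//.
    by apply: sumr_ge0 => *; apply: sumr_ge0 => *; exact: sqr_ge0.
  by apply: ler_sum => a _; rewrite !mxE.
Qed.

Section Basis.
Context (t : R) (x0 : 'cV[R]_n) (ht : 0 <= t <= T) (B : brownian_basis d t T).
Notation Om := (bb_Omega B).
Notation P := (bb_P B).
Notation lam := (@lebesgue_measure R).
Notation mu := (lam \x P)%E.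
Notation Dom := (@Dom R (bb_disp B) Om).
Notation E f := (Rintegral P setT f).
Notation mDom := (@measurable_Dom R (bb_disp B) Om _ _).
Let tT : t <= T. Proof. by case/andP: ht. Qed.
Let t0 : 0 <= t. Proof. by case/andP: ht. Qed.
Let in0 s : t <= s <= T -> 0 <= s <= T. Proof. by move=> /andP[h ->]; rewrite (le_trans t0). Qed.

(** The regular version of the state: adapted with continuous paths for every outcome,
    square-integrable over time and chance, and with its Ito integrals at hand. *)
Definition good_state alpha (X : R -> Om -> 'cV[R]_n) := vproc X /\ L2v X /\ exists I, (forall i, is_ito (fun s w => (row i (vol M s (X s w)))^T) (I i)) /\
  {ae P, forall w, forall s i, t <= s <= T -> X s w i 0 = picard (along (drift M) alpha) x0 I X s w i 0}.

Lemma good_state_exists alpha : valued_in M alpha -> (forall k, lpc T (fun s x => alpha s x k 0)) ->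
  exists X, [/\ good_state alpha X, sde_solution (along (drift M) alpha) (vol M) x0 X &
    forall X', sde_solution (along (drift M) alpha) (vol M) x0 X' -> {ae P, forall w, forall s, t <= s <= T -> X' s w = X s w}].
Proof.
move=> hv la; have [K [K0 lb ls bs]] := sde_consts hv la.
have jb i : jcont t T (fun s x => along (drift M) alpha s x i 0) := jcont_sub t0 (lexx T) (drift_lpc i hv la).1.
have js i j : jcont t T (fun s x => vol M s x i j) := jcont_sub t0 (lexx T) (vol_lpc i j).1.
have lb' s x y i (hs : t <= s <= T) := lb s x y i (in0 hs).
have ls' s x y i (hs : t <= s <= T) := ls s x y i (in0 hs).
have bs' s x i (hs : t <= s <= T) := bs s x i (in0 hs).
have [X [I [vX LX iI _ eX]]] := @sde_exists _ _ _ _ B tT _ _ _ x0 _ K0 jb js lb' ls' bs'.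
exists X; split.
- by split => //; split => //; exists I.
- split.
  + by move=> i; exact: (cproc_progressive tT (vX i)).
  + move=> i; apply: aeW => w; have [c _] := comp_cproc tT (jb i) vX.
    exact: cont_L1 (lexx t) (lexx T) (c w).
  + by exists I; split => //; move: eX; apply: filterS => w h s i hs; rewrite h// mxE.
- move=> X' [pX bX [I' [iI' eX']]].
  apply: (sde_unique tT K0 jb lb' ls' pX iI' bX _ vX iI eX).
  by move: eX'; apply: filterS => w h s i hs; rewrite mxE; exact: h.
Qed.

Section Along.
Variables (alphab : policy R n m) (X : R -> Om -> 'cV[R]_n).
Hypotheses (hvb : valued_in M alphab) (jab : forall k, jcont 0 T (fun s x => alphab s x k 0)) (gX : good_state alphab X).

(** The square of a function of linear growth is dominated by 2 C^2 (1 + |X|^2), which is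
    integrable. *)
Lemma lgc_L2 phi : lgc T phi -> L2 mu (Dom t T) (fun p => phi p.1 (X p.1 p.2)).
Proof.
move=> [jc [C C0 h]]; have [vX [LX _]] := gX.
have mp := progressive_meas tT (cproc_progressive tT (comp_cproc tT (jcont_sub t0 (lexx T) jc) vX)).
split => //; have i1 : L1 mu (Dom t T) (fun p => 2 * C ^+ 2 * (1 + enorm (X p.1 p.2) ^+ 2)).
  apply: L1Z; first exact: mDom.
  apply: L1D; [exact: mDom| |exact: L2v_enorm].
  by apply: L1_bounded => [||//|? _]; [exact: mDom|exact: mu_Dom|exact: lexx].
apply: (L1_le mDom _ i1); first exact: measurable_funX.
move=> p hp; have := h p.1 (X p.1 p.2) (in0 hp); move: (phi _ _) (enorm_ge0 (X p.1 p.2)) => y.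
move: (enorm _) => e e0 hy; rewrite ger0_norm ?sqr_ge0//.
apply: (@le_trans _ _ ((C * (1 + e)) ^+ 2)).
  by rewrite -real_normK ?num_real// ler_sqr// ?nnegrE// mulr_ge0// addr_ge0.
rewrite exprMn (_ : 2 * C ^+ 2 * _ = C ^+ 2 * (2 * (1 + e ^+ 2))); last by ring.
apply: ler_wpM2l; first exact: sqr_ge0.
by have := sqr_ge0 (1 - e); nra.
Qed.

Section Solution.
Variables (alpha : policy R n m) (w wt : R -> 'cV[R]_n -> R) (wx : R -> 'cV[R]_n -> 'cV[R]_n) (wxx : R -> 'cV[R]_n -> 'M[R]_n).
Hypotheses (hv : valued_in M alpha) (la : forall k, lgc T (fun s x => alpha s x k 0))
  (sw : smooth M w wt wx wxx)
  (gen : forall s x, 0 <= s < T -> generator M wt wx wxx (alpha s x) s x + along (cost M) alpha s x = 0).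

Definition hedge s x : 'cV[R]_d := (vol M s x)^T *m wx s x.

Lemma hedge_lgc a : lgc T (fun s x => hedge s x a 0).
Proof.
have [_ hx] := sw; apply: (@eq_lgc _ _ _ (fun s x => \sum_i vol M s x i a * wx s x i 0)).
  by move=> s x _; rewrite mxE; apply: eq_bigr => i _; rewrite mxE.
by apply: lgc_sum => i; apply: lgcM; [exact: (vol_lpc i a).1|exact: vol_bdc|exact: Cb_lgc].
Qed.

Lemma hedge_L2p : L2p (fun s v => hedge s (X s v)).
Proof. by move=> a; exact: lgc_L2 (hedge_lgc a). Qed.

(** The BSDE driver of alpha with Z replaced by [hedge]. It is also - L^b w, with L^b the generator
    of the fixed policy [alphab], as soon as w solves the linear equation of alpha. *)
Definition backward_drift s x := along (cost M) alpha s x +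
  dotv (along (drift_hat M) alpha s x - along (drift_hat M) alphab s x) (hedge s x).

Lemma backward_drift_lgc : lgc T backward_drift.
Proof.
apply: lgcD; first exact: cost_lgc.
apply: lgc_sum => a; apply: lgcM; last exact: hedge_lgc.
  rewrite (_ : (fun s x => _) = (fun s x => drift_hat M s x (alpha s x) a 0 + - drift_hat M s x (alphab s x) a 0)).
    by apply: jcontD; [apply: hat_jcont => // k; exact: (la k).1|apply: jcontN; exact: hat_jcont].
  by apply/funext => s; apply/funext => x; rewrite !mxE.
have [C C0 h1] := hat_bdc a hv; have [D D0 h2] := hat_bdc a hvb.
exists (C + D) => [|s x hs]; first exact: addr_ge0.
rewrite !mxE; apply: le_trans (ler_normB _ _) _; exact: lerD (h1 s x hs) (h2 s x hs).
Qed.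

(** The drift enters as sigma times [drift_hat], so <b^alpha - b^alphab, w_x> is the inner product
    of the difference of the [drift_hat] with sigma^T w_x. The equation of alpha thus becomes one
    along the dynamics of alphab, to which [ito_formula] applies. *)
Lemma ito_policy : exists J, is_ito (fun s v => hedge s (X s v)) J /\ {ae P, forall v, forall s, t <= s <= T ->
  w s (X s v) = w t x0 + Rintegral lam `[t, s] (fun r => - backward_drift r (X r v)) + J s v}.
Proof.
have [vX [LX [I [iI eX]]]] := gX; have [h12 hx] := sw.
have [jw jwt jwx jwxx] := smooth_jcont h12.
have [K K1 [bwx bwxx]] := smooth_bounds h12 hx.
have lb i := drift_lgc i hvb jab.
have lpsi := lgcN backward_drift_lgc.
have geq s x : 0 <= s < T -> wt s x + \sum_i along (drift M) alphab s x i 0 * wx s x i 0 +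
     2^-1 * \sum_i \sum_j wxx s x i j * dotv (row i (vol M s x))^T (row j (vol M s x))^T = - backward_drift s x.
  move=> hs; have hs' : 0 <= s <= T by case/andP: hs => -> /ltW.
  have := gen x hs; rewrite /generator /backward_drift.
  have -> : \tr (vol M s x *m (vol M s x)^T *m wxx s x) = \sum_i \sum_j wxx s x i j * dotv (row i (vol M s x))^T (row j (vol M s x))^T.
    rewrite /mxtrace; under eq_bigr do rewrite mxE.
    rewrite exchange_big/=; apply: eq_bigr => i _; apply: eq_bigr => j _.
    rewrite mxE mulrC /dotv; congr (_ * _); apply: eq_bigr => k _; rewrite !mxE mulrC//.
  have -> : dotv (drift M s x (alpha s x)) (wx s x) = \sum_i along (drift M) alphab s x i 0 * wx s x i 0 +
      dotv (along (drift_hat M) alpha s x - along (drift_hat M) alphab s x) (hedge s x).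
    have -> : dotv (along (drift_hat M) alpha s x - along (drift_hat M) alphab s x) (hedge s x) =
        \sum_i (\sum_a vol M s x i a * (drift_hat M s x (alpha s x) a 0 - drift_hat M s x (alphab s x) a 0)) * wx s x i 0.
      under eq_bigr do rewrite mulr_suml; rewrite exchange_big/=; apply: eq_bigr => a _.
      by rewrite !mxE mulr_sumr; apply: eq_bigr => i _; rewrite !mxE; ring.
    rewrite -big_split/=; apply: eq_bigr => i _; rewrite -mulrDl; congr (_ * _).
    have e1 := driftE x i hv hs'; rewrite /along in e1; rewrite -e1 -(driftE x i hvb hs') -addrA -big_split/=.
    by congr (_ + _); apply: eq_bigr => a _; ring.
  by move=> e; apply/eqP; rewrite -subr_eq0; apply/eqP; rewrite -[RHS]e; ring.
(* Nothing in the class of w bounds the growth of its time derivative. The equation expresses it,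
   before T, by terms of at most quadratic growth. *)
have qwt : exists2 C, 0 <= C & forall s x, t <= s < T -> `|wt s x| <= C * (1 + \sum_j x j 0 ^+ 2).
  have q1 : qgc T (fun s x => \sum_i along (drift M) alphab s x i 0 * wx s x i 0).
    by apply: qgc_sum => i; apply: lgcM_qgc; [exact: lb|exact: Cb_lgc].
  have q2 : qgc T (fun s x => \sum_i \sum_j wxx s x i j * dotv (row i (vol M s x))^T (row j (vol M s x))^T).
    apply: qgc_sum => i; apply: qgc_sum => j; apply: bdc_qgc; apply: bdcM.
      by exists K => [|s x hs]; [lra|exact: bwxx].
    exists (\sum_(k < d) L * L) => [|s x hs]; first by apply: sumr_ge0 => k _; rewrite -expr2 sqr_ge0.
    apply: le_trans (ler_norm_sum _ _ _) _; apply: ler_sum => k _; rewrite normrM !mxE.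
    by apply: ler_pM => //; exact: le_trans (abs_coord_le _ _ _) (bv x hs).
  have [C1 C10 h1] := q1; have [C2 C20 h2] := q2; have [C3 C30 h3] := lgc_qgc lpsi.
  exists (C3 + C1 + C2) => [|s x /andP[hs1 hs2]]; first by rewrite !addr_ge0.
  have hs : 0 <= s < T by rewrite hs2 (le_trans t0).
  have hs' : 0 <= s <= T by case/andP: hs => -> /ltW.
  have := geq s x hs; have := h1 s x hs'; have := h2 s x hs'; have := h3 s x hs'.
  have : 0 <= \sum_j x j 0 ^+ 2 by apply: sumr_ge0 => *; exact: sqr_ge0.
  move: (\sum_j x j 0 ^+ 2) => q; move: (\sum_i _) => y1; move: (\sum_i _) => y2; move: (- backward_drift s x) => y3 q0.
  rewrite !ler_norml => /andP[a1 a2] /andP[a3 a4] /andP[a5 a6] e.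
  have : 0 <= C2 * (1 + q) by rewrite mulr_ge0// addr_ge0.
  rewrite !mulrDl => c2; apply/andP; split; lra.
have [C C0 bwt] := qwt.
have K' : K <= K + C by rewrite lerDl.
have x1 (x : 'cV[R]_n) : 0 <= 1 + \sum_j x j 0 ^+ 2 by rewrite addr_ge0// sumr_ge0// => *; exact: sqr_ge0.
apply: (@ito_formula _ _ _ _ B tT n (K + C) w wt (fun s x => - backward_drift s x) wx (along (drift M) alphab) wxx (vol M) x0 X I (jcont_sub t0 (lexx T) jw) (jcont_sub t0 (lexx T) jwt)
  (fun i => jcont_sub t0 (lexx T) (jwx i)) (fun i j => jcont_sub t0 (lexx T) (jwxx i j))).
- by move=> s x v hs; exact: (smooth_dx h12 x v (in0 hs)).
- by move=> s i x v hs; exact: (smooth_dxx h12 i x v (in0 hs)).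
- by move=> s x /andP[h1 h2]; apply: (smooth_dt h12 x); rewrite h2 (le_lt_trans t0).
- by lra.
- by move=> s x i hs; apply: le_trans (bwx s x i (in0 hs)) _; rewrite ler_wpM2r.
- by move=> s x i j hs; apply: le_trans (bwxx s x i j (in0 hs)) _.
- move=> s x hs; apply: le_trans (bwt s x hs) _; rewrite ler_wpM2r// lerDr; lra.
- exact: (jcont_sub t0 (lexx T) lpsi.1).
- by move=> i j; exact: (jcont_sub t0 (lexx T) (vol_lpc i j).1).
- by move=> s x /andP[h1 h2]; apply: geq; rewrite h2 (le_trans t0).
- exact: vX.
- exact: LX.
- exact: (lgc_L2 lpsi).
- by move=> i; exact: (lgc_L2 (lb i)).
- exact: iI.
- exact: eX.
- exact: hedge_L2p.
Qed.

End Solution.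
End Along.
End Basis.
End App.

(** * Policy improvement *)

Lemma integral_ae d (Om : measurableType d) (R : realType) (P : probability Om R) (g : Om -> \bar R) (h : Om -> R) :
  measure_is_complete P -> L1 P setT h -> {ae P, forall w, g w = (h w)%:E} ->
  (\int[P]_w g w = (Rintegral P setT h)%:E)%E.
Proof.
move=> cP ih gh; have mh : measurable_fun setT (EFin \o h) by apply/measurable_EFinP; exact: L1_meas ih.
have mg : measurable_fun setT g by apply: (complete_measurable cP mh); move: gh; apply: filterS => w ->.
rewrite -(L1_EFin measurableT ih); apply: ae_eq_integral => //; move: gh; apply: filterS => w e _; exact: e.
Qed.

Lemma dotv_CS (R : realType) k (u v : 'cV[R]_k) : dotv u v ^+ 2 <= enorm u ^+ 2 * enorm v ^+ 2.
Proof.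
have key (a b c : R) : 0 <= b -> (forall l : R, 0 <= c - 2 * l * a + l ^+ 2 * b) -> 0 <= c -> a ^+ 2 <= c * b.
  move=> b0 h c0; have [b1|b1] := eqVneq b 0.
    rewrite b1 mulr0; have [->|a0] := eqVneq a 0; first by rewrite expr0n.
    (* The form is affine in l when b = 0; this l makes it equal to - 1. *)
    have := h ((c + 1) / (2 * a)); rewrite b1 mulr0 addr0.
    have -> : 2 * ((c + 1) / (2 * a)) * a = c + 1 by field.
    by lra.
  have bp : 0 < b by rewrite lt_neqAle eq_sym b1.
  have := h (a / b); rewrite (_ : c - _ + _ = c - a ^+ 2 / b); last by field.
  by rewrite subr_ge0 ler_pdivrMr.
apply: key; [exact: sqr_ge0| |exact: sqr_ge0] => l; rewrite !enormc_sq /dotv.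
have -> : \sum_i u i 0 ^+ 2 - 2 * l * (\sum_i u i 0 * v i 0) + l ^+ 2 * (\sum_i v i 0 ^+ 2) = \sum_i (u i 0 - l * v i 0) ^+ 2.
  rewrite !mulr_sumr -sumrB -big_split/=; apply: eq_bigr => i _; ring.
by apply: sumr_ge0 => i _; exact: sqr_ge0.
Qed.

Lemma enormB_sq (R : realType) k (u v : 'cV[R]_k) : enorm (u - v) ^+ 2 <= 2 * enorm u ^+ 2 + 2 * enorm v ^+ 2.
Proof.
rewrite !enormc_sq !mulr_sumr -big_split/=; apply: ler_sum => i _.
by rewrite !mxE; apply: le_trans (sqrD2 _ _) _; rewrite sqrrN.
Qed.

Section Iteration.
Context (R : realType) (n m d : nat) (M : model R n m d).
Let T := horizon M.
Let A := actions M.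
Context (L : R).
Hypotheses (hM : standing M)
  (uB : UniLip `[0, T] setT A (fun t x _ => drift_bar M t x))
  (uH : UniLip `[0, T] setT A (drift_hat M))
  (uS : UniLip `[0, T] setT A (fun t x _ => vol M t x))
  (uC : UniLip `[0, T] setT A (fun t x a => (cost M t x a)%:M : 'M[R]_1))
  (uM : UniLip `[0, T] setT setT (argmu M))
  (b0 : forall t, 0 <= t <= T -> enorm (drift_bar M t 0) + enorm (argmu M t 0 0) + `|cost M t 0 0| <= L)
  (bL : forall t x a, 0 <= t <= T -> A a -> enorm (drift_hat M t x a) + enorm (vol M t x) <= L).
Implicit Types alpha : policy R n m.

Let mu_val s x z : 0 <= s <= T -> A (argmu M s x z).
Proof. by move=> hs; case: hM => _ _ _ _ [_ h]; case: (h s x z hs). Qed.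
Let mu_min s x z a : 0 <= s <= T -> A a -> dotv (drift_hat M s x (argmu M s x z)) z + cost M s x (argmu M s x z)
          <= dotv (drift_hat M s x a) z + cost M s x a.
Proof. by move=> hs; case: hM => _ _ _ _ [_ h]; case: (h s x z hs) => _; apply. Qed.

Let mu_lgc (z : R -> 'cV[R]_n -> 'cV[R]_d) k : (forall k, lgc T (fun s x => z s x k 0)) ->
  lgc T (fun s x => argmu M s x (z s x) k 0).
Proof.
apply: (comp_lgc (C := L) (E3 := setT) uM (fun _ _ _ => Logic.I)) => // s hs.
apply: le_trans (abs_coord_le _ _ _) _.
by have := b0 hs; have := enorm_ge0 (drift_bar M s 0); have := normr_ge0 (cost M s 0 0); lra.
Qed.

(** A composition of Lipschitz maps; its value at y = 0 is bounded because [argmu] composed with z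
    has linear growth. Every policy of the iteration therefore stays in the class for which the
    linear problem is solvable. *)
Lemma argmu_Cb (z : R -> 'cV[R]_n -> 'cV[R]_d) alpha : Cb M z ->
  (forall s y, 0 <= s <= T -> alpha s y = argmu M s y (z s y)) -> Cb M alpha /\ valued_in M alpha.
Proof.
move=> hz e; split; last by move=> s y hs; rewrite e//; exact: mu_val.
have [f hf] := choice (fun k => let: ex_intro2 C C0 h := (mu_lgc k (fun k => Cb_lgc hz k 0)).2 in ex_intro
  (fun C => forall s x, 0 <= s <= T -> `|argmu M s x (z s x) k 0| <= C * (1 + enorm x)) C h).
apply: (@lpc_Cb _ _ _ _ _ _ (\sum_k f k)) => [i j|s hs].
  rewrite ord1; apply: (@eq_lpc _ _ _ (fun s x => argmu M s x (z s x) i 0)) => [s x hs|]; first by rewrite e.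
  by apply: (comp_lpc (E3 := setT) uM (fun _ _ _ => Logic.I)) => k; exact: Cb_lpc.
rewrite e//; apply: le_trans (enorm_le_sum _) _; apply: ler_sum => k _.
by rewrite big_ord1; have := hf k s 0 hs; rewrite enorm0 addr0 mulr1.
Qed.

Lemma admissible_Cb (B : forall (t : R) (x : 'cV[R]_n), brownian_basis d t T) alpha :
  Cb M alpha -> valued_in M alpha -> admissible B alpha.
Proof.
move=> ha hv; have T0 : 0 <= T := horizon_ge0 hM; split => //.
  move=> i j; rewrite ord1; have jc := (Cb_lpc ha i 0).1.
  have mV k : measurable_fun setT (fun u : measurableTypeR R * borelV R n => u.2 k 0).
    have mc : measurable_fun setT (fun v : borelV R n => v k 0).
      apply: (measurability _ (RGenOpens.measurableE R)) => _ [_ [a [b ->]] <-]; rewrite setTI; apply: sub_sigma_algebra.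
      apply: open_comp; last exact: itv_open.
      by move=> v _; exact: coord_continuous.
    exact: (measurableT_comp mc measurable_snd).
  have h := @jcont_meas R n _ (measurableTypeR R * borelV R n)%type (fun s x => alpha s x i 0) 0 T (fun u => u.1) (fun u => u.2) T0 jc
    measurable_fst mV.
  apply: eq_measurable_fun (measurable_funTS h) => u; rewrite inE /= => /andP[h1 h2].
  by rewrite (min_idPr h2) (max_idPr h1).
move=> t x ht; have [X [gX sX uX]] := good_state_exists hM uB uH uS bL x ht (B t x) hv (fun k => Cb_lpc ha k 0).
exists X; split => // X' sX'; move: (uX X' sX'); apply: filterS => w h s hs; exact/esym/h.
Qed.

Section Point.
Context (t : R) (x0 : 'cV[R]_n) (ht : 0 <= t <= T) (B : brownian_basis d t T).
Notation Om := (bb_Omega B).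
Notation P := (bb_P B).
Notation lam := (@lebesgue_measure R).
Notation mu := (lam \x P)%E.
Notation Dom := (@Dom R (bb_disp B) Om).
Notation E f := (Rintegral P setT f).
Notation mDom := (@measurable_Dom R (bb_disp B) Om _ _).
Let tT : t <= T. Proof. by case/andP: ht. Qed.
Let t0 : 0 <= t. Proof. by case/andP: ht. Qed.
Let in0 s : t <= s <= T -> 0 <= s <= T. Proof. by move=> /andP[h ->]; rewrite (le_trans t0). Qed.
Let hT : t <= T <= T. Proof. by rewrite tT lexx. Qed.
Let htt : t <= t <= T. Proof. by rewrite lexx. Qed.

Variables (alphab : policy R n m) (X X' : R -> Om -> 'cV[R]_n).
Hypotheses (hvb : valued_in M alphab) (jab : forall k, jcont 0 T (fun s x => alphab s x k 0)) (gX : good_state x0 alphab X)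
  (eX' : {ae P, forall w, forall s, t <= s <= T -> X' s w = X s w}).

Let start : {ae P, forall v, X t v = x0}.
Proof.
have [vX [LX [I [iI eX]]]] := gX.
have h : {ae P, forall v, forall i, I i t v = 0} by apply: filter_forall => i; exact: ito_start tT _ _ (iI i).
move: h eX; apply: filterS2 => v I0 hX; apply/matrixP => i j.
by rewrite ord1 hX// mxE set_itv1 Rintegral_set1 I0 !addr0.
Qed.

Let path phi v r s : lgc T phi -> t <= r -> s <= T -> L1 lam `[r, s] (fun u => phi u (X u v)).
Proof.
move=> [jc _] tr sT; have [vX _] := gX; have [c _] := comp_cproc tT (jcont_sub t0 (lexx T) jc) vX.
exact: (cont_L1 tr sT (c v)).
Qed.

Let comp_Fm phi s : jcont 0 T phi -> t <= s <= T -> Fm (B := B) s (fun v => phi s (X s v)).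
Proof. by move=> jc; have [vX _] := gX; have [_ h] := comp_cproc tT (jcont_sub t0 (lexx T) jc) vX; exact: h. Qed.

Section Policy.
Variables (alpha : policy R n m) (w wt : R -> 'cV[R]_n -> R) (wx : R -> 'cV[R]_n -> 'cV[R]_n) (wxx : R -> 'cV[R]_n -> 'M[R]_n).
Hypotheses (hv : valued_in M alpha) (la : forall k, lgc T (fun s x => alpha s x k 0))
  (sw : smooth M w wt wx wxx)
  (gen : forall s x, 0 <= s < T -> generator M wt wx wxx (alpha s x) s x + along (cost M) alpha s x = 0).
Notation bd := (backward_drift M alphab alpha wx).
Let lbd : lgc T bd := backward_drift_lgc hM uH uS uC b0 bL hvb jab hv la sw.

Lemma backward_ito : exists J, is_ito (fun s v => hedge M wx s (X s v)) J /\
  {ae P, forall v, forall s, t <= s <= T ->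
    w s (X s v) = w T (X T v) + Rintegral lam `[s, T] (fun r => bd r (X r v)) - (J T v - J s v)}.
Proof.
have [J [iJ eJ]] := ito_policy hM uB uH uS uC b0 bL ht hvb jab gX hv la sw gen.
exists J; split => //; move: eJ; apply: filterS => v h s hs; have /andP[ts sT] := hs.
have pN : L1 lam `[t, T] (fun r => - bd r (X r v)) by exact: (path v (lgcN lbd) (lexx t) (lexx T)).
rewrite (h s hs) (h T hT) (Rint_chasles ts sT pN).
have e : Rintegral lam `[s, T] (fun r => - bd r (X r v)) = - Rintegral lam `[s, T] (fun r => bd r (X r v)).
  by rewrite (EN _ (path v lbd ts (lexx T))).
rewrite e; ring.
Qed.

Hypothesis term : forall x, w T x = final M x.

(** When alpha is the policy that drives the path, the driver reduces to the running cost and the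
    Ito integral has mean 0, so the expected cost is the initial value of w. *)
Lemma cost_value : alpha = alphab ->
  (\int[P]_v ((\int[lam]_(s in `[t, T]) (along (cost M) alpha s (X' s v))%:E) + (final M (X' T v))%:E) = (w t x0)%:E)%E.
Proof.
move=> eab; have [J [iJ eJ]] := backward_ito; have [jw _ _ _] := smooth_jcont sw.1.
have [_ FI _] := ito_approx tT iJ.
have lc := cost_lgc hM uC b0 hv la.
have bdE s x : bd s x = along (cost M) alpha s x by rewrite /backward_drift eab subrr dotv0l addr0.
(* The factor 1 is the test variable of the martingale identity. *)
have LJ : L1 P setT (fun v => 1 * (J T v - J t v)).
  apply: L1Z => //; apply: (L2_L1 measurableT (PT_lty B)); apply: L2B => //; [exact: (FI T hT).2|exact: (FI t htt).2].
have Lc : L1 P setT (fun=> w t x0) by apply: L1_bounded => [||//|? _]; [exact: measurableT|exact: PT_lty|exact: lexx].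
rewrite (@integral_ae _ _ _ P _ (fun v => w t x0 + 1 * (J T v - J t v)) (@bb_complete _ _ _ _ B) (L1D measurableT Lc LJ)).
  rewrite (ED measurableT Lc LJ) (ito_martingale tT iJ).2//; last first.
  - by split => //; apply: L1_bounded => [||//|? _]; [exact: measurableT|exact: PT_lty|exact: lexx].
  - exact: Fm_cst.
  by rewrite Rintegral_cst//= probability_setT/= mulr1 addr0.
move: eJ eX' start; apply: filterS3 => v hJ hX hs; have := hJ t htt; rewrite hs => e.
have -> : (\int[lam]_(s in `[t, T]) (along (cost M) alpha s (X' s v))%:E)%E = (Rintegral lam `[t, T] (fun s => bd s (X s v)))%:E.
  rewrite -(L1_EFin _ (path v lbd (lexx t) (lexx T)))//; apply: eq_integral => s; rewrite inE /= in_itv/= => hs'.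
  by rewrite bdE hX.
rewrite hX// -term -EFinD; congr (_%:E); rewrite e; ring.
Qed.

Variables (N : nat) (kap : R).
Hypotheses (lt_tT : t < T) (kap0 : 0 < kap)
  (small : ((T - t) / N.+1%:R + kap^-1) * (8 * L ^+ 2) <= 9^-1).

(** The constant 8 L^2 in [small] is twice this 4 L^2, the 2 coming from the square of a sum of two
    terms in [improve_step]. *)
Let hat_dist s x a a' : 0 <= s <= T -> A a -> A a' -> enorm (drift_hat M s x a - drift_hat M s x a') ^+ 2 <= 4 * L ^+ 2.
Proof.
move=> hs ha ha'; have sq b : A b -> enorm (drift_hat M s x b) ^+ 2 <= L ^+ 2.
  move=> hb; have h := bL x hs hb; have h1 := enorm_ge0 (vol M s x); have h2 := enorm_ge0 (drift_hat M s x b).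
  by rewrite ler_sqr ?nnegrE//; lra.
have := enormB_sq (drift_hat M s x a) (drift_hat M s x a'); have := sq a ha; have := sq a' ha'; lra.
Qed.

Let dot_hat s x a a' p : 0 <= s <= T -> A a -> A a' ->
  dotv (drift_hat M s x a - drift_hat M s x a') p ^+ 2 <= 4 * L ^+ 2 * enorm p ^+ 2.
Proof.
move=> hs ha ha'; apply: le_trans (dotv_CS _ _) _.
by apply: ler_wpM2r; [exact: sqr_ge0|exact: hat_dist].
Qed.

Let conclude (a b D : R) : 0 <= a -> 0 <= b ->
  D + a <= ((T - t) / N.+1%:R + kap^-1) * (8 * L ^+ 2) * (a + b) -> D + a <= 9^-1 * (a + b).
Proof. by move=> h1 h2 h3; apply: le_trans h3 _; apply: ler_wpM2r small; exact: addr_ge0. Qed.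

(** The hedge process solves the same BSDE as Z, and the difference zeta has a driver linear in zeta
    alone. The energy estimate with eta = 0 then bounds the norm of zeta by one ninth of itself,
    which is uniqueness. The form <= 0 is the one needed in the final sum of estimates. *)
Lemma bsde_hedge Y Z : bsde_solution (fun v => final M (X' T v)) (fun s v => along (cost M) alpha s (X' s v))
    (fun s v => along (drift_hat M) alpha s (X' s v) - along (drift_hat M) alphab s (X' s v)) Y Z ->
  L2p Z /\ wnorm N kap (fun s v => Z s v + -1 *: hedge M wx s (X s v)) <= 0.
Proof.
move=> [[pY _] HZ _ pcZ [I [iI eI]]]; have LZ := H2_L2p tT HZ; split => //.
have [J [iJ eJ]] := backward_ito; have [jw _ _ _] := smooth_jcont sw.1.
have Lh : L2p (fun s v => hedge M wx s (X s v)) := hedge_L2p hM uS bL ht gX sw.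
pose c s v := along (drift_hat M) alpha s (X s v) - along (drift_hat M) alphab s (X s v).
pose zeta s v := Z s v + -1 *: hedge M wx s (X s v).
have Lz : L2p zeta by exact: L2pD LZ (L2pZ (-1) Lh).
have L0 : L2p (B := B) (fun _ _ => 0 : 'cV[R]_d).
  by move=> a; apply: eq_L2 (L20 mu mDom) => [|p _]; [exact: mDom|rewrite mxE].
have cb s v : t <= s <= T -> forall p, dotv (c s v) p ^+ 2 <= 4 * L ^+ 2 * enorm p ^+ 2.
  by move=> hs p; apply: dot_hat (in0 hs) _ _; [exact: hv (in0 hs)|exact: hvb (in0 hs)].
have LA : L2 mu (Dom t T) (fun p => dotv (c p.1 p.2) (zeta p.1 p.2)).
  have jc a : jcont 0 T (fun s x => drift_hat M s x (alpha s x) a 0 + - drift_hat M s x (alphab s x) a 0).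
    by apply: jcontD; [apply: (hat_jcont uH) => // k; exact: (la k).1|apply: jcontN; exact: (hat_jcont uH)].
  apply: L2_sum => [|a _]; first exact: mDom.
  have [C C0 h1] := hat_bdc bL a hv; have [D D0 h2] := hat_bdc bL a hvb.
  have [vX _] := gX.
  have mp := progressive_meas tT (cproc_progressive tT (comp_cproc tT (jcont_sub t0 (lexx T) (jc a)) vX)).
  apply: (@L2bM _ _ _ mu (Dom t T) mDom (C + D) (fun p => c p.1 p.2 a 0) (fun p => zeta p.1 p.2 a 0)); last exact: Lz.
    by apply: eq_measurable_fun mp => p _; rewrite !mxE.
  move=> p hp; rewrite !mxE; apply: le_trans (ler_normB _ _) _; exact: lerD (h1 _ _ (in0 hp)) (h2 _ _ (in0 hp)).
have en := @energy _ _ _ _ B tT N kap kap0 lt_tT zeta (fun _ _ => 0) _ (fun s v => dotv (c s v) (zeta s v))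
  (fun s v => Y s v - w s (X s v)) (8 * L ^+ 2) (is_ito_lin tT (-1) iI iJ) LA L0.
have w0 : wnorm (B := B) N kap (fun _ _ => 0) = 0.
  rewrite /wnorm big1// => j _; rewrite /n2 (_ : Rintegral _ _ _ = 0) ?mulr0//.
  by rewrite -[RHS](E0 mu (Dom (grid t T N j) (grid t T N j.+1))); apply: eq_E => p _; rewrite enorm0 expr0n.
have e0 : 0 <= E2 (fun v => Y t v - w t (X t v)) by apply: E_ge0 => *; exact: sqr_ge0.
have w1 := wnorm_ge0 tT N kap0 zeta.
suff H : E2 (fun v => Y t v - w t (X t v)) + wnorm N kap zeta <= 9^-1 * (wnorm N kap zeta + 0) by lra.
apply: conclude => //; rewrite -[X in _ * (_ + X)]w0; apply: en.
- by move=> s hs; apply: measurable_funB; [exact: (progressive_Fm hs pY)|exact: comp_Fm].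
- have h1 : {ae P, forall v, L1 lam `[t, T] (fun s => dotv (c s v) (Z s v))}.
    move: pcZ eX'; apply: filterS2 => v i1 hX; apply: eq_L1 i1 => [|s]; first exact: measurable_itv.
    by rewrite /= in_itv/= => hs; rewrite /c !hX.
  have h2 : {ae P, forall v, forall s, t <= s <= T -> w s (X s v) = w T (X T v) + Rintegral lam `[s, T] (fun r => bd r (X r v)) - (J T v - J s v)
     /\ X' s v = X s v} by move: eJ eX'; apply: filterS2 => v a1 a2 s hs; split; [exact: a1|exact: a2].
  move: eI h1 h2; apply: filterS3 => v hY i1 hh s hs; have /andP[ts sT] := hs.
  have i2 := path v (cost_lgc hM uC b0 hv la) ts (lexx T).
  have i3 := path v lbd ts (lexx T).
  have i1' := L1_sub ts (lexx T) i1.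
  have -> : Rintegral lam `[s, T] (fun r => dotv (c r v) (zeta r v)) =
      Rintegral lam `[s, T] (fun r => along (cost M) alpha r (X r v)) + Rintegral lam `[s, T] (fun r => dotv (c r v) (Z r v)) -
      Rintegral lam `[s, T] (fun r => bd r (X r v)).
    rewrite -(ED _ i2 i1')// -(EB _ (L1D _ i2 i1') i3)//; apply: eq_E => r _.
    by rewrite /zeta scaleN1r dotvBr /backward_drift /c; ring.
  have [ew _] := hh s hs; have [_ eXT] := hh T hT; rewrite hY// ew eXT term.
  have -> : Rintegral lam `[s, T] (fun r => along (cost M) alpha r (X' r v)) = Rintegral lam `[s, T] (fun r => along (cost M) alpha r (X r v)).
    by apply: eq_E => r; rewrite /= in_itv/= => /andP[r1 r2]; have [|_ ->//] := hh r; rewrite (le_trans ts).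
  have -> : Rintegral lam `[s, T] (fun r => dotv (along (drift_hat M) alpha r (X' r v) - along (drift_hat M) alphab r (X' r v)) (Z r v)) =
      Rintegral lam `[s, T] (fun r => dotv (c r v) (Z r v)).
    by apply: eq_E => r; rewrite /= in_itv/= => /andP[r1 r2]; have [|_ ->//] := hh r; rewrite (le_trans ts).
  ring.
- move=> s v hs; apply: le_trans (cb s v hs _) _; rewrite enorm0 expr0n addr0.
  by rewrite ler_wpM2r ?sqr_ge0//; have := sqr_ge0 L; lra.
Qed.

Section Improve.
Variables (w' wt' : R -> 'cV[R]_n -> R) (wx' : R -> 'cV[R]_n -> 'cV[R]_n) (wxx' : R -> 'cV[R]_n -> 'M[R]_n)
  (alpha' : policy R n m) (z : R -> 'cV[R]_n -> 'cV[R]_d).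
Hypotheses (hv' : valued_in M alpha') (la' : forall k, lgc T (fun s x => alpha' s x k 0))
  (sw' : smooth M w' wt' wx' wxx')
  (gen' : forall s x, 0 <= s < T -> generator M wt' wx' wxx' (alpha' s x) s x + along (cost M) alpha' s x = 0)
  (term' : forall x, w' T x = final M x)
  (lz : forall k, lgc T (fun s x => z s x k 0))
  (ea : forall s y, 0 <= s <= T -> alpha s y = argmu M s y (hedge M wx s y))
  (ea' : forall s y, 0 <= s <= T -> alpha' s y = argmu M s y (z s y)).

(** Used with [alpha] the optimal feedback, w = v_opt, and [alpha'] the policy that the iteration
    derives from z. The driver of the difference is the Hamiltonian gap [D1], controlled by z - p,
    plus a term linear in p' - p; its square is at most 8 L^2 times the sum of the two squared
    norms. *)
Lemma improve_step : (w' t x0 - w t x0) ^+ 2 + wnorm N kap (fun s v => hedge M wx' s (X s v) + -1 *: hedge M wx s (X s v)) <=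
  9^-1 * (wnorm N kap (fun s v => hedge M wx' s (X s v) + -1 *: hedge M wx s (X s v)) +
          wnorm N kap (fun s v => z s (X s v) + -1 *: hedge M wx s (X s v))).
Proof.
have [J [iJ eJ]] := backward_ito.
have [J' [iJ' eJ']] : exists J, is_ito (fun s v => hedge M wx' s (X s v)) J /\
  {ae P, forall v, forall s, t <= s <= T ->
    w' s (X s v) = w' T (X T v) + Rintegral lam `[s, T] (fun r => backward_drift M alphab alpha' wx' r (X r v)) - (J T v - J s v)}.
  have lbd' := backward_drift_lgc hM uH uS uC b0 bL hvb jab hv' la' sw'.
  have [J2 [iJ2 eJ2]] := ito_policy hM uB uH uS uC b0 bL ht hvb jab gX hv' la' sw' gen'.
  exists J2; split => //; move: eJ2; apply: filterS => v h s hs; have /andP[ts sT] := hs.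
  have pN := path v (lgcN lbd') (lexx t) (lexx T).
  by rewrite (h s hs) (h T hT) (Rint_chasles ts sT pN) (EN _ (path v lbd' ts (lexx T))); [ring|exact: measurable_itv].
have lbd' := backward_drift_lgc hM uH uS uC b0 bL hvb jab hv' la' sw'.
have [jw _ _ _] := smooth_jcont sw.1; have [jw' _ _ _] := smooth_jcont sw'.1.
have Lh : L2p (fun s v => hedge M wx s (X s v)) := hedge_L2p hM uS bL ht gX sw.
have Lz : L2p (fun s v => z s (X s v) + -1 *: hedge M wx s (X s v)).
  by apply: L2pD (L2pZ (-1) Lh) => a; exact: (lgc_L2 ht gX (lz a)).
pose D s x := backward_drift M alphab alpha' wx' s x + - bd s x.
have lD : lgc T D by exact: lgcD lbd' (lgcN lbd).
have en := @energy _ _ _ _ B tT N kap kap0 lt_tT _ (fun s v => z s (X s v) + -1 *: hedge M wx s (X s v)) _ (fun s v => D s (X s v))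
  (fun s v => w' s (X s v) - w s (X s v)) (8 * L ^+ 2) (is_ito_lin tT (-1) iJ' iJ) (lgc_L2 ht gX lD) Lz.
have -> : (w' t x0 - w t x0) ^+ 2 = E2 (fun v => w' t (X t v) - w t (X t v)).
  rewrite -[LHS]mulr1 -[X in _ * X](_ : fine (P setT) = 1); last by rewrite probability_setT.
  rewrite -Rintegral_cst//; apply/esym; apply: E_ae => //.
    by apply: measurable_funX; apply: measurable_funB; [exact: Fm_meas htt (comp_Fm jw' htt)|exact: Fm_meas htt (comp_Fm jw htt)].
  by move: start; apply: filterS => v -> _.
apply: conclude; [exact: (wnorm_ge0 tT N kap0)|exact: (wnorm_ge0 tT N kap0)|apply: en].
- by move=> s hs; apply: measurable_funB; exact: comp_Fm.
- move: eJ eJ'; apply: filterS2 => v h h' s hs; have /andP[ts sT] := hs.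
  have i1 := path v lbd' ts (lexx T); have i2 := path v lbd ts (lexx T).
  rewrite (h s hs) (h' s hs) term term' /D (EB _ i1 i2)//.
  move: (Rintegral _ _ _) (Rintegral _ _ _) => u1 u2; ring.
- move=> s v hs; have hs0 := in0 hs; set x := X s v.
  set p' := hedge M wx' s x; set p := hedge M wx s x.
  have a1 : A (alpha s x) := hv x hs0; have a2 : A (alpha' s x) := hv' x hs0; have a3 : A (alphab s x) := hvb x hs0.
  pose h a := drift_hat M s x a.
  (* Minimality of alpha at p and of alpha' at z give 0 <= D1 <= <hat b(alpha') - hat b(alpha), p - z>. *)
  pose D1 := (dotv (h (alpha' s x)) p + cost M s x (alpha' s x)) - (dotv (h (alpha s x)) p + cost M s x (alpha s x)).
  have D10 : 0 <= D1 by rewrite subr_ge0 ea//; exact: mu_min.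
  have D11 : D1 <= dotv (h (alpha' s x) - h (alpha s x)) (- (z s x + -1 *: p)).
    have hm : dotv (h (alpha' s x)) (z s x) + cost M s x (alpha' s x) <= dotv (h (alpha s x)) (z s x) + cost M s x (alpha s x).
      by rewrite ea'//; exact: mu_min.
    by rewrite scaleN1r opprB dotvBr !dotvBl /D1; lra.
  have DE : D s x = D1 + dotv (h (alpha' s x) - h (alphab s x)) (p' + -1 *: p).
    by rewrite /D /backward_drift /along -/p -/p' -/(h _) -/(h _) -/(h _) scaleN1r dotvBr !dotvBl /D1; ring.
  have q1 : D1 ^+ 2 <= 4 * L ^+ 2 * enorm (z s x + -1 *: p) ^+ 2.
    have := @dot_hat s x _ _ (- (z s x + -1 *: p)) hs0 a2 a1; rewrite -/(h _) -/(h _) => q.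
    apply: (@le_trans _ _ (dotv (h (alpha' s x) - h (alpha s x)) (- (z s x + -1 *: p)) ^+ 2)).
      by rewrite ler_sqr ?nnegrE ?(le_trans D10).
    apply: le_trans q _; rewrite le_eqVlt; apply/orP; left; apply/eqP; congr (_ * _).
    by rewrite !enormc_sq; apply: eq_bigr => i _; rewrite [in LHS]mxE sqrrN.
  have q2 := @dot_hat s x _ _ (p' + -1 *: p) hs0 a2 a3.
  rewrite DE; apply: le_trans (sqrD2 _ _) _; rewrite mulrDr.
  move: q1 q2; rewrite -/(h _) -/(h _); move: (dotv _ _) (enorm _) (enorm _) => y e1 e2; lra.
Qed.

End Improve.
End Policy.
End Point.
End Iteration.

(** * Limit superior of a perturbed contraction *)

Section Limsup.
Context (R : realType).
Implicit Types (u eps : nat -> \bar R).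

Lemma limn_esup_le u (y : \bar R) N : (forall k, (N <= k)%N -> (u k <= y)%E) -> (limn_esup u <= y)%E.
Proof.
move=> h; rewrite /limn_esup/limf_esup.
apply: (@le_trans _ _ (ereal_sup (u @` [set k | (N <= k)%N]))).
  by apply: ereal_inf_lbound; exists [set k | (N <= k)%N] => //; exists N.
by apply: ge_ereal_sup => _ [k hk <-]; exact: h.
Qed.

Lemma limn_esup_lt u (y : \bar R) : (limn_esup u < y)%E -> exists N, forall k, (N <= k)%N -> (u k <= y)%E.
Proof.
rewrite /limn_esup/limf_esup => /ereal_inf_lt[_ [A [N _ NA] <-] hy].
exists N => k Nk; apply: le_trans (ltW hy); apply: ereal_sup_ubound; exists k => //; exact: NA.
Qed.

(** Dropping D from the recursion gives a_{k+1} <= e_k / 2 + a_k / 4. If e <= M eventually, then a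
    <= M up to a geometric tail, and reinserting this gives D <= (4 M + 2 M) / 9 <= M up to the same
    tail. *)
Lemma limsup_contract (a e D : nat -> R) eps (C : R) : 0 < C -> (forall k, 0 <= a k) -> (forall k, 0 <= D k) ->
  (forall k, (0 <= eps k)%E) -> (forall k, ((e k)%:E <= C%:E * eps k)%E) ->
  (forall k, D k.+1 + a k.+1 <= 9^-1 * (a k.+1 + (4 * e k + 2 * a k))) ->
  (limn_esup (fun k => (D k)%:E) <= C%:E * limn_esup eps)%E.
Proof.
move=> C0 a0 D0 eps0 he hD.
have l0 : (0 <= limn_esup eps)%E.
  rewrite /limn_esup/limf_esup; apply: le_ereal_inf_tmp => _ [A [N _ NA] <-].
  by apply: le_trans (eps0 N) _; apply: ereal_sup_ubound; exists N => //; apply: NA => /=.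
(* For an infinite limsup the right-hand side is infinite since C > 0; the value -oo is excluded by
   [l0]. *)
case: (limn_esup eps) (@limn_esup_lt eps) l0 => [l| |] hl l0 //; last first.
  by rewrite gt0_muley ?lte_fin// leey.
rewrite lee_fin in l0; rewrite -EFinM.
apply/lee_addgt0Pr => th th0; rewrite -EFinD.
have th1 : 0 < th / (C + 1) by rewrite divr_gt0// addr_gt0.
(* The tolerance th is shared out: C l + th = M + th / (C + 1), the last term being reserved for the
   geometric tail. *)
pose M := C * (l + th / (C + 1)); have M0 : 0 <= M by rewrite mulr_ge0 ?addr_ge0 ?(ltW C0) ?(ltW th1).
have [N hN] : exists N, forall k, (N <= k)%N -> e k <= M.
  have [|N hN] := hl (l + th / (C + 1))%:E; first by rewrite lte_fin ltrDl.
  exists N => k Nk; rewrite -lee_fin; apply: le_trans (he k) _; rewrite /M EFinM.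
  by apply: lee_wpmul2l (hN k Nk); rewrite lee_fin ltW.
have step k : (N <= k)%N -> a k.+1 <= M / 2 + a k / 4 /\ D k.+1 <= (4 * M + 2 * a k) / 9.
  move=> Nk; have h1 := hD k; have h2 := hN k Nk; have h3 := a0 k.+1; have h4 := D0 k.+1.
  move: h1 h2 h3 h4; move: (a k.+1) (a k) (e k) (D k.+1) => a' a1 e1 D' h1 h2 h3 h4; clear - h1 h2 h3 h4 M0.
  by split; lra.
have bd j : a (N + j)%N <= M + a N * 4^-1 ^+ j.
  elim: j => [|j IH]; first by rewrite addn0 expr0 mulr1 lerDr.
  have [h _] := step _ (leq_addr j N); rewrite addnS; apply: le_trans h _.
  by rewrite exprS; move: IH; move: (4^-1 ^+ j) => y; lra.
have g0 := @geo0 _ (a N) 4^-1.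
have [|K _ hK] := cvgr0_norm_lt _ (g0 _) _ th1; first by rewrite invr_ge0 ler0n/= invf_lt1// ltr1n.
apply: (@limn_esup_le _ _ (N + K).+1) => -[//|k]; rewrite ltnS => Nk; rewrite lee_fin.
have NNk : (N <= k)%N := leq_trans (leq_addr K N) Nk.
have [_ h1] := step k NNk; apply: le_trans h1 _.
have Kk : (K <= k - N)%N by rewrite leq_subRL.
have h2 := bd (k - N)%N; rewrite subnKC// in h2.
have h3 := le_lt_trans (ler_norm _) (hK _ Kk).
have e1 : C * l + th = M + th / (C + 1) by rewrite /M; field; rewrite gt_eqF// addr_gt0.
rewrite e1; move: h2 h3 M0 th1; move: (a N * _) (th / _) => y1 y2 h2 h3 M0 th1; lra.
Qed.

End Limsup.

Lemma dotv_trmx (R : realType) p k (V : 'M[R]_(p, k)) (u : 'cV[R]_k) (v : 'cV[R]_p) : dotv (V *m u) v = dotv u (V^T *m v).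
Proof.
have e l (a b : 'cV[R]_l) : dotv a b = (a^T *m b) 0 0 by rewrite mxE; apply: eq_bigr => i _; rewrite mxE.
by rewrite !e trmx_mul mulmxA.
Qed.

(** By the structure of the drift, the action enters generator plus cost only through <drift_hat,
    sigma^T w_x> + cost, which [argmu] at [hedge] minimises. The infimum is therefore attained, and
    v_opt solves the linear equation of this feedback. *)
Lemma hjb_attained (R : realType) n m d (M : model R n m d) (hM : standing M) wt wx wxx s x : 0 <= s <= horizon M ->
  ereal_inf [set (generator M wt wx wxx a s x + cost M s x a)%:E | a in actions M] = 0%E ->
  generator M wt wx wxx (argmu M s x (hedge M wx s x)) s x + cost M s x (argmu M s x (hedge M wx s x)) = 0.
Proof.
move=> hs; case: hM => _ _ _ dE [_ /(_ s x (hedge M wx s x) hs)[]]; move: (argmu _ _ _ _) => b Ab hb.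
have gE a : actions M a -> generator M wt wx wxx a s x + cost M s x a =
    wt s x + dotv (drift_bar M s x) (wx s x) + 2^-1 * \tr (vol M s x *m (vol M s x)^T *m wxx s x)
    + (dotv (drift_hat M s x a) (hedge M wx s x) + cost M s x a).
  move=> Aa; rewrite /generator dE// dotvDl dotv_trmx -/(hedge M wx s x); ring.
move=> h0; apply/eqP; rewrite eq_le; apply/andP; split; rewrite -lee_fin.
  rewrite -[leRHS]h0; apply: le_ereal_inf_tmp => _ [a Aa <-]; rewrite lee_fin !gE//.
  by rewrite lerD2l; exact: hb.
by rewrite -[leLHS]h0; apply: ereal_inf_lbound; exists b.
Qed.

Lemma sqdist2_n2 (R : realType) d (t T : R) (B : brownian_basis d t T) (V V' Z : R -> bb_Omega B -> 'cV[R]_d) :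
  {ae bb_P B, forall w, forall s, t <= s <= T -> V' s w = V s w} -> L2p (fun s w => V s w + -1 *: Z s w) ->
  sqdist2 V' Z = (n2 t T (fun s w => V s w + -1 *: Z s w))%:E.
Proof.
rewrite /n2 => eV LV; have [i1 [<- ae]] := Dom_fubini (f := fun s w => enorm (V s w + -1 *: Z s w) ^+ 2) (L2p_L1 (lexx t) (lexx T) LV).
apply: integral_ae i1 _; first exact: bb_complete.
move: eV ae; apply: filterS2 => w e iw; rewrite -(L1_EFin _ iw); last exact: measurable_itv.
apply: eq_integral => s; by rewrite inE /= in_itv/= => hs; rewrite e// scaleN1r.
Qed.

(** * Convergence of the inexact policy iteration *)

Section Convergence.
Context (R : realType).

Let arith (u v p q : R) : u <= 2 * p + 2 * q -> q <= 0 -> 2 * u + 2 * v <= 4 * p + 2 * v.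
Proof. lra. Qed.

Context (n m d : nat) (M : model R n m d).
Let T := horizon M.
Let A := actions M.
Context (L : R).
Hypotheses (hM : standing M)
  (uB : UniLip `[0, T] setT A (fun t x _ => drift_bar M t x))
  (uH : UniLip `[0, T] setT A (drift_hat M))
  (uS : UniLip `[0, T] setT A (fun t x _ => vol M t x))
  (uC : UniLip `[0, T] setT A (fun t x a => (cost M t x a)%:M : 'M[R]_1))
  (uM : UniLip `[0, T] setT setT (argmu M))
  (b0 : forall t, 0 <= t <= T -> enorm (drift_bar M t 0) + enorm (argmu M t 0 0) + `|cost M t 0 0| <= L)
  (bL : forall t x a, 0 <= t <= T -> A a -> enorm (drift_hat M t x a) + enorm (vol M t x) <= L).

Definition linear_solution (alpha : policy R n m) w wt wx wxx := [/\ smooth M w wt wx wxx,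
  forall t x, 0 <= t < T -> generator M wt wx wxx (alpha t x) t x + along (cost M) alpha t x = 0 &
  forall x, w T x = final M x].

Lemma state_good (B : forall (t : R) (x : 'cV[R]_n), brownian_basis d t T) alpha t x : 0 <= t <= T ->
  Cb M alpha -> valued_in M alpha -> exists2 X, good_state (B := B t x) x alpha X &
    {ae bb_P (B t x), forall w, forall s, t <= s <= T -> @state _ _ _ _ M B alpha t x s w = X s w}.
Proof.
move=> ht ca va; have [X [gX sX uX]] := good_state_exists hM uB uH uS bL x ht (B t x) va (fun k => Cb_lpc ca k 0).
exists X => //; apply: uX; apply: (@xgetPex _ _ (@state_eq _ _ _ _ M B alpha t x)); by exists X.
Qed.

Lemma value_linear_solution (B : forall (t : R) (x : 'cV[R]_n), brownian_basis d t T) alpha t x w wt wx wxx :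
  0 <= t <= T -> Cb M alpha -> valued_in M alpha -> linear_solution alpha w wt wx wxx -> value B alpha t x = (w t x)%:E.
Proof.
move=> ht ca va [sw gen term]; have [X gX eX] := state_good B x ht ca va.
exact: (cost_value hM uB uH uS uC b0 bL ht va (fun k => (Cb_lpc ca k 0).1) gX eX va (fun k => Cb_lgc ca k 0) sw gen term erefl).
Qed.

Lemma policy_iteration_rate t (x : 'cV[R]_n) (B : brownian_basis d t T) (alphab : policy R n m) (X X' : R -> bb_Omega B -> 'cV[R]_n)
    (alpha : nat -> policy R n m) (z : nat -> R -> 'cV[R]_n -> 'cV[R]_d) w wt wx wxx ws wst wsx wsxx
    (Y : nat -> R -> bb_Omega B -> R) (Z : nat -> R -> bb_Omega B -> 'cV[R]_d) kap :
  0 <= t -> t < T -> Cb M alphab -> valued_in M alphab -> good_state x alphab X ->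
  {ae bb_P B, forall v, forall s, t <= s <= T -> X' s v = X s v} ->
  (forall k, Cb M (alpha k)) -> (forall k, valued_in M (alpha k)) -> (forall k, Cb M (z k)) ->
  (forall k s y, 0 <= s <= T -> alpha k.+1 s y = argmu M s y (z k s y)) ->
  (forall k, linear_solution (alpha k) (w k) (wt k) (wx k) (wxx k)) ->
  linear_solution (fun s y => argmu M s y (hedge M wsx s y)) ws wst wsx wsxx ->
  (forall k, bsde_solution (fun v => final M (X' T v)) (fun s v => along (cost M) (alpha k) s (X' s v))
    (fun s v => along (drift_hat M) (alpha k) s (X' s v) - along (drift_hat M) alphab s (X' s v)) (Y k) (Z k)) ->
  0 < kap -> 18 * (8 * L ^+ 2) <= kap ->
  (limn_esup (fun k => ((w k t x - ws t x) ^+ 2)%:E) <=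
   (expR (kap * (T - t)))%:E * limn_esup (fun k => sqdist2 (fun s v => z k s (X' s v)) (Z k)))%E.
Proof.
move=> t0 lt_tT cb vb gX eX' ca va cz ea lw [ss gs ts] hbsde kap0 hkap.
have tT := ltW lt_tT; have ht : 0 <= t <= T by rewrite t0.
(* N + 1 exceeds 18 (8 L^2) (T - t), so the mesh times 8 L^2 is at most 1/18; the choice of kap
   supplies the other 1/18. *)
pose N := Num.truncn (18 * (8 * L ^+ 2) * (T - t)).
have small : ((T - t) / N.+1%:R + kap^-1) * (8 * L ^+ 2) <= 9^-1.
  have h1 := truncnS_gt (18 * (8 * L ^+ 2) * (T - t)); rewrite -/N in h1.
  have N0 : 0 < N.+1%:R :> R by rewrite ltr0n.
  have q1 : (T - t) / N.+1%:R * (8 * L ^+ 2) <= 18^-1 by rewrite mulrAC ler_pdivrMr//; lra.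
  have q2 : kap^-1 * (8 * L ^+ 2) <= 18^-1 by rewrite mulrC ler_pdivrMr//; lra.
  by rewrite mulrDl; apply: le_trans (lerD q1 q2) _; lra.
have jab k := (Cb_lpc cb k 0).1.
have la k i := Cb_lgc (ca k) i 0.
have vs : valued_in M (fun s y => argmu M s y (hedge M wsx s y)).
  by move=> s y hs; case: hM => _ _ _ _ [_ h]; case: (h s y (hedge M wsx s y) hs).
have ls i : lgc T (fun s y => argmu M s y (hedge M wsx s y) i 0).
  apply: (comp_lgc (C := L) (E3 := setT) uM (fun _ _ _ => Logic.I)) => // [s hs|k]; last exact: (hedge_lgc hM uS bL ss k).
  apply: le_trans (abs_coord_le _ _ _) _.
  by have := b0 hs; have := enorm_ge0 (drift_bar M s 0); have := normr_ge0 (cost M s 0 0); lra.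
have hedge_w k : L2p (fun s v => hedge M (wx k) s (X s v)) by have [sw _ _] := lw k; exact: (hedge_L2p hM uS bL ht gX sw).
have hedge_s : L2p (fun s v => hedge M wsx s (X s v)) := hedge_L2p hM uS bL ht gX ss.
have bsde k : L2p (Z k) /\ wnorm N kap (fun s v => Z k s v + -1 *: hedge M (wx k) s (X s v)) <= 0.
  have [sw gw tw] := lw k.
  exact: (bsde_hedge hM uB uH uS uC b0 bL ht vb jab gX eX' (va k) (la k) sw gw tw lt_tT kap0 small (hbsde k)).
have Lz k : L2p (fun s v => z k s (X s v)) by move=> a; exact: (lgc_L2 ht gX (Cb_lgc (cz k) a 0)).
have LzZ k : L2p (fun s v => z k s (X s v) + -1 *: Z k s v) by exact: L2pD (Lz k) (L2pZ (-1) (bsde k).1).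
pose a k := wnorm N kap (fun s v => hedge M (wx k) s (X s v) + -1 *: hedge M wsx s (X s v)).
pose e k := wnorm N kap (fun s v => z k s (X s v) + -1 *: Z k s v).
apply: (@limsup_contract _ a e) => [|k|k|k|k|k]; first exact: expR_gt0.
- exact: (wnorm_ge0 tT N kap0).
- exact: sqr_ge0.
- by apply: integral_ge0 => v _; apply: integral_ge0 => s _; rewrite lee_fin sqr_ge0.
- have eV : {ae bb_P B, forall v, forall s, t <= s <= T -> z k s (X' s v) = z k s (X s v)}.
    by move: eX'; apply: filterS => v h s hs; rewrite h.
  rewrite (@sqdist2_n2 _ _ _ _ _ _ _ _ eV (LzZ k)) -EFinM lee_fin.
  exact: (wnorm_le tT N kap0 lt_tT (LzZ k)).
- have [sw gw tw] := lw k.+1.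
  apply: le_trans (improve_step hM uB uH uS uC b0 bL ht vb jab gX vs ls ss gs ts lt_tT kap0 small
    (va k.+1) (la k.+1) sw gw tw (fun i => Cb_lgc (cz k) i 0) (fun _ _ _ => erefl) (ea k)) _.
  apply: ler_wpM2l; first by rewrite invr_ge0.
  rewrite lerD2l.
  have LZh := L2pD (bsde k).1 (L2pZ (-1) (hedge_w k)).
  have Lhh := L2pD (hedge_w k) (L2pZ (-1) hedge_s).
  have h1 := wnormD tT N kap0 (L2pD (LzZ k) LZh) Lhh.
  have h2 := wnormD tT N kap0 (LzZ k) LZh.
  have h3 := (bsde k).2.
  (* z^k - p_opt is split as (z^k - Z^k) + (Z^k - p_k) + (p_k - p_opt). Applying [wnormD] twice
     gives the factors 4 and 2, and the middle term vanishes by [bsde]. *)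
  have -> : (fun s v => z k s (X s v) + -1 *: hedge M wsx s (X s v)) = (fun s v =>
     ((z k s (X s v) + -1 *: Z k s v) + (Z k s v + -1 *: hedge M (wx k) s (X s v))) +
     (hedge M (wx k) s (X s v) + -1 *: hedge M wsx s (X s v))).
    by apply/funext => s; apply/funext => v; rewrite !scaleN1r !addrA subrK subrK.
  by apply: le_trans h1 _; exact: arith h2 h3.
Qed.

End Convergence.

Theorem theorem4 (R : realType) (n m d : nat) (M : model R n m d)
    (B : forall (t : R) (x : 'cV[R]_n), brownian_basis d t (horizon M))
    (hM : standing M) (hA : assumption1 B)
    (alpha0 alphab : policy R n m)
    (h0 : Cb M alpha0) (h0A : valued_in M alpha0)
    (hb : Cb M alphab) (hbA : valued_in M alphab) :
  (forall (t : R) (x : 'cV[R]_n) (alpha : nat -> policy R n m)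
      (z : nat -> R -> 'cV[R]_n -> 'cV[R]_d) (eps : nat -> \bar R),
      0 <= t <= horizon M -> pi_iteration B alpha0 alphab t x alpha z eps ->
      forall k : nat, admissible B (alpha k)) /\
  exists q gamma : R, [/\ 0 < q, q < 1, 0 < gamma &
    forall (t : R) (x : 'cV[R]_n) (alpha : nat -> policy R n m)
      (z : nat -> R -> 'cV[R]_n -> 'cV[R]_d) (eps : nat -> \bar R),
      0 <= t <= horizon M -> pi_iteration B alpha0 alphab t x alpha z eps ->
      (limn_esup (fun k : nat =>
          `|value B (alpha k) t x - opt_value B t x| ^+ 2)
       <= (q * expR (gamma * (horizon M - t)) / (1 - q))%:E
          * limn_esup eps)%E].
Proof.
have [[[uB uH uS uC _] uM] [L [b0 bL]] lin [ws [wst [wsx [wsxx [ss hjb ts opt]]]]]] := hA.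
have policies t x alpha z eps : pi_iteration B alpha0 alphab t x alpha z eps -> forall k, Cb M (alpha k) /\ valued_in M (alpha k).
  move=> [e0 h] [|k]; first by rewrite e0.
  by have [_ cz ea] := h k; exact: (argmu_Cb hM uM b0 cz ea).
split=> [t x alpha z eps ht hpi k|].
  by have [ca va] := policies _ _ _ _ _ hpi k; exact: admissible_Cb hM uB uH uS bL B _ ca va.
(* The + 1 keeps kap positive when L = 0. *)
pose kap := 18 * (8 * L ^+ 2) + 1.
have kap0 : 0 < kap by rewrite /kap; have := sqr_ge0 L; lra.
exists 2^-1, kap; split=> [||//|t x alpha z eps ht hpi]; [lra|lra|].
have -> : 2^-1 * expR (kap * (horizon M - t)) / (1 - 2^-1) = expR (kap * (horizon M - t)).
  by rewrite (_ : 1 - 2^-1 = 2^-1); [rewrite mulrAC divff ?mul1r// invr_eq0 pnatr_eq0|lra].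
have cv := policies _ _ _ _ _ hpi.
have [w /choice[wt /choice[wx /choice[wxx lw]]]] := choice (fun k => lin _ (cv k).1 (cv k).2).
have eps0 : (0 <= limn_esup eps)%E.
  rewrite /limn_esup/limf_esup; apply: le_ereal_inf_tmp => _ [D [N _ ND] <-].
  have [_ /(_ N)[[Y [Z [_ eN]]] _ _]] := hpi.
  apply: (@le_trans _ _ (eps N)); last by apply: ereal_sup_ubound; exists N => //; apply: ND => /=.
  by rewrite eN; apply: integral_ge0 => v _; apply: integral_ge0 => s _; rewrite lee_fin sqr_ge0.
(* Both values are finite, being given by smooth solutions, so the distance in the extended reals
   becomes a real square. *)
have -> : (fun k => (`|value B (alpha k) t x - opt_value B t x| ^+ 2)%E) = (fun k => ((w k t x - ws t x) ^+ 2)%:E).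
  apply/funext => k; rewrite (value_linear_solution hM uB uH uS uC b0 bL B x ht (cv k).1 (cv k).2 (lw k)) opt//.
  by rewrite -EFinB abse_EFin -EFin_expe real_normK// num_real.
(* At t = T every value equals the terminal cost; the energy estimate on grids is for t < T. *)
have /andP[t0 tT] := ht; move: tT; rewrite le_eqVlt => /orP[/eqP eT|lt_tT].
  have -> : (fun k => ((w k t x - ws t x) ^+ 2)%:E) = (fun=> 0%E : \bar R).
    by apply/funext => k; have [_ _ tw] := lw k; rewrite eT tw ts subrr expr0n.
  apply: (@le_trans _ _ 0%E); first by apply: (@limn_esup_le _ _ _ 0%N).
  by apply: mule_ge0 => //; rewrite lee_fin expR_ge0.
have [_ /all_and3[/choice[Y /choice[Z /all_and2[bs ee]]] cz ea]] := hpi.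
have [X gX eX] := state_good hM uB uH uS bL B x ht hb hbA.
have -> : eps = fun k => sqdist2 (fun s v => z k s (@state _ _ _ _ M B alphab t x s v)) (Z k) by apply/funext => k; exact: ee.
apply: (policy_iteration_rate hM uB uH uS uC uM b0 bL t0 lt_tT hb hbA gX eX (fun k => (cv k).1) (fun k => (cv k).2) cz ea lw _ bs kap0).
  split; [exact: ss| |exact: ts] => s y hs; have hs' : 0 <= s <= horizon M by move/andP: hs => [-> /ltW].
  exact: (hjb_attained hM hs' (hjb s y hs)).
by rewrite /kap lerDl.
Qed.
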